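(* Let $(\phi_t)$ be a semigroup in $\mathbb{D}$. Then: (1) $(\phi_t)$ is hyperbolic with spectral value $\lambda>0$ if and only if it has a holomorphic model of the form $(\mathbb{S}_{\pi/\lambda},h,z\mapsto z+it)$. (2) $(\phi_t)$ is parabolic of positive hyperbolic step if and only if it has a holomorphic model either of the form $(\mathbb{H},h,z\mapsto z+it)$ or of the form $(\mathbb{H}^-,h,z\mapsto z+it)$. (3) $(\phi_t)$ is parabolic of zero hyperbolic step if and only if it has a holomorphic model of the form $(\mathbb{C},h,z\mapsto z+it)$.
   Context: $\mathbb{D}=\{z\in\mathbb{C}:|z|<1\}$, $\mathbb{H}=\{\zeta\in\mathbb{C}:\operatorname{Re}\zeta>0\}$, $\mathbb{H}^-=\{\zeta\in\mathbb{C}:\operatorname{Re}\zeta<0\}$, and for $\rho>0$, $\mathbb{S}_\rho=\{\zeta\in\mathbb{C}:0<\operatorname{Re}\zeta<\rho\}$. A semigroup $(\phi_t)$ in $\mathbb{D}$ is a continuous homomorphism $t\mapsto\phi_t$ from the additive semigroup $[0,+\infty)$ to the semigroup (under composition) of holomorphic self-maps of $\mathbb{D}$ with the topology of uniform convergence on compacta. It is elliptic if there is $x\in\mathbb{D}$ with $\phi_t(x)=x$ for all $t\ge0$. If it is not elliptic, there is a unique point $\tau\in\partial\mathbb{D}$ (the Denjoy-Wolff point) for which there exists $\lambda\ge0$ (the spectral value) with $\liminf_{z\to\tau}\frac{1-|\phi_t(z)|}{1-|z|}=e^{-\lambda t}$ for all $t\ge0$; a non-elliptic semigroup is hyperbolic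 if $\lambda>0$ and parabolic if $\lambda=0$. Let $\omega$ be the hyperbolic distance of $\mathbb{D}$. For $u\ge0$ and $z\in\mathbb{D}$, the hyperbolic step of order $u$ is $s_u(\phi_t,z):=\lim_{r\to+\infty}\omega(\phi_r(z),\phi_{r+u}(z))$ (the limit exists since the quantity is decreasing in $r$). The semigroup is of positive hyperbolic step if there exist $z\in\mathbb{D}$ and $u\ge0$ with $s_u(\phi_t,z)>0$; otherwise it is of zero hyperbolic step. A holomorphic model for $(\phi_t)$ is a triple $(\Omega,h,\psi_t)$ where $\Omega$ is a Riemann surface, $h:\mathbb{D}\to\Omega$ is univalent (holomorphic and injective), and $(\psi_t)$ is a continuous group of automorphisms of $\Omega$ such that $h\circ\phi_t=\psi_t\circ h$ for all $t\ge0$ and $\bigcup_{t\ge0}\psi_{-t}(h(\mathbb{D}))=\Omega$. *)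

(* Defs.v *)
From Stdlib Require Export Reals List.
From Coquelicot Require Export Coquelicot.

Open Scope R_scope.

(** Subsets of the complex plane are predicates [C -> Prop]; partially defined
    maps are total functions whose values off their domain are never used. *)

Definition unit_disc (z : C) : Prop := Cmod z < 1.
Definition right_half_plane (z : C) : Prop := 0 < Re z.
Definition left_half_plane (z : C) : Prop := Re z < 0.
Definition strip (rho : R) (z : C) : Prop := 0 < Re z < rho.
Definition whole_plane (z : C) : Prop := True.

Definition compact_set (K : C -> Prop) : Prop :=
  forall (I : Type) (U : I -> C -> Prop),
    (forall i, open (U i)) ->
    (forall z, K z -> exists i, U i z) ->
    exists l : list I, forall z, K z -> exists i, In i l /\ U i z.

Definition connected_set (A : C -> Prop) : Prop :=
  forall U V : C -> Prop,
    open U -> open V ->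
    (forall z, A z -> U z \/ V z) ->
    (exists z, A z /\ U z) ->
    (exists z, A z /\ V z) ->
    exists z, A z /\ U z /\ V z.

(** [ex_derive] over the base field [C_AbsRing] is complex differentiability. *)
Definition holomorphic_on (A : C -> Prop) (f : C -> C) : Prop :=
  forall z, A z -> ex_derive (K := C_AbsRing) (V := C_NormedModule) f z.

Definition maps_into (A B : C -> Prop) (f : C -> C) : Prop :=
  forall z, A z -> B (f z).

Definition univalent_on (A : C -> Prop) (f : C -> C) : Prop :=
  holomorphic_on A f /\
  forall z w, A z -> A w -> f z = f w -> z = w.

Definition automorphism (A : C -> Prop) (f : C -> C) : Prop :=
  holomorphic_on A f /\ maps_into A A f /\
  exists g : C -> C,
    holomorphic_on A g /\ maps_into A A g /\
    (forall z, A z -> g (f z) = z) /\ (forall z, A z -> f (g z) = z).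

(** Continuity of [t |-> f t] on the set of times [T], for the topology of
    uniform convergence on the compact subsets of [A]. *)
Definition continuous_family
    (T : R -> Prop) (A : C -> Prop) (f : R -> C -> C) : Prop :=
  forall t0, T t0 ->
  forall K : C -> Prop, compact_set K -> (forall z, K z -> A z) ->
  forall eps : posreal, exists delta : posreal,
  forall t, T t -> Rabs (t - t0) < delta ->
  forall z, K z -> Cmod (f t z - f t0 z)%C < eps.

Record semigroup (phi : R -> C -> C) : Prop := {
  semigroup_holo : forall t, 0 <= t -> holomorphic_on unit_disc (phi t);
  semigroup_maps : forall t, 0 <= t -> maps_into unit_disc unit_disc (phi t);
  semigroup_0 : forall z, unit_disc z -> phi 0 z = z;
  semigroup_add : forall s t z, 0 <= s -> 0 <= t -> unit_disc z ->
    phi (s + t) z = phi s (phi t z);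
  semigroup_cont : continuous_family (fun t => 0 <= t) unit_disc phi
}.

Record automorphism_group (A : C -> Prop) (psi : R -> C -> C) : Prop := {
  group_auto : forall t, automorphism A (psi t);
  group_0 : forall z, A z -> psi 0 z = z;
  group_add : forall s t z, A z -> psi (s + t) z = psi s (psi t z);
  group_cont : continuous_family (fun _ => True) A psi
}.

Definition elliptic (phi : R -> C -> C) : Prop :=
  exists x, unit_disc x /\ forall t, 0 <= t -> phi t x = x.

(** [l] is the (finite) lower limit of [f] along the filter [F]; compare
    [is_LimInf_seq]. *)
Definition is_liminf (F : (C -> Prop) -> Prop) (f : C -> R) (l : R) : Prop :=
  forall eps : posreal,
    F (fun z => l - eps < f z) /\ ~ F (fun z => l + eps <= f z).

Definition denjoy_wolff (phi : R -> C -> C) (tau : C) (lam : R) : Prop :=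
  Cmod tau = 1 /\ 0 <= lam /\
  forall t, 0 <= t ->
    is_liminf (within unit_disc (locally tau))
      (fun z => (1 - Cmod (phi t z)) / (1 - Cmod z)) (exp (- lam * t)).

Definition spectral_value (phi : R -> C -> C) (lam : R) : Prop :=
  exists tau, denjoy_wolff phi tau lam.

Definition hyperbolic (phi : R -> C -> C) : Prop :=
  ~ elliptic phi /\ exists lam, 0 < lam /\ spectral_value phi lam.

Definition parabolic (phi : R -> C -> C) : Prop :=
  ~ elliptic phi /\ spectral_value phi 0.

Definition hyperbolic_distance (z w : C) : R :=
  let r := Cmod ((z - w) / (1 - Cconj w * z))%C in
  / 2 * ln ((1 + r) / (1 - r)).

Definition hyperbolic_step (phi : R -> C -> C) (u : R) (z : C) : Rbar :=
  Lim (fun r => hyperbolic_distance (phi r z) (phi (r + u) z)) p_infty.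

Definition positive_hyperbolic_step (phi : R -> C -> C) : Prop :=
  exists z u, unit_disc z /\ 0 <= u /\ Rbar_lt 0 (hyperbolic_step phi u z).

Definition zero_hyperbolic_step (phi : R -> C -> C) : Prop :=
  ~ positive_hyperbolic_step phi.

(** Holomorphic models whose base space is a plane domain, with the Riemann
    surface structure it inherits from [C]. *)
Record holomorphic_model (phi : R -> C -> C)
    (Omega : C -> Prop) (h : C -> C) (psi : R -> C -> C) : Prop := {
  model_open : open Omega;
  model_connected : connected_set Omega;
  model_maps : maps_into unit_disc Omega h;
  model_univalent : univalent_on unit_disc h;
  model_group : automorphism_group Omega psi;
  model_conj : forall t z, 0 <= t -> unit_disc z -> h (phi t z) = psi t (h z);
  model_absorbing : forall w,
    Omega w <-> exists t z, 0 <= t /\ unit_disc z /\ w = psi (- t) (h z)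
}.

Definition vertical_translation (t : R) (z : C) : C := (z + Ci * RtoC t)%C.

(* Main.v *)
Require Import Defs.
From Stdlib Require Import Reals Lra Lia Psatz Classical ClassicalChoice Ranalysis5.
From Coquelicot Require Import Coquelicot.

Open Scope R_scope.

(** A non-elliptic semigroup has the same boundary fixed point [tau] for all its maps,
    with Julia constant at most [1] there ([Denjoy_Wolff_point]). Sending [tau] to
    infinity by a Cayley transform turns the infinitesimal generator into a zero-free
    function [p] with nonnegative real part on the right half-plane; a primitive of
    [Ci / p] is injective and conjugates the semigroup to vertical translations
    ([Koenigs_function]). The union of the downward translates of its image is
    invariant under all vertical translations, hence it is a vertical strip, a
    half-plane or the plane ([model_exists]). So some model of one of the four types
    always exists, and the theorem amounts to reading off spectral value and hyperbolic
    step from the type of the base space.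

    Spectral value. The lower limit of [(1 - |f z|) / (1 - |z|)] at a boundary point is
    the best constant in Julia's inequality there ([liminf_iff_exact_julia]). At [tau]
    this constant is [1 / c] where [(c - 1)^2 / (4 c)] is the infimum over the disc of the
    hyperbolic displacement [pdist y (f y)]: one inequality is Julia's, the other one
    comes from the angular derivative ([dilation_of_displacement]). In a model the
    displacement can be compared with that of a translation of the base space: it is at
    least as large because [h] contracts hyperbolic distances, and late parts of orbits
    come arbitrarily close to equality, because compact parts of the base space are
    eventually translated into [h(D)] ([orbit_exhaustion]). For a strip of width
    [PI / lam] this gives the constant [exp (- lam t)], for the other three base spaces
    it gives [1].

    Hyperbolic step. In a half-plane an orbit moves along a line parallel to the
    boundary, by a hyperbolic distance that is fixed, and [h] is a contraction. In the
    plane discs of arbitrary radius are available, and [orbit_exhaustion] makes the step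
    tend to [0].

    Uniqueness of the spectral value. The definition quantifies over all boundary
    points, so a second point [sigma] with lower limits [exp (- lam t)] has to be
    excluded ([no_second_dilation_point]). Its boundary values [eta t] under the
    semigroup form a continuous injective curve on the circle, and [phi t] has the exact
    Julia constant [a = exp (- lam t)] at every point of the curve. Exactness at a point
    determines how the boundary values move near it to first order
    ([boundary_quotient]), so [phi t] acts on an arc of the circle by an affine map of
    the angle with slope [a]. For [a < 1] this contradicts [chord_contraction], since
    [sin (a y) > a sin y]; for [a = 1] the map is a rotation and fixes [0]
    ([arc_affine_rotation]), whereas in the presence of a model [phi t] has no fixed point
    for [t > 0].

    The function theory behind this is derived from Goursat's theorem: circle means
    give the mean value property, smoothness of derivatives, the maximum principle and
    the Schwarz-Pick inequality. *)

(** * Complex arithmetic *)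

Bind Scope C_scope with C.

Notation cderiv := (is_derive (K := C_AbsRing) (V := C_NormedModule)).
Notation cderivable := (ex_derive (K := C_AbsRing) (V := C_NormedModule)).
Notation Ccont := (continuous (T := C_UniformSpace) (U := C_UniformSpace)).
Notation Rcont := (continuous (T := R_UniformSpace) (U := C_UniformSpace)).

Arguments Cmod _%_C_scope.
Arguments Re _%_C_scope.
Arguments Im _%_C_scope.
Arguments Cconj _%_C_scope.

(** Several type expressions denote [C]; the field tactics want this one. *)
Lemma C_eq : forall a b : C, @eq C a b -> a = b.
Proof. auto. Qed.
Ltac Cring := first [apply C_eq; ring | symmetry; apply C_eq; ring | ring].
Ltac Cfield := first [apply C_eq; field | field].

Lemma C_ext : forall z w : C, Re z = Re w -> Im z = Im w -> z = w.
Proof. intros [a b] [c d]; simpl; intros; subst; reflexivity. Qed.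

(** Squared moduli are polynomials in the coordinates, so identities between them are within
    reach of [ring]. *)
Definition norm2 (z : C) : R := Re z * Re z + Im z * Im z.
Arguments norm2 _%_C_scope.

Lemma Cmod_sqr : forall z, Cmod z * Cmod z = norm2 z.
Proof.
  intros z. unfold Cmod, norm2, Re, Im. rewrite sqrt_sqrt; [ring|nra].
Qed.

Lemma norm2_ge_0 : forall z, 0 <= norm2 z.
Proof. intros z; unfold norm2; nra. Qed.

Lemma norm2_mult : forall z w, norm2 (z * w) = norm2 z * norm2 w.
Proof. intros [a b] [c d]; unfold norm2; simpl; ring. Qed.

Lemma norm2_eq_0 : forall z : C, norm2 z = 0 -> z = 0%C.
Proof.
  intros z H. apply Cmod_eq_0. rewrite <- Cmod_sqr in H.
  pose proof (Cmod_ge_0 z); nra.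
Qed.

Lemma norm2_pos : forall z : C, z <> 0%C -> 0 < norm2 z.
Proof.
  intros z H. pose proof (norm2_ge_0 z) as [P|P]; auto.
  exfalso; apply H, norm2_eq_0; auto.
Qed.

Lemma Cmod_le_norm2 : forall z b, 0 <= b -> (Cmod z <= b <-> norm2 z <= b * b).
Proof.
  intros z b Hb; rewrite <- Cmod_sqr; pose proof (Cmod_ge_0 z); split; intros; nra.
Qed.

Lemma Cmod_lt_norm2 : forall z b, 0 <= b -> (Cmod z < b <-> norm2 z < b * b).
Proof.
  intros z b Hb; rewrite <- Cmod_sqr; pose proof (Cmod_ge_0 z); split; intros; nra.
Qed.

Lemma unit_disc_norm2 : forall z, unit_disc z <-> norm2 z < 1.
Proof.
  intros z; unfold unit_disc. rewrite (Cmod_lt_norm2 z 1) by lra.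
  rewrite Rmult_1_r; tauto.
Qed.

Lemma Cmod_minus_sym : forall z w, Cmod (z - w) = Cmod (w - z).
Proof. intros; rewrite <- Cmod_opp; f_equal; Cring. Qed.

Lemma Cmod_sub_triangle : forall a b c, Cmod (a - c) <= Cmod (a - b) + Cmod (b - c).
Proof.
  intros; replace (a - c)%C with ((a - b) + (b - c))%C by Cring; apply Cmod_triangle.
Qed.

Lemma Cmod_le_add : forall z w, Cmod z <= Cmod w + Cmod (z - w).
Proof.
  intros; replace z with (w + (z - w))%C at 1 by Cring; apply Cmod_triangle.
Qed.

Lemma Cmod_diff_le : forall z w, Rabs (Cmod z - Cmod w) <= Cmod (z - w).
Proof.
  intros. pose proof (Cmod_le_add z w). pose proof (Cmod_le_add w z).
  rewrite (Cmod_minus_sym w z) in *. apply Rabs_le; lra.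
Qed.

Lemma im_le_Cmod : forall z, Rabs (Im z) <= Cmod z.
Proof.
  intros z; eapply Rle_trans; [apply Rmax_r| apply (Rmax_Cmod z)].
Qed.

Lemma Cmod_le_re_im : forall z, Cmod z <= Rabs (Re z) + Rabs (Im z).
Proof.
  intros z. pose proof (Rabs_pos (Re z)); pose proof (Rabs_pos (Im z)).
  apply Cmod_le_norm2; [lra|].
  unfold norm2. assert (forall x, x*x = Rabs x * Rabs x) as E
    by (intros x; rewrite <- Rabs_mult, Rabs_pos_eq; nra).
  rewrite (E (Re z)), (E (Im z)). nra.
Qed.

Lemma Cmod_Ci : Cmod Ci = 1.
Proof. unfold Cmod, Ci; cbn [fst snd]. rewrite <- sqrt_1 at 2. apply f_equal; ring. Qed.

(** * Neighbourhoods and continuity in terms of the modulus *)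

Lemma locally_C : forall (z : C) (P : C -> Prop),
  locally (T := C_UniformSpace) z P <->
  exists d, 0 < d /\ forall w, Cmod (w - z) < d -> P w.
Proof.
  intros z P; split.
  - intros [d Hd]. exists d; split; [apply cond_pos|].
    intros w Hw. apply Hd. apply (C_NormedModule_mixin_compat1 z w d Hw).
  - intros [d [Hd H]].
    assert (0 < d / 2) as Hd2 by lra.
    exists (mkposreal _ Hd2); intros w Hw. apply H.
    pose proof (C_NormedModule_mixin_compat2 z w (mkposreal _ Hd2) Hw) as K; simpl in K.
    change (minus w z) with (w - z)%C in K.
    eapply Rlt_le_trans; [exact K|].
    assert (sqrt 2 <= 2); [|nra].
    rewrite <- (sqrt_square 2) at 2 by lra. apply sqrt_le_1_alt; lra.
Qed.

Lemma open_C : forall U : C -> Prop,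
  open (T := C_UniformSpace) U <->
  forall z, U z -> exists d, 0 < d /\ forall w, Cmod (w - z) < d -> U w.
Proof.
  intros U; unfold open; split; intros H z Hz; apply locally_C; auto.
Qed.

Lemma Ccont_eps : forall (f : C -> C) z,
  Ccont f z <-> forall e, 0 < e ->
    exists d, 0 < d /\ forall w, Cmod (w - z) < d -> Cmod (f w - f z) < e.
Proof.
  intros f z; split.
  - intros H e He. apply locally_C.
    apply (H (fun w => Cmod (w - f z) < e)). apply locally_C. exists e; auto.
  - intros H P HP. apply locally_C in HP. destruct HP as [e [He HP]].
    destruct (H e He) as [d [Hd H']]. apply locally_C. exists d; auto.
Qed.

Lemma Rcont_eps : forall (f : R -> C) t,
  Rcont f t <-> forall e, 0 < e ->
    exists d, 0 < d /\ forall s, Rabs (s - t) < d -> Cmod (f s - f t) < e.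
Proof.
  intros f t; split.
  - intros H e He.
    destruct (H (fun w => Cmod (w - f t) < e)) as [d Hd].
    { apply locally_C. exists e; auto. }
    exists d; split; [apply cond_pos|]. intros s Hs; apply Hd, Hs.
  - intros H P HP. apply locally_C in HP. destruct HP as [e [He HP]].
    destruct (H e He) as [d [Hd H']]. exists (mkposreal d Hd); intros s Hs; apply HP, H', Hs.
Qed.

Lemma RRcont_eps : forall (f : R -> R) t,
  continuous f t <-> forall e, 0 < e ->
    exists d, 0 < d /\ forall s, Rabs (s - t) < d -> Rabs (f s - f t) < e.
Proof.
  intros f t; split.
  - intros H e He.
    destruct (H (fun w => Rabs (w - f t) < e)) as [d Hd].
    { exists (mkposreal e He); auto. }
    exists d; split; [apply cond_pos|]. intros s Hs; apply Hd, Hs.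
  - intros H P [e HP].
    destruct (H e (cond_pos e)) as [d [Hd H']].
    exists (mkposreal d Hd); intros s Hs; apply HP, H', Hs.
Qed.

Lemma Rcont_comp : forall (f : C -> C) (g : R -> C) t,
  Rcont g t -> Ccont f (g t) -> Rcont (fun s => f (g s)) t.
Proof. intros; apply (continuous_comp g f); auto. Qed.

Lemma Ccont_comp : forall (f g : C -> C) z,
  Ccont g z -> Ccont f (g z) -> Ccont (fun s => f (g s)) z.
Proof. intros; apply (continuous_comp g f); auto. Qed.

(** The form in which estimates with an arbitrary [e] are turned into equalities. *)
Lemma Cmod_small_eq : forall a b c : R, 0 <= a -> (forall e, 0 < e -> a <= e * c) -> a = 0.
Proof.
  intros a _ c Ha H. destruct (Req_dec a 0); auto.
  assert (0 < c). { specialize (H 1 ltac:(lra)). lra. }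
  specialize (H (a / (2 * c))). assert (0 < a / (2*c)) by (apply Rdiv_lt_0_compat; lra).
  specialize (H H2). replace (a / (2*c) * c) with (a/2) in H by (field; lra). lra.
Qed.

Lemma Rcont_re_im : forall (f : R -> C) t,
  Rcont f t <-> continuous (fun s => Re (f s)) t /\ continuous (fun s => Im (f s)) t.
Proof.
  intros f t; rewrite Rcont_eps, !RRcont_eps; split.
  - intros H; split; intros e He; destruct (H e He) as [d [Hd K]]; exists d; split; auto;
    intros s Hs; specialize (K s Hs); eapply Rle_lt_trans; try exact K.
    + replace (Re (f s) - Re (f t)) with (Re (f s - f t)) by (unfold Re, Im; simpl; ring); apply re_le_Cmod.
    + replace (Im (f s) - Im (f t)) with (Im (f s - f t)) by (unfold Re, Im; simpl; ring); apply im_le_Cmod.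
  - intros [H1 H2] e He. destruct (H1 (e/2)) as [d1 [D1 K1]]; [lra|].
    destruct (H2 (e/2)) as [d2 [D2 K2]]; [lra|].
    exists (Rmin d1 d2); split; [apply Rmin_glb_lt; auto|].
    intros s Hs. eapply Rle_lt_trans; [apply Cmod_le_re_im|].
    assert (Rabs (s-t) < d1 /\ Rabs (s-t) < d2) as [A B]
      by (split; eapply Rlt_le_trans; try exact Hs; [apply Rmin_l|apply Rmin_r]).
    specialize (K1 s A); specialize (K2 s B). unfold Re, Im in *; simpl in *. unfold Rminus in *. lra.
Qed.

Lemma Ccont_mult : forall (f g : C -> C) z,
  Ccont f z -> Ccont g z -> Ccont (fun w => f w * g w)%C z.
Proof.
  intros f g z Hf Hg. rewrite Ccont_eps in *. intros e He.
  pose proof (Cmod_ge_0 (f z)); pose proof (Cmod_ge_0 (g z)).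
  set (m := Cmod (f z) + Cmod (g z) + 1 + e).
  assert (0 < m) by (unfold m; lra).
  destruct (Hf (e / (2*m))) as [d1 [D1 K1]]; [apply Rdiv_lt_0_compat; lra|].
  destruct (Hg (e / (2*m))) as [d2 [D2 K2]]; [apply Rdiv_lt_0_compat; lra|].
  exists (Rmin d1 d2); split; [apply Rmin_glb_lt; auto|].
  intros w Hw.
  specialize (K1 w (Rlt_le_trans _ _ _ Hw (Rmin_l _ _))).
  specialize (K2 w (Rlt_le_trans _ _ _ Hw (Rmin_r _ _))).
  replace (f w * g w - f z * g z)%C with ((f w - f z) * g w + f z * (g w - g z))%C by Cring.
  eapply Rle_lt_trans; [apply Cmod_triangle|]. rewrite !Cmod_mult.
  pose proof (Cmod_le_add (g w) (g z)).
  set (u := e / (2*m)) in *. assert (u * (2*m) = e) by (unfold u; field; lra).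
  assert (0 < u) by (unfold u; apply Rdiv_lt_0_compat; lra).
  pose proof (Cmod_ge_0 (f w - f z)); pose proof (Cmod_ge_0 (g w - g z)); pose proof (Cmod_ge_0 (g w)).
  assert (u <= e) by (unfold m in *; nra).
  assert (Cmod (f w - f z) * Cmod (g w) <= u * m) by (apply Rmult_le_compat; unfold m; lra).
  assert (Cmod (f z) * Cmod (g w - g z) <= Cmod (f z) * u) by (apply Rmult_le_compat_l; lra).
  unfold m in *; nra.
Qed.

Lemma Ccont_plus : forall (f g : C -> C) z,
  Ccont f z -> Ccont g z -> Ccont (fun w => f w + g w)%C z.
Proof.
  intros f g z Hf Hg. apply (continuous_plus (V := C_NormedModule) f g z Hf Hg).
Qed.

Lemma Ccont_const : forall (c : C) z, Ccont (fun _ => c) z.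
Proof. intros; apply continuous_const. Qed.

Lemma Ccont_id : forall z, Ccont (fun w => w) z.
Proof. intros; apply continuous_id. Qed.

Lemma Ccont_opp : forall (f : C -> C) z, Ccont f z -> Ccont (fun w => - f w)%C z.
Proof. intros f z Hf. apply (continuous_opp (V := C_NormedModule) f z Hf). Qed.

Lemma Ccont_minus : forall (f g : C -> C) z,
  Ccont f z -> Ccont g z -> Ccont (fun w => f w - g w)%C z.
Proof. intros f g z Hf Hg. apply Ccont_plus; auto. apply Ccont_opp; auto. Qed.

(** Away from [0], inversion is bounded on a whole neighbourhood; this is the estimate behind
    its continuity and differentiability. *)
Lemma Cinv_diff_bound : forall z w : C, z <> 0%C -> Cmod (w - z) <= Cmod z / 2 ->
  w <> 0%C /\ Cmod (/ w) <= 2 / Cmod z.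
Proof.
  intros z w Hz H. assert (0 < Cmod z) by (apply Cmod_gt_0; auto).
  pose proof (Cmod_le_add z w). rewrite (Cmod_minus_sym z w) in *.
  assert (Cmod z / 2 <= Cmod w) by lra.
  assert (w <> 0%C) by (apply Cmod_gt_0; lra).
  split; auto. rewrite Cmod_inv by auto.
  replace (2 / Cmod z) with (/ (Cmod z / 2)) by (field; lra).
  apply Rinv_le_contravar; lra.
Qed.

Lemma Ccont_Cinv : forall z : C, z <> 0%C -> Ccont Cinv z.
Proof.
  intros z Hz. apply Ccont_eps; intros e He.
  assert (0 < Cmod z) as Hm by (apply Cmod_gt_0; auto).
  exists (Rmin (Cmod z / 2) (e * (Cmod z * Cmod z) / 4)); split.
  { apply Rmin_glb_lt; [lra|]. assert (0 < e * (Cmod z * Cmod z)) by (repeat apply Rmult_lt_0_compat; auto). lra. }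
  intros w Hw.
  destruct (Cinv_diff_bound z w Hz) as [Hw0 Hb].
  { apply Rlt_le, (Rlt_le_trans _ _ _ Hw (Rmin_l _ _)). }
  pose proof (Rlt_le_trans _ _ _ Hw (Rmin_r _ _)) as Hw2.
  replace (/ w - / z)%C with ((z - w) * (/ w * / z))%C by (Cfield; auto).
  rewrite !Cmod_mult, (Cmod_minus_sym z w), (Cmod_inv z) by auto.
  apply Rle_lt_trans with (Cmod (w - z) * (2 / Cmod z * / Cmod z)).
  - apply Rmult_le_compat_l; [apply Cmod_ge_0|].
    apply Rmult_le_compat_r; auto. left; apply Rinv_0_lt_compat; auto.
  - apply Rlt_le_trans with (e * (Cmod z * Cmod z) / 4 * (2 / Cmod z * / Cmod z)).
    + apply Rmult_lt_compat_r; auto.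
      apply Rmult_lt_0_compat; [apply Rdiv_lt_0_compat; lra | apply Rinv_0_lt_compat; auto].
    + replace (e * (Cmod z * Cmod z) / 4 * (2 / Cmod z * / Cmod z)) with (e / 2) by (field; lra). lra.
Qed.

Lemma Ccont_inv : forall (f : C -> C) z, Ccont f z -> f z <> 0%C -> Ccont (fun w => / f w)%C z.
Proof. intros f z Hf Hz. apply (Ccont_comp Cinv f); auto. apply Ccont_Cinv; auto. Qed.

(** * Complex derivatives *)

Lemma cderiv_eps : forall (f : C -> C) z l,
  cderiv f z l <-> forall e, 0 < e ->
    exists d, 0 < d /\ forall w, Cmod (w - z) < d ->
      Cmod (f w - f z - (w - z) * l) <= e * Cmod (w - z).
Proof.
  intros f z l; split.
  - intros [_ H] e He. destruct (H z (fun P HP => HP) (mkposreal e He)) as [d Hd].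
    exists d; split; [apply cond_pos|]. intros w Hw. apply (Hd w Hw).
  - intros H; split.
    + apply is_linear_scal_l.
    + intros x Hx. apply (is_filter_lim_locally_unique (V := AbsRing_NormedModule C_AbsRing)) in Hx.
      subst x. intros e. destruct (H e (cond_pos e)) as [d [Hd K]].
      exists (mkposreal d Hd). intros w Hw. apply (K w Hw).
Qed.

Lemma cderiv_unique : forall (f : C -> C) (z l1 l2 : C), cderiv f z l1 -> cderiv f z l2 -> l1 = l2.
Proof.
  intros f z l1 l2 H1 H2. apply is_C_derive_unique in H1, H2. congruence.
Qed.

Lemma cderiv_continuous : forall (f : C -> C) (z l : C), cderiv f z l -> Ccont f z.
Proof.
  intros f z l H. apply Ccont_eps; intros e He. rewrite cderiv_eps in H.
  destruct (H 1 Rlt_0_1) as [d [Hd K]].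
  pose proof (Cmod_ge_0 l).
  exists (Rmin d (e / (Cmod l + 2))); split.
  { apply Rmin_glb_lt; auto. apply Rdiv_lt_0_compat; lra. }
  intros w Hw. specialize (K w (Rlt_le_trans _ _ _ Hw (Rmin_l _ _))).
  pose proof (Rlt_le_trans _ _ _ Hw (Rmin_r _ _)) as Hw2.
  pose proof (Cmod_le_add (f w - f z) ((w - z) * l)).
  rewrite Cmod_mult in H1. apply Rle_lt_trans with (Cmod (w - z) * (Cmod l + 1)); [nra|].
  apply Rlt_le_trans with (e / (Cmod l + 2) * (Cmod l + 2)); [|right; field; lra].
  pose proof (Cmod_ge_0 (w - z)). nra.
Qed.

Lemma cderiv_const : forall c z : C, cderiv (fun _ => c) z (RtoC 0).
Proof. intros. apply (is_derive_const (K := C_AbsRing) (V := C_NormedModule)). Qed.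

Lemma cderiv_id : forall z : C, cderiv (fun w => w) z (RtoC 1).
Proof.
  intros z. apply cderiv_eps. intros e He. exists 1; split; [lra|].
  intros w _. replace (w - z - (w - z) * 1)%C with (RtoC 0) by Cring. rewrite Cmod_0.
  pose proof (Cmod_ge_0 (w - z)); nra.
Qed.

Lemma cderiv_plus : forall (f g : C -> C) (z a b : C), cderiv f z a -> cderiv g z b ->
  cderiv (fun w => f w + g w)%C z (a + b)%C.
Proof. intros. apply (is_derive_plus (K := C_AbsRing) (V := C_NormedModule) f g); auto. Qed.

Lemma cderiv_opp : forall (f : C -> C) (z a : C), cderiv f z a -> cderiv (fun w => - f w)%C z (- a)%C.
Proof. intros. apply (is_derive_opp (K := C_AbsRing) (V := C_NormedModule) f); auto. Qed.

Lemma cderiv_minus : forall (f g : C -> C) (z a b : C), cderiv f z a -> cderiv g z b ->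
  cderiv (fun w => f w - g w)%C z (a - b)%C.
Proof. intros. apply cderiv_plus; auto. apply cderiv_opp; auto. Qed.

(** Multiplication is not treated as a scalar action here, because the neighbourhoods of
    [C] as a ring of scalars are presented differently from those of the plane. *)
Lemma cderiv_mult : forall (f g : C -> C) (z a b : C), cderiv f z a -> cderiv g z b ->
  cderiv (fun w => f w * g w)%C z (a * g z + f z * b)%C.
Proof.
  intros f g z a b Hf Hg. pose proof (cderiv_continuous _ _ _ Hg) as Cg.
  rewrite cderiv_eps in *. rewrite Ccont_eps in Cg. intros e He.
  pose proof (Cmod_ge_0 (f z)); pose proof (Cmod_ge_0 (g z)); pose proof (Cmod_ge_0 a).
  set (m := 2 * (Cmod (f z) + Cmod (g z) + Cmod a + 2)).
  set (u := Rmin 1 (e / m)). assert (0 < m) by (unfold m; lra).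
  assert (0 < e / m) by (apply Rdiv_lt_0_compat; lra).
  assert (0 < u) by (unfold u; apply Rmin_glb_lt; lra).
  assert (u <= 1) by apply Rmin_l.
  assert (u * m <= e). { apply Rle_trans with (e / m * m); [|right; field; lra].
    apply Rmult_le_compat_r; [lra|apply Rmin_r]. }
  destruct (Hf u) as [d1 [D1 K1]]; auto. destruct (Hg u) as [d2 [D2 K2]]; auto.
  destruct (Cg u) as [d3 [D3 K3]]; auto.
  exists (Rmin d1 (Rmin d2 d3)); split; [repeat apply Rmin_glb_lt; auto|].
  intros w Hw.
  pose proof (Rmin_l d1 (Rmin d2 d3)); pose proof (Rmin_r d1 (Rmin d2 d3));
  pose proof (Rmin_l d2 d3); pose proof (Rmin_r d2 d3).
  specialize (K1 w ltac:(lra)); specialize (K2 w ltac:(lra)); specialize (K3 w ltac:(lra)).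
  replace (f w * g w - f z * g z - (w - z) * (a * g z + f z * b))%C with
    ((f w - f z - (w - z) * a) * g w + ((w - z) * (a * (g w - g z)) + f z * (g w - g z - (w - z) * b)))%C by Cring.
  eapply Rle_trans; [apply Cmod_triangle|].
  eapply Rle_trans; [apply Rplus_le_compat_l, Cmod_triangle|].
  rewrite !Cmod_mult. pose proof (Cmod_le_add (g w) (g z)).
  set (X := Cmod (w - z)) in *. assert (0 <= X) by apply Cmod_ge_0.
  set (Y1 := Cmod (f w - f z - (w - z) * a)) in *. set (Y2 := Cmod (g w - g z - (w - z) * b)) in *.
  assert (0 <= Y1) by apply Cmod_ge_0. assert (0 <= Y2) by apply Cmod_ge_0.
  set (G := Cmod (g w - g z)) in *. assert (0 <= G) by apply Cmod_ge_0.
  assert (Cmod (g w) <= Cmod (g z) + 1) by lra. pose proof (Cmod_ge_0 (g w)).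
  assert (Y1 * Cmod (g w) <= u * X * (Cmod (g z) + 1)) by (apply Rmult_le_compat; lra).
  assert (X * (Cmod a * G) <= X * (Cmod a * u)).
  { apply Rmult_le_compat_l; auto. apply Rmult_le_compat_l; lra. }
  assert (Cmod (f z) * Y2 <= Cmod (f z) * (u * X)) by (apply Rmult_le_compat_l; lra).
  assert (0 <= u * X) by (apply Rmult_le_pos; lra).
  assert (u * X * m <= e * X). { replace (u * X * m) with (u * m * X) by Cring. apply Rmult_le_compat_r; lra. }
  unfold m in *. nra.
Qed.

Lemma cderiv_comp : forall (f g : C -> C) (z a b : C), cderiv f (g z) a -> cderiv g z b ->
  cderiv (fun w => f (g w)) z (a * b)%C.
Proof.
  intros f g z a b Hf Hg. pose proof (cderiv_continuous _ _ _ Hg) as Cg.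
  rewrite cderiv_eps in *. rewrite Ccont_eps in Cg. intros e He.
  pose proof (Cmod_ge_0 a); pose proof (Cmod_ge_0 b).
  set (u := Rmin 1 (e / (Cmod a + Cmod b + 1))).
  assert (0 < e / (Cmod a + Cmod b + 1)) by (apply Rdiv_lt_0_compat; lra).
  assert (0 < u) by (unfold u; apply Rmin_glb_lt; lra).
  assert (u <= 1) by apply Rmin_l.
  assert (u * (Cmod a + Cmod b + 1) <= e).
  { apply Rle_trans with (e / (Cmod a + Cmod b + 1) * (Cmod a + Cmod b + 1)); [|right; field; lra].
    apply Rmult_le_compat_r; [lra|apply Rmin_r]. }
  destruct (Hf u) as [d1 [D1 K1]]; auto. destruct (Hg u) as [d2 [D2 K2]]; auto.
  destruct (Cg d1) as [d3 [D3 K3]]; auto.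
  exists (Rmin d2 d3); split; [apply Rmin_glb_lt; auto|].
  intros w Hw. pose proof (Rmin_l d2 d3); pose proof (Rmin_r d2 d3).
  specialize (K2 w ltac:(lra)). specialize (K3 w ltac:(lra)). specialize (K1 (g w) K3).
  replace (f (g w) - f (g z) - (w - z) * (a * b))%C with
    ((f (g w) - f (g z) - (g w - g z) * a) + a * (g w - g z - (w - z) * b))%C by Cring.
  eapply Rle_trans; [apply Cmod_triangle|]. rewrite Cmod_mult.
  pose proof (Cmod_le_add (g w - g z) ((w - z) * b)). rewrite Cmod_mult in *.
  set (X := Cmod (w - z)) in *. assert (0 <= X) by apply Cmod_ge_0.
  set (Y := Cmod (g w - g z - (w - z) * b)) in *.
  assert (Cmod (g w - g z) <= X * (Cmod b + 1)) by nra.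
  assert (u * Cmod (g w - g z) <= u * (X * (Cmod b + 1))) by (apply Rmult_le_compat_l; lra).
  assert (Cmod a * Y <= Cmod a * (u * X)) by (apply Rmult_le_compat_l; lra).
  assert (u * (Cmod a + Cmod b + 1) * X <= e * X) by (apply Rmult_le_compat_r; lra).
  nra.
Qed.

Lemma cderiv_Cinv : forall z : C, z <> 0%C -> cderiv Cinv z (- (/ z * / z))%C.
Proof.
  intros z Hz. pose proof (Ccont_Cinv z Hz) as Ci. rewrite Ccont_eps in Ci.
  apply cderiv_eps; intros e He.
  assert (0 < Cmod z) as Hm by (apply Cmod_gt_0; auto).
  destruct (Ci (e * Cmod z)) as [d [Hd K]]; [apply Rmult_lt_0_compat; auto|].
  exists (Rmin d (Cmod z / 2)); split; [apply Rmin_glb_lt; lra|].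
  intros w Hw. specialize (K w (Rlt_le_trans _ _ _ Hw (Rmin_l _ _))).
  destruct (Cinv_diff_bound z w Hz) as [Hw0 Hb].
  { apply Rlt_le, (Rlt_le_trans _ _ _ Hw (Rmin_r _ _)). }
  replace (/ w - / z - (w - z) * - (/ z * / z))%C with ((w - z) * ((/ z - / w) * / z))%C by (Cfield; auto).
  rewrite !Cmod_mult, (Cmod_minus_sym (/z)), (Cmod_inv z), Rmult_comm by auto.
  apply Rmult_le_compat_r; [apply Cmod_ge_0|].
  apply Rle_trans with (e * Cmod z * / Cmod z); [|right; field; lra].
  apply Rmult_le_compat_r; [left; apply Rinv_0_lt_compat; auto| lra].
Qed.

Lemma cderiv_inv : forall (f : C -> C) (z a : C), cderiv f z a -> f z <> 0%C ->
  cderiv (fun w => / f w)%C z (- (/ f z * / f z) * a)%C.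
Proof.
  intros f z a Hf Hz. apply (cderiv_comp Cinv f); auto. apply cderiv_Cinv; auto.
Qed.

Lemma cderiv_div : forall (f g : C -> C) (z a b : C), cderiv f z a -> cderiv g z b -> g z <> 0%C ->
  cderiv (fun w => f w / g w)%C z ((a * g z - f z * b) / (g z * g z))%C.
Proof.
  intros f g z a b Hf Hg Hz.
  replace ((a * g z - f z * b) / (g z * g z))%C with (a * / g z + f z * (- (/ g z * / g z) * b))%C
    by (Cfield; auto).
  apply (cderiv_mult f (fun w => / g w)%C); auto. apply cderiv_inv; auto.
Qed.

Lemma cderiv_ext_loc : forall (f g : C -> C) (z l : C),
  (exists d, 0 < d /\ forall w, Cmod (w - z) < d -> f w = g w) -> cderiv f z l -> cderiv g z l.
Proof.
  intros f g z l [d [Hd E]] H. rewrite cderiv_eps in *. intros e He.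
  destruct (H e He) as [d' [Hd' K]].
  exists (Rmin d d'); split; [apply Rmin_glb_lt; auto|]. intros w Hw.
  rewrite <- (E w), <- (E z).
  - apply K, (Rlt_le_trans _ _ _ Hw (Rmin_r _ _)).
  - replace (z - z)%C with (RtoC 0) by Cring; rewrite Cmod_0; auto.
  - apply (Rlt_le_trans _ _ _ Hw (Rmin_l _ _)).
Qed.

Lemma cderiv_ext : forall (f g : C -> C) (z l : C), (forall w, f w = g w) -> cderiv f z l -> cderiv g z l.
Proof. intros f g z l E. apply cderiv_ext_loc. exists 1; split; [lra|auto]. Qed.

Lemma cderiv_eq : forall (f : C -> C) (z l l' : C), cderiv f z l -> l = l' -> cderiv f z l'.
Proof. intros; subst; auto. Qed.

(** Derivatives of expressions built from field operations; the remaining goals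
    are the derivatives of the atoms and the non-vanishing of denominators. *)
Ltac cder :=
  lazymatch goal with
  | |- is_derive (fun _ => ?c) _ _ => apply (cderiv_const c)
  | |- is_derive (fun z => z) _ _ => apply cderiv_id
  | |- is_derive (fun z => Cplus (@?f z) (@?g z)) _ _ => apply (cderiv_plus f g); cder
  | |- is_derive (fun z => Cminus (@?f z) (@?g z)) _ _ => apply (cderiv_minus f g); cder
  | |- is_derive (fun z => Copp (@?f z)) _ _ => apply (cderiv_opp f); cder
  | |- is_derive (fun z => Cmult (@?f z) (@?g z)) _ _ => apply (cderiv_mult f g); cder
  | |- is_derive (fun z => Cdiv (@?f z) (@?g z)) _ _ => apply (cderiv_div f g); [cder|cder|]
  | |- is_derive (fun z => Cinv (@?f z)) _ _ => apply (cderiv_inv f); [cder|]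
  | _ => idtac
  end.

Ltac ccont :=
  lazymatch goal with
  | |- continuous (fun _ => ?c) _ => apply (Ccont_const c)
  | |- continuous (fun z => z) _ => apply Ccont_id
  | |- continuous (fun z => Cplus (@?f z) (@?g z)) _ => apply (Ccont_plus f g); ccont
  | |- continuous (fun z => Cminus (@?f z) (@?g z)) _ => apply (Ccont_minus f g); ccont
  | |- continuous (fun z => Copp (@?f z)) _ => apply (Ccont_opp f); ccont
  | |- continuous (fun z => Cmult (@?f z) (@?g z)) _ => apply (Ccont_mult f g); ccont
  | |- continuous (fun z => Cinv (@?f z)) _ => apply (Ccont_inv f); [ccont|]
  | _ => idtac
  end.

(** * Curves and their integrals *)

Notation rderiv := (is_derive (K := R_AbsRing) (V := C_R_NormedModule)).
Notation Cint := (RInt (V := C_R_CompleteNormedModule)).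
Notation is_Cint := (is_RInt (V := C_R_NormedModule)).
Notation ex_Cint := (ex_RInt (V := C_R_NormedModule)).

Lemma norm_C_R : forall z : C, norm (V := C_R_NormedModule) z = Cmod z.
Proof.
  intros z. symmetry; exact (Cmod_norm z).
Qed.

Lemma rderiv_eps : forall (f : R -> C) t (l : C),
  rderiv f t l <-> forall e, 0 < e ->
    exists d, 0 < d /\ forall s, Rabs (s - t) < d ->
      Cmod (f s - f t - RtoC (s - t) * l) <= e * Rabs (s - t).
Proof.
  intros f z l; split.
  - intros [_ H] e He. destruct (H z (fun P HP => HP) (mkposreal e He)) as [d Hd].
    exists d; split; [apply cond_pos|]. intros w Hw. specialize (Hd w Hw).
    rewrite <- scal_R_Cmult, <- norm_C_R. apply Hd.
  - intros H; split.
    + apply is_linear_scal_l.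
    + intros x Hx. apply (is_filter_lim_locally_unique (V := AbsRing_NormedModule R_AbsRing)) in Hx.
      subst x. intros e. destruct (H e (cond_pos e)) as [d [Hd K]].
      exists (mkposreal d Hd). intros w Hw. specialize (K w Hw).
      rewrite <- scal_R_Cmult, <- norm_C_R in K. apply K.
Qed.

Lemma rderiv_continuous : forall (f : R -> C) t (l : C), rderiv f t l -> Rcont f t.
Proof.
  intros f t l H. apply (ex_derive_continuous (K := R_AbsRing) (V := C_R_NormedModule)).
  exists l; exact H.
Qed.

Lemma rderiv_eq : forall (f : R -> C) t (l l' : C), rderiv f t l -> l = l' -> rderiv f t l'.
Proof. intros; subst; auto. Qed.

Lemma rderiv_affine : forall (a b : C) t, rderiv (fun s => a + RtoC s * b)%C t b.
Proof.
  intros a b t. apply rderiv_eps; intros e He. exists 1; split; [lra|]. intros s _.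
  replace (a + RtoC s * b - (a + RtoC t * b) - RtoC (s - t) * b)%C with (RtoC 0)
    by (rewrite RtoC_minus; Cring).
  rewrite Cmod_0. pose proof (Rabs_pos (s - t)); nra.
Qed.

Lemma rderiv_comp : forall (f : C -> C) (g : R -> C) t (a b : C),
  cderiv f (g t) a -> rderiv g t b -> rderiv (fun s => f (g s)) t (a * b)%C.
Proof.
  intros f g t a b Hf Hg. pose proof (rderiv_continuous _ _ _ Hg) as Cg.
  rewrite cderiv_eps in Hf. rewrite rderiv_eps in *. rewrite Rcont_eps in Cg. intros e He.
  pose proof (Cmod_ge_0 a); pose proof (Cmod_ge_0 b).
  set (u := Rmin 1 (e / (Cmod a + Cmod b + 1))).
  assert (0 < e / (Cmod a + Cmod b + 1)) by (apply Rdiv_lt_0_compat; lra).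
  assert (0 < u) by (unfold u; apply Rmin_glb_lt; lra).
  assert (u <= 1) by apply Rmin_l.
  assert (u * (Cmod a + Cmod b + 1) <= e).
  { apply Rle_trans with (e / (Cmod a + Cmod b + 1) * (Cmod a + Cmod b + 1)); [|right; field; lra].
    apply Rmult_le_compat_r; [lra|apply Rmin_r]. }
  destruct (Hf u) as [d1 [D1 K1]]; auto. destruct (Hg u) as [d2 [D2 K2]]; auto.
  destruct (Cg d1) as [d3 [D3 K3]]; auto.
  exists (Rmin d2 d3); split; [apply Rmin_glb_lt; auto|].
  intros w Hw. pose proof (Rmin_l d2 d3); pose proof (Rmin_r d2 d3).
  specialize (K2 w ltac:(lra)). specialize (K3 w ltac:(lra)). specialize (K1 (g w) K3).
  replace (f (g w) - f (g t) - RtoC (w - t) * (a * b))%C with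
    ((f (g w) - f (g t) - (g w - g t) * a) + a * (g w - g t - RtoC (w - t) * b))%C by Cring.
  eapply Rle_trans; [apply Cmod_triangle|]. rewrite Cmod_mult.
  pose proof (Cmod_le_add (g w - g t) (RtoC (w - t) * b)). rewrite Cmod_mult, Cmod_R in *.
  set (X := Rabs (w - t)) in *. assert (0 <= X) by apply Rabs_pos.
  set (Y := Cmod (g w - g t - RtoC (w - t) * b)) in *.
  assert (Cmod (g w - g t) <= X * (Cmod b + 1)) by nra.
  assert (u * Cmod (g w - g t) <= u * (X * (Cmod b + 1))) by (apply Rmult_le_compat_l; lra).
  assert (Cmod a * Y <= Cmod a * (u * X)) by (apply Rmult_le_compat_l; lra).
  assert (u * (Cmod a + Cmod b + 1) * X <= e * X) by (apply Rmult_le_compat_r; lra).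
  nra.
Qed.

Lemma rderiv_re_im : forall (f : R -> C) t (l : C), rderiv f t l ->
  is_derive (fun s => Re (f s)) t (Re l) /\ is_derive (fun s => Im (f s)) t (Im l).
Proof.
  intros f t l H. rewrite rderiv_eps in H.
  assert (forall (g : R -> R) t (l : R), (forall e, 0 < e -> exists d, 0 < d /\ forall s, Rabs (s - t) < d ->
      Rabs (g s - g t - (s - t) * l) <= e * Rabs (s - t)) -> is_derive g t l) as K.
  { intros g x k Hg. split; [apply (is_linear_scal_l k)|]. intros y Hy.
    apply (is_filter_lim_locally_unique (V := AbsRing_NormedModule R_AbsRing)) in Hy. subst y.
    intros e. destruct (Hg e (cond_pos e)) as [d [Hd K]].
    exists (mkposreal d Hd). intros w Hw. apply (K w Hw). }
  split; apply K; intros e He; destruct (H e He) as [d [Hd D]]; exists d; split; auto;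
    intros s Hs; specialize (D s Hs); eapply Rle_trans; try exact D.
  - match goal with |- Rabs ?x <= Cmod ?z => replace x with (Re z) by (unfold Re; simpl; ring) end.
    apply re_le_Cmod.
  - match goal with |- Rabs ?x <= Cmod ?z => replace x with (Im z) by (unfold Im; simpl; ring) end.
    apply im_le_Cmod.
Qed.

Lemma Rcont_affine : forall (a b : C) t, Rcont (fun s => a + RtoC s * b)%C t.
Proof. intros; eapply rderiv_continuous, rderiv_affine. Qed.

Lemma Rcont_Cmult : forall (c : C) f t, Rcont f t -> Rcont (fun s => c * f s)%C t.
Proof.
  intros c f t H. apply (Rcont_comp (fun w => c * w)%C f t H).
  apply Ccont_mult; [apply Ccont_const|apply Ccont_id].
Qed.

Lemma Rcont_mult : forall (f g : R -> C) t, Rcont f t -> Rcont g t -> Rcont (fun s => f s * g s)%C t.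
Proof.
  intros f g t Hf Hg. rewrite Rcont_re_im in *. destruct Hf, Hg.
  split.
  - apply (continuous_minus (V := R_NormedModule) (fun s => Re (f s) * Re (g s)) (fun s => Im (f s) * Im (g s)));
      apply (continuous_mult (K := R_AbsRing)); auto.
  - apply (continuous_plus (V := R_NormedModule) (fun s => Re (f s) * Im (g s)) (fun s => Im (f s) * Re (g s)));
      apply (continuous_mult (K := R_AbsRing)); auto.
Qed.

Lemma Rcont_plus : forall (f g : R -> C) t, Rcont f t -> Rcont g t -> Rcont (fun s => f s + g s)%C t.
Proof. intros f g t Hf Hg. apply (continuous_plus (V := C_R_NormedModule) f g t Hf Hg). Qed.

Lemma Rcont_minus : forall (f g : R -> C) t, Rcont f t -> Rcont g t -> Rcont (fun s => f s - g s)%C t.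
Proof. intros f g t Hf Hg. apply (continuous_minus (V := C_R_NormedModule) f g t Hf Hg). Qed.

Lemma is_Cint_mult : forall (f : R -> C) a b (c l : C),
  is_Cint f a b l -> is_Cint (fun t => c * f t)%C a b (c * l)%C.
Proof.
  intros f a b c l H.
  pose proof (is_RInt_fct_extend_fst (U := R_NormedModule) (V := R_NormedModule) _ _ _ _ H) as H1.
  pose proof (is_RInt_fct_extend_snd (U := R_NormedModule) (V := R_NormedModule) _ _ _ _ H) as H2.
  apply (is_RInt_fct_extend_pair (U := R_NormedModule) (V := R_NormedModule)); simpl.
  - apply (is_RInt_minus (V := R_NormedModule));
      apply (is_RInt_scal (V := R_NormedModule)); auto.
  - apply (is_RInt_plus (V := R_NormedModule));
      apply (is_RInt_scal (V := R_NormedModule)); auto.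
Qed.

Lemma ex_Cint_cont : forall (f : R -> C) a b, a <= b ->
  (forall t, a <= t <= b -> Rcont f t) -> ex_Cint f a b.
Proof.
  intros f a b Hab H. apply (ex_RInt_continuous (V := C_R_CompleteNormedModule)).
  intros t Ht. rewrite Rmin_left, Rmax_right in Ht by auto. apply H; auto.
Qed.

Lemma Cint_correct : forall (f : R -> C) a b, a <= b ->
  (forall t, a <= t <= b -> Rcont f t) -> is_Cint f a b (Cint f a b).
Proof. intros. apply (RInt_correct (V := C_R_CompleteNormedModule)). apply ex_Cint_cont; auto. Qed.

Lemma Cint_unique : forall (f : R -> C) a b (l : C), is_Cint f a b l -> Cint f a b = l.
Proof. intros. apply is_RInt_unique; auto. Qed.

Lemma Cint_bound : forall (f : R -> C) a b M, a <= b ->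
  (forall t, a <= t <= b -> Rcont f t) ->
  (forall t, a <= t <= b -> Cmod (f t) <= M) -> Cmod (Cint f a b) <= (b - a) * M.
Proof.
  intros f a b M Hab Hc HM.
  rewrite <- norm_C_R. apply (norm_RInt_le_const (V := C_R_NormedModule) f a b); auto.
  - intros t Ht. rewrite norm_C_R; auto.
  - apply Cint_correct; auto.
Qed.

Lemma Cint_mult : forall (f : R -> C) a b (c : C), a <= b ->
  (forall t, a <= t <= b -> Rcont f t) -> Cint (fun t => c * f t)%C a b = (c * Cint f a b)%C.
Proof. intros. apply Cint_unique, is_Cint_mult, Cint_correct; auto. Qed.

Lemma Cint_minus : forall (f g : R -> C) a b, a <= b ->
  (forall t, a <= t <= b -> Rcont f t) -> (forall t, a <= t <= b -> Rcont g t) ->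
  Cint (fun t => f t - g t)%C a b = (Cint f a b - Cint g a b)%C.
Proof.
  intros. apply Cint_unique. apply (is_RInt_minus (V := C_R_NormedModule)); apply Cint_correct; auto.
Qed.

Lemma Cint_const : forall (c : C) a b, Cint (fun _ => c) a b = (RtoC (b - a) * c)%C.
Proof.
  intros. rewrite <- scal_R_Cmult. apply (RInt_const (V := C_R_CompleteNormedModule)).
Qed.

Lemma Cint_Chasles : forall (f : R -> C) a b c, a <= b -> b <= c ->
  (forall t, a <= t <= c -> Rcont f t) -> Cint f a c = (Cint f a b + Cint f b c)%C.
Proof.
  intros f a b c H1 H2 H. symmetry.
  apply (RInt_Chasles (V := C_R_CompleteNormedModule)); apply ex_Cint_cont; auto;
    intros; apply H; lra.
Qed.

Lemma Cint_ext : forall (f g : R -> C) a b, a <= b ->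
  (forall t, a <= t <= b -> f t = g t) -> Cint f a b = Cint g a b.
Proof.
  intros f g a b Hab H. apply RInt_ext. intros t Ht.
  rewrite Rmin_left, Rmax_right in Ht by auto. apply H; lra.
Qed.

Lemma Cint_FTC : forall (F f : R -> C) a b, a <= b ->
  (forall t, a <= t <= b -> rderiv F t (f t)) -> (forall t, a <= t <= b -> Rcont f t) ->
  Cint f a b = (F b - F a)%C.
Proof.
  intros F f a b Hab H1 H2. apply Cint_unique.
  apply (is_RInt_derive (V := C_R_CompleteNormedModule) F f);
  intros t Ht; rewrite Rmin_left, Rmax_right in Ht by auto; auto.
Qed.

(** * Goursat's theorem for rectangles *)

Definition hseg (f : C -> C) (a b y : R) : C := Cint (fun x => f (x, y)) a b.
Definition vseg (f : C -> C) (x c d : R) : C := Cint (fun y => Ci * f (x, y))%C c d.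
(** The boundary integral, counterclockwise: the vertical sides carry the factor [Ci] of
    [vseg], the derivative of the parametrization. *)
Definition rect_int (f : C -> C) (a b c d : R) : C :=
  (hseg f a b c - hseg f a b d + vseg f b c d - vseg f a c d)%C.
Definition in_rect (a b c d : R) (z : C) : Prop := a <= Re z <= b /\ c <= Im z <= d.

Lemma rderiv_hline : forall y t, rderiv (fun x => (x, y) : C) t (RtoC 1).
Proof.
  intros y t. apply (is_derive_ext (fun x => (0, y) + RtoC x * RtoC 1)%C).
  - intros x. apply C_ext; unfold Re, Im; simpl; ring.
  - apply rderiv_affine.
Qed.

Lemma rderiv_vline : forall x t, rderiv (fun y => (x, y) : C) t Ci.
Proof.
  intros y t. apply (is_derive_ext (fun x => (y, 0) + RtoC x * Ci)%C).
  - intros x. apply C_ext; unfold Re, Im; simpl; ring.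
  - apply rderiv_affine.
Qed.

Lemma hline_cont : forall f x y, Ccont f (x, y) -> Rcont (fun x => f (x, y)) x.
Proof.
  intros f x y H. apply (Rcont_comp f (fun x => (x, y))); auto.
  eapply rderiv_continuous, rderiv_hline.
Qed.

Lemma vline_cont : forall f x y, Ccont f (x, y) -> Rcont (fun y => f (x, y)) y.
Proof.
  intros f x y H. apply (Rcont_comp f (fun y => (x, y))); auto.
  eapply rderiv_continuous, rderiv_vline.
Qed.

Lemma vline_cont_Ci : forall f x y, Ccont f (x, y) -> Rcont (fun y => Ci * f (x, y))%C y.
Proof. intros. apply Rcont_Cmult, vline_cont; auto. Qed.

Lemma hseg_primitive : forall F f a b y, a <= b ->
  (forall x, a <= x <= b -> cderiv F (x, y) (f (x, y))) ->
  (forall x, a <= x <= b -> Ccont f (x, y)) -> hseg f a b y = (F (b, y) - F (a, y))%C.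
Proof.
  intros F f a b y Hab HF Hf.
  apply (Cint_FTC (fun x => F (x, y)) (fun x => f (x, y))); auto.
  - intros x Hx. eapply rderiv_eq.
    + apply (rderiv_comp F (fun x => (x, y) : C)); [apply HF; auto| apply rderiv_hline].
    + Cring.
  - intros; apply hline_cont; auto.
Qed.

Lemma vseg_primitive : forall F f x c d, c <= d ->
  (forall y, c <= y <= d -> cderiv F (x, y) (f (x, y))) ->
  (forall y, c <= y <= d -> Ccont f (x, y)) -> vseg f x c d = (F (x, d) - F (x, c))%C.
Proof.
  intros F f x c d Hab HF Hf.
  apply (Cint_FTC (fun y => F (x, y)) (fun y => Ci * f (x, y))%C); auto.
  - intros y Hy. eapply rderiv_eq.
    + apply (rderiv_comp F (fun y => (x, y) : C)); [apply HF; auto| apply rderiv_vline].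
    + Cring.
  - intros; apply vline_cont_Ci; auto.
Qed.

Lemma rect_int_primitive : forall F f a b c d, a <= b -> c <= d ->
  (forall z, in_rect a b c d z -> cderiv F z (f z)) ->
  (forall z, in_rect a b c d z -> Ccont f z) -> rect_int f a b c d = 0%C.
Proof.
  intros F f a b c d Hab Hcd HF Hf. unfold rect_int.
  rewrite (hseg_primitive F f a b c), (hseg_primitive F f a b d),
    (vseg_primitive F f b c d), (vseg_primitive F f a c d);
    try (intros; first [apply HF|apply Hf]; split; simpl; lra); auto.
  Cring.
Qed.

Lemma rect_int_split : forall f a m b c n d, a <= m <= b -> c <= n <= d ->
  (forall z, in_rect a b c d z -> Ccont f z) ->
  rect_int f a b c d = (rect_int f a m c n + rect_int f m b c n
                        + rect_int f a m n d + rect_int f m b n d)%C.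
Proof.
  intros f a m b c n d Hm Hn Hf.
  assert (forall y, c <= y <= d -> hseg f a b y = (hseg f a m y + hseg f m b y)%C) as HH.
  { intros y Hy. apply Cint_Chasles; try lra. intros x Hx. apply hline_cont, Hf. split; simpl; lra. }
  assert (forall x, a <= x <= b -> vseg f x c d = (vseg f x c n + vseg f x n d)%C) as VV.
  { intros x Hx. apply Cint_Chasles; try lra. intros y Hy. apply vline_cont_Ci, Hf. split; simpl; lra. }
  unfold rect_int. rewrite !HH, !VV by lra. Cring.
Qed.

Lemma rect_int_bound : forall f a b c d M, a <= b -> c <= d ->
  (forall z, in_rect a b c d z -> Ccont f z) ->
  (forall z, in_rect a b c d z -> Cmod (f z) <= M) ->
  Cmod (rect_int f a b c d) <= 2 * ((b - a) + (d - c)) * M.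
Proof.
  intros f a b c d M Hab Hcd Hf HM.
  assert (forall y, c <= y <= d -> Cmod (hseg f a b y) <= (b - a) * M) as HH.
  { intros y Hy. apply Cint_bound; auto.
    - intros x Hx. apply hline_cont, Hf. split; simpl; lra.
    - intros x Hx. apply HM. split; simpl; lra. }
  assert (forall x, a <= x <= b -> Cmod (vseg f x c d) <= (d - c) * M) as VV.
  { intros x Hx. apply Cint_bound; auto.
    - intros y Hy. apply vline_cont_Ci, Hf. split; simpl; lra.
    - intros y Hy. rewrite Cmod_mult, Cmod_Ci, Rmult_1_l. apply HM. split; simpl; lra. }
  unfold rect_int, Cminus.
  eapply Rle_trans; [apply Cmod_triangle|]. rewrite Cmod_opp.
  pose proof (Cmod_triangle (hseg f a b c + - hseg f a b d) (vseg f b c d)).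
  pose proof (Cmod_triangle (hseg f a b c) (- hseg f a b d)). rewrite Cmod_opp in *.
  pose proof (HH c ltac:(lra)); pose proof (HH d ltac:(lra));
  pose proof (VV a ltac:(lra)); pose proof (VV b ltac:(lra)). lra.
Qed.

Lemma rect_int_minus : forall f g a b c d, a <= b -> c <= d ->
  (forall z, in_rect a b c d z -> Ccont f z) ->
  (forall z, in_rect a b c d z -> Ccont g z) ->
  rect_int (fun z => f z - g z)%C a b c d = (rect_int f a b c d - rect_int g a b c d)%C.
Proof.
  intros f g a b c d Hab Hcd Hf Hg.
  assert (forall y, c <= y <= d ->
    hseg (fun z => f z - g z)%C a b y = (hseg f a b y - hseg g a b y)%C) as HH.
  { intros y Hy. apply Cint_minus; auto; intros x Hx; apply hline_cont; [apply Hf|apply Hg]; split; simpl; lra. }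
  assert (forall x, a <= x <= b ->
    vseg (fun z => f z - g z)%C x c d = (vseg f x c d - vseg g x c d)%C) as VV.
  { intros x Hx. unfold vseg. rewrite <- Cint_minus; auto.
    - apply Cint_ext; auto. intros; Cring.
    - intros y Hy; apply vline_cont_Ci, Hf; split; simpl; lra.
    - intros y Hy; apply vline_cont_Ci, Hg; split; simpl; lra. }
  unfold rect_int. rewrite !HH, !VV by lra. Cring.
Qed.

(** Near a point of differentiability the affine part of [f] has a primitive, so
    only the remainder contributes, and it is small compared with the area. *)
Lemma rect_int_small : forall f (p l : C) e a b c d, a <= b -> c <= d -> 0 <= e ->
  in_rect a b c d p ->
  (forall z, in_rect a b c d z -> Ccont f z) ->
  (forall z, in_rect a b c d z -> Cmod (f z - f p - (z - p) * l) <= e * Cmod (z - p)) ->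
  Cmod (rect_int f a b c d) <= 2 * e * (((b - a) + (d - c)) * ((b - a) + (d - c))).
Proof.
  intros f p l e a b c d Hab Hcd He Hp Hf Hd.
  set (g := fun z : C => (f p + (z - p) * l)%C).
  set (G := fun z : C => (f p * z + (z - p) * (z - p) * (l * / RtoC 2))%C).
  assert (forall z, cderiv G z (g z)) as HG.
  { intros z. unfold G, g. eapply cderiv_eq.
    - cder.
    - cbv beta. Cfield. }
  assert (forall z, Ccont g z) as Hg by (intros z; unfold g; ccont).
  assert (rect_int g a b c d = 0%C) as E by (apply (rect_int_primitive G); auto).
  replace (rect_int f a b c d) with (rect_int (fun z => f z - g z)%C a b c d)
    by (rewrite rect_int_minus, E; auto; Cring).
  replace (2 * e * ((b - a + (d - c)) * (b - a + (d - c)))) with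
    (2 * (b - a + (d - c)) * (e * (b - a + (d - c)))) by ring.
  apply rect_int_bound; auto.
  - intros; apply Ccont_minus; auto.
  - intros z Hz. unfold g. replace (f z - (f p + (z - p) * l))%C with (f z - f p - (z - p) * l)%C by Cring.
    eapply Rle_trans; [apply Hd; auto|]. apply Rmult_le_compat_l; auto.
    eapply Rle_trans; [apply Cmod_le_re_im|]. destruct Hz, Hp. unfold Re, Im in *; simpl.
    apply Rplus_le_compat; apply Rabs_le; lra.
Qed.

(** The selection step of the bisection. *)
Lemma sum4_large : forall (a b c d : C) m,
  m <= Cmod (a + b + c + d) ->
  m / 4 <= Cmod a \/ m / 4 <= Cmod b \/ m / 4 <= Cmod c \/ m / 4 <= Cmod d.
Proof.
  intros a b c d m H. apply NNPP; intros K.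
  apply not_or_and in K; destruct K as [K1 K]. apply not_or_and in K; destruct K as [K2 K].
  apply not_or_and in K; destruct K as [K3 K4].
  pose proof (Cmod_triangle (a + b + c) d); pose proof (Cmod_triangle (a + b) c);
  pose proof (Cmod_triangle a b). lra.
Qed.

Section Bisection.
Variables (f : C -> C) (L M : R).
Hypotheses (HL : 0 <= L) (HM : 0 <= M).

Let bad (m : R) (n : nat) (p : C) : Prop :=
  m / 4 ^ n <= Cmod (rect_int f (Re p) (Re p + L / 2 ^ n) (Im p) (Im p + M / 2 ^ n)).

Let child (n : nat) (p q : C) : Prop :=
  Re p <= Re q <= Re p + L / 2 ^ S n /\ Im p <= Im q <= Im p + M / 2 ^ S n.

Lemma bisection_step : forall m n p,
  (forall z, in_rect (Re p) (Re p + L / 2 ^ n) (Im p) (Im p + M / 2 ^ n) z -> Ccont f z) ->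
  bad m n p -> exists q, child n p q /\ bad m (S n) q.
Proof.
  intros m n [x y] Hc Hb. unfold bad, child in *; unfold Re, Im in *; cbn [fst snd] in *.
  assert (0 < 2 ^ n) by (apply pow_lt; lra). assert (0 < 4 ^ n) by (apply pow_lt; lra).
  set (l := L / 2 ^ S n). set (k := M / 2 ^ S n).
  assert (0 <= l) by (apply Rle_div_r; [simpl; lra|rewrite Rmult_0_l; auto]).
  assert (0 <= k) by (apply Rle_div_r; [simpl; lra|rewrite Rmult_0_l; auto]).
  assert (L / 2 ^ n = l + l) as EL by (unfold l; simpl; field; lra).
  assert (M / 2 ^ n = k + k) as EM by (unfold k; simpl; field; lra).
  rewrite EL, EM in *.
  rewrite (rect_int_split f x (x + l) (x + (l + l)) y (y + k) (y + (k + k))) in Hb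
    by (auto; split; lra).
  assert (m / 4 ^ n / 4 = m / 4 ^ S n) as E4 by (simpl; field; lra).
  apply sum4_large in Hb. rewrite E4 in Hb.
  destruct Hb as [Hb|[Hb|[Hb|Hb]]].
  - exists (x, y); cbn [fst snd]; split; [lra|auto].
  - exists (x + l, y); cbn [fst snd]; split; [lra|].
    replace (x + l + l) with (x + (l + l)) by ring; auto.
  - exists (x, y + k); cbn [fst snd]; split; [lra|].
    replace (y + k + k) with (y + (k + k)) by ring; auto.
  - exists (x + l, y + k); cbn [fst snd]; split; [lra|].
    replace (y + k + k) with (y + (k + k)) by ring.
    replace (x + l + l) with (x + (l + l)) by ring; auto.
Qed.
End Bisection.

Lemma nested_limit : forall (x : nat -> R) L, 0 <= L ->
  (forall n, x n <= x (S n) <= x n + L / 2 ^ S n) ->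
  exists p, forall n, x n <= p <= x n + L / 2 ^ n.
Proof.
  intros x L HL H.
  assert (forall n, 0 < 2 ^ n) as P by (intros; apply pow_lt; lra).
  assert (forall n, x (S n) + L / 2 ^ S n <= x n + L / 2 ^ n) as Dn.
  { intros n. specialize (H n). replace (L / 2 ^ n) with (L / 2 ^ S n + L / 2 ^ S n).
    - lra.
    - simpl; specialize (P n); field; lra. }
  assert (forall n k, x n <= x (n + k)%nat) as I1.
  { intros n k; induction k. rewrite Nat.add_0_r; lra. rewrite Nat.add_succ_r. specialize (H (n + k)%nat); lra. }
  assert (forall n k, x (n + k)%nat + L / 2 ^ (n + k) <= x n + L / 2 ^ n) as I2.
  { intros n k; induction k. rewrite Nat.add_0_r; lra. rewrite Nat.add_succ_r. specialize (Dn (n + k)%nat); lra. }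
  assert (forall n, 0 <= L / 2 ^ n) as Q.
  { intros n. apply Rle_div_r; [apply Rlt_gt, P|lra]. }
  assert (forall n m, x m <= x n + L / 2 ^ n) as I3.
  { intros n m. destruct (Nat.le_ge_cases n m) as [K|K].
    - replace m with (n + (m - n))%nat by lia. specialize (I2 n (m - n)%nat).
      specialize (Q (n + (m - n))%nat). lra.
    - specialize (I1 m (n - m)%nat). replace (m + (n - m))%nat with n in I1 by lia.
      specialize (Q n). lra. }
  destruct (completeness (fun r => exists n, r = x n)) as [p [Hp1 Hp2]].
  - exists (x O + L / 2 ^ O). intros r [n ->]. apply I3.
  - exists (x O), O; auto.
  - exists p. intros n; split.
    + apply Hp1; exists n; auto.
    + apply Hp2. intros r [m ->]. apply I3.
Qed.

(** Goursat's theorem: a failure would persist, scaled by the area, on nested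
    rectangles shrinking to a point of differentiability. *)
Theorem Goursat : forall f a b c d, a <= b -> c <= d ->
  (forall z, in_rect a b c d z -> cderivable f z) -> rect_int f a b c d = 0%C.
Proof.
  intros f a b c d Hab Hcd Hf.
  assert (forall z, in_rect a b c d z -> Ccont f z) as Hc.
  { intros z Hz. destruct (Hf z Hz) as [l Hl]. eapply cderiv_continuous; eauto. }
  set (L := b - a). set (M := d - c).
  assert (0 <= L) by (unfold L; lra). assert (0 <= M) by (unfold M; lra).
  set (m := Cmod (rect_int f a b c d)).
  destruct (Cmod_ge_0 (rect_int f a b c d)) as [Hm|Hm]; [|apply Cmod_eq_0; auto].
  exfalso. fold m in Hm.
  assert (forall n, 0 < 2 ^ n) as P2 by (intros; apply pow_lt; lra).
  assert (forall n, 0 <= L / 2 ^ n) as PL by (intros n; apply Rle_div_r; [apply Rlt_gt, P2|lra]).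
  assert (forall n, 0 <= M / 2 ^ n) as PM by (intros n; apply Rle_div_r; [apply Rlt_gt, P2|lra]).
  set (inside := fun (n : nat) (p : C) => a <= Re p /\ Re p + L / 2 ^ n <= b /\ c <= Im p /\ Im p + M / 2 ^ n <= d).
  set (bad := fun (n : nat) (p : C) => m / 4 ^ n <= Cmod (rect_int f (Re p) (Re p + L / 2 ^ n) (Im p) (Im p + M / 2 ^ n))).
  set (child := fun (n : nat) (p q : C) => Re p <= Re q <= Re p + L / 2 ^ S n /\ Im p <= Im q <= Im p + M / 2 ^ S n).
  assert (forall np : nat * C, exists q, (inside (fst np) (snd np) -> bad (fst np) (snd np) ->
            inside (S (fst np)) q /\ bad (S (fst np)) q) /\ child (fst np) (snd np) q) as Step.
  { intros [n p]; cbn [fst snd].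
    destruct (classic (inside n p /\ bad n p)) as [[Hi Hb]|Hn].
    - destruct (bisection_step f L M H H0 m n p) as [q [Hq1 Hq2]]; auto.
      { intros z [Hz1 Hz2]. apply Hc. destruct Hi as [? [? [? ?]]]. split; lra. }
      exists q; split; auto. intros _ _; split; auto.
      destruct Hi as [? [? [? ?]]], Hq1. unfold inside.
      specialize (P2 n).
      replace (L / 2 ^ n) with (L / 2 ^ S n + L / 2 ^ S n) in * by (simpl; field; lra).
      replace (M / 2 ^ n) with (M / 2 ^ S n + M / 2 ^ S n) in * by (simpl; field; lra). lra.
    - exists p; split; [tauto|]. specialize (PL (S n)); specialize (PM (S n)). unfold child; lra. }
  apply choice in Step. destruct Step as [nxt Hnxt].
  set (s := fix s n := match n with O => (a, c) : C | S k => nxt (k, s k) end).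
  assert (forall n, inside n (s n) /\ bad n (s n)) as Inv.
  { induction n.
    - unfold inside, bad; unfold Re, Im; simpl. unfold L, M, m.
      split; [lra|]. right. rewrite Rdiv_1_r. do 2 f_equal; field.
    - destruct IHn as [I1 I2]. destruct (Hnxt (n, s n)) as [K _]. apply K; auto. }
  assert (forall n, child n (s n) (s (S n))) as Ch.
  { intros n. destruct (Hnxt (n, s n)) as [_ K]. apply K. }
  destruct (nested_limit (fun n => Re (s n)) L) as [px Hpx]; auto. { intros n; apply (Ch n). }
  destruct (nested_limit (fun n => Im (s n)) M) as [py Hpy]; auto. { intros n; apply (Ch n). }
  set (p := (px, py) : C).
  assert (in_rect a b c d p) as Hp.
  { specialize (Hpx O); specialize (Hpy O); simpl in *. unfold in_rect, p, Re, Im, L, M in *; simpl in *. lra. }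
  destruct (Hf p Hp) as [l Hl]. rewrite cderiv_eps in Hl.
  set (S2 := (L + M) * (L + M)). assert (0 <= S2) by (unfold S2; nra).
  (* Small enough for the bound of [rect_int_small] to fall below [m / 4^N]. *)
  set (e := m / (4 * (S2 + 1))).
  assert (0 < e) by (unfold e; apply Rdiv_lt_0_compat; lra).
  destruct (Hl e) as [dl [Hdl K]]; auto.
  destruct (pow_lt_1_zero (/ 2) ltac:(rewrite Rabs_pos_eq; lra) (dl / (L + M + 1))) as [N HN].
  { apply Rdiv_lt_0_compat; lra. }
  specialize (HN N (Nat.le_refl _)). rewrite Rabs_pos_eq in HN by (apply pow_le; lra).
  rewrite pow_inv in HN.
  destruct (Inv N) as [[I1 [I2 [I3 I4]]] Ib]. unfold bad in Ib.
  specialize (Hpx N); specialize (Hpy N). simpl in Hpx, Hpy.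
  specialize (PL N); specialize (PM N). pose proof (P2 N) as P2N.
  set (q := s N) in *. set (l' := L / 2 ^ N) in *. set (k' := M / 2 ^ N) in *.
  assert (l' + k' < dl) as Hlk.
  { unfold l', k'. replace (L / 2 ^ N + M / 2 ^ N) with ((L + M) * / 2 ^ N) by (field; lra).
    apply Rle_lt_trans with ((L + M) * (dl / (L + M + 1))).
    - apply Rmult_le_compat_l; lra.
    - replace dl with ((L + M + 1) * (dl / (L + M + 1))) at 2 by (field; lra).
      apply Rmult_lt_compat_r; [apply Rdiv_lt_0_compat|]; lra. }
  assert (Cmod (rect_int f (Re q) (Re q + l') (Im q) (Im q + k')) <=
     2 * e * ((l' + k') * (l' + k'))) as B.
  { replace ((l' + k') * (l' + k')) with
      (((Re q + l' - Re q) + (Im q + k' - Im q)) * ((Re q + l' - Re q) + (Im q + k' - Im q))) by ring.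
    apply (rect_int_small f p l); try lra.
    - unfold in_rect, p, Re, Im; simpl. unfold Re, Im in *. lra.
    - intros z [Z1 Z2]; apply Hc; unfold in_rect; lra.
    - intros z [Z1 Z2]. apply K. eapply Rle_lt_trans; [apply Cmod_le_re_im|].
      eapply Rle_lt_trans; [|apply Hlk].
      unfold p, Re, Im in *; simpl. apply Rplus_le_compat; apply Rabs_le; lra. }
  assert (2 * e * ((l' + k') * (l' + k')) < m / 4 ^ N); [|lra].
  replace (4 ^ N) with (2 ^ N * 2 ^ N) by (rewrite <- Rpow_mult_distr; f_equal; ring).
  replace ((l' + k') * (l' + k')) with (S2 / (2 ^ N * 2 ^ N)) by (unfold l', k', S2; field; lra).
  replace (2 * e * (S2 / (2 ^ N * 2 ^ N))) with ((2 * e * S2) / (2 ^ N * 2 ^ N)) by (field; lra).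
  apply Rmult_lt_compat_r; [apply Rinv_0_lt_compat; nra|].
  unfold e.
  replace (2 * (m / (4 * (S2 + 1))) * S2) with (m * (S2 / (2 * (S2 + 1)))) by (field; lra).
  rewrite <- (Rmult_1_r m) at 2. apply Rmult_lt_compat_l; [lra|].
  apply Rlt_div_l; lra.
Qed.

(** * Sequences in the plane *)

Definition Cconv (z : nat -> C) (l : C) : Prop :=
  forall e, 0 < e -> exists N, forall n, (N <= n)%nat -> Cmod (z n - l) < e.

Lemma subseq_ge : forall s : nat -> nat, (forall n, (s n < s (S n))%nat) -> forall n, (n <= s n)%nat.
Proof. intros s H n; induction n; [lia|specialize (H n); lia]. Qed.

Lemma Cconv_subseq : forall z l (s : nat -> nat), (forall n, (s n < s (S n))%nat) ->
  Cconv z l -> Cconv (fun n => z (s n)) l.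
Proof.
  intros z l s Hs H e He. destruct (H e He) as [N HN]. exists N; intros n Hn.
  apply HN. pose proof (subseq_ge s Hs n); lia.
Qed.

Lemma real_bounded_subseq : forall (u : nat -> R) M, (forall n, Rabs (u n) <= M) ->
  exists (s : nat -> nat) l, (forall n, (s n < s (S n))%nat) /\
    forall e, 0 < e -> exists N, forall n, (N <= n)%nat -> Rabs (u (s n) - l) < e.
Proof.
  intros u M HM.
  destruct (Bolzano_Weierstrass u (fun x => - M <= x <= M)) as [l Hl].
  { apply compact_P3. }
  { intros n. specialize (HM n). apply Rabs_le_between in HM; auto. }
  assert (forall p : nat * nat, exists k, (fst p <= k)%nat /\ Rabs (u k - l) < / INR (S (snd p))) as K.
  { intros [N n]; cbn [fst snd].
    assert (0 < / INR (S n)) as P by (apply Rinv_0_lt_compat, lt_0_INR; lia).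
    destruct (Hl (fun x => Rabs (x - l) < / INR (S n)) N) as [k [Hk1 Hk2]]; [|exists k; auto].
    exists (mkposreal _ P). intros x Hx. apply Hx. }
  apply choice in K. destruct K as [g Hg].
  set (s := fix s n := match n with O => g (O, O) | S k => g (S (s k), S k) end).
  assert (forall n, Rabs (u (s n) - l) < / INR (S n)) as A.
  { intros [|n]; [apply (Hg (O, O))|apply (Hg (S (s n), S n))]. }
  exists s, l; split.
  - intros n. destruct (Hg (S (s n), S n)) as [Q _]. cbn [fst] in Q. simpl; lia.
  - intros e He. destruct (archimed_cor1 e He) as [N [HN HN0]]. exists N; intros n Hn.
    eapply Rlt_trans; [apply A|]. eapply Rle_lt_trans; [|exact HN].
    apply Rinv_le_contravar; [apply lt_0_INR; lia|apply le_INR; lia].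
Qed.

Lemma bounded_subseq : forall (z : nat -> C) M, (forall n, Cmod (z n) <= M) ->
  exists (s : nat -> nat) l, (forall n, (s n < s (S n))%nat) /\ Cconv (fun n => z (s n)) l.
Proof.
  intros z M HM.
  destruct (real_bounded_subseq (fun n => Re (z n)) M) as [s1 [x [S1 L1]]].
  { intros n. eapply Rle_trans; [apply re_le_Cmod|auto]. }
  destruct (real_bounded_subseq (fun n => Im (z (s1 n))) M) as [s2 [y [S2 L2]]].
  { intros n. eapply Rle_trans; [apply im_le_Cmod|auto]. }
  exists (fun n => s1 (s2 n)), (x, y); split.
  - intros n. specialize (S2 n).
    assert (forall a b, (a < b)%nat -> (s1 a < s1 b)%nat) as Mono.
    { intros a b Hab. induction Hab; [apply S1|]. eapply Nat.lt_trans; eauto. }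
    auto.
  - intros e He. destruct (L1 (e / 2)) as [N1 H1]; [lra|]. destruct (L2 (e / 2)) as [N2 H2]; [lra|].
    exists (N1 + N2)%nat; intros n Hn. eapply Rle_lt_trans; [apply Cmod_le_re_im|].
    specialize (H1 (s2 n)). specialize (H2 n ltac:(lia)).
    pose proof (subseq_ge s2 S2 n). specialize (H1 ltac:(lia)).
    unfold Re, Im in *; simpl; unfold Rminus in *; lra.
Qed.

Lemma Cconv_unique : forall z l1 l2, Cconv z l1 -> Cconv z l2 -> l1 = l2.
Proof.
  intros z l1 l2 H1 H2. apply Ceq_minus, Cmod_eq_0.
  destruct (Cmod_ge_0 (l1 - l2)) as [P|P]; auto. exfalso.
  destruct (H1 (Cmod (l1 - l2) / 2)) as [N1 K1]; [lra|].
  destruct (H2 (Cmod (l1 - l2) / 2)) as [N2 K2]; [lra|].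
  specialize (K1 (N1 + N2)%nat ltac:(lia)); specialize (K2 (N1 + N2)%nat ltac:(lia)).
  pose proof (Cmod_sub_triangle l1 (z (N1 + N2)%nat) l2). rewrite (Cmod_minus_sym l1 (z _)) in H. lra.
Qed.

Lemma Cconv_cont : forall f z l, Ccont f l -> Cconv z l -> Cconv (fun n => f (z n)) (f l).
Proof.
  intros f z l Hf Hz e He. rewrite Ccont_eps in Hf. destruct (Hf e He) as [d [Hd K]].
  destruct (Hz d Hd) as [N HN]. exists N; auto.
Qed.

Lemma Cconv_Cmod_le : forall z l M, Cconv z l -> (forall n, Cmod (z n) <= M) -> Cmod l <= M.
Proof.
  intros z l M H HM. apply Rnot_lt_le; intros K. destruct (H (Cmod l - M)) as [N HN]; [lra|].
  specialize (HN N (Nat.le_refl _)). specialize (HM N).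
  pose proof (Cmod_le_add l (z N)). rewrite (Cmod_minus_sym l) in H0. lra.
Qed.

Lemma Ccont_disc_bounded : forall f a r,
  (forall z, Cmod (z - a) <= r -> Ccont f z) ->
  exists M, 0 <= M /\ forall z, Cmod (z - a) <= r -> Cmod (f z) <= M.
Proof.
  intros f a r Hf. apply NNPP; intros K.
  assert (forall n, exists z, Cmod (z - a) <= r /\ INR n < Cmod (f z)) as Hn.
  { intros n. apply NNPP; intros Q. apply K. exists (INR n); split; [apply pos_INR|].
    intros z Hz. apply Rnot_lt_le; intros P; apply Q; exists z; auto. }
  apply choice in Hn. destruct Hn as [z Hz].
  destruct (bounded_subseq z (Cmod a + r)) as [s [l [Hs Hl]]].
  { intros n. destruct (Hz n) as [Hz1 _]. pose proof (Cmod_le_add (z n) a). lra. }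
  assert (Cmod (l - a) <= r) as Hla.
  { apply (Cconv_Cmod_le (fun n => z (s n) - a)%C).
    - intros e He. destruct (Hl e He) as [N HN]; exists N; intros n Hn.
      replace (z (s n) - a - (l - a))%C with (z (s n) - l)%C by Cring; auto.
    - intros n; apply Hz. }
  pose proof (Cconv_cont f _ l (Hf l Hla) Hl) as Hc.
  destruct (Hc 1 Rlt_0_1) as [N HN].
  destruct (INR_unbounded (Cmod (f l) + 1)) as [m Hm].
  specialize (HN (N + m)%nat ltac:(lia)). destruct (Hz (s (N + m)%nat)) as [_ Q].
  pose proof (subseq_ge s Hs (N + m)). pose proof (Cmod_le_add (f (z (s (N + m)%nat))) (f l)).
  assert (INR m <= INR (s (N + m)%nat)) by (apply le_INR; lia). lra.
Qed.

(** * The mean value inequality *)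

(** The constant [c] allows first-order Taylor estimates: take [c] to be the derivative at
    [z] and [K] the oscillation of the derivative on the segment. The proof applies the
    real mean value theorem in the direction of the value to be estimated. *)
Lemma cderiv_mean_value : forall (f df : C -> C) (z w c : C) K,
  (forall s, 0 <= s <= 1 -> cderiv f (z + RtoC s * (w - z))%C (df (z + RtoC s * (w - z))%C)) ->
  (forall s, 0 <= s <= 1 -> Cmod (df (z + RtoC s * (w - z))%C - c) <= K) ->
  Cmod (f w - f z - c * (w - z)) <= K * Cmod (w - z).
Proof.
  intros f df z w c K Hd HK.
  set (v := (f w - f z - c * (w - z))%C).
  assert (0 <= K) as K0. { eapply Rle_trans; [apply Cmod_ge_0|apply (HK 0); lra]. }
  destruct (Cmod_ge_0 v) as [Hv|Hv]; [|rewrite <- Hv; apply Rmult_le_pos; auto; apply Cmod_ge_0].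
  set (g := fun u : C => (Cconj v * (f u - c * u))%C).
  set (p := fun s => Re (g (z + RtoC s * (w - z))%C)).
  set (dp := fun s => Re (Cconj v * (df (z + RtoC s * (w - z))%C - c) * (w - z))%C).
  assert (forall s, 0 <= s <= 1 -> is_derive p s (dp s)) as Dp.
  { intros s Hs. unfold p, dp.
    apply (rderiv_re_im (fun s => g (z + RtoC s * (w - z))%C) s).
    apply (rderiv_comp g (fun s => z + RtoC s * (w - z))%C); [|apply rderiv_affine].
    unfold g. eapply cderiv_eq.
    - cder. apply Hd; auto.
    - cbv beta. Cring. }
  destruct (MVT_gen p 0 1 dp) as [s [Hs E]].
  - intros s Hs. rewrite Rmin_left, Rmax_right in Hs by lra. apply Dp; lra.
  - intros s Hs. rewrite Rmin_left, Rmax_right in Hs by lra.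
    apply continuity_pt_filterlim.
    apply (ex_derive_continuous (K := R_AbsRing) (V := R_NormedModule)). exists (dp s). apply Dp; auto.
  - rewrite Rmin_left, Rmax_right in Hs by lra.
    assert (p 1 - p 0 = norm2 v) as E1.
    { unfold p. replace (z + RtoC 1 * (w - z))%C with w by Cring.
      replace (z + RtoC 0 * (w - z))%C with z by Cring.
      transitivity (Re (Cconj v * v)%C).
      - replace (Cconj v * v)%C with (g w - g z)%C by (unfold g, v; Cring).
        unfold Re; simpl; ring.
      - unfold norm2, Re, Im; simpl; ring. }
    rewrite E1, Rminus_0_r, Rmult_1_r, <- Cmod_sqr in E.
    assert (dp s <= Cmod v * (K * Cmod (w - z))).
    { unfold dp. eapply Rle_trans; [apply Rle_abs|]. eapply Rle_trans; [apply re_le_Cmod|].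
      rewrite !Cmod_mult, Cmod_conj, Rmult_assoc. apply Rmult_le_compat_l; [apply Cmod_ge_0|].
      apply Rmult_le_compat_r; [apply Cmod_ge_0|]. apply HK; auto. }
    apply Rmult_le_reg_l with (Cmod v); lra.
Qed.

(** * The complex exponential *)

Lemma exp_le_mono : forall x y, x <= y -> exp x <= exp y.
Proof. intros x y [H|H]; [left; apply exp_increasing; auto|right; rewrite H; auto]. Qed.

Definition cexp (z : C) : C := (exp (Re z) * cos (Im z), exp (Re z) * sin (Im z)).

Lemma cexp_plus : forall z w, cexp (z + w) = (cexp z * cexp w)%C.
Proof.
  intros [a b] [c d]. unfold cexp, Re, Im; simpl. rewrite exp_plus, cos_plus, sin_plus.
  apply C_ext; unfold Re, Im; simpl; ring.
Qed.

Lemma cexp_0 : cexp 0 = 1%C.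
Proof. unfold cexp, Re, Im; simpl. rewrite exp_0, cos_0, sin_0. apply C_ext; unfold Re, Im; simpl; ring. Qed.

Lemma Cmod_cexp : forall z, Cmod (cexp z) = exp (Re z).
Proof.
  intros [x y]. pose proof (exp_pos x) as P. pose proof (Cmod_ge_0 (cexp (x, y))) as Q.
  pose proof (Cmod_sqr (cexp (x, y))) as E. pose proof (sin2_cos2 y) as T. unfold Rsqr in T.
  replace (norm2 (cexp (x, y))) with (exp x * exp x * (sin y * sin y + cos y * cos y)) in E
    by (unfold norm2, cexp, Re, Im; simpl; ring).
  rewrite T in E. unfold Re; simpl. nra.
Qed.

Lemma real_deriv_eps : forall (f : R -> R) t l, is_derive f t l -> forall e, 0 < e ->
  exists d, 0 < d /\ forall s, Rabs (s - t) < d -> Rabs (f s - f t - (s - t) * l) <= e * Rabs (s - t).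
Proof.
  intros f t l [_ H] e He. destruct (H t (fun P HP => HP) (mkposreal e He)) as [d Hd].
  exists d; split; [apply cond_pos|]. intros w Hw. apply (Hd w Hw).
Qed.

(** The power series is avoided: the remainder is estimated through the real
    derivatives of [exp], [cos] and [sin] at [0]. *)
Lemma cderiv_cexp_0 : cderiv cexp (RtoC 0) (RtoC 1).
Proof.
  apply cderiv_eps. intros e He.
  (* The remainder is a sum of at most ten terms, each bounded by [u] times the modulus. *)
  set (u := Rmin 1 (e / 16)). assert (0 < u) as U0 by (unfold u; apply Rmin_glb_lt; lra).
  assert (u <= 1) as U1 by apply Rmin_l. assert (u <= e / 16) as U2 by apply Rmin_r.
  clearbody u.
  destruct (real_deriv_eps exp 0 (exp 0) (is_derive_exp 0) u U0) as [d1 [D1 K1]].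
  destruct (real_deriv_eps cos 0 (- sin 0) (is_derive_cos 0) u U0) as [d2 [D2 K2]].
  destruct (real_deriv_eps sin 0 (cos 0) (is_derive_sin 0) u U0) as [d3 [D3 K3]].
  rewrite exp_0 in K1. rewrite sin_0, cos_0 in *.
  exists (Rmin u (Rmin d1 (Rmin d2 d3))); split; [repeat apply Rmin_glb_lt; auto|].
  intros w Hw. rewrite cexp_0.
  replace (w - RtoC 0)%C with w in * by Cring.
  pose proof (Rmin_l u (Rmin d1 (Rmin d2 d3))); pose proof (Rmin_r u (Rmin d1 (Rmin d2 d3))).
  pose proof (Rmin_l d1 (Rmin d2 d3)); pose proof (Rmin_r d1 (Rmin d2 d3)).
  pose proof (Rmin_l d2 d3); pose proof (Rmin_r d2 d3).
  pose proof (re_le_Cmod w) as Rx. pose proof (im_le_Cmod w) as Ry.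
  destruct w as [x y]; unfold Re, Im in Rx, Ry; cbn [fst snd] in *.
  set (m := Cmod (x, y)) in *. assert (0 <= m) by apply Cmod_ge_0.
  specialize (K1 x). specialize (K2 y). specialize (K3 y). rewrite !Rminus_0_r in *.
  specialize (K1 ltac:(lra)); specialize (K2 ltac:(lra)); specialize (K3 ltac:(lra)).
  replace (cos y - 1 - y * - 0) with (cos y - 1) in K2 by ring. rewrite Rmult_1_r in *.
  set (A := exp x - 1 - x) in *. set (B := cos y - 1) in *. set (S := sin y - y) in *.
  eapply Rle_trans; [apply Cmod_le_re_im|].
  unfold cexp, Re, Im; cbn [fst snd]. simpl.
  replace (exp x * cos y + - (1) + - (x * 1 - y * 0)) with (A + A * B + (1 + x) * B) by (unfold A, B; ring).
  replace (exp x * sin y + - 0 + - (x * 0 + y * 1)) with (A * y + A * S + x * y + x * S + S) by (unfold A, S; ring).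
  assert (Rabs A <= u * m) by (eapply Rle_trans; [exact K1|apply Rmult_le_compat_l; lra]).
  assert (Rabs B <= u * m) by (eapply Rle_trans; [exact K2|apply Rmult_le_compat_l; lra]).
  assert (Rabs S <= u * m) by (eapply Rle_trans; [exact K3|apply Rmult_le_compat_l; lra]).
  assert (forall p q a b, Rabs p <= a -> Rabs q <= b -> Rabs (p * q) <= a * b) as MM.
  { intros. rewrite Rabs_mult. apply Rmult_le_compat; auto; apply Rabs_pos. }
  assert (forall p q a b, Rabs p <= a -> Rabs q <= b -> Rabs (p + q) <= a + b) as PP.
  { intros. eapply Rle_trans; [apply Rabs_triang|lra]. }
  assert (Rabs 1 <= 1) by (rewrite Rabs_R1; lra).
  assert (Rabs (A + A * B + (1 + x) * B) <= u * m + u * m * (u * m) + (1 + m) * (u * m))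
    by (repeat first [apply PP|apply MM]; auto).
  assert (Rabs (A * y + A * S + x * y + x * S + S) <= u * m * m + u * m * (u * m) + m * m + m * (u * m) + u * m)
    by (repeat first [apply PP|apply MM]; auto).
  assert (m <= u) by lra.
  assert (0 <= u * m) by (apply Rmult_le_pos; lra).
  assert (u * m <= 1 * 1) by (apply Rmult_le_compat; lra).
  assert (m * m <= u * m) by (apply Rmult_le_compat_r; lra).
  assert (u * m * m <= u * m * 1) by (apply Rmult_le_compat_l; lra).
  assert (u * m * (u * m) <= u * m * 1) by (apply Rmult_le_compat_l; lra).
  assert (u * m <= e / 16 * m) by (apply Rmult_le_compat_r; lra). nra.
Qed.

Lemma cderiv_cexp : forall z, cderiv cexp z (cexp z).
Proof.
  intros z. apply (cderiv_ext (fun w => cexp z * cexp (w - z))%C).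
  { intros w. rewrite <- cexp_plus. f_equal; Cring. }
  eapply cderiv_eq.
  - apply (cderiv_mult (fun _ => cexp z) (fun w => cexp (w - z)%C)); [apply cderiv_const|].
    apply (cderiv_comp cexp (fun w => w - z)%C).
    + replace (z - z)%C with (RtoC 0) by Cring. apply cderiv_cexp_0.
    + cder.
  - cbv beta. Cring.
Qed.

(** * Circle means *)

Definition unit_at (t : R) : C := (cos t, sin t).

Lemma Cmod_unit_at : forall t, Cmod (unit_at t) = 1.
Proof.
  intros t. pose proof (Cmod_ge_0 (unit_at t)). pose proof (Cmod_sqr (unit_at t)) as Q.
  unfold norm2, unit_at, Re, Im in Q; simpl in Q. fold (unit_at t) in Q.
  pose proof (sin2_cos2 t) as T. unfold Rsqr in T. nra.
Qed.

Lemma unit_at_nonzero : forall t, unit_at t <> RtoC 0.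
Proof. intros t; apply Cmod_gt_0; rewrite Cmod_unit_at; lra. Qed.

Lemma unit_at_cexp : forall t, unit_at t = cexp (Ci * RtoC t).
Proof.
  intros t. unfold cexp, unit_at, Re, Im; simpl.
  replace (0 * t - 1 * 0) with 0 by ring. replace (0 * 0 + 1 * t) with t by ring.
  rewrite exp_0. apply C_ext; unfold Re, Im; simpl; ring.
Qed.

Lemma rderiv_unit_at : forall t, rderiv unit_at t (Ci * unit_at t)%C.
Proof.
  intros t. apply (is_derive_ext (fun t => cexp (RtoC 0 + RtoC t * Ci)%C)).
  { intros s. rewrite unit_at_cexp. f_equal. Cring. }
  eapply rderiv_eq.
  - apply (rderiv_comp cexp (fun t => RtoC 0 + RtoC t * Ci)%C); [apply cderiv_cexp|apply rderiv_affine].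
  - rewrite unit_at_cexp. replace (RtoC 0 + RtoC t * Ci)%C with (Ci * RtoC t)%C by Cring. Cring.
Qed.

Lemma Rcont_unit_at : forall t, Rcont unit_at t.
Proof. intros; eapply rderiv_continuous, rderiv_unit_at. Qed.

Definition circle (a : C) (r t : R) : C := (a + RtoC r * unit_at t)%C.

Lemma Cmod_circle : forall a r t, 0 <= r -> Cmod (circle a r t - a) = r.
Proof.
  intros. unfold circle. replace (a + RtoC r * unit_at t - a)%C with (RtoC r * unit_at t)%C by Cring.
  rewrite Cmod_mult, Cmod_unit_at, Cmod_R, Rabs_pos_eq; lra.
Qed.

Lemma Rcont_circle : forall a r t, Rcont (circle a r) t.
Proof.
  intros. unfold circle. apply (Rcont_plus (fun _ => a)); [apply continuous_const|].
  apply Rcont_Cmult, Rcont_unit_at.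
Qed.

Lemma PI2_pos : 0 <= 2 * PI.
Proof. pose proof PI_RGT_0; lra. Qed.

Definition circle_int (f : C -> C) (a : C) (r : R) : C :=
  Cint (fun t => f (circle a r t)) 0 (2 * PI).

(** In the coordinate [log (z - a)] an annulus is a rectangle whose horizontal
    sides carry the same values, so Goursat's theorem compares the other two. *)
Lemma circle_int_radius : forall (f : C -> C) (a : C) r1 r2, 0 < r1 -> r1 <= r2 ->
  (forall z, r1 <= Cmod (z - a) <= r2 -> cderivable f z) ->
  circle_int f a r1 = circle_int f a r2.
Proof.
  intros f a r1 r2 H1 H2 Hf.
  set (F := fun w => f (a + cexp w)%C).
  assert (ln r1 <= ln r2) as Hl by (apply ln_le; auto).
  assert (forall z, in_rect (ln r1) (ln r2) 0 (2 * PI) z -> cderivable F z) as HF.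
  { intros z [Hz _]. destruct (Hf (a + cexp z)%C) as [l Hl'].
    - replace (a + cexp z - a)%C with (cexp z) by Cring. rewrite Cmod_cexp.
      rewrite <- (exp_ln r1), <- (exp_ln r2) by lra. unfold Re in *. split; apply exp_le_mono; lra.
    - eexists. apply (cderiv_comp f (fun w => a + cexp w)%C); [exact Hl'|].
      apply (cderiv_plus (fun _ => a) cexp); [apply cderiv_const|apply cderiv_cexp]. }
  assert (forall r, r1 <= r <= r2 -> vseg F (ln r) 0 (2 * PI) = (Ci * circle_int f a r)%C) as HV.
  { intros r Hr. unfold vseg, circle_int.
    assert (forall t, F (ln r, t) = f (circle a r t)) as E.
    { intros t. unfold F, circle. f_equal. f_equal. unfold cexp, unit_at, Re, Im; simpl.
      rewrite exp_ln by lra. apply C_ext; unfold Re, Im; simpl; ring. }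
    rewrite <- Cint_mult; [| apply PI2_pos|].
    - apply Cint_ext; [apply PI2_pos|]. intros t _. rewrite E; auto.
    - intros t _. apply (Rcont_comp f (circle a r)); [apply Rcont_circle|].
      destruct (Hf (circle a r t)) as [l Hl'].
      + rewrite Cmod_circle; lra.
      + eapply cderiv_continuous; eauto. }
  pose proof (Goursat F _ _ 0 (2 * PI) Hl PI2_pos HF) as G.
  unfold rect_int in G. rewrite !HV in G by lra.
  assert (hseg F (ln r1) (ln r2) (2 * PI) = hseg F (ln r1) (ln r2) 0) as EH.
  { unfold hseg. apply Cint_ext; auto. intros t _. unfold F, cexp, Re, Im; simpl.
    rewrite cos_2PI, sin_2PI, cos_0, sin_0; auto. }
  rewrite EH in G.
  assert (Ci * (circle_int f a r2 - circle_int f a r1) = 0)%C as G2 by (rewrite <- G; Cring).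
  symmetry. apply Ceq_minus.
  replace (circle_int f a r2 - circle_int f a r1)%C with (- Ci * (Ci * (circle_int f a r2 - circle_int f a r1)))%C.
  - rewrite G2; Cring.
  - apply C_ext; unfold Re, Im; simpl; ring.
Qed.

(** As the integral is independent of the radius, it can be computed on arbitrarily
    small circles. *)
Lemma circle_int_limit : forall (f : C -> C) (a : C) R0 (l : C), 0 < R0 ->
  (forall z, 0 < Cmod (z - a) <= R0 -> cderivable f z) ->
  (forall e, 0 < e -> exists d, 0 < d /\
     forall z, 0 < Cmod (z - a) < d -> Cmod (f z - l) <= e) ->
  circle_int f a R0 = (RtoC (2 * PI) * l)%C.
Proof.
  intros f a R0 l HR Hf Hl. apply Ceq_minus, Cmod_eq_0.
  apply (Cmod_small_eq _ 0 (2 * PI)); [apply Cmod_ge_0|]. intros e He.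
  destruct (Hl e He) as [d [Hd K]].
  set (r := Rmin R0 (d / 2)). assert (0 < r) by (unfold r; apply Rmin_glb_lt; lra).
  assert (r <= R0) by apply Rmin_l. assert (r <= d / 2) by apply Rmin_r.
  rewrite <- (circle_int_radius f a r R0); auto.
  2:{ intros z Hz. apply Hf; lra. }
  assert (forall t, Rcont (fun t => f (circle a r t)) t) as Hc.
  { intros t. apply (Rcont_comp f (circle a r)); [apply Rcont_circle|].
    destruct (Hf (circle a r t)) as [l' Hl']; [rewrite Cmod_circle; lra|].
    eapply cderiv_continuous; eauto. }
  replace (RtoC (2 * PI) * l)%C with (Cint (fun _ => l) 0 (2 * PI))
    by (rewrite Cint_const, Rminus_0_r; auto).
  unfold circle_int. rewrite <- Cint_minus; auto using PI2_pos.
  2:{ intros; apply continuous_const. }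
  replace (e * (2 * PI)) with ((2 * PI - 0) * e) by ring.
  apply Cint_bound; auto using PI2_pos.
  - intros t _. apply (Rcont_minus (fun t => f (circle a r t)) (fun _ => l)); auto. apply continuous_const.
  - intros t _. apply K. rewrite Cmod_circle; lra.
Qed.

Theorem mean_value_property : forall (f : C -> C) (a : C) r, 0 < r ->
  (forall z, Cmod (z - a) <= r -> cderivable f z) ->
  circle_int f a r = (RtoC (2 * PI) * f a)%C.
Proof.
  intros f a r Hr Hf. apply circle_int_limit; auto.
  - intros z Hz; apply Hf; lra.
  - intros e He. destruct (Hf a) as [l Hl].
    { replace (a - a)%C with (RtoC 0) by Cring. rewrite Cmod_0; lra. }
    apply cderiv_continuous in Hl. rewrite Ccont_eps in Hl. destruct (Hl e He) as [d [Hd K]].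
    exists d; split; auto. intros z Hz. left; apply K; lra.
Qed.

(** The difference quotient at [a] extends continuously by [l] to [a], and [1 / (z - a)] has
    mean [0] over the circle because its integrand is a derivative in the angle. *)
Lemma circle_int_deriv : forall (f : C -> C) (a : C) r (l : C), 0 < r -> cderiv f a l ->
  (forall z, Cmod (z - a) <= r -> cderivable f z) ->
  circle_int (fun z => f z / (z - a))%C a r = (RtoC (2 * PI) * l)%C.
Proof.
  intros f a r l Hr Hl Hf.
  assert (forall z, 0 < Cmod (z - a) -> (z - a)%C <> RtoC 0) as NZ by (intros z Hz; apply Cmod_gt_0; auto).
  transitivity (circle_int (fun z => (f z - f a) / (z - a))%C a r).
  - assert (forall t, (circle a r t - a)%C <> RtoC 0) as NZ'.
    { intros t. apply NZ. rewrite Cmod_circle; lra. }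
    assert (forall t, Ccont f (circle a r t)) as Cf.
    { intros t. destruct (Hf (circle a r t)) as [l' Hl']; [rewrite Cmod_circle; lra|].
      eapply cderiv_continuous; eauto. }
    assert (forall t, Rcont (fun t => / (circle a r t - a))%C t) as Cv.
    { intros t. apply (Rcont_comp (fun z => / (z - a))%C (circle a r)); [apply Rcont_circle|].
      ccont. auto. }
    assert (circle_int (fun z => / (z - a))%C a r = RtoC 0) as Z.
    { unfold circle_int.
      rewrite (Cint_FTC (fun t => (Ci * / RtoC r) * / unit_at t)%C).
      - unfold unit_at. rewrite cos_2PI, sin_2PI, cos_0, sin_0. Cring.
      - apply PI2_pos.
      - intros t _. eapply rderiv_eq.
        + apply (rderiv_comp (fun u => Ci * / RtoC r * / u)%C unit_at); [|apply rderiv_unit_at].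
          cder. apply unit_at_nonzero.
        + cbv beta. unfold circle. replace (a + RtoC r * unit_at t - a)%C with (RtoC r * unit_at t)%C by Cring.
          assert (RtoC r <> 0)%C by (intros Q; apply RtoC_inj in Q; lra).
          pose proof (unit_at_nonzero t).
          transitivity (- (Ci * Ci) * / (RtoC r * unit_at t))%C; [Cfield; auto|].
          replace (Ci * Ci)%C with (- RtoC 1)%C by (apply C_ext; unfold Re, Im; simpl; ring). Cring.
      - intros t _; apply Cv. }
    unfold circle_int in *.
    rewrite (Cint_ext (fun t => (f (circle a r t) - f a) / (circle a r t - a))%C
       (fun t => f (circle a r t) / (circle a r t - a) - f a * / (circle a r t - a))%C);
      [|apply PI2_pos|intros; unfold Cdiv; Cring].
    rewrite Cint_minus, Cint_mult, Z; auto using PI2_pos.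
    + unfold Cdiv. match goal with |- ?x = _ => set (v := x : C) end.
      apply C_ext; unfold v, Re, Im; simpl; ring.
    + intros t _. apply (Rcont_mult (fun t => f (circle a r t)) (fun t => / (circle a r t - a))%C); auto.
      apply (Rcont_comp f (circle a r)); auto. apply Rcont_circle.
    + intros t _. apply Rcont_Cmult; auto.
  - apply circle_int_limit; auto.
    + intros z Hz. destruct (Hf z) as [l' Hl']; [lra|]. eexists.
      cder; [exact Hl'|]. apply NZ; lra.
    + intros e He. rewrite cderiv_eps in Hl. destruct (Hl e He) as [d [Hd K]]. exists d; split; auto.
      intros z Hz. specialize (K z ltac:(lra)).
      replace ((f z - f a) / (z - a) - l)%C with ((f z - f a - (z - a) * l) / (z - a))%C
        by (Cfield; apply NZ; lra).
      rewrite Cmod_div by (apply NZ; lra). apply Rle_div_l; [|rewrite Rmult_comm in K |- *]; lra.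
Qed.

(** * Cauchy estimates and smoothness *)

(** The integral over [|z - a| = r] representing [2 PI f'(a)]; as a function of [a] with
    [r] fixed it only involves values of [f]. *)
Definition dquot_mean (f : C -> C) (r : R) (a : C) : C :=
  Cint (fun t => f (circle a r t) * / (RtoC r * unit_at t))%C 0 (2 * PI).

Lemma RtoC_neq : forall x y : R, x <> y -> RtoC x <> RtoC y.
Proof. intros x y H Q; apply H, RtoC_inj; auto. Qed.

Lemma circle_minus : forall a r t, (circle a r t - a)%C = (RtoC r * unit_at t)%C.
Proof. intros; unfold circle; Cring. Qed.

Lemma Cmod_circle_radius : forall r t, 0 < r -> Cmod (/ (RtoC r * unit_at t))%C = / r.
Proof.
  intros r t Hr. pose proof (unit_at_nonzero t).
  assert (RtoC r <> RtoC 0) by (apply RtoC_neq; lra).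
  rewrite Cmod_inv by (apply Cmult_neq_0; auto).
  rewrite Cmod_mult, Cmod_unit_at, Cmod_R, Rabs_pos_eq by lra. f_equal; ring.
Qed.

Lemma Rcont_radius_inv : forall r t, 0 < r -> Rcont (fun t => / (RtoC r * unit_at t))%C t.
Proof.
  intros r t Hr. apply (Rcont_comp Cinv (fun t => RtoC r * unit_at t)%C).
  - apply Rcont_Cmult, Rcont_unit_at.
  - apply Ccont_Cinv, Cmult_neq_0; [apply RtoC_neq; lra|apply unit_at_nonzero].
Qed.

Lemma deriv_dquot_mean : forall (f : C -> C) (a : C) r (l : C), 0 < r -> cderiv f a l ->
  (forall z, Cmod (z - a) <= r -> cderivable f z) ->
  dquot_mean f r a = (RtoC (2 * PI) * l)%C.
Proof.
  intros f a r l Hr Hl Hf. rewrite <- (circle_int_deriv f a r l); auto.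
  unfold dquot_mean, circle_int. apply Cint_ext; [apply PI2_pos|]. intros t _.
  rewrite circle_minus. reflexivity.
Qed.

Lemma dquot_mean_bound : forall (g : R -> C) r M, 0 < r ->
  (forall t, Rcont g t) -> (forall t, Cmod (g t) <= M) ->
  Cmod (Cint (fun t => g t * / (RtoC r * unit_at t))%C 0 (2 * PI)) <= 2 * PI * (M / r).
Proof.
  intros g r M Hr Hg HM.
  replace (2 * PI * (M / r)) with ((2 * PI - 0) * (M / r)) by ring.
  apply Cint_bound; [apply PI2_pos| |].
  - intros t _. apply (Rcont_mult g (fun t => / (RtoC r * unit_at t))%C); auto. apply Rcont_radius_inv; auto.
  - intros t _. rewrite Cmod_mult, Cmod_circle_radius by auto.
    apply Rmult_le_compat_r; auto. left; apply Rinv_0_lt_compat; auto.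
Qed.

Lemma Cmod_2PI : forall l, Cmod (RtoC (2 * PI) * l) = 2 * PI * Cmod l.
Proof. intros. rewrite Cmod_mult, Cmod_R, Rabs_pos_eq; auto using PI2_pos. Qed.

Lemma Rcont_on_circle : forall f a r t, 0 <= r ->
  (forall z, Cmod (z - a) <= r -> cderivable f z) -> Rcont (fun t => f (circle a r t)) t.
Proof.
  intros f a r t Hr Hf. apply (Rcont_comp f (circle a r)); [apply Rcont_circle|].
  destruct (Hf (circle a r t)) as [l Hl]; [rewrite Cmod_circle; lra|].
  eapply cderiv_continuous; eauto.
Qed.

Lemma Cauchy_estimate : forall (f : C -> C) (a : C) r (l : C) M, 0 < r -> cderiv f a l ->
  (forall z, Cmod (z - a) <= r -> cderivable f z) ->
  (forall z, Cmod (z - a) = r -> Cmod (f z) <= M) -> Cmod l <= M / r.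
Proof.
  intros f a r l M Hr Hl Hf HM. pose proof PI_RGT_0.
  apply Rmult_le_reg_l with (2 * PI); [lra|]. rewrite <- Cmod_2PI.
  rewrite <- (deriv_dquot_mean f a r l) by auto.
  apply (dquot_mean_bound (fun t => f (circle a r t))); auto.
  - intros t; apply Rcont_on_circle; auto; lra.
  - intros t; apply HM, Cmod_circle; lra.
Qed.

Lemma segment_in_disc : forall (a z w : C) r s, 0 <= s <= 1 ->
  Cmod (z - a) <= r -> Cmod (w - a) <= r -> Cmod (z + RtoC s * (w - z) - a) <= r.
Proof.
  intros a z w r s Hs Hz Hw.
  replace (z + RtoC s * (w - z) - a)%C with (RtoC (1 - s) * (z - a) + RtoC s * (w - a))%C
    by (rewrite RtoC_minus; Cring).
  eapply Rle_trans; [apply Cmod_triangle|]. rewrite !Cmod_mult, !Cmod_R, !Rabs_pos_eq by lra.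
  nra.
Qed.

Lemma Lipschitz_of_deriv_bound : forall (f df : C -> C) (a : C) r L,
  (forall z, Cmod (z - a) <= r -> cderiv f z (df z)) ->
  (forall z, Cmod (z - a) <= r -> Cmod (df z) <= L) ->
  forall z w, Cmod (z - a) <= r -> Cmod (w - a) <= r -> Cmod (f w - f z) <= L * Cmod (w - z).
Proof.
  intros f df a r L Hd HL z w Hz Hw.
  replace (f w - f z)%C with (f w - f z - RtoC 0 * (w - z))%C by Cring.
  apply (cderiv_mean_value f df); intros s Hs.
  - apply Hd, segment_in_disc; auto.
  - replace (df (z + RtoC s * (w - z))%C - RtoC 0)%C with (df (z + RtoC s * (w - z))%C) by Cring.
    apply HL, segment_in_disc; auto.
Qed.

(** The derivative is a circle mean of [f]; such means inherit first Lipschitz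
    continuity and then differentiability from [f]. *)
Theorem deriv_differentiable : forall (f df : C -> C) (a : C) R0, 0 < R0 ->
  (forall z, Cmod (z - a) < R0 -> cderiv f z (df z)) -> cderivable df a.
Proof.
  intros f df a R0 HR Hd. set (r := R0 / 4). assert (0 < r) as Hr by (unfold r; lra).
  assert (4 * r = R0) as E4 by (unfold r; field). clearbody r.
  pose proof PI_RGT_0 as HPI.
  assert (forall z, Cmod (z - a) < R0 -> cderivable f z) as Hf by (intros; eexists; eauto).
  destruct (Ccont_disc_bounded f a (3 * r)) as [M [M0 HM]].
  { intros z Hz. eapply cderiv_continuous, Hd; lra. }
  assert (forall z w s, Cmod (z - a) <= s -> forall r', Cmod (w - z) <= r' -> Cmod (w - a) <= s + r') as Tri.
  { intros z w s Hz r' Hw. pose proof (Cmod_sub_triangle w z a). lra. }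
  set (L := M / r).
  assert (forall z, Cmod (z - a) <= 2 * r -> Cmod (df z) <= L) as HL.
  { intros z Hz. apply (Cauchy_estimate f z r); auto.
    - apply Hd; lra.
    - intros w Hw. apply Hf. specialize (Tri z w _ Hz _ Hw). lra.
    - intros w Hw. apply HM. specialize (Tri z w _ Hz r ltac:(lra)). lra. }
  assert (0 <= L) as L0 by (unfold L; apply Rle_div_r; lra).
  assert (forall z w, Cmod (z - a) <= 2 * r -> Cmod (w - a) <= 2 * r -> Cmod (f w - f z) <= L * Cmod (w - z)) as Lf.
  { apply (Lipschitz_of_deriv_bound f df); auto. intros; apply Hd; lra. }
  assert (forall z s, 0 < s -> Cmod (z - a) <= r -> s <= r ->
    dquot_mean f s z = (RtoC (2 * PI) * df z)%C) as Rep.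
  { intros z s Hs Hz Hsr. apply deriv_dquot_mean; auto. { apply Hd; lra. }
    intros w Hw. apply Hf. specialize (Tri z w _ Hz _ Hw). lra. }
  assert (forall z s t, 0 < s -> Cmod (z - a) <= r -> s <= r ->
    Rcont (fun t => f (circle z s t)) t) as Cc.
  { intros z s t Hs Hz Hsr. apply Rcont_on_circle; [lra|].
    intros w Hw. apply Hf. specialize (Tri z w _ Hz _ Hw). lra. }
  assert (forall z w, Cmod (z - a) <= r -> Cmod (w - a) <= r -> Cmod (df w - df z) <= L / r * Cmod (w - z)) as Ldf.
  { intros z w Hz Hw. apply Rmult_le_reg_l with (2 * PI); [lra|]. rewrite <- Cmod_2PI.
    replace (RtoC (2 * PI) * (df w - df z))%C with (dquot_mean f r w - dquot_mean f r z)%C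
      by (rewrite !Rep by lra; Cring).
    unfold dquot_mean. rewrite <- Cint_minus; try apply PI2_pos;
      try (intros t _; apply (Rcont_mult (fun t => f (circle _ r t)) (fun t => / (RtoC r * unit_at t))%C);
        [apply Cc; lra|apply Rcont_radius_inv; auto]).
    rewrite (Cint_ext _ (fun t => (f (circle w r t) - f (circle z r t)) * / (RtoC r * unit_at t))%C)
      by (try apply PI2_pos; intros; Cring).
    replace (L / r * Cmod (w - z)) with (L * Cmod (w - z) / r) by (field; lra).
    apply (dquot_mean_bound (fun t => f (circle w r t) - f (circle z r t))%C); auto.
    - intros t. apply Rcont_minus; apply Cc; lra.
    - intros t. replace (w - z)%C with (circle w r t - circle z r t)%C by (unfold circle; Cring).
      replace (2 * r) with (r + r) in Lf by ring.
      apply Lf; [apply (Tri z _ r Hz)|apply (Tri w _ r Hw)]; rewrite Cmod_circle; lra. }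
  assert (forall t, Rcont (fun t => df (circle a (r / 2) t)) t) as Cdf.
  { intros t. apply (Rcont_comp df (circle a (r / 2))); [apply Rcont_circle|].
    apply Ccont_eps. intros e He. set (p := circle a (r / 2) t).
    assert (Cmod (p - a) = r / 2) as Hp by (apply Cmod_circle; lra).
    assert (0 <= L / r) by (apply Rle_div_r; lra).
    exists (Rmin (r / 2) (e / (L / r + 1))); split.
    { apply Rmin_glb_lt; [lra|]. apply Rdiv_lt_0_compat; lra. }
    intros w Hw. pose proof (Rlt_le_trans _ _ _ Hw (Rmin_l _ _)). pose proof (Rlt_le_trans _ _ _ Hw (Rmin_r _ _)).
    eapply Rle_lt_trans; [apply Ldf; try lra|].
    - pose proof (Tri p w _ (Req_le _ _ Hp) (r/2) ltac:(lra)). lra.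
    - apply Rlt_div_r in H1; [|lra]. pose proof (Cmod_ge_0 (w - p)). nra. }
  set (D := (RtoC (/ (2 * PI)) * dquot_mean df (r / 2) a)%C).
  exists D. apply cderiv_eps. intros e He.
  set (K := L / r * (2 / r)).
  assert (0 <= K). { unfold K. apply Rmult_le_pos; apply Rle_div_r; lra. }
  exists (Rmin (r / 2) (e / (K + 1))); split.
  { apply Rmin_glb_lt; [lra|]. apply Rdiv_lt_0_compat; lra. }
  intros w Hw. pose proof (Rlt_le_trans _ _ _ Hw (Rmin_l _ _)). pose proof (Rlt_le_trans _ _ _ Hw (Rmin_r _ _)) as Hw2.
  assert (a - a = RtoC 0)%C as Eaa by Cring.
  assert (Cmod (a - a) <= r) as Haa by (rewrite Eaa, Cmod_0; lra).
  assert (Cmod (df w - df a - (w - a) * D) <= K * Cmod (w - a) * Cmod (w - a)) as B.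
  { apply Rmult_le_reg_l with (2 * PI); [lra|]. rewrite <- Cmod_2PI.
    replace (RtoC (2 * PI) * (df w - df a - (w - a) * D))%C with
      (dquot_mean f (r / 2) w - dquot_mean f (r / 2) a - (w - a) * dquot_mean df (r / 2) a)%C.
    2:{ rewrite !Rep by lra. unfold D. rewrite RtoC_inv by lra.
        assert (RtoC (2 * PI) <> RtoC 0) by (apply RtoC_neq; lra). Cfield; auto. }
    unfold dquot_mean.
    assert (forall z t, Cmod (z - a) <= r -> Rcont (fun t => f (circle z (r / 2) t) * / (RtoC (r / 2) * unit_at t))%C t) as C1.
    { intros z t Hz. apply (Rcont_mult (fun t => f (circle z (r/2) t)) (fun t => / (RtoC (r/2) * unit_at t))%C);
        [apply Cc; lra|apply Rcont_radius_inv; lra]. }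
    assert (forall t, Rcont (fun t => df (circle a (r / 2) t) * / (RtoC (r / 2) * unit_at t))%C t) as C2.
    { intros t. apply (Rcont_mult (fun t => df (circle a (r/2) t)) (fun t => / (RtoC (r/2) * unit_at t))%C);
        [apply Cdf|apply Rcont_radius_inv; lra]. }
    rewrite <- Cint_mult, <- !Cint_minus; try apply PI2_pos; auto;
      try (intros t _; apply C1; lra).
    2:{ intros t _. apply (Rcont_minus (fun t => f (circle w (r / 2) t) * / (RtoC (r / 2) * unit_at t))%C
         (fun t => f (circle a (r / 2) t) * / (RtoC (r / 2) * unit_at t))%C); apply C1; lra. }
    2:{ intros t _. apply (Rcont_Cmult (w - a)%C (fun t => df (circle a (r / 2) t) * / (RtoC (r / 2) * unit_at t))%C); auto. }
    rewrite (Cint_ext _ (fun t => (f (circle w (r/2) t) - f (circle a (r/2) t) - df (circle a (r/2) t) * (w - a))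
       * / (RtoC (r/2) * unit_at t))%C) by (try apply PI2_pos; intros; Cring).
    replace (K * Cmod (w - a) * Cmod (w - a)) with ((L / r * Cmod (w - a) * Cmod (w - a)) / (r / 2))
      by (unfold K; field; lra).
    apply (dquot_mean_bound (fun t => f (circle w (r/2) t) - f (circle a (r/2) t) - df (circle a (r/2) t) * (w - a))%C); [lra| |].
    - intros t. apply (Rcont_minus (fun t => f (circle w (r/2) t) - f (circle a (r/2) t))%C
        (fun t => df (circle a (r/2) t) * (w - a))%C).
      + apply Rcont_minus; apply Cc; lra.
      + apply (Rcont_mult (fun t => df (circle a (r/2) t)) (fun _ => (w - a)%C)); auto. apply continuous_const.
    - intros t. set (p := circle a (r/2) t). set (q := circle w (r/2) t).
      assert (Cmod (p - a) <= r) as Hp by (unfold p; rewrite Cmod_circle; lra).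
      assert (Cmod (q - a) <= r) as Hq.
      { replace r with (r/2 + r/2) by field. eapply Tri; [left; exact H0|]. unfold q. rewrite Cmod_circle; lra. }
      assert (q - p = w - a)%C as Eqp by (unfold p, q, circle; Cring).
      rewrite <- Eqp. apply (cderiv_mean_value f df); intros s Hs.
      + apply Hd. eapply Rle_lt_trans; [apply segment_in_disc; eauto|lra].
      + eapply Rle_trans; [apply Ldf; auto; apply segment_in_disc; auto|].
        apply Rmult_le_compat_l; [apply Rle_div_r; lra|].
        replace (p + RtoC s * (q - p) - p)%C with (RtoC s * (q - p))%C by Cring.
        rewrite Cmod_mult, Cmod_R, Rabs_pos_eq by lra. pose proof (Cmod_ge_0 (q - p)). nra. }
  eapply Rle_trans; [exact B|]. apply Rmult_le_compat_r; [apply Cmod_ge_0|].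
  apply Rlt_div_r in Hw2; [|lra]. pose proof (Cmod_ge_0 (w - a)). nra.
Qed.

(** * The maximum principle and Schwarz's lemma *)

Definition moebius (a z : C) : C := ((z + a) / (1 + Cconj a * z))%C.

(** The source of all invariance properties of disc automorphisms. *)
Lemma moebius_identity : forall a z,
  norm2 (1 + Cconj a * z) - norm2 (z + a) = (1 - norm2 a) * (1 - norm2 z).
Proof. intros [a b] [x y]; unfold norm2, Re, Im; simpl; ring. Qed.

Lemma Cmod_le_1_norm2 : forall z, Cmod z <= 1 <-> norm2 z <= 1.
Proof. intros z; rewrite (Cmod_le_norm2 z 1), Rmult_1_r by lra; tauto. Qed.

Lemma Cmod_lt_1_norm2 : forall z, Cmod z < 1 <-> norm2 z < 1.
Proof. intros z; rewrite (Cmod_lt_norm2 z 1), Rmult_1_r by lra; tauto. Qed.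

Lemma moebius_den : forall a z, Cmod a < 1 -> Cmod z <= 1 -> (1 + Cconj a * z)%C <> RtoC 0.
Proof.
  intros a z Ha Hz Q.
  assert (Cmod (Cconj a * z) < 1).
  { rewrite Cmod_mult, Cmod_conj. pose proof (Cmod_ge_0 a); pose proof (Cmod_ge_0 z). nra. }
  replace (Cconj a * z)%C with (- RtoC 1 + (1 + Cconj a * z))%C in H by Cring.
  rewrite Q in H. replace (- RtoC 1 + RtoC 0)%C with (- RtoC 1)%C in H by Cring.
  rewrite Cmod_opp, Cmod_R, Rabs_R1 in H. lra.
Qed.

Lemma norm2_div : forall z w : C, w <> RtoC 0 -> norm2 (z / w) = norm2 z / norm2 w.
Proof.
  intros z w Hw. rewrite <- !Cmod_sqr, Cmod_div by auto.
  assert (0 < Cmod w) by (apply Cmod_gt_0; auto). field; lra.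
Qed.

Lemma norm2_moebius : forall a z, Cmod a < 1 -> Cmod z <= 1 ->
  1 - norm2 (moebius a z) = (1 - norm2 a) * (1 - norm2 z) / norm2 (1 + Cconj a * z).
Proof.
  intros a z Ha Hz. pose proof (moebius_den a z Ha Hz) as D.
  unfold moebius. rewrite norm2_div by auto. rewrite <- moebius_identity.
  pose proof (norm2_pos _ D). field; lra.
Qed.

Lemma moebius_closed : forall a z, Cmod a < 1 -> Cmod z <= 1 -> Cmod (moebius a z) <= 1.
Proof.
  intros a z Ha Hz. apply Cmod_le_1_norm2. apply Cmod_lt_1_norm2 in Ha as Ha2. apply Cmod_le_1_norm2 in Hz as Hz2.
  assert (0 <= 1 - norm2 (moebius a z)); [|lra]. rewrite norm2_moebius by auto.
  pose proof (norm2_pos _ (moebius_den a z Ha Hz)). apply Rle_div_r; [lra|]. rewrite Rmult_0_l. nra.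
Qed.

Lemma moebius_open : forall a z, Cmod a < 1 -> Cmod z < 1 -> Cmod (moebius a z) < 1.
Proof.
  intros a z Ha Hz. apply Cmod_lt_1_norm2. apply Cmod_lt_1_norm2 in Ha as Ha2. apply Cmod_lt_1_norm2 in Hz as Hz2.
  assert (0 < 1 - norm2 (moebius a z)); [|lra]. rewrite norm2_moebius by lra.
  pose proof (norm2_pos _ (moebius_den a z Ha (Rlt_le _ _ Hz))). apply Rdiv_lt_0_compat; nra.
Qed.

Lemma moebius_circle : forall a z, Cmod a < 1 -> Cmod z = 1 -> Cmod (moebius a z) = 1.
Proof.
  intros a z Ha Hz. pose proof (norm2_moebius a z Ha (Req_le _ _ Hz)) as E.
  rewrite <- (Cmod_sqr z), Hz in E. replace (1 - 1 * 1) with 0 in E by ring.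
  rewrite Rmult_0_r in E. unfold Rdiv in E. rewrite Rmult_0_l in E.
  rewrite <- Cmod_sqr in E. pose proof (Cmod_ge_0 (moebius a z)). nra.
Qed.

Lemma moebius_inv : forall a z, Cmod a < 1 -> Cmod z < 1 -> moebius a (moebius (- a) z) = z.
Proof.
  intros a z Ha Hz. assert (Cmod (- a) < 1) as Ha' by (rewrite Cmod_opp; auto).
  pose proof (moebius_den (-a) z Ha' (Rlt_le _ _ Hz)) as D.
  pose proof (moebius_den a (moebius (- a) z) Ha (Rlt_le _ _ (moebius_open _ _ Ha' Hz))) as D2.
  pose proof (moebius_den (- a) a Ha' (Rlt_le _ _ Ha)) as D3.
  unfold moebius in *. rewrite Copp_conj in *.
  replace (1 + Cconj a * ((z + - a) / (1 + - Cconj a * z)))%C with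
    ((1 + - Cconj a * a) / (1 + - Cconj a * z))%C in * by (Cfield; auto).
  Cfield; auto.
Qed.

Lemma moebius_0 : forall a, moebius a (RtoC 0) = a.
Proof.
  intros a. unfold moebius. replace (1 + Cconj a * RtoC 0)%C with (RtoC 1) by Cring. Cfield.
Qed.

Lemma cderivable_moebius : forall a z, Cmod a < 1 -> Cmod z <= 1 -> cderivable (moebius a) z.
Proof.
  intros a z Ha Hz. eexists. unfold moebius. cder. apply moebius_den; auto.
Qed.

Lemma cderivable_comp : forall (f g : C -> C) (z : C), cderivable f (g z) -> cderivable g z ->
  cderivable (fun w => f (g w)) z.
Proof. intros f g z [a Ha] [b Hb]. eexists. eapply cderiv_comp; eauto. Qed.

(** Moving an interior point to the centre by a disc automorphism, the mean value
    property there expresses the value as a mean over boundary values. *)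
Theorem max_principle : forall (f : C -> C) r M, 0 < r ->
  (forall z, Cmod z <= r -> cderivable f z) ->
  (forall z, Cmod z = r -> Cmod (f z) <= M) ->
  forall a, Cmod a < r -> Cmod (f a) <= M.
Proof.
  intros f r M Hr Hf HM a Ha. set (b := (a / RtoC r)%C).
  assert (RtoC r <> RtoC 0) as Rn by (apply RtoC_neq; lra).
  assert (Cmod b < 1) as Hb.
  { unfold b. rewrite Cmod_div, Cmod_R, Rabs_pos_eq by (auto; lra). apply Rlt_div_l; lra. }
  set (g := fun z => f (RtoC r * moebius b z)%C).
  assert (forall z, Cmod z <= 1 -> cderivable g z) as Hg.
  { intros z Hz. apply (cderivable_comp f (fun z => RtoC r * moebius b z)%C).
    - apply Hf. rewrite Cmod_mult, Cmod_R, Rabs_pos_eq by lra.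
      pose proof (moebius_closed b z Hb Hz). nra.
    - destruct (cderivable_moebius b z Hb Hz) as [l Hl]. eexists. cder. exact Hl. }
  assert (g (RtoC 0) = f a) as E.
  { unfold g. rewrite moebius_0. f_equal. unfold b. Cfield; auto. }
  pose proof PI_RGT_0.
  apply Rmult_le_reg_l with (2 * PI); [lra|]. rewrite <- Cmod_2PI, <- E.
  assert (forall z, Cmod (z - RtoC 0) <= 1 -> cderivable g z) as Hg'.
  { intros z Hz. apply Hg. replace z with (z - RtoC 0)%C by Cring; auto. }
  rewrite <- (mean_value_property g (RtoC 0) 1) by (auto; lra).
  unfold circle_int. replace (2 * PI * M) with ((2 * PI - 0) * M) by ring.
  apply Cint_bound; [apply PI2_pos| |].
  - intros t _. apply Rcont_on_circle; auto; lra.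
  - intros t _. unfold g. apply HM. rewrite Cmod_mult, Cmod_R, Rabs_pos_eq by lra.
    rewrite moebius_circle; [ring|auto|].
    replace (circle (RtoC 0) 1 t) with (circle (RtoC 0) 1 t - RtoC 0)%C by Cring. apply Cmod_circle; lra.
Qed.

Lemma deriv_choice : forall (P : C -> Prop) (f : C -> C), (forall z, P z -> cderivable f z) ->
  exists df : C -> C, forall z, P z -> cderiv f z (df z).
Proof.
  intros P f H. assert (forall z, exists l : C, P z -> cderiv f z l) as K.
  { intros z. destruct (classic (P z)) as [Hz|Hz].
    - destruct (H z Hz) as [l Hl]. exists l; auto.
    - exists (RtoC 0); tauto. }
  apply choice in K. destruct K as [df Hdf]; exists df; auto.
Qed.

(** At the zero, [f] agrees up to second order with its Taylor polynomial, because the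
    derivative is itself differentiable there; this makes the quotient differentiable. *)
Lemma divided_zero_differentiable : forall (f : C -> C), (forall z, Cmod z < 1 -> cderivable f z) ->
  f (RtoC 0) = RtoC 0 ->
  exists g : C -> C, (forall z, Cmod z < 1 -> cderivable g z) /\
    forall z, f z = (z * g z)%C.
Proof.
  intros f Hf F0. destruct (deriv_choice _ f Hf) as [df Hdf].
  assert (forall z, (z - RtoC 0)%C = z) as Z0 by (intros; Cring).
  destruct (deriv_differentiable f df (RtoC 0) 1 Rlt_0_1) as [f2 Hf2].
  { intros z Hz. rewrite Z0 in Hz; auto. }
  set (g := fun z => if Ceq_dec z (RtoC 0) then df (RtoC 0) else (f z / z)%C).
  exists g; split.
  - intros z Hz. destruct (Ceq_dec z (RtoC 0)) as [Ez|Nz].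
    + subst z. exists (f2 * RtoC (/ 2))%C. apply cderiv_eps. intros e He.
      rewrite cderiv_eps in Hf2. destruct (Hf2 e He) as [d [Hd K]].
      exists (Rmin d 1); split; [apply Rmin_glb_lt; lra|]. intros w Hw. rewrite Z0 in *.
      pose proof (Rlt_le_trans _ _ _ Hw (Rmin_l _ _)) as W1. pose proof (Rlt_le_trans _ _ _ Hw (Rmin_r _ _)) as W2.
      unfold g. destruct (Ceq_dec (RtoC 0) (RtoC 0)) as [_|Q]; [|tauto].
      destruct (Ceq_dec w (RtoC 0)) as [Ew|Nw].
      * subst w. replace (df (RtoC 0) - df (RtoC 0) - RtoC 0 * (f2 * RtoC (/ 2)))%C with (RtoC 0) by Cring.
        rewrite Cmod_0. lra.
      * set (k := fun u : C => (f u - df (RtoC 0) * u - f2 * RtoC (/ 2) * u * u)%C).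
        set (dk := fun u : C => (df u - df (RtoC 0) - f2 * u)%C).
        assert (Cmod (k w - k (RtoC 0) - RtoC 0 * (w - RtoC 0)) <= e * Cmod w * Cmod (w - RtoC 0)) as B.
        { assert (forall s, 0 <= s <= 1 -> Cmod (RtoC 0 + RtoC s * (w - RtoC 0)) <= Cmod w) as Sg.
          { intros s Hs. replace (RtoC 0 + RtoC s * (w - RtoC 0))%C with (RtoC s * w)%C by Cring.
            rewrite Cmod_mult, Cmod_R, Rabs_pos_eq by lra. pose proof (Cmod_ge_0 w); nra. }
          apply (cderiv_mean_value k dk); intros s Hs; specialize (Sg s Hs).
          - unfold k, dk. eapply cderiv_eq; [cder; apply Hdf; lra|].
            cbv beta. rewrite RtoC_inv by lra. Cfield.
          - unfold dk. set (u := (RtoC 0 + RtoC s * (w - RtoC 0))%C) in *.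
            specialize (K u). rewrite Z0 in K.
            replace (df u - df (RtoC 0) - f2 * u - RtoC 0)%C with (df u - df (RtoC 0) - u * f2)%C by Cring.
            eapply Rle_trans; [apply K; lra|]. apply Rmult_le_compat_l; lra. }
        rewrite Z0 in B.
        replace (f w / w - df (RtoC 0) - w * (f2 * RtoC (/ 2)))%C with
          ((k w - k (RtoC 0) - RtoC 0 * w) / w)%C by (unfold k; rewrite F0; Cfield; auto).
        rewrite Cmod_div by auto. apply Rle_div_l; [apply Rlt_gt, Cmod_gt_0|]; auto.
    + destruct (Hf z Hz) as [l Hl]. eexists.
      eapply (cderiv_ext_loc (fun z => f z / z)%C).
      * exists (Cmod z); split; [apply Cmod_gt_0; auto|]. intros w Hw. unfold g.
        destruct (Ceq_dec w (RtoC 0)) as [Ew|]; auto. subst w. exfalso.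
        replace (RtoC 0 - z)%C with (- z)%C in Hw by Cring. rewrite Cmod_opp in Hw; lra.
      * cder; [exact Hl|auto].
  - intros z. unfold g. destruct (Ceq_dec z (RtoC 0)) as [Ez|Nz].
    + subst z. rewrite F0. Cring.
    + Cfield; auto.
Qed.

(** The maximum principle on circles of radius [r] bounds the quotient by [1 / r]; let
    [r] tend to [1]. *)
Lemma Schwarz_quotient : forall (f : C -> C), (forall z, Cmod z < 1 -> cderivable f z) ->
  (forall z, Cmod z < 1 -> Cmod (f z) <= 1) -> f (RtoC 0) = RtoC 0 ->
  exists g : C -> C, (forall z, Cmod z < 1 -> cderivable g z) /\
    (forall z, f z = (z * g z)%C) /\ (forall z, Cmod z < 1 -> Cmod (g z) <= 1).
Proof.
  intros f Hf H1 F0. destruct (divided_zero_differentiable f Hf F0) as [g [Hg E]].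
  exists g; split; [auto|split; auto]. intros z Hz.
  assert (forall r, Cmod z < r -> r < 1 -> Cmod (g z) <= / r) as B.
  { intros r Hr1 Hr2. assert (0 < r) by (pose proof (Cmod_ge_0 z); lra).
    apply (max_principle g r (/ r)); auto.
    - intros w Hw; apply Hg; lra.
    - intros w Hw. specialize (H1 w ltac:(lra)). rewrite E, Cmod_mult, Hw in H1.
      apply Rmult_le_reg_l with r; auto. rewrite Rinv_r; lra. }
  apply Rnot_lt_le; intros Q. set (m := Cmod (g z)) in *.
  set (r := Rmax ((1 + Cmod z) / 2) ((1 + / m) / 2)).
  assert (/ m < 1) by (rewrite <- Rinv_1; apply Rinv_lt_contravar; lra).
  assert (0 < / m) by (apply Rinv_0_lt_compat; lra).
  assert ((1 + Cmod z) / 2 <= r) by apply Rmax_l. assert ((1 + / m) / 2 <= r) by apply Rmax_r.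
  assert (r < 1) as Hr1 by (apply Rmax_lub_lt; lra).
  specialize (B r ltac:(lra) Hr1). assert (/ m < r) by lra.
  assert (/ r < m). { rewrite <- (Rinv_inv m). apply Rinv_lt_contravar; auto. apply Rmult_lt_0_compat; lra. }
  lra.
Qed.

Lemma Schwarz : forall (f : C -> C), (forall z, Cmod z < 1 -> cderivable f z) ->
  (forall z, Cmod z < 1 -> Cmod (f z) <= 1) -> f (RtoC 0) = RtoC 0 ->
  forall z, Cmod z < 1 -> Cmod (f z) <= Cmod z.
Proof.
  intros f Hf H1 F0 z Hz. destruct (Schwarz_quotient f Hf H1 F0) as [g [_ [E G]]].
  rewrite E, Cmod_mult. specialize (G z Hz). pose proof (Cmod_ge_0 z). nra.
Qed.

Definition disc_selfmap (f : C -> C) : Prop :=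
  holomorphic_on unit_disc f /\ maps_into unit_disc unit_disc f.

(** The inequality says that [f] increases [(1-|z|^2)(1-|w|^2)/|1-conj w z|^2], that
    is, decreases the pseudo-hyperbolic distance. *)
Theorem Schwarz_Pick : forall f, disc_selfmap f -> forall z w, unit_disc z -> unit_disc w ->
  (1 - norm2 z) * (1 - norm2 w) * norm2 (1 - Cconj (f w) * f z) <=
  (1 - norm2 (f z)) * (1 - norm2 (f w)) * norm2 (1 - Cconj w * z).
Proof.
  intros f [Hf Mf] z w Hz Hw. unfold unit_disc in *.
  pose proof (Mf z Hz) as Fz. pose proof (Mf w Hw) as Fw. unfold unit_disc in *.
  assert (forall a, Cmod a < 1 -> Cmod (- a) < 1) as Op by (intros; rewrite Cmod_opp; auto).
  set (F := fun u => moebius (- f w) (f (moebius w u))).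
  assert (forall u, Cmod u < 1 -> cderivable F u) as HF.
  { intros u Hu. apply (cderivable_comp (moebius (- f w)) (fun u => f (moebius w u))).
    - apply cderivable_moebius; auto. left. apply Mf, moebius_open; auto.
    - apply (cderivable_comp f (moebius w)); [apply Hf, moebius_open; auto|].
      apply cderivable_moebius; auto; lra. }
  assert (F (RtoC 0) = RtoC 0) as F0.
  { unfold F. rewrite moebius_0. unfold moebius. replace (f w + - f w)%C with (RtoC 0) by Cring. unfold Cdiv; Cring. }
  assert (forall u, Cmod u < 1 -> Cmod (F u) < 1) as BF.
  { intros u Hu. unfold F. apply moebius_open; auto. apply Mf, moebius_open; auto. }
  set (u := moebius (- w) z). assert (Cmod u < 1) as Hu by (apply moebius_open; auto).
  pose proof (Schwarz F HF (fun u Hu => Rlt_le _ _ (BF u Hu)) F0 u Hu) as S.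
  unfold F, u in S. rewrite moebius_inv in S by auto.
  apply Cmod_le_norm2 in S; [|apply Cmod_ge_0]. rewrite Cmod_sqr in S.
  pose proof (norm2_moebius (- f w) (f z) (Op _ Fw) (Rlt_le _ _ Fz)) as E1.
  pose proof (norm2_moebius (- w) z (Op _ Hw) (Rlt_le _ _ Hz)) as E2.
  pose proof (norm2_pos _ (moebius_den (- f w) (f z) (Op _ Fw) (Rlt_le _ _ Fz))) as P1.
  pose proof (norm2_pos _ (moebius_den (- w) z (Op _ Hw) (Rlt_le _ _ Hz))) as P2.
  rewrite !Copp_conj in *.
  replace (1 + - Cconj w * z)%C with (1 - Cconj w * z)%C in * by Cring.
  replace (1 + - Cconj (f w) * f z)%C with (1 - Cconj (f w) * f z)%C in * by Cring.
  assert (forall a, norm2 (- a) = norm2 a) as No by (intros [a b]; unfold norm2, Re, Im; simpl; ring).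
  rewrite !No in *.
  set (X := norm2 (1 - Cconj w * z)) in *. set (Y := norm2 (1 - Cconj (f w) * f z)) in *.
  assert ((1 - norm2 w) * (1 - norm2 z) / X <= (1 - norm2 (f w)) * (1 - norm2 (f z)) / Y) as Q by lra.
  set (A := (1 - norm2 w) * (1 - norm2 z)) in *.
  set (B := (1 - norm2 (f w)) * (1 - norm2 (f z))) in *.
  apply (Rmult_le_compat_r (X * Y)) in Q; [|apply Rmult_le_pos; lra].
  replace (A / X * (X * Y)) with (A * Y) in Q by (field; lra).
  replace (B / Y * (X * Y)) with (B * X) in Q by (field; lra).
  rewrite (Rmult_comm (1 - norm2 z)), (Rmult_comm (1 - norm2 (f z))). exact Q.
Qed.

(** * Disc and half-plane *)

(** The disc onto the right half-plane, with the boundary point [s] going to infinity. *)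
Definition cayley (s z : C) : C := ((s + z) / (s - z))%C.
Definition icayley (s w : C) : C := (s * ((w - 1) / (w + 1)))%C.
(** The real part of [cayley s z]; its level sets are the horocycles at [s]. *)
Definition poisson (s z : C) : R := (1 - norm2 z) / norm2 (s - z).

Lemma disc_neq_circle : forall s z : C, Cmod s = 1 -> unit_disc z -> (s - z)%C <> RtoC 0.
Proof.
  intros s z Hs Hz Q. apply Ceq_minus in Q. subst s. unfold unit_disc in Hz; lra.
Qed.

Lemma half_plane_neq : forall w : C, 0 <= Re w -> (w + 1)%C <> RtoC 0.
Proof.
  intros [x y] H Q. apply (f_equal Re) in Q. unfold Re in *; simpl in *. lra.
Qed.

Lemma re_cayley : forall s z : C, Cmod s = 1 -> (s - z)%C <> RtoC 0 -> Re (cayley s z) = poisson s z.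
Proof.
  intros s z Hs Hz. pose proof (norm2_pos _ Hz) as P. pose proof (Cmod_sqr s) as Q. rewrite Hs in Q.
  unfold cayley, poisson. destruct s as [a b], z as [x y].
  unfold norm2, Re, Im in *; simpl in *.
  apply (Rmult_eq_reg_r ((a + - x) * (a + - x) + (b + - y) * (b + - y))); [|lra].
  field_simplify; lra.
Qed.

Lemma cayley_pos : forall s z, Cmod s = 1 -> unit_disc z -> 0 < Re (cayley s z).
Proof.
  intros s z Hs Hz. pose proof (disc_neq_circle s z Hs Hz) as N. rewrite re_cayley by auto.
  apply unit_disc_norm2 in Hz. unfold poisson. apply Rdiv_lt_0_compat; [lra|apply norm2_pos; auto].
Qed.

Lemma poisson_pos : forall s z, Cmod s = 1 -> unit_disc z -> 0 < poisson s z.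
Proof.
  intros s z Hs Hz. rewrite <- re_cayley by (auto; apply disc_neq_circle; auto). apply cayley_pos; auto.
Qed.

Lemma norm2_shift : forall w, norm2 (w + 1) - norm2 (w - 1) = 4 * Re w.
Proof. intros [x y]; unfold norm2, Re, Im; simpl; ring. Qed.

Lemma norm2_icayley : forall s w, Cmod s = 1 -> 0 <= Re w ->
  1 - norm2 (icayley s w) = 4 * Re w / norm2 (w + 1).
Proof.
  intros s w Hs Hw. pose proof (half_plane_neq w Hw) as N. pose proof (norm2_pos _ N).
  unfold icayley. rewrite norm2_mult, norm2_div, <- (Cmod_sqr s), Hs, <- norm2_shift by auto.
  field; lra.
Qed.

Lemma icayley_disc : forall s w, Cmod s = 1 -> 0 < Re w -> unit_disc (icayley s w).
Proof.
  intros s w Hs Hw. apply unit_disc_norm2. pose proof (norm2_icayley s w Hs (Rlt_le _ _ Hw)).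
  pose proof (norm2_pos _ (half_plane_neq w (Rlt_le _ _ Hw))).
  assert (0 < 4 * Re w / norm2 (w + 1)) by (apply Rdiv_lt_0_compat; lra). lra.
Qed.

Lemma Cmod1_neq : forall s : C, Cmod s = 1 -> s <> RtoC 0.
Proof. intros s Hs; apply Cmod_gt_0; lra. Qed.

Lemma cayley_icayley : forall s w, Cmod s = 1 -> 0 < Re w -> cayley s (icayley s w) = w.
Proof.
  intros s w Hs Hw. pose proof (half_plane_neq w (Rlt_le _ _ Hw)) as N.
  pose proof (disc_neq_circle s _ Hs (icayley_disc s w Hs Hw)) as N2. pose proof (Cmod1_neq s Hs) as N3.
  unfold cayley, icayley in *.
  assert (RtoC 2 <> RtoC 0) by (apply RtoC_neq; lra).
  replace (s - s * ((w - 1) / (w + 1)))%C with (s * RtoC 2 / (w + 1))%C by (Cfield; auto).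
  Cfield; auto.
Qed.

Lemma icayley_cayley : forall s z, Cmod s = 1 -> unit_disc z -> icayley s (cayley s z) = z.
Proof.
  intros s z Hs Hz. pose proof (disc_neq_circle s _ Hs Hz) as N2. pose proof (Cmod1_neq s Hs) as N3.
  pose proof (half_plane_neq _ (Rlt_le _ _ (cayley_pos s z Hs Hz))) as N.
  unfold cayley, icayley in *.
  assert (RtoC 2 <> RtoC 0) by (apply RtoC_neq; lra).
  replace ((s + z) / (s - z) + 1)%C with (s * RtoC 2 / (s - z))%C by (Cfield; auto).
  Cfield; auto.
Qed.

Lemma cderiv_cayley : forall s z, (s - z)%C <> RtoC 0 ->
  cderiv (cayley s) z (RtoC 2 * s / ((s - z) * (s - z)))%C.
Proof.
  intros s z H. eapply cderiv_eq; [unfold cayley; cder; auto|]. cbv beta. Cfield; auto.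
Qed.

Lemma cderivable_icayley : forall s w, 0 <= Re w -> cderivable (icayley s) w.
Proof.
  intros s w H. eexists. unfold icayley. cder. apply half_plane_neq; auto.
Qed.

Lemma cderivable_cayley : forall s z, Cmod s = 1 -> unit_disc z -> cderivable (cayley s) z.
Proof. intros. eexists. apply cderiv_cayley, disc_neq_circle; auto. Qed.

(** * Schwarz-Pick inequalities with values in the half-plane *)

Lemma Schwarz_Pick_half_plane_open : forall f : C -> C,
  (forall w, 0 < Re w -> cderivable f w) -> (forall w, 0 < Re w -> 0 < Re (f w)) ->
  forall w v, 0 < Re w -> 0 < Re v ->
  Re w * Re v * norm2 (f w - f v) <= Re (f w) * Re (f v) * norm2 (w - v).
Proof.
  intros f Hf Pf w v Hw Hv.
  assert (Cmod (RtoC 1) = 1) as H1 by (rewrite Cmod_R, Rabs_R1; auto).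
  set (F := fun z => icayley 1 (f (cayley 1 z))).
  assert (disc_selfmap F) as SF.
  { split.
    - intros z Hz. pose proof (cayley_pos _ z H1 Hz). pose proof (Pf _ H).
      apply (cderivable_comp (icayley 1) (fun z => f (cayley 1 z))).
      + apply cderivable_icayley; lra.
      + apply (cderivable_comp f (cayley 1)); [auto|]. apply cderivable_cayley; auto.
    - intros z Hz. apply icayley_disc; auto. apply Pf, cayley_pos; auto. }
  pose proof (Schwarz_Pick F SF (icayley 1 w) (icayley 1 v) (icayley_disc _ _ H1 Hw) (icayley_disc _ _ H1 Hv)) as S.
  unfold F in S. rewrite !cayley_icayley in S by auto.
  pose proof (Pf w Hw) as Pw. pose proof (Pf v Hv) as Pv.
  rewrite !norm2_icayley in S by (auto; lra).
  assert (forall a b : C, 0 < Re a -> 0 < Re b ->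
    norm2 (1 - Cconj (icayley 1 b) * icayley 1 a) =
    4 * (norm2 (a - b) + 4 * Re a * Re b) / (norm2 (a + 1) * norm2 (b + 1))) as E.
  { intros a b Ha Hb. pose proof (half_plane_neq a (Rlt_le _ _ Ha)) as Na.
    pose proof (half_plane_neq b (Rlt_le _ _ Hb)) as Nb.
    assert (Cconj b + 1 <> RtoC 0)%C as Ncb.
    { apply half_plane_neq. rewrite re_conj; lra. }
    replace (1 - Cconj (icayley 1 b) * icayley 1 a)%C with
      (RtoC 2 * (a + Cconj b) / ((a + 1) * (Cconj b + 1)))%C.
    - rewrite norm2_div, !norm2_mult by (apply Cmult_neq_0; auto).
      replace (norm2 (RtoC 2)) with 4 by (unfold norm2, Re, Im; simpl; ring).
      replace (norm2 (Cconj b + 1)) with (norm2 (b + 1)) by (destruct b; unfold norm2, Re, Im; simpl; ring).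
      replace (norm2 (a + Cconj b)) with (norm2 (a - b) + 4 * Re a * Re b)
        by (destruct a, b; unfold norm2, Re, Im; simpl; ring). reflexivity.
    - unfold icayley. rewrite Cmult_conj, Cdiv_conj by auto.
      rewrite Cminus_conj, Cplus_conj. replace (Cconj 1) with (RtoC 1) by (apply C_ext; unfold Re, Im; simpl; ring).
      Cfield; auto. }
  rewrite !E in S by auto.
  pose proof (norm2_pos _ (half_plane_neq w (Rlt_le _ _ Hw))) as P1.
  pose proof (norm2_pos _ (half_plane_neq v (Rlt_le _ _ Hv))) as P2.
  pose proof (norm2_pos _ (half_plane_neq _ (Rlt_le _ _ Pw))) as P3.
  pose proof (norm2_pos _ (half_plane_neq _ (Rlt_le _ _ Pv))) as P4.
  set (a := norm2 (w + 1)) in *. set (b := norm2 (v + 1)) in *.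
  set (c := norm2 (f w + 1)) in *. set (d := norm2 (f v + 1)) in *.
  assert (0 < a * b * c * d) as P by (repeat apply Rmult_lt_0_compat; auto).
  apply (Rmult_le_compat_r (a * b * c * d / 64)) in S; [|lra].
  match type of S with ?x <= ?y =>
    replace x with (Re w * Re v * (norm2 (f w - f v) + 4 * Re (f w) * Re (f v))) in S by (field; lra);
    replace y with (Re (f w) * Re (f v) * (norm2 (w - v) + 4 * Re w * Re v)) in S by (field; lra)
  end. lra.
Qed.

(** Values on the boundary line are allowed: apply the previous inequality to
    [f + e] and let [e] tend to [0]. *)
Theorem Schwarz_Pick_half_plane : forall f : C -> C,
  (forall w, 0 < Re w -> cderivable f w) -> (forall w, 0 < Re w -> 0 <= Re (f w)) ->
  forall w v, 0 < Re w -> 0 < Re v ->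
  Re w * Re v * norm2 (f w - f v) <= Re (f w) * Re (f v) * norm2 (w - v).
Proof.
  intros f Hf Pf w v Hw Hv.
  assert (forall e, 0 < e -> Re w * Re v * norm2 (f w - f v) <= (Re (f w) + e) * (Re (f v) + e) * norm2 (w - v)) as H.
  { intros e He. pose proof (Schwarz_Pick_half_plane_open (fun z => f z + RtoC e)%C) as S.
    replace (f w - f v)%C with ((f w + RtoC e) - (f v + RtoC e))%C by Cring.
    replace (Re (f w) + e) with (Re (f w + RtoC e)%C) by (unfold Re; simpl; ring).
    replace (Re (f v) + e) with (Re (f v + RtoC e)%C) by (unfold Re; simpl; ring).
    apply S; auto.
    - intros z Hz. destruct (Hf z Hz) as [l Hl]. eexists. cder. exact Hl.
    - intros z Hz. specialize (Pf z Hz). unfold Re in *; simpl; lra. }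
  pose proof (Pf w Hw) as A. pose proof (Pf v Hv) as B. pose proof (norm2_ge_0 (w - v)) as N.
  apply Rnot_lt_le; intros Q.
  set (x := Re w * Re v * norm2 (f w - f v)) in *. set (a := Re (f w)) in *. set (b := Re (f v)) in *.
  set (n := norm2 (w - v)) in *. set (g := x - a * b * n) in *.
  assert (0 < g) by (unfold g; lra).
  set (m := (a + b + 1) * (n + 1)). assert (0 < m) by (unfold m; nra).
  set (e := Rmin 1 (g / (2 * m))).
  assert (0 < g / (2 * m)) by (apply Rdiv_lt_0_compat; lra).
  assert (0 < e) as E0 by (unfold e; apply Rmin_glb_lt; lra). assert (e <= 1) as E1 by apply Rmin_l.
  assert (e <= g / (2 * m)) as E2 by apply Rmin_r. clearbody e.
  apply Rle_div_r in E2; [|lra]. specialize (H e E0).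
  assert ((a + e) * (b + e) * n - a * b * n <= e * m).
  { replace ((a + e) * (b + e) * n - a * b * n) with (e * ((a + b + e) * n)) by ring.
    apply Rmult_le_compat_l; [lra|]. unfold m. apply Rmult_le_compat; lra. }
  unfold g in *. lra.
Qed.

(** * Primitives on the half-plane *)

Lemma Cint_swap : forall (f : R -> C) a b,
  (forall t, Rmin a b <= t <= Rmax a b -> Rcont f t) -> Cint f b a = (- Cint f a b)%C.
Proof.
  intros f a b H. symmetry. apply (opp_RInt_swap (V := C_R_CompleteNormedModule) f a b).
  apply (ex_RInt_continuous (V := C_R_CompleteNormedModule)); auto.
Qed.

Definition in_signed_rect (a b c d : R) (z : C) : Prop :=
  Rmin a b <= Re z <= Rmax a b /\ Rmin c d <= Im z <= Rmax c d.

(** The primitive is defined by integrals from a base point, so rectangles with sides in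
    either orientation occur. *)
Lemma Goursat_signed : forall f a b c d,
  (forall z, in_signed_rect a b c d z -> cderivable f z) -> rect_int f a b c d = RtoC 0.
Proof.
  intros f a b c d Hf.
  assert (forall z, in_signed_rect a b c d z -> Ccont f z) as Cf.
  { intros z Hz. destruct (Hf z Hz) as [l Hl]. eapply cderiv_continuous; eauto. }
  assert (forall y, Rmin c d <= y <= Rmax c d -> hseg f b a y = (- hseg f a b y)%C) as HS.
  { intros y Hy. apply Cint_swap. intros t Ht. apply hline_cont, Cf. split; auto. }
  assert (forall x, Rmin a b <= x <= Rmax a b -> vseg f x d c = (- vseg f x c d)%C) as VS.
  { intros x Hx. apply Cint_swap. intros t Ht. apply vline_cont_Ci, Cf. split; auto. }
  pose proof (Rmin_l a b); pose proof (Rmin_r a b); pose proof (Rmax_l a b); pose proof (Rmax_r a b).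
  pose proof (Rmin_l c d); pose proof (Rmin_r c d); pose proof (Rmax_l c d); pose proof (Rmax_r c d).
  destruct (Rle_dec a b) as [Hab|Hab]; destruct (Rle_dec c d) as [Hcd|Hcd].
  - apply Goursat; auto. intros z Hz. apply Hf. unfold in_signed_rect. rewrite !Rmin_left, !Rmax_right by lra. auto.
  - replace (rect_int f a b c d) with (- rect_int f a b d c)%C
      by (unfold rect_int; rewrite (VS b), (VS a) by lra; Cring).
    rewrite Goursat; [Cring|lra|lra|]. intros z Hz. apply Hf. unfold in_signed_rect.
    rewrite (Rmin_left a b), (Rmax_right a b), (Rmin_right c d), (Rmax_left c d) by lra. auto.
  - replace (rect_int f a b c d) with (- rect_int f b a c d)%C
      by (unfold rect_int; rewrite (HS c), (HS d) by lra; Cring).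
    rewrite Goursat; [Cring|lra|lra|]. intros z Hz. apply Hf. unfold in_signed_rect.
    rewrite (Rmin_right a b), (Rmax_left a b), (Rmin_left c d), (Rmax_right c d) by lra. auto.
  - replace (rect_int f a b c d) with (rect_int f b a d c)%C
      by (unfold rect_int; rewrite (HS c), (HS d), (VS b), (VS a) by lra; Cring).
    rewrite Goursat; [Cring|lra|lra|]. intros z Hz. apply Hf. unfold in_signed_rect.
    rewrite !Rmin_right, !Rmax_left by lra. auto.
Qed.

Lemma Cint_Chasles_signed : forall (f : R -> C) a b c,
  (forall t, Rmin a (Rmin b c) <= t <= Rmax a (Rmax b c) -> Rcont f t) ->
  Cint f a c = (Cint f a b + Cint f b c)%C.
Proof.
  intros f a b c H. symmetry.
  assert (forall x y, Rmin a (Rmin b c) <= Rmin x y -> Rmax x y <= Rmax a (Rmax b c) -> ex_Cint f x y) as E.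
  { intros x y H1 H2. apply (ex_RInt_continuous (V := C_R_CompleteNormedModule)).
    intros t Ht. apply H; lra. }
  apply (RInt_Chasles (V := C_R_CompleteNormedModule)); apply E;
    unfold Rmin, Rmax; repeat destruct Rle_dec; lra.
Qed.

Lemma Cint_near_const : forall (f : R -> C) (c : C) a b e,
  (forall t, Rmin a b <= t <= Rmax a b -> Rcont f t) ->
  (forall t, Rmin a b <= t <= Rmax a b -> Cmod (f t - c) <= e) ->
  Cmod (Cint f a b - RtoC (b - a) * c) <= e * Rabs (b - a).
Proof.
  assert (forall (f : R -> C) (c : C) a b e, a <= b ->
    (forall t, a <= t <= b -> Rcont f t) ->
    (forall t, a <= t <= b -> Cmod (f t - c) <= e) ->
    Cmod (Cint f a b - RtoC (b - a) * c) <= e * Rabs (b - a)) as K.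
  { intros f c a b e Hab Hf He. rewrite <- Cint_const, <- Cint_minus; auto.
    - rewrite Rabs_pos_eq, Rmult_comm by lra. apply Cint_bound; auto.
      intros t Ht. apply (Rcont_minus f (fun _ => c)); auto. apply continuous_const.
    - intros; apply continuous_const. }
  intros f c a b e Hf He. destruct (Rle_dec a b) as [H|H].
  - rewrite Rmin_left, Rmax_right in * by lra. apply K; auto.
  - rewrite Rmin_right, Rmax_left in * by lra. rewrite (Cint_swap f b a) by (rewrite Rmin_left, Rmax_right by lra; auto).
    replace (- Cint f b a - RtoC (b - a) * c)%C with (- (Cint f b a - RtoC (a - b) * c))%C
      by (rewrite !RtoC_minus; Cring).
    rewrite Cmod_opp, <- Rabs_Ropp, Ropp_minus_distr. apply K; auto; lra.
Qed.

(** Integrate from [1] along the real axis and then vertically. By Goursat's theorem the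
    increment of this function is the integral along the two sides next to the end
    point, which is read off from the continuity of [f] there. *)
Theorem primitive_half_plane : forall f : C -> C, (forall w, 0 < Re w -> cderivable f w) ->
  exists F : C -> C, forall w, 0 < Re w -> cderiv F w (f w).
Proof.
  intros f Hf.
  assert (forall w, 0 < Re w -> Ccont f w) as Cf.
  { intros w Hw. destruct (Hf w Hw) as [l Hl]. eapply cderiv_continuous; eauto. }
  set (F := fun w : C => (hseg f 1 (Re w) 0 + vseg f (Re w) 0 (Im w))%C).
  exists F. intros [x y] Hz. unfold Re in Hz; simpl in Hz.
  assert (forall x' y', 0 < x' -> F (x', y') = (F (x, y) + hseg f x x' y + vseg f x' y y')%C) as Inc.
  { intros x' y' Hx'. unfold F, Re, Im; simpl.
    assert (hseg f 1 x' 0 = hseg f 1 x 0 + hseg f x x' 0)%C as E1.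
    { apply Cint_Chasles_signed. intros t Ht. apply hline_cont, Cf. unfold Re; simpl.
      assert (0 < Rmin 1 (Rmin x x')) by (repeat apply Rmin_glb_lt; lra). lra. }
    assert (vseg f x' 0 y' = vseg f x' 0 y + vseg f x' y y')%C as E2.
    { apply Cint_Chasles_signed. intros t Ht. apply vline_cont_Ci, Cf. unfold Re; simpl; auto. }
    assert (rect_int f x x' 0 y = RtoC 0) as E3.
    { apply Goursat_signed. intros z [Z1 _]. apply Hf.
      assert (0 < Rmin x x') by (repeat apply Rmin_glb_lt; lra). lra. }
    rewrite E1, E2. unfold rect_int in E3.
    replace (hseg f x x' 0)%C with ((hseg f x x' 0 - hseg f x x' y + vseg f x' 0 y - vseg f x 0 y)
       + hseg f x x' y - vseg f x' 0 y + vseg f x 0 y)%C by Cring.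
    rewrite E3. Cring. }
  apply cderiv_eps. intros e He.
  pose proof (Cf (x, y)) as C0. unfold Re in C0; simpl in C0. specialize (C0 Hz).
  rewrite Ccont_eps in C0. destruct (C0 (e / 2)) as [d [Hd K]]; [lra|].
  exists (Rmin (d / 2) x); split; [apply Rmin_glb_lt; lra|].
  intros [x' y'] Hw. pose proof (Rlt_le_trans _ _ _ Hw (Rmin_l _ _)) as W1.
  pose proof (Rlt_le_trans _ _ _ Hw (Rmin_r _ _)) as W2.
  pose proof (re_le_Cmod ((x', y') - (x, y))) as Rx. pose proof (im_le_Cmod ((x', y') - (x, y))) as Ry.
  unfold Re, Im in Rx, Ry; simpl in Rx, Ry. change (x' + - x) with (x' - x) in Rx. change (y' + - y) with (y' - y) in Ry.
  assert (0 < x').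
  { pose proof (Rle_abs (- (x' - x))). rewrite Rabs_Ropp in H. lra. }
  rewrite (Inc x' y') by auto.
  assert (forall u v, Rabs (u - x) <= Rabs (x' - x) -> Rabs (v - y) <= Rabs (y' - y) -> Cmod (f (u, v) - f (x, y)) <= e / 2) as Near.
  { intros u v Hu Hv. left. apply K. eapply Rle_lt_trans; [apply Cmod_le_re_im|]. unfold Re, Im; simpl.
    change (u + - x) with (u - x). change (v + - y) with (v - y). lra. }
  assert (forall a b t, Rmin a b <= t <= Rmax a b -> Rabs (t - a) <= Rabs (b - a)) as Btw.
  { intros a b t. unfold Rmin, Rmax; destruct (Rle_dec a b); intros Ht.
    - rewrite !Rabs_pos_eq; lra.
    - rewrite <- (Rabs_Ropp (t - a)), <- (Rabs_Ropp (b - a)), !Rabs_pos_eq; lra. }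
  assert (Cmod (hseg f x x' y - RtoC (x' - x) * f (x, y)) <= e / 2 * Rabs (x' - x)) as B1.
  { apply (Cint_near_const (fun x => f (x, y))).
    - intros t Ht. apply hline_cont, Cf. unfold Re; simpl.
      assert (0 < Rmin x x') by (apply Rmin_glb_lt; lra). lra.
    - intros t Ht. apply Near; [apply Btw; auto|]. rewrite Rminus_diag, Rabs_R0. apply Rabs_pos. }
  assert (Cmod (vseg f x' y y' - RtoC (y' - y) * (Ci * f (x, y))) <= e / 2 * Rabs (y' - y)) as B2.
  { apply (Cint_near_const (fun y => Ci * f (x', y))%C).
    - intros t Ht. apply vline_cont_Ci, Cf. unfold Re; simpl; auto.
    - intros t Ht. replace (Ci * f (x', t) - Ci * f (x, y))%C with (Ci * (f (x', t) - f (x, y)))%C by Cring.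
      rewrite Cmod_mult, Cmod_Ci, Rmult_1_l. apply Near; [lra|apply Btw; auto]. }
  replace (((x', y') : C) - (x, y))%C with (RtoC (x' - x) + RtoC (y' - y) * Ci)%C in *
    by (apply C_ext; unfold Re, Im; simpl; ring).
  replace (F (x, y) + hseg f x x' y + vseg f x' y y' - F (x, y) - (RtoC (x' - x) + RtoC (y' - y) * Ci) * f (x, y))%C
    with ((hseg f x x' y - RtoC (x' - x) * f (x, y)) + (vseg f x' y y' - RtoC (y' - y) * (Ci * f (x, y))))%C by Cring.
  eapply Rle_trans; [apply Cmod_triangle|]. nra.
Qed.

(** * Inverses of univalent maps *)

(** Compactness of the circle. *)
Lemma circle_min_pos : forall (f : C -> C) (a : C) r, 0 <= r ->
  (forall z, Cmod (z - a) = r -> Ccont f z) -> (forall z, Cmod (z - a) = r -> f z <> RtoC 0) ->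
  exists m, 0 < m /\ forall z, Cmod (z - a) = r -> m <= Cmod (f z).
Proof.
  intros f a r Hr Hc Hn. apply NNPP; intros K.
  assert (forall n, exists z, Cmod (z - a) = r /\ Cmod (f z) < / INR (S n)) as Hs.
  { intros n. apply NNPP; intros Q. apply K. exists (/ INR (S n)); split.
    - apply Rinv_0_lt_compat, lt_0_INR; lia.
    - intros z Hz. apply Rnot_lt_le; intros P; apply Q; exists z; auto. }
  apply choice in Hs. destruct Hs as [z Hz].
  destruct (bounded_subseq z (Cmod a + r)) as [s [l [Hs Hl]]].
  { intros n. destruct (Hz n) as [Hz1 _]. pose proof (Cmod_le_add (z n) a). lra. }
  assert (Cmod (l - a) = r) as Hla.
  { apply Rminus_diag_uniq, Rabs_eq_0.
    apply (Cmod_small_eq _ 0 1); [apply Rabs_pos|]. intros e He. destruct (Hl e He) as [N HN].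
    specialize (HN N (Nat.le_refl _)). destruct (Hz (s N)) as [Q _]. rewrite <- Q, Rmult_1_r.
    eapply Rle_trans; [apply Cmod_diff_le|]. left.
    replace (l - a - (z (s N) - a))%C with (l - z (s N))%C by Cring. rewrite Cmod_minus_sym; auto. }
  apply (Hn l Hla). apply Cmod_eq_0. apply (Cmod_small_eq _ 0 1); [apply Cmod_ge_0|]. intros e He.
  destruct (Cconv_cont f _ l (Hc l Hla) Hl (e / 2)) as [N1 H1]; [lra|].
  destruct (archimed_cor1 (e / 2)) as [N2 [H2 H3]]; [lra|].
  specialize (H1 (N1 + N2)%nat ltac:(lia)). destruct (Hz (s (N1 + N2)%nat)) as [_ Q].
  pose proof (subseq_ge s Hs (N1 + N2)).
  assert (/ INR (S (s (N1 + N2)%nat)) <= / INR N2).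
  { apply Rinv_le_contravar; [apply lt_0_INR; lia|apply le_INR; lia]. }
  pose proof (Cmod_le_add (f l) (f (z (s (N1 + N2)%nat)))). rewrite (Cmod_minus_sym (f l)) in H4. lra.
Qed.

(** A value [b] close to [f a] that is omitted near [a] would make [1/(f - b)] violate the
    mean value property, being much larger at [a] than on a circle around it. *)
Theorem univalent_open_map : forall f, univalent_on unit_disc f ->
  forall a, unit_disc a -> forall r, 0 < r -> exists m, 0 < m /\
  forall b, Cmod (b - f a) < m -> exists z, unit_disc z /\ Cmod (z - a) < r /\ f z = b.
Proof.
  intros f [Hf Inj] a Ha r0 Hr0. unfold unit_disc in Ha.
  set (r := Rmin (r0 / 2) ((1 - Cmod a) / 2)). assert (0 < r) as Hr by (unfold r; apply Rmin_glb_lt; lra).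
  assert (r <= r0 / 2) by apply Rmin_l. assert (r <= (1 - Cmod a) / 2) by apply Rmin_r.
  assert (forall z, Cmod (z - a) <= r -> unit_disc z) as Hd.
  { intros z Hz. unfold unit_disc. pose proof (Cmod_le_add z a). lra. }
  destruct (circle_min_pos (fun z => f z - f a)%C a r) as [m [Hm Km]]; [lra| | |].
  - intros z Hz. ccont. destruct (Hf z) as [l Hl]; [apply Hd; lra|]. eapply cderiv_continuous; eauto.
  - intros z Hz Q. apply Ceq_minus in Q. apply Inj in Q; [|apply Hd; lra|auto].
    subst z. replace (a - a)%C with (RtoC 0) in Hz by Cring. rewrite Cmod_0 in Hz; lra.
  - exists (m / 2); split; [lra|]. intros b Hb. apply NNPP; intros K.
    assert (forall z, Cmod (z - a) <= r -> (f z - b)%C <> RtoC 0) as Nz.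
    { intros z Hz Q. apply Ceq_minus in Q. apply K. exists z; split; [auto|split; [lra|auto]]. }
    set (g := fun z : C => (/ (f z - b))%C).
    assert (forall z, Cmod (z - a) <= r -> cderivable g z) as Hg.
    { unfold g. intros z Hz. destruct (Hf z (Hd z Hz)) as [l Hl]. eexists. cder; [exact Hl|auto]. }
    pose proof (mean_value_property _ a r Hr Hg) as MV.
    assert (Cmod (circle_int g a r) <= (2 * PI - 0) * (/ (m / 2))) as B.
    { apply Cint_bound; [apply PI2_pos| |].
      - intros t _. apply (Rcont_on_circle g); auto; lra.
      - intros t _. pose proof (Cmod_circle a r t ltac:(lra)) as Ec.
        unfold g. rewrite Cmod_inv by (apply Nz; lra). apply Rinv_le_contravar; [lra|].
        specialize (Km _ Ec). pose proof (Cmod_le_add (f (circle a r t) - f a) (f (circle a r t) - b)).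
        replace (f (circle a r t) - f a - (f (circle a r t) - b))%C with (b - f a)%C in H1 by Cring. lra. }
    rewrite MV, Cmod_2PI, Rminus_0_r in B. pose proof PI_RGT_0.
    apply Rmult_le_reg_l in B; [|lra].
    assert ((f a - b)%C <> RtoC 0) as Na.
    { apply Nz. replace (a - a)%C with (RtoC 0) by Cring. rewrite Cmod_0; lra. }
    unfold g in B. rewrite Cmod_inv in B by auto. rewrite Cmod_minus_sym in Hb.
    assert (0 < Cmod (f a - b)) by (apply Cmod_gt_0; auto).
    apply Rinv_lt_contravar in Hb; [lra|]. apply Rmult_lt_0_compat; lra.
Qed.

Lemma cderiv_inverse : forall (f g : C -> C) (b l : C), l <> RtoC 0 ->
  cderiv f (g b) l -> Ccont g b ->
  (exists d, 0 < d /\ forall w, Cmod (w - b) < d -> f (g w) = w) -> cderiv g b (/ l)%C.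
Proof.
  intros f g b l Hl Hf Hg [d0 [Hd0 E]].
  assert (f (g b) = b) as Eb. { apply E. replace (b - b)%C with (RtoC 0) by Cring. rewrite Cmod_0; auto. }
  rewrite cderiv_eps in *. rewrite Ccont_eps in Hg. intros e He.
  assert (0 < Cmod l) as Pl by (apply Cmod_gt_0; auto).
  set (u := Rmin (Cmod l / 2) (e * Cmod l * Cmod l / 2)).
  assert (0 < e * Cmod l * Cmod l) by (repeat apply Rmult_lt_0_compat; auto).
  assert (0 < u) by (unfold u; apply Rmin_glb_lt; lra).
  assert (u <= Cmod l / 2) by apply Rmin_l. assert (u <= e * Cmod l * Cmod l / 2) by apply Rmin_r. clearbody u.
  destruct (Hf u) as [d1 [D1 K1]]; auto. destruct (Hg d1) as [d2 [D2 K2]]; auto.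
  exists (Rmin d0 d2); split; [apply Rmin_glb_lt; auto|]. intros w Hw.
  pose proof (Rlt_le_trans _ _ _ Hw (Rmin_l _ _)) as W1. pose proof (Rlt_le_trans _ _ _ Hw (Rmin_r _ _)) as W2.
  specialize (K1 _ (K2 w W2)). rewrite Eb, (E w W1) in K1.
  set (h := (g w - g b)%C) in *.
  assert (Cmod (h * l) <= Cmod (w - b) + u * Cmod h) as B.
  { pose proof (Cmod_le_add (h * l) (w - b)). rewrite (Cmod_minus_sym (h * l)) in H3. lra. }
  rewrite Cmod_mult in B. pose proof (Cmod_ge_0 h).
  assert (u * Cmod h <= Cmod l / 2 * Cmod h) by (apply Rmult_le_compat_r; lra).
  assert (Cmod h * Cmod l <= 2 * Cmod (w - b)) as B2 by lra.
  replace (h - (w - b) * / l)%C with (- ((w - b - h * l) / l))%C by (Cfield; auto).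
  rewrite Cmod_opp, Cmod_div by auto. apply Rle_div_l; [lra|].
  eapply Rle_trans; [exact K1|].
  assert (u * Cmod h <= e * Cmod l * Cmod l / 2 * Cmod h) by (apply Rmult_le_compat_r; lra).
  assert (e * Cmod l / 2 * (Cmod h * Cmod l) <= e * Cmod l / 2 * (2 * Cmod (w - b))) by (apply Rmult_le_compat_l; nra).
  lra.
Qed.

(** * Uniform Taylor estimates for maps of the disc *)

Lemma disc_ball : forall (z w : C) rho r, Cmod z <= rho -> Cmod (w - z) <= r -> Cmod w <= rho + r.
Proof. intros. pose proof (Cmod_le_add w z). lra. Qed.

Lemma bounded_deriv_bound : forall (f df : C -> C) M,
  (forall z, unit_disc z -> cderiv f z (df z)) -> (forall z, unit_disc z -> Cmod (f z) <= M) ->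
  forall rho z, rho < 1 -> Cmod z <= rho -> Cmod (df z) <= M / ((1 - rho) / 2).
Proof.
  intros f df M Hd HM rho z Hr Hz. apply (Cauchy_estimate f z); [lra| |intros w Hw|intros w Hw].
  - apply Hd. unfold unit_disc; lra.
  - exists (df w). apply Hd. unfold unit_disc. pose proof (disc_ball _ _ _ _ Hz Hw). lra.
  - apply HM. unfold unit_disc. pose proof (disc_ball _ _ _ _ Hz (Req_le _ _ Hw)). lra.
Qed.

(** Cauchy estimates for the first two derivatives give a constant that depends on [rho]
    only, hence the same for all maps of a semigroup. *)
Lemma disc_map_Taylor : forall (f df : C -> C),
  (forall z, unit_disc z -> cderiv f z (df z)) -> (forall z, unit_disc z -> Cmod (f z) <= 1) ->
  forall rho z w, rho < 1 -> Cmod z <= rho -> Cmod w <= rho ->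
  Cmod (f w - f z - df z * (w - z)) <= 8 / ((1 - rho) * (1 - rho)) * Cmod (w - z) * Cmod (w - z).
Proof.
  intros f df Hd H1 rho z w Hr Hz Hw.
  assert (forall u, (u - RtoC 0)%C = u) as Z by (intros; Cring).
  set (K := 8 / ((1 - rho) * (1 - rho))).
  assert (0 < (1 - rho) * (1 - rho)) by nra.
  assert (0 <= K) by (unfold K; apply Rle_div_r; lra).
  destruct (deriv_choice unit_disc df) as [d2 Hd2].
  { intros u Hu. apply (deriv_differentiable f df u (1 - Cmod u)); [unfold unit_disc in Hu; lra|].
    intros v Hv. apply Hd. unfold unit_disc. pose proof (Cmod_le_add v u). lra. }
  set (s := (1 + rho) / 2).
  assert (forall u, Cmod u <= rho -> Cmod (d2 u) <= K) as B2.
  { intros u Hu. replace K with (4 / (1 - rho) / ((1 - rho) / 2)) by (unfold K; field; lra).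
    apply (Cauchy_estimate df u); [lra| |intros v Hv|intros v Hv].
    - apply Hd2; unfold unit_disc; lra.
    - exists (d2 v). apply Hd2. unfold unit_disc. pose proof (disc_ball _ _ _ _ Hu Hv). lra.
    - replace (4 / (1 - rho)) with (1 / ((1 - s) / 2)) by (unfold s; field; lra).
      apply (bounded_deriv_bound f df 1); auto; unfold s; [lra|].
      pose proof (disc_ball _ _ _ _ Hu (Req_le _ _ Hv)). lra. }
  apply (cderiv_mean_value f df); intros t Ht;
    assert (Cmod (z + RtoC t * (w - z)) <= rho) as Sg
      by (rewrite <- (Z (z + RtoC t * (w - z))%C); apply segment_in_disc; rewrite ?Z; auto).
  - apply Hd; unfold unit_disc; lra.
  - set (u := (z + RtoC t * (w - z))%C) in *.
    apply Rle_trans with (K * Cmod (u - z)).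
    + apply (Lipschitz_of_deriv_bound df d2 (RtoC 0) rho); rewrite ?Z; auto; intros v Hv; rewrite Z in Hv; auto.
      apply Hd2; unfold unit_disc; lra.
    + apply Rmult_le_compat_l; auto. unfold u. replace (z + RtoC t * (w - z) - z)%C with (RtoC t * (w - z))%C by Cring.
      rewrite Cmod_mult, Cmod_R, Rabs_pos_eq by lra. pose proof (Cmod_ge_0 (w - z)). nra.
Qed.

(** * Derivatives along nonnegative times *)

(** Derivative in the half-line of times; at time [0] only right neighbourhoods count. *)
Definition tderiv (y : R -> C) (t0 : R) (l : C) : Prop :=
  forall e, 0 < e -> exists d, 0 < d /\ forall t, 0 <= t -> Rabs (t - t0) < d ->
    Cmod (y t - y t0 - RtoC (t - t0) * l) <= e * Rabs (t - t0).

Definition tcont (y : R -> C) (t0 : R) : Prop :=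
  forall e, 0 < e -> exists d, 0 < d /\ forall t, 0 <= t -> Rabs (t - t0) < d -> Cmod (y t - y t0) < e.

Lemma tderiv_unique : forall y t0 l1 l2, 0 <= t0 -> tderiv y t0 l1 -> tderiv y t0 l2 -> l1 = l2.
Proof.
  intros y t0 l1 l2 Ht0 H1 H2. apply Ceq_minus, Cmod_eq_0.
  apply (Cmod_small_eq _ 0 2); [apply Cmod_ge_0|]. intros e He.
  destruct (H1 e He) as [d1 [D1 K1]]. destruct (H2 e He) as [d2 [D2 K2]].
  set (h := Rmin d1 d2 / 2). assert (0 < Rmin d1 d2) by (apply Rmin_glb_lt; auto).
  pose proof (Rmin_l d1 d2); pose proof (Rmin_r d1 d2).
  assert (0 < h) as Hh by (unfold h; lra).
  assert (Rabs (t0 + h - t0) = h) as E by (replace (t0 + h - t0) with h by ring; apply Rabs_pos_eq; lra).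
  specialize (K1 (t0 + h) ltac:(lra)); specialize (K2 (t0 + h) ltac:(lra)). rewrite E in *.
  specialize (K1 ltac:(unfold h; lra)); specialize (K2 ltac:(unfold h; lra)).
  apply Rmult_le_reg_l with h; auto.
  replace (h * Cmod (l1 - l2)) with (Cmod (RtoC h * (l1 - l2))) by (rewrite Cmod_mult, Cmod_R, Rabs_pos_eq; lra).
  replace (t0 + h - t0) with h in * by ring.
  replace (RtoC h * (l1 - l2))%C with ((y (t0 + h)%R - y t0 - RtoC h * l2) - (y (t0 + h)%R - y t0 - RtoC h * l1))%C by Cring.
  pose proof (Cmod_triangle (y (t0 + h)%R - y t0 - RtoC h * l2) (- (y (t0 + h)%R - y t0 - RtoC h * l1))) as T.
  rewrite Cmod_opp in T. unfold Cminus at 1. lra.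
Qed.

Lemma tderiv_comp : forall (f : C -> C) (y : R -> C) t0 (a b : C), tcont y t0 ->
  cderiv f (y t0) a -> tderiv y t0 b -> tderiv (fun s => f (y s)) t0 (a * b)%C.
Proof.
  intros f g t a b Cg Hf Hg e He. rewrite cderiv_eps in Hf.
  pose proof (Cmod_ge_0 a); pose proof (Cmod_ge_0 b).
  set (u := Rmin 1 (e / (Cmod a + Cmod b + 1))).
  assert (0 < e / (Cmod a + Cmod b + 1)) by (apply Rdiv_lt_0_compat; lra).
  assert (0 < u) by (unfold u; apply Rmin_glb_lt; lra).
  assert (u <= 1) by apply Rmin_l.
  assert (u * (Cmod a + Cmod b + 1) <= e).
  { apply Rle_trans with (e / (Cmod a + Cmod b + 1) * (Cmod a + Cmod b + 1)); [|right; field; lra].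
    apply Rmult_le_compat_r; [lra|apply Rmin_r]. }
  destruct (Hf u) as [d1 [D1 K1]]; auto. destruct (Hg u) as [d2 [D2 K2]]; auto.
  destruct (Cg d1) as [d3 [D3 K3]]; auto.
  exists (Rmin d2 d3); split; [apply Rmin_glb_lt; auto|].
  intros w Hw0 Hw. pose proof (Rmin_l d2 d3); pose proof (Rmin_r d2 d3).
  specialize (K2 w Hw0 ltac:(lra)). specialize (K3 w Hw0 ltac:(lra)). specialize (K1 (g w) K3).
  replace (f (g w) - f (g t) - RtoC (w - t) * (a * b))%C with
    ((f (g w) - f (g t) - (g w - g t) * a) + a * (g w - g t - RtoC (w - t) * b))%C by Cring.
  eapply Rle_trans; [apply Cmod_triangle|]. rewrite Cmod_mult.
  pose proof (Cmod_le_add (g w - g t) (RtoC (w - t) * b)). rewrite Cmod_mult, Cmod_R in *.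
  set (X := Rabs (w - t)) in *. assert (0 <= X) by apply Rabs_pos.
  set (Y := Cmod (g w - g t - RtoC (w - t) * b)) in *.
  assert (Cmod (g w - g t) <= X * (Cmod b + 1)) by nra.
  assert (u * Cmod (g w - g t) <= u * (X * (Cmod b + 1))) by (apply Rmult_le_compat_l; lra).
  assert (Cmod a * Y <= Cmod a * (u * X)) by (apply Rmult_le_compat_l; lra).
  assert (u * (Cmod a + Cmod b + 1) * X <= e * X) by (apply Rmult_le_compat_r; lra).
  nra.
Qed.

(** As [a <> 0], the expansion of [f] at [y t0] first bounds [y t - y t0] linearly in
    time and can then be solved for it. *)
Lemma tderiv_of_comp : forall (f : C -> C) (y : R -> C) t0 (a q : C), tcont y t0 ->
  cderiv f (y t0) a -> a <> RtoC 0 -> tderiv (fun s => f (y s)) t0 q -> tderiv y t0 (q / a)%C.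
Proof.
  intros f y t0 a q Cy Hf Ha Hq e He. rewrite cderiv_eps in Hf.
  assert (0 < Cmod a) as Pa by (apply Cmod_gt_0; auto). pose proof (Cmod_ge_0 q).
  set (m := 2 * (Cmod q + 1) / Cmod a).
  assert (0 < m) by (unfold m; apply Rdiv_lt_0_compat; lra).
  set (u := Rmin (Cmod a / 2) (e * Cmod a / (2 * m))). set (v := Rmin 1 (e * Cmod a / 2)).
  assert (0 < e * Cmod a) by nra.
  assert (0 < u) by (unfold u; apply Rmin_glb_lt; [|apply Rdiv_lt_0_compat]; lra).
  assert (0 < v) by (unfold v; apply Rmin_glb_lt; lra).
  assert (u <= Cmod a / 2) by apply Rmin_l. assert (u <= e * Cmod a / (2 * m)) as U2 by apply Rmin_r.
  assert (v <= 1) by apply Rmin_l. assert (v <= e * Cmod a / 2) by apply Rmin_r. clearbody u v.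
  apply Rle_div_r in U2; [|lra].
  destruct (Hf u) as [d1 [D1 K1]]; auto. destruct (Cy d1) as [d2 [D2 K2]]; auto.
  destruct (Hq v) as [d3 [D3 K3]]; auto.
  exists (Rmin d2 d3); split; [apply Rmin_glb_lt; auto|]. intros t Ht0 Ht.
  pose proof (Rmin_l d2 d3); pose proof (Rmin_r d2 d3).
  specialize (K1 _ (K2 t Ht0 ltac:(lra))). specialize (K3 t Ht0 ltac:(lra)).
  set (h := (y t - y t0)%C) in *. set (X := Rabs (t - t0)) in *. assert (0 <= X) by apply Rabs_pos.
  set (F := (f (y t) - f (y t0))%C) in *.
  assert (Cmod F <= X * (Cmod q + 1)).
  { pose proof (Cmod_le_add F (RtoC (t - t0) * q)) as T. rewrite Cmod_mult, Cmod_R in T. fold X in T. nra. }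
  pose proof (Cmod_le_add (h * a) F) as T. rewrite Cmod_mult, (Cmod_minus_sym (h * a)) in T.
  pose proof (Cmod_ge_0 h).
  assert (u * Cmod h <= Cmod a / 2 * Cmod h) by (apply Rmult_le_compat_r; lra).
  assert (Cmod h <= m * X) as Bh.
  { unfold m. apply Rmult_le_reg_r with (Cmod a); auto. replace (2 * (Cmod q + 1) / Cmod a * X * Cmod a) with
    (2 * (Cmod q + 1) * X) by (field; lra). lra. }
  replace (h - RtoC (t - t0) * (q / a))%C with (((F - RtoC (t - t0) * q) - (F - h * a)) / a)%C by (Cfield; auto).
  rewrite Cmod_div by auto. apply Rle_div_l; [lra|].
  pose proof (Cmod_triangle (F - RtoC (t - t0) * q) (- (F - h * a))) as T2. rewrite Cmod_opp in T2.
  unfold Cminus at 1.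
  assert (u * Cmod h <= u * (m * X)) by (apply Rmult_le_compat_l; lra).
  assert (u * (2 * m) * X <= e * Cmod a * X) by (apply Rmult_le_compat_r; lra).
  assert (v * X <= e * Cmod a / 2 * X) by (apply Rmult_le_compat_r; lra). lra.
Qed.

(** * The infinitesimal generator *)

Lemma compact_singleton : forall z, compact_set (fun w => w = z).
Proof.
  intros z I U HU Hc. destruct (Hc z eq_refl) as [i Hi]. exists (cons i nil).
  intros w ->. exists i; simpl; auto.
Qed.

Section Generator.
Variable phi : R -> C -> C.
Hypothesis Hphi : semigroup phi.

Lemma semigroup_selfmap : forall t, 0 <= t -> disc_selfmap (phi t).
Proof. intros t Ht; split; [apply (semigroup_holo _ Hphi)|apply (semigroup_maps _ Hphi)]; auto. Qed.

Lemma semigroup_tcont : forall z t0, unit_disc z -> 0 <= t0 -> tcont (fun t => phi t z) t0.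
Proof.
  intros z t0 Hz Ht0 e He.
  destruct (semigroup_cont _ Hphi t0 Ht0 _ (compact_singleton z) ltac:(intros w ->; auto) (mkposreal e He)) as [d K].
  exists d; split; [apply cond_pos|]. intros t Ht Hd. apply (K t Ht Hd z eq_refl).
Qed.

(** The extension by the value at [0] makes curves defined for nonnegative times
    integrable in the ordinary sense. *)
Lemma Rcont_extend : forall y : R -> C, (forall t, 0 <= t -> tcont y t) -> forall t, Rcont (fun s => y (Rmax s 0)) t.
Proof.
  intros y Hy t. apply Rcont_eps. intros e He.
  destruct (Hy (Rmax t 0) (Rmax_r _ _) e He) as [d [Hd K]]. exists d; split; auto. intros s Hs.
  apply K; [apply Rmax_r|]. eapply Rle_lt_trans; [|exact Hs].
  unfold Rmax; repeat destruct Rle_dec; unfold Rabs; repeat destruct Rcase_abs; lra.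
Qed.

Lemma semigroup_deriv : exists dphi : R -> C -> C,
  forall t z, 0 <= t -> unit_disc z -> cderiv (phi t) z (dphi t z).
Proof.
  assert (forall p : R * C, exists l : C, 0 <= fst p -> unit_disc (snd p) -> cderiv (phi (fst p)) (snd p) l) as K.
  { intros [t z]; simpl. destruct (classic (0 <= t /\ unit_disc z)) as [[A B]|N].
    - destruct (semigroup_holo _ Hphi t A z B) as [l Hl]. exists l; auto.
    - exists (RtoC 0); tauto. }
  apply choice in K. destruct K as [d Hd]. exists (fun t z => d (t, z)). intros t z. apply (Hd (t, z)).
Qed.

Lemma semigroup_bound : forall t z, 0 <= t -> unit_disc z -> Cmod (phi t z) <= 1.
Proof. intros t z Ht Hz. left. apply (semigroup_maps _ Hphi t Ht z Hz). Qed.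

(** By the uniform Taylor estimate the derivative is a uniform limit of difference
    quotients with a fixed increment [h], and these are continuous in time. *)
Lemma semigroup_deriv_tcont : forall (dphi : R -> C -> C),
  (forall t z, 0 <= t -> unit_disc z -> cderiv (phi t) z (dphi t z)) ->
  forall z t0, unit_disc z -> 0 <= t0 -> tcont (fun t => dphi t z) t0.
Proof.
  intros dphi Hd z t0 Hz Ht0 e He.
  set (rho := (1 + Cmod z) / 2). assert (Cmod z < rho < 1) as Hr by (unfold rho, unit_disc in *; lra).
  set (K := 8 / ((1 - rho) * (1 - rho))).
  assert (0 < K) by (unfold K; apply Rdiv_lt_0_compat; nra).
  set (h := Rmin (rho - Cmod z) (e / (4 * K))).
  assert (0 < e / (4 * K)) by (apply Rdiv_lt_0_compat; lra).
  assert (0 < h) by (unfold h; apply Rmin_glb_lt; lra).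
  assert (h <= rho - Cmod z) by apply Rmin_l. assert (h <= e / (4 * K)) as Hh2 by apply Rmin_r. clearbody h.
  apply Rle_div_r in Hh2; [|lra].
  set (w := (z + RtoC h)%C).
  assert (Cmod w <= rho) as Hw.
  { unfold w. eapply Rle_trans; [apply Cmod_triangle|]. rewrite Cmod_R, Rabs_pos_eq; lra. }
  assert (unit_disc w) as Hw1 by (unfold unit_disc; lra).
  destruct (semigroup_tcont z t0 Hz Ht0 (h * e / 8)) as [d1 [D1 K1]]; [nra|].
  destruct (semigroup_tcont w t0 Hw1 Ht0 (h * e / 8)) as [d2 [D2 K2]]; [nra|].
  exists (Rmin d1 d2); split; [apply Rmin_glb_lt; auto|]. intros t Ht Hdt.
  specialize (K1 t Ht (Rlt_le_trans _ _ _ Hdt (Rmin_l _ _))).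
  specialize (K2 t Ht (Rlt_le_trans _ _ _ Hdt (Rmin_r _ _))).
  assert (forall s, 0 <= s -> Cmod (phi s w - phi s z - dphi s z * RtoC h) <= K * h * h) as T.
  { intros s Hs. pose proof (disc_map_Taylor (phi s) (dphi s) (fun u Hu => Hd s u Hs Hu)
      (fun u Hu => semigroup_bound s u Hs Hu) rho z w ltac:(lra) ltac:(lra) Hw) as Q.
    replace (w - z)%C with (RtoC h) in Q by (unfold w; Cring). rewrite Cmod_R, Rabs_pos_eq in Q by lra. exact Q. }
  pose proof (T t Ht) as T1. pose proof (T t0 Ht0) as T2.
  apply Rmult_lt_reg_l with h; auto.
  replace (h * Cmod (dphi t z - dphi t0 z)) with (Cmod (RtoC h * (dphi t z - dphi t0 z)))
    by (rewrite Cmod_mult, Cmod_R, Rabs_pos_eq; lra).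
  replace (RtoC h * (dphi t z - dphi t0 z))%C with
    ((phi t0 w - phi t0 z - dphi t0 z * RtoC h) + - (phi t w - phi t z - dphi t z * RtoC h)
      + ((phi t w - phi t0 w) + - (phi t z - phi t0 z)))%C by Cring.
  eapply Rle_lt_trans; [apply Cmod_triangle|].
  pose proof (Cmod_triangle (phi t0 w - phi t0 z - dphi t0 z * RtoC h) (- (phi t w - phi t z - dphi t z * RtoC h))).
  pose proof (Cmod_triangle (phi t w - phi t0 w) (- (phi t z - phi t0 z))).
  rewrite Cmod_opp in *.
  assert (h * (4 * K) * h <= e * h) by (apply Rmult_le_compat_r; lra).
  assert (0 < h * e) by nra. lra.
Qed.

Definition time_mean (d : R) (z : C) : C := Cint (fun s => phi (Rmax s 0) z) 0 d.

Lemma Rcont_orbit : forall z t, unit_disc z -> Rcont (fun s => phi (Rmax s 0) z) t.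
Proof. intros z t Hz. apply (Rcont_extend (fun s => phi s z)). intros; apply semigroup_tcont; auto. Qed.

Lemma time_mean_deriv : forall (dphi : R -> C -> C),
  (forall t z, 0 <= t -> unit_disc z -> cderiv (phi t) z (dphi t z)) ->
  forall d z, 0 < d -> unit_disc z ->
  cderiv (time_mean d) z (Cint (fun s => dphi (Rmax s 0) z) 0 d).
Proof.
  intros dphi Hd d z Hdp Hz. apply cderiv_eps. intros e He.
  set (rho := (1 + Cmod z) / 2). assert (Cmod z < rho < 1) as Hr by (unfold rho, unit_disc in *; lra).
  set (K := 8 / ((1 - rho) * (1 - rho))).
  assert (0 < K) by (unfold K; apply Rdiv_lt_0_compat; nra).
  assert (0 < d * K) by nra.
  exists (Rmin (rho - Cmod z) (e / (d * K))); split.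
  { apply Rmin_glb_lt; [lra|]. apply Rdiv_lt_0_compat; lra. }
  intros w Hw. pose proof (Rlt_le_trans _ _ _ Hw (Rmin_l _ _)) as W1.
  pose proof (Rlt_le_trans _ _ _ Hw (Rmin_r _ _)) as W2. apply Rlt_div_r in W2; [|lra].
  assert (Cmod w <= rho) as Hwr by (pose proof (Cmod_le_add w z); lra).
  assert (unit_disc w) as Hw1 by (unfold unit_disc; lra).
  assert (forall t, Rcont (fun s => dphi (Rmax s 0) z) t) as Cd.
  { apply (Rcont_extend (fun s => dphi s z)). intros; apply semigroup_deriv_tcont; auto. }
  unfold time_mean.
  rewrite <- Cint_mult, <- !Cint_minus; try lra; auto using Rcont_orbit.
  2:{ intros; apply Rcont_minus; apply Rcont_orbit; auto. }
  2:{ intros; apply Rcont_Cmult; auto. }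
  apply Rle_trans with ((d - 0) * (K * Cmod (w - z) * Cmod (w - z))).
  - apply Cint_bound; [lra| |].
    + intros t _. apply (Rcont_minus (fun s => phi (Rmax s 0) w - phi (Rmax s 0) z)%C (fun s => (w - z) * dphi (Rmax s 0) z)%C).
      * apply Rcont_minus; apply Rcont_orbit; auto.
      * apply Rcont_Cmult; auto.
    + intros t _. rewrite (Cmult_comm (w - z)).
      apply (disc_map_Taylor (phi (Rmax t 0)) (dphi (Rmax t 0))); try lra.
      * intros u Hu. apply Hd; auto. apply Rmax_r.
      * intros u Hu. apply semigroup_bound; auto. apply Rmax_r.
  - rewrite Rminus_0_r. pose proof (Cmod_ge_0 (w - z)). nra.
Qed.

(** The derivative of [phi 0] is [1], so for small [s] that of [phi s] stays close to [1]. *)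
Lemma time_mean_deriv_nonzero : forall (dphi : R -> C -> C),
  (forall t z, 0 <= t -> unit_disc z -> cderiv (phi t) z (dphi t z)) ->
  forall z, unit_disc z -> exists d, 0 < d /\ Cint (fun s => dphi (Rmax s 0) z) 0 d <> RtoC 0.
Proof.
  intros dphi Hd z Hz.
  assert (dphi 0 z = RtoC 1) as E.
  { apply (cderiv_unique (phi 0) z); [apply Hd; auto; lra|].
    apply (cderiv_ext_loc (fun w => w)); [|apply cderiv_id].
    exists (1 - Cmod z); split; [unfold unit_disc in Hz; lra|]. intros w Hw.
    symmetry. apply (semigroup_0 _ Hphi). unfold unit_disc. pose proof (Cmod_le_add w z). lra. }
  destruct (semigroup_deriv_tcont dphi Hd z 0 Hz ltac:(lra) (1/2)) as [d [Hd0 K]]; [lra|].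
  exists (d / 2); split; [lra|]. intros Q.
  assert (forall t, Rcont (fun s => dphi (Rmax s 0) z) t) as Cd.
  { apply (Rcont_extend (fun s => dphi s z)). intros; apply semigroup_deriv_tcont; auto. }
  assert (Cmod (Cint (fun s => dphi (Rmax s 0) z - RtoC 1)%C 0 (d/2)) <= (d / 2 - 0) * (1 / 2)) as B.
  { apply Cint_bound; [lra| |].
    - intros t _. apply (Rcont_minus (fun s => dphi (Rmax s 0) z) (fun _ => RtoC 1)); auto. apply continuous_const.
    - intros t Ht. rewrite Rmax_left by lra. rewrite <- E. left; apply K; [lra|]. rewrite Rabs_pos_eq; lra. }
  rewrite Cint_minus in B; [|lra|auto|intros; apply continuous_const].
  rewrite Q, Cint_const in B.
  replace (RtoC 0 - RtoC (d / 2 - 0) * RtoC 1)%C with (- RtoC (d / 2 - 0))%C in B by Cring.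
  rewrite Cmod_opp, Cmod_R, Rabs_pos_eq in B; lra.
Qed.

(** Along the orbit, [time_mean d] is the integral of the orbit over a window of length [d],
    whose derivative is the difference of the values at the two ends. *)
Lemma orbit_time_mean_deriv : forall d z t0, 0 < d -> unit_disc z -> 0 <= t0 ->
  tderiv (fun t => time_mean d (phi t z)) t0 (phi d (phi t0 z) - phi t0 z)%C.
Proof.
  intros d z t0 Hd Hz Ht0.
  set (E := fun s => phi (Rmax s 0) z).
  assert (forall t, Rcont E t) as CE by (intros; apply Rcont_orbit; auto).
  set (B := fun t => Cint E 0 t).
  assert (forall t, rderiv B t (E t)) as DB.
  { intros t. apply (is_derive_RInt (V := C_R_NormedModule) E B 0 t); [|apply CE].
    exists (mkposreal 1 Rlt_0_1). intros s _. apply (RInt_correct (V := C_R_CompleteNormedModule)).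
    apply (ex_RInt_continuous (V := C_R_CompleteNormedModule)); auto. }
  assert (forall t, 0 <= t -> time_mean d (phi t z) = (B (t + d)%R - B t)%C) as Sh.
  { intros t Ht. unfold B.
    rewrite (Cint_Chasles E 0 t (t + d)) by (auto; lra).
    replace (Cint E 0 t + Cint E t (t + d) - Cint E 0 t)%C with (Cint E t (t + d)) by Cring.
    unfold time_mean.
    pose proof (RInt_comp_lin (V := C_R_CompleteNormedModule) E 1 t 0 d) as R1.
    replace (1 * 0 + t) with t in R1 by ring. replace (1 * d + t) with (t + d) in R1 by ring.
    rewrite <- R1.
    - apply Cint_ext; [lra|]. intros s Hs. rewrite scal_R_Cmult. unfold E.
      rewrite !Rmax_left by lra. replace (1 * s + t) with (s + t) by ring.
      rewrite (semigroup_add _ Hphi) by (auto; lra). Cring.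
    - apply ex_Cint_cont; [lra|auto]. }
  assert (rderiv (fun t => B (t + d)%R - B t)%C t0 (E (t0 + d)%R - E t0)%C) as DQ.
  { apply (is_derive_minus (K := R_AbsRing) (V := C_R_NormedModule) (fun t => B (t + d)) B); [|apply DB].
    apply (rderiv_eq _ _ (scal 1 (E (t0 + d)))); [|rewrite scal_R_Cmult; Cring].
    apply (is_derive_comp (K := R_AbsRing) (V := C_R_NormedModule) B (fun t => t + d) t0 (E (t0 + d)) 1); [apply DB|].
    auto_derive; auto. }
  rewrite rderiv_eps in DQ. intros e He. destruct (DQ e He) as [dl [Hdl K]]. exists dl; split; auto.
  intros t Ht Htd. rewrite !Sh by auto.
  replace (phi d (phi t0 z) - phi t0 z)%C with (E (t0 + d)%R - E t0)%C; [apply K; auto|].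
  unfold E. rewrite !Rmax_left by lra. rewrite Rplus_comm, (semigroup_add _ Hphi); auto; lra.
Qed.

(** Averaging an orbit over a short time gives a locally invertible holomorphic
    map [time_mean d] along which the orbit is visibly differentiable; this
    yields the generator in closed form, hence its holomorphy. *)
Theorem generator_exists : exists G : C -> C,
  (forall z, unit_disc z -> cderivable G z) /\
  (forall z t, unit_disc z -> 0 <= t -> tderiv (fun s => phi s z) t (G (phi t z))) /\
  (forall z, unit_disc z -> G z = RtoC 0 -> forall t, 0 <= t -> phi t z = z).
Proof.
  destruct semigroup_deriv as [dphi Hd].
  (* An opaque name for the derivative of [time_mean], with its defining equation. *)
  destruct (ex_intro (fun F : R -> C -> C => F = fun d z => Cint (fun s => dphi (Rmax s 0) z) 0 d) _ eq_refl)
    as [DA EDA].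
  assert (forall d z, 0 < d -> unit_disc z -> cderiv (time_mean d) z (DA d z)) as HDA.
  { intros; rewrite EDA; apply time_mean_deriv; auto. }
  assert (forall z, exists d, unit_disc z -> 0 < d /\ DA d z <> RtoC 0) as Hn.
  { intros z. destruct (classic (unit_disc z)) as [Hz|Hz]; [|exists 0; tauto].
    destruct (time_mean_deriv_nonzero dphi Hd z Hz) as [d Hdd]. exists d; rewrite EDA; auto. }
  apply choice in Hn. destruct Hn as [D HD].
  (* The choice of [D z] is arbitrary, so differentiability of [G] is seen from the
     relation [Rel], which holds for all [d] and allows a fixed [d] near each point. *)
  set (G := fun z => ((phi (D z) z - z) / DA (D z) z)%C).
  assert (forall z, unit_disc z -> phi 0 z = z) as P0 by (intros; apply (semigroup_0 _ Hphi); auto).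
  assert (forall z t, unit_disc z -> 0 <= t -> unit_disc (phi t z)) as Pm
    by (intros; apply (semigroup_maps _ Hphi); auto).
  assert (forall z t, unit_disc z -> 0 <= t -> tderiv (fun s => phi s z) t (G (phi t z))) as HG.
  { intros z t Hz Ht. set (y := phi t z). assert (unit_disc y) as Hy by (apply Pm; auto).
    destruct (HD y Hy) as [D1 D2]. unfold G.
    apply (tderiv_of_comp (time_mean (D y)) (fun s => phi s z)); auto.
    - apply semigroup_tcont; auto.
    - exact (orbit_time_mean_deriv (D y) z t D1 Hz Ht). }
  assert (forall d z, 0 < d -> unit_disc z -> (G z * DA d z = phi d z - z)%C) as Rel.
  { intros d z Hdp Hz. apply (tderiv_unique (fun t => time_mean d (phi t z)) 0); [lra| |].
    - rewrite Cmult_comm. apply (tderiv_comp (time_mean d) (fun t => phi t z)).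
      + apply semigroup_tcont; auto; lra.
      + rewrite P0; auto.
      + pose proof (HG z 0 Hz (Rle_refl 0)) as Q. rewrite (P0 z Hz) in Q. exact Q.
    - pose proof (orbit_time_mean_deriv d z 0 Hdp Hz (Rle_refl 0)) as Q. rewrite (P0 z Hz) in Q. exact Q. }
  exists G; split; [|split]; auto.
  - intros z0 Hz0. destruct (HD z0 Hz0) as [D1 D2]. set (d := D z0) in *.
    assert (cderivable (DA d) z0) as HH.
    { apply (deriv_differentiable (time_mean d) (DA d) z0 (1 - Cmod z0)); [unfold unit_disc in Hz0; lra|].
      intros w Hw. apply HDA; auto. unfold unit_disc. pose proof (Cmod_le_add w z0). lra. }
    destruct HH as [l Hl]. pose proof (cderiv_continuous _ _ _ Hl) as Cl. rewrite Ccont_eps in Cl.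
    destruct (Cl (Cmod (DA d z0))) as [r [Hr K]]; [apply Cmod_gt_0; auto|].
    destruct (semigroup_holo _ Hphi d (Rlt_le _ _ D1) z0 Hz0) as [l2 Hl2].
    eexists. apply (cderiv_ext_loc (fun z => (phi d z - z) / DA d z)%C).
    + exists (Rmin r (1 - Cmod z0)); split; [apply Rmin_glb_lt; auto; unfold unit_disc in Hz0; lra|].
      intros w Hw. pose proof (Rlt_le_trans _ _ _ Hw (Rmin_l _ _)) as W1.
      pose proof (Rlt_le_trans _ _ _ Hw (Rmin_r _ _)) as W2.
      assert (unit_disc w) as Hwd by (unfold unit_disc; pose proof (Cmod_le_add w z0); lra).
      rewrite <- (Rel d w D1 Hwd).
      assert (DA d w <> RtoC 0).
      { intros Q. specialize (K w W1). rewrite Q in K.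
        replace (RtoC 0 - DA d z0)%C with (- DA d z0)%C in K by Cring. rewrite Cmod_opp in K; lra. }
      Cfield; auto.
    + cder; [exact Hl2|exact Hl|auto].
  - intros z Hz HGz t [Ht|Ht].
    + specialize (Rel t z Ht Hz). rewrite HGz in Rel. apply Ceq_minus. rewrite <- Rel. Cring.
    + subst t. auto.
Qed.

End Generator.

(** * Wolff's lemma *)

Lemma norm2_one_minus_conj : forall z w,
  norm2 (1 - Cconj w * z) = norm2 (z - w) + (1 - norm2 z) * (1 - norm2 w).
Proof. intros [a b] [x y]; unfold norm2, Re, Im; simpl; ring. Qed.

Lemma norm2_lt_1 : forall z, unit_disc z -> 0 < 1 - norm2 z.
Proof. intros z Hz; apply unit_disc_norm2 in Hz; lra. Qed.

Lemma Schwarz_Pick_diff : forall f, disc_selfmap f -> forall z w, unit_disc z -> unit_disc w ->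
  (1 - norm2 z) * (1 - norm2 w) * norm2 (f z - f w) <=
  (1 - norm2 (f z)) * (1 - norm2 (f w)) * norm2 (z - w).
Proof.
  intros f Hf z w Hz Hw. pose proof (Schwarz_Pick f Hf z w Hz Hw) as S.
  rewrite !norm2_one_minus_conj in S. lra.
Qed.

Lemma Cconv_re_im : forall z l, Cconv z l ->
  is_lim_seq (fun n => Re (z n)) (Re l) /\ is_lim_seq (fun n => Im (z n)) (Im l).
Proof.
  intros z l H.
  split; apply is_lim_seq_spec; intros e; destruct (H e (cond_pos e)) as [N HN]; exists N; intros n Hn;
    (eapply Rle_lt_trans; [|apply (HN n Hn)]).
  - replace (Re (z n) - Re l) with (Re (z n - l)) by (unfold Re; simpl; ring). apply re_le_Cmod.
  - replace (Im (z n) - Im l) with (Im (z n - l)) by (unfold Im; simpl; ring). apply im_le_Cmod.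
Qed.

Lemma is_lim_seq_opp' : forall u (l : R), is_lim_seq u l -> is_lim_seq (fun n => - u n) (- l).
Proof. intros u l H. exact (proj1 (is_lim_seq_opp u l) H). Qed.

Ltac lim_poly :=
  lazymatch goal with
  | |- is_lim_seq (fun n => @?f n + @?g n) _ => apply (is_lim_seq_plus' f g); lim_poly
  | |- is_lim_seq (fun n => @?f n - @?g n) _ => apply (is_lim_seq_minus' f g); lim_poly
  | |- is_lim_seq (fun n => @?f n * @?g n) _ => apply (is_lim_seq_mult' f g); lim_poly
  | |- is_lim_seq (fun n => - @?f n) _ => apply (is_lim_seq_opp' f); lim_poly
  | |- is_lim_seq (fun _ => ?c) _ => apply is_lim_seq_const
  | _ => try match goal with H : is_lim_seq _ _ |- _ => exact H end
  end.

Lemma norm2_lim : forall z l, Cconv z l -> is_lim_seq (fun n => norm2 (z n)) (norm2 l).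
Proof. intros z l H. destruct (Cconv_re_im z l H). unfold norm2. lim_poly. Qed.

Lemma Cconv_const : forall c, Cconv (fun _ => c) c.
Proof.
  intros c e He. exists O; intros. replace (c - c)%C with (RtoC 0) by Cring. rewrite Cmod_0; auto.
Qed.

Lemma Cconv_minus : forall u v a b, Cconv u a -> Cconv v b -> Cconv (fun n => u n - v n)%C (a - b)%C.
Proof.
  intros u v a b Hu Hv e He. destruct (Hu (e/2)) as [N1 H1]; [lra|]. destruct (Hv (e/2)) as [N2 H2]; [lra|].
  exists (N1 + N2)%nat. intros n Hn. specialize (H1 n ltac:(lia)); specialize (H2 n ltac:(lia)).
  replace (u n - v n - (a - b))%C with ((u n - a) + - (v n - b))%C by Cring.
  eapply Rle_lt_trans; [apply Cmod_triangle|]. rewrite Cmod_opp. lra.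
Qed.

Lemma Cconv_mult : forall u v a b, Cconv u a -> Cconv v b -> Cconv (fun n => u n * v n)%C (a * b)%C.
Proof.
  intros u v a b Hu Hv.
  assert (forall z l, is_lim_seq (fun n => Re (z n)) (Re l) -> is_lim_seq (fun n => Im (z n)) (Im l) -> Cconv z l) as K.
  { intros z l H1 H2 e He. apply is_lim_seq_spec in H1. apply is_lim_seq_spec in H2.
    assert (0 < e / 2) as He2 by lra.
    destruct (H1 (mkposreal _ He2)) as [N1 K1]. destruct (H2 (mkposreal _ He2)) as [N2 K2].
    exists (N1 + N2)%nat. intros n Hn. specialize (K1 n ltac:(lia)); specialize (K2 n ltac:(lia)). simpl in K1, K2.
    eapply Rle_lt_trans; [apply Cmod_le_re_im|]. unfold Re, Im in *; simpl. unfold Rminus in *. lra. }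
  destruct (Cconv_re_im _ _ Hu), (Cconv_re_im _ _ Hv).
  apply K; unfold Re, Im in *; simpl; unfold Re, Im in *; lim_poly.
Qed.

Lemma Cconv_conj : forall u a, Cconv u a -> Cconv (fun n => Cconj (u n)) (Cconj a).
Proof.
  intros u a H e He. destruct (H e He) as [N HN]. exists N; intros n Hn.
  rewrite <- Cminus_conj, Cmod_conj. auto.
Qed.

(** For [x] in the disc this is the Schwarz-Pick inequality at a fixed point [x]; for
    [x] on the circle it says that [f] maps horodiscs at [x] into themselves. The
    formula covers both cases, so it survives when interior fixed points converge to a
    boundary point. *)
Definition wolff (f : C -> C) (x : C) : Prop := forall z, unit_disc z ->
  norm2 (1 - Cconj x * f z) * (1 - norm2 z) <= norm2 (1 - Cconj x * z) * (1 - norm2 (f z)).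

Lemma wolff_fixed : forall f x, disc_selfmap f -> unit_disc x -> f x = x -> wolff f x.
Proof.
  intros f x Hf Hx E z Hz. pose proof (Schwarz_Pick f Hf z x Hz Hx) as S. rewrite E in S.
  pose proof (norm2_lt_1 x Hx). apply Rmult_le_reg_r with (1 - norm2 x); auto. lra.
Qed.

(** [sinh^2] of the hyperbolic distance in the normalization where that distance is
    [artanh] of [|z - w| / |1 - conj w z|]; rational in the coordinates, and invariant
    under disc automorphisms. *)
Definition pdist (z w : C) : R := norm2 (z - w) / ((1 - norm2 z) * (1 - norm2 w)).

Lemma pdist_selfmap : forall f, disc_selfmap f -> forall z w, unit_disc z -> unit_disc w ->
  pdist (f z) (f w) <= pdist z w.
Proof.
  intros f Hf z w Hz Hw. pose proof (Schwarz_Pick_diff f Hf z w Hz Hw) as S.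
  pose proof (norm2_lt_1 _ Hz); pose proof (norm2_lt_1 _ Hw).
  pose proof (norm2_lt_1 _ (proj2 Hf z Hz)); pose proof (norm2_lt_1 _ (proj2 Hf w Hw)).
  unfold pdist. set (P := (1 - norm2 z) * (1 - norm2 w)) in *.
  set (Q := (1 - norm2 (f z)) * (1 - norm2 (f w))) in *.
  assert (0 < P) by (apply Rmult_lt_0_compat; auto). assert (0 < Q) by (apply Rmult_lt_0_compat; auto).
  apply Rle_div_l; auto. replace (norm2 (z - w) / P * Q) with (Q * norm2 (z - w) / P) by (field; lra).
  apply Rle_div_r; auto. lra.
Qed.

Lemma pdist_scale_lt : forall r a b, 0 < r < 1 -> unit_disc a -> unit_disc b -> a <> b ->
  pdist (RtoC r * a) (RtoC r * b) < pdist a b.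
Proof.
  intros r a b Hr Ha Hb Hab. unfold pdist.
  replace (RtoC r * a - RtoC r * b)%C with (RtoC r * (a - b))%C by Cring.
  rewrite !norm2_mult. replace (norm2 (RtoC r)) with (r * r) by (unfold norm2, Re, Im; simpl; ring).
  pose proof (norm2_lt_1 a Ha); pose proof (norm2_lt_1 b Hb).
  pose proof (norm2_ge_0 a); pose proof (norm2_ge_0 b).
  assert (0 < norm2 (a - b)) by (apply norm2_pos; intros Q; apply Ceq_minus in Q; auto).
  set (A := norm2 a) in *. set (B := norm2 b) in *. set (N := norm2 (a - b)) in *.
  assert (r * r < 1) by nra. assert (r * r * A <= A) by nra. assert (r * r * B <= B) by nra.
  assert (0 < (1 - A) * (1 - B)) by nra.
  assert ((1 - A) * (1 - B) <= (1 - r * r * A) * (1 - r * r * B)) by (apply Rmult_le_compat; lra).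
  apply Rlt_div_l; [lra|]. apply Rlt_le_trans with (N / ((1 - A) * (1 - B)) * ((1 - A) * (1 - B))).
  - replace (N / ((1 - A) * (1 - B)) * ((1 - A) * (1 - B))) with N by (field; lra). nra.
  - apply Rmult_le_compat_l; auto. apply Rle_div_r; lra.
Qed.

(** The map [r f] sends the compact disc of radius [r] into itself and strictly
    decreases [pdist], so a point moved least cannot be moved at all. *)
Lemma shrunk_fixed_point : forall f r, disc_selfmap f -> 0 < r < 1 ->
  exists x, unit_disc x /\ (RtoC r * f x)%C = x.
Proof.
  intros f r Hf Hr. set (g := fun z => (RtoC r * f z)%C).
  assert (forall z, unit_disc z -> Cmod (g z) <= r) as Hg.
  { intros z Hz. unfold g. rewrite Cmod_mult, Cmod_R, Rabs_pos_eq by lra.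
    pose proof (proj2 Hf z Hz) as F. unfold unit_disc in F. nra. }
  assert (forall z, Cmod z <= r -> unit_disc z) as Hrd by (unfold unit_disc; intros; lra).
  assert (forall z, Cmod z <= r -> 0 <= pdist z (g z)) as Pp.
  { intros z Hz. unfold pdist. pose proof (norm2_lt_1 z (Hrd z Hz)).
    pose proof (norm2_lt_1 _ (Hrd _ (Hg z (Hrd z Hz)))). apply Rle_div_r; [nra|].
    rewrite Rmult_0_l. apply norm2_ge_0. }
  destruct (completeness (fun y => exists z, Cmod z <= r /\ y = - pdist z (g z))) as [m [Hm1 Hm2]].
  - exists 0. intros y [z [Hz ->]]. specialize (Pp z Hz). lra.
  - exists (- pdist 0 (g 0)), (RtoC 0); split; auto. rewrite Cmod_0; lra.
  - assert (forall n, exists z, Cmod z <= r /\ m - / INR (S n) <= - pdist z (g z)) as Hs.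
    { intros n. apply NNPP; intros K. assert (0 < / INR (S n)) by (apply Rinv_0_lt_compat, lt_0_INR; lia).
      assert (m <= m - / INR (S n)); [|lra]. apply Hm2. intros y [z [Hz ->]].
      apply Rnot_lt_le; intros Q. apply K. exists z; split; auto; lra. }
    apply choice in Hs. destruct Hs as [z Hz].
    destruct (bounded_subseq z r) as [s [x [Hs Hx]]]; [intros; apply Hz|].
    assert (Cmod x <= r) as Hxr by (apply (Cconv_Cmod_le _ x r Hx); intros; apply Hz).
    assert (unit_disc x) as Hxd by auto.
    assert (Cconv (fun n => g (z (s n))) (g x)) as Hgx.
    { apply (Cconv_mult (fun _ => RtoC r) (fun n => f (z (s n)))); [apply Cconv_const|].
      apply (Cconv_cont f); auto. destruct (proj1 Hf x Hxd) as [l Hl]. eapply cderiv_continuous; eauto. }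
    assert (is_lim_seq (fun n => - pdist (z (s n)) (g (z (s n)))) (- pdist x (g x))) as Lim1.
    { apply is_lim_seq_opp'. unfold pdist. apply is_lim_seq_div'.
      - apply norm2_lim, Cconv_minus; auto.
      - pose proof (norm2_lim _ _ Hx). pose proof (norm2_lim _ _ Hgx). lim_poly.
      - pose proof (norm2_lt_1 x Hxd). pose proof (norm2_lt_1 _ (Hrd _ (Hg x Hxd))). nra. }
    assert (is_lim_seq (fun n => m - / INR (S (s n))) (m - 0)) as Lim2.
    { apply is_lim_seq_minus'; [apply is_lim_seq_const|].
      apply (is_lim_seq_le_le (fun _ => 0) _ (fun n => / INR (S n))).
      - intros n. split; [left; apply Rinv_0_lt_compat, lt_0_INR; lia|].
        apply Rinv_le_contravar; [apply lt_0_INR; lia|]. apply le_INR. pose proof (subseq_ge s Hs n). lia.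
      - apply is_lim_seq_const.
      - replace (Finite 0) with (Rbar_inv p_infty) by reflexivity. apply is_lim_seq_inv; [|discriminate].
        apply (is_lim_seq_incr_1 INR), is_lim_seq_INR. }
    assert (m <= - pdist x (g x)) as Mx.
    { pose proof (is_lim_seq_le _ _ _ _ (fun n => proj2 (Hz (s n))) Lim2 Lim1) as Q. simpl in Q. lra. }
    destruct (Ceq_dec (f x) (f (g x))) as [E|N].
    + exists (g x); split; [apply Hrd, Hg; auto|]. unfold g at 2. rewrite E. reflexivity.
    + exfalso.
      assert (unit_disc (g x)) as Hgd by (apply Hrd, Hg; auto).
      assert (- pdist (g x) (g (g x)) <= m) by (apply Hm1; exists (g x); split; auto).
      pose proof (pdist_scale_lt r (f x) (f (g x)) Hr (proj2 Hf x Hxd) (proj2 Hf _ Hgd) N).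
      pose proof (pdist_selfmap f Hf x (g x) Hxd Hgd). unfold g at 2 3 in H. fold (g x) in H. unfold g at 1 in H. lra.
Qed.

Lemma wolff_limit : forall (f : nat -> C -> C) (g : C -> C) x l, Cconv x l ->
  (forall z, unit_disc z -> Cconv (fun n => f n z) (g z)) ->
  (forall n, wolff (f n) (x n)) -> wolff g l.
Proof.
  intros f g x l Hx Hf Hw z Hz.
  assert (forall v b, Cconv v b -> Cconv (fun n => RtoC 1 - Cconj (x n) * v n)%C (RtoC 1 - Cconj l * b)%C) as K.
  { intros v b Hv. apply Cconv_minus; [apply Cconv_const|]. apply Cconv_mult; auto. apply Cconv_conj; auto. }
  pose proof (norm2_lim _ _ (K _ _ (Hf z Hz))) as L1. pose proof (norm2_lim _ _ (K _ _ (Cconv_const z))) as L2.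
  pose proof (norm2_lim _ _ (Hf z Hz)) as L3.
  assert (is_lim_seq (fun n => norm2 (1 - Cconj (x n) * f n z) * (1 - norm2 z))
    (norm2 (1 - Cconj l * g z) * (1 - norm2 z))) as A by lim_poly.
  assert (is_lim_seq (fun n => norm2 (1 - Cconj (x n) * z) * (1 - norm2 (f n z)))
    (norm2 (1 - Cconj l * z) * (1 - norm2 (g z)))) as B by lim_poly.
  apply (is_lim_seq_le _ _ _ _ (fun n => Hw n z Hz) A B).
Qed.

Lemma RtoC_lim : forall u (l : R), is_lim_seq u l -> Cconv (fun n => RtoC (u n)) (RtoC l).
Proof.
  intros u l H e He. apply is_lim_seq_spec in H. destruct (H (mkposreal e He)) as [N HN].
  exists N; intros n Hn. rewrite <- RtoC_minus, Cmod_R. apply (HN n Hn).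
Qed.

Lemma lim_one_minus_inv : is_lim_seq (fun n => 1 - / INR (S (S n))) 1.
Proof.
  replace (Finite 1) with (Finite (1 - 0)) by (f_equal; ring). apply is_lim_seq_minus'; [apply is_lim_seq_const|].
  replace (Finite 0) with (Rbar_inv p_infty) by reflexivity. apply is_lim_seq_inv; [|discriminate].
  apply (is_lim_seq_incr_1 (fun n => INR (S n))), (is_lim_seq_incr_1 INR), is_lim_seq_INR.
Qed.

Lemma one_minus_inv_range : forall n, 0 < 1 - / INR (S (S n)) < 1.
Proof.
  intros n. assert (1 < INR (S (S n))) by (apply lt_1_INR; lia).
  assert (/ INR (S (S n)) < / 1) by (apply Rinv_lt_contravar; lra).
  assert (0 < / INR (S (S n))) by (apply Rinv_0_lt_compat; lra). lra.
Qed.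

(** Fixed points of the maps [r f] accumulate at a Wolff point as [r] tends to [1]. *)
Theorem wolff_exists : forall f, disc_selfmap f -> exists x, Cmod x <= 1 /\ wolff f x.
Proof.
  intros f Hf. set (r := fun n => 1 - / INR (S (S n))).
  assert (forall n, exists x, unit_disc x /\ (RtoC (r n) * f x)%C = x) as H.
  { intros n. apply shrunk_fixed_point; auto. apply one_minus_inv_range. }
  apply choice in H. destruct H as [x Hx].
  destruct (bounded_subseq x 1) as [s [l [Hs Hl]]].
  { intros n. left. apply Hx. }
  exists l; split.
  - apply (Cconv_Cmod_le _ l 1 Hl). intros n; left; apply Hx.
  - apply (wolff_limit (fun n z => RtoC (r (s n)) * f z)%C f (fun n => x (s n)) l Hl).
    + intros z Hz.
      assert (Cconv (fun n => RtoC (r (s n)) * f z)%C (RtoC 1 * f z)%C) as Q.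
      { apply (Cconv_mult (fun n => RtoC (r (s n))) (fun _ => f z)); [|apply Cconv_const].
        apply (Cconv_subseq (fun n => RtoC (r n)) (RtoC 1) s Hs). apply RtoC_lim, lim_one_minus_inv. }
      rewrite Cmult_1_l in Q. exact Q.
    + intros n. apply wolff_fixed; try apply Hx. pose proof (one_minus_inv_range (s n)) as Rg. fold (r (s n)) in Rg.
      split.
      * intros z Hz. destruct (proj1 Hf z Hz) as [k Hk]. eexists. cder. exact Hk.
      * intros z Hz. pose proof (proj2 Hf z Hz) as F. unfold unit_disc in *.
        rewrite Cmod_mult, Cmod_R, Rabs_pos_eq by lra. pose proof (Cmod_ge_0 (f z)). nra.
Qed.

Lemma wolff_comp : forall f g x, disc_selfmap f -> disc_selfmap g -> wolff f x -> wolff g x ->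
  wolff (fun z => f (g z)) x.
Proof.
  intros f g x Hf Hg Wf Wg z Hz. pose proof (proj2 Hg z Hz) as Gz.
  specialize (Wf (g z) Gz). specialize (Wg z Hz).
  pose proof (norm2_lt_1 _ Hz); pose proof (norm2_lt_1 _ Gz); pose proof (norm2_lt_1 _ (proj2 Hf _ Gz)).
  apply Rmult_le_reg_r with (1 - norm2 (g z)); auto.
  apply Rle_trans with (norm2 (1 - Cconj x * g z) * (1 - norm2 (f (g z))) * (1 - norm2 z)).
  - replace (norm2 (1 - Cconj x * f (g z)) * (1 - norm2 z) * (1 - norm2 (g z))) with
      (norm2 (1 - Cconj x * f (g z)) * (1 - norm2 (g z)) * (1 - norm2 z)) by ring.
    apply Rmult_le_compat_r; lra.
  - replace (norm2 (1 - Cconj x * g z) * (1 - norm2 (f (g z))) * (1 - norm2 z)) with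
      (norm2 (1 - Cconj x * g z) * (1 - norm2 z) * (1 - norm2 (f (g z)))) by ring.
    replace (norm2 (1 - Cconj x * z) * (1 - norm2 (f (g z))) * (1 - norm2 (g z))) with
      (norm2 (1 - Cconj x * z) * (1 - norm2 (g z)) * (1 - norm2 (f (g z)))) by ring.
    apply Rmult_le_compat_r; lra.
Qed.

Lemma wolff_ext : forall f g x, (forall z, unit_disc z -> f z = g z) -> wolff f x -> wolff g x.
Proof. intros f g x E W z Hz. rewrite <- (E z Hz). auto. Qed.

Section DenjoyWolff.
Variable phi : R -> C -> C.
Hypothesis Hphi : semigroup phi.

Lemma wolff_multiples : forall s x n, 0 <= s -> wolff (phi s) x -> wolff (phi (INR n * s)) x.
Proof.
  intros s x n Hs W. induction n.
  - simpl. rewrite Rmult_0_l. intros z Hz. rewrite (semigroup_0 _ Hphi) by auto. lra.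
  - apply (wolff_ext (fun z => phi s (phi (INR n * s) z))).
    + intros z Hz. rewrite <- (semigroup_add _ Hphi); auto.
      * f_equal. rewrite S_INR; ring.
      * pose proof (pos_INR n); nra.
    + apply wolff_comp; auto; apply semigroup_selfmap; auto. pose proof (pos_INR n); nra.
Qed.

(** A common Wolff point of all [phi t]: Wolff points of [phi (2^-k)] accumulate at
    one, every [phi t] being a limit of iterates of these maps. *)
Theorem common_wolff_point : exists x, Cmod x <= 1 /\ forall t, 0 <= t -> wolff (phi t) x.
Proof.
  assert (forall k : nat, 0 < / 2 ^ k) as P by (intros; apply Rinv_0_lt_compat, pow_lt; lra).
  assert (forall k : nat, exists x, Cmod x <= 1 /\ wolff (phi (/ 2 ^ k)) x) as H.
  { intros k. apply wolff_exists, semigroup_selfmap; auto. left; auto. }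
  apply choice in H. destruct H as [x Hx].
  destruct (bounded_subseq x 1) as [s [l [Hs Hl]]]; [intros; apply Hx|].
  exists l; split; [apply (Cconv_Cmod_le _ l 1 Hl); intros; apply Hx|].
  intros t Ht.
  assert (forall k : nat, exists n, INR n * / 2 ^ k <= t < INR n * / 2 ^ k + / 2 ^ k) as Hn.
  { intros k. destruct (nfloor_ex (t * 2 ^ k)) as [n Hn].
    - apply Rmult_le_pos; auto. apply pow_le; lra.
    - exists n. specialize (P k). assert (0 < 2 ^ k) by (apply pow_lt; lra).
      assert (t = t * 2 ^ k * / 2 ^ k) as E by (field; lra).
      split.
      + rewrite E. apply Rmult_le_compat_r; lra.
      + rewrite E. replace (INR n * / 2 ^ k + / 2 ^ k) with ((INR n + 1) * / 2 ^ k) by ring.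
        apply Rmult_lt_compat_r; lra. }
  apply choice in Hn. destruct Hn as [n Hn].
  apply (wolff_limit (fun k => phi (INR (n (s k)) * / 2 ^ (s k))) (phi t) (fun k => x (s k)) l Hl).
  - intros z Hz e He. destruct (semigroup_tcont _ Hphi z t Hz Ht e He) as [d [Hd K]].
    destruct (pow_lt_1_zero (/ 2) ltac:(rewrite Rabs_pos_eq; lra) d Hd) as [N HN].
    exists N. intros k Hk. apply K.
    + apply Rmult_le_pos; [apply pos_INR|left; auto].
    + pose proof (subseq_ge s Hs k). specialize (HN (s k) ltac:(lia)).
      rewrite Rabs_pos_eq in HN by (apply pow_le; lra). rewrite pow_inv in HN.
      specialize (Hn (s k)). apply Rabs_def1; lra.
  - intros k. apply wolff_multiples; [left; auto|apply Hx].
Qed.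

Lemma norm2_one_minus_conj_circle : forall s z, Cmod s = 1 -> norm2 (1 - Cconj s * z) = norm2 (s - z).
Proof.
  intros s z Hs. rewrite norm2_one_minus_conj, <- (Cmod_sqr s), Hs.
  destruct s, z; unfold norm2, Re, Im; simpl; ring.
Qed.

(** A common Wolff point inside the disc would be fixed by the semigroup. *)
Theorem Denjoy_Wolff_point : ~ elliptic phi -> exists tau, Cmod tau = 1 /\
  forall t z, 0 <= t -> unit_disc z -> poisson tau z <= poisson tau (phi t z).
Proof.
  intros Hne. destruct common_wolff_point as [x [Hx W]]. exists x.
  assert (Cmod x = 1) as Hx1.
  { destruct Hx as [Hx|Hx]; auto. exfalso. apply Hne. exists x; split; [exact Hx|].
    intros t Ht. specialize (W t Ht x Hx). rewrite !norm2_one_minus_conj in W.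
    pose proof (norm2_lt_1 x Hx). replace (x - x)%C with (RtoC 0) in W by Cring.
    replace (norm2 (RtoC 0)) with 0 in W by (unfold norm2, Re, Im; simpl; ring).
    assert (norm2 (phi t x - x) * (1 - norm2 x) <= 0) as Q by lra.
    pose proof (norm2_ge_0 (phi t x - x)). apply Ceq_minus, norm2_eq_0. nra. }
  split; auto. intros t z Ht Hz. specialize (W t Ht z Hz).
  rewrite !norm2_one_minus_conj_circle in W by auto. unfold poisson.
  pose proof (semigroup_maps _ Hphi t Ht z Hz) as Fz.
  pose proof (norm2_pos _ (disc_neq_circle x z Hx1 Hz)). pose proof (norm2_pos _ (disc_neq_circle x _ Hx1 Fz)).
  apply Rle_div_l; auto. replace ((1 - norm2 (phi t z)) / norm2 (x - phi t z) * norm2 (x - z)) with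
    (norm2 (x - z) * (1 - norm2 (phi t z)) / norm2 (x - phi t z)) by (field; lra).
  apply Rle_div_r; auto. lra.
Qed.

End DenjoyWolff.

(** * Noshiro-Warschawski *)

Lemma Cinv_neq_0 : forall z : C, z <> RtoC 0 -> (/ z)%C <> RtoC 0.
Proof.
  intros z Hz. apply Cmod_gt_0. rewrite Cmod_inv by auto. apply Rinv_0_lt_compat, Cmod_gt_0; auto.
Qed.

Lemma half_plane_segment : forall (z w : C) s, 0 <= s <= 1 -> 0 < Re z -> 0 < Re w ->
  0 < Re (z + RtoC s * (w - z)).
Proof.
  intros [a b] [c d] s Hs Hz Hw. unfold Re in *; simpl in *.
  replace (a + (s * (c + - a) - 0 * (d + - b))) with ((1 - s) * a + s * c) by ring.
  destruct (Req_dec s 0) as [->|]; [lra|]. assert (0 < s * c) by nra. nra.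
Qed.

Lemma MVT_curve_re : forall (y : R -> C) (dy : R -> C) a b, a <= b ->
  (forall t, a < t < b -> rderiv y t (dy t)) -> (forall t, a <= t <= b -> Rcont y t) ->
  exists c, a <= c <= b /\ Re (y b) - Re (y a) = Re (dy c) * (b - a).
Proof.
  intros y dy a b Hab Hd Hc.
  destruct (MVT_gen (fun t => Re (y t)) a b (fun t => Re (dy t))) as [c [Hc1 Hc2]].
  - intros t Ht. rewrite Rmin_left, Rmax_right in Ht by auto. apply rderiv_re_im; auto.
  - intros t Ht. rewrite Rmin_left, Rmax_right in Ht by auto. apply continuity_pt_filterlim.
    apply Rcont_re_im; auto.
  - rewrite Rmin_left, Rmax_right in Hc1 by auto. exists c; auto.
Qed.

(** The increment of [f] along the segment from [z] to [w], divided by [w - z], is an average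
    of values of the derivative, so its real part is positive. *)
Theorem Noshiro_Warschawski : forall f df : C -> C,
  (forall w, 0 < Re w -> cderiv f w (df w)) -> (forall w, 0 < Re w -> 0 < Re (df w)) ->
  forall z w, 0 < Re z -> 0 < Re w -> f z = f w -> z = w.
Proof.
  intros f df Hd Hp z w Hz Hw E. destruct (Ceq_dec z w) as [|N]; auto. exfalso.
  set (d := (w - z)%C). set (g := fun s : R => (Cconj d * f (z + RtoC s * d))%C).
  assert (forall s, 0 <= s <= 1 -> rderiv g s (Cconj d * df (z + RtoC s * d) * d)%C) as Dg.
  { intros s Hs. apply (rderiv_comp (fun u => Cconj d * f u)%C (fun s => z + RtoC s * d)%C); [|apply rderiv_affine].
    eapply cderiv_eq; [cder; apply Hd, half_plane_segment; auto|]. cbv beta. fold d. Cring. }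
  destruct (MVT_curve_re g (fun s => Cconj d * df (z + RtoC s * d)%C * d)%C 0 1) as [s [Hs Q]]; try lra.
  - intros; apply Dg; lra.
  - intros t Ht. eapply rderiv_continuous, Dg; auto.
  - assert (g 1 = g 0) as E1.
    { unfold g. f_equal. replace (z + RtoC 1 * d)%C with w by (unfold d; Cring).
      replace (z + RtoC 0 * d)%C with z by Cring. auto. }
    rewrite E1 in Q. pose proof (half_plane_segment z w s Hs Hz Hw) as Hsg. fold d in Hsg.
    specialize (Hp _ Hsg). set (v := df (z + RtoC s * d)%C) in *.
    assert (Re (Cconj d * v * d) = norm2 d * Re v) as R1
      by (destruct d, v; unfold norm2, Re, Im; simpl; ring).
    rewrite R1 in Q. assert (0 < norm2 d); [|nra].
    apply norm2_pos. intros K. apply N. symmetry. apply Ceq_minus; auto.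
Qed.

Lemma tderiv_zero_const : forall y : R -> C, (forall t, 0 <= t -> tcont y t) ->
  (forall t, 0 < t -> tderiv y t (RtoC 0)) -> forall t, 0 <= t -> y t = y 0.
Proof.
  intros y Hc Hd t Ht.
  assert (forall c : C, Re (c * y t) = Re (c * y 0)%C) as K.
  { intros c.
    destruct (MVT_curve_re (fun s => c * y (Rmax s 0))%C (fun _ => RtoC 0) 0 t Ht) as [s [_ E]].
    - intros s Hs. apply (rderiv_eq _ _ (c * RtoC 0)%C); [|Cring].
      apply (rderiv_comp (fun w => c * w)%C (fun s => y (Rmax s 0))).
      + eapply cderiv_eq; [cder|cbv beta; Cring].
      + apply rderiv_eps. intros e He. destruct (Hd s ltac:(lra) e He) as [d [Hd0 Q]].
        exists (Rmin d s); split; [apply Rmin_glb_lt; lra|]. intros r Hr.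
        pose proof (Rlt_le_trans _ _ _ Hr (Rmin_l _ _)). pose proof (Rlt_le_trans _ _ _ Hr (Rmin_r _ _)) as R2.
        apply Rabs_def2 in R2. rewrite !Rmax_left by lra. apply Q; auto; lra.
    - intros s Hs. apply Rcont_Cmult. apply Rcont_extend; auto.
    - rewrite !Rmax_left in E by lra. unfold Re in *; simpl in *; lra. }
  apply C_ext.
  - specialize (K (RtoC 1)). rewrite !Cmult_1_l in K. auto.
  - specialize (K (- Ci)%C). destruct (y t), (y 0); unfold Re, Im in *; simpl in *; lra.
Qed.

(** * The Koenigs function *)

Section Koenigs.
Variable phi : R -> C -> C.
Hypothesis Hphi : semigroup phi.
Hypothesis Hne : ~ elliptic phi.

(** Sending the Denjoy-Wolff point to infinity, the generator becomes a function with
    nonnegative real part; the primitive of [Ci / p] is then univalent and conjugates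
    the semigroup to vertical translations. *)
Theorem Koenigs_function : exists h : C -> C, univalent_on unit_disc h /\
  forall t z, 0 <= t -> unit_disc z -> h (phi t z) = vertical_translation t (h z).
Proof.
  destruct (Denjoy_Wolff_point phi Hphi Hne) as [tau [Htau HP]].
  destruct (generator_exists phi Hphi) as [G [GH [Gd Gz]]].
  set (dc := fun z => (RtoC 2 * tau / ((tau - z) * (tau - z)))%C).
  assert (forall z, unit_disc z -> cderiv (cayley tau) z (dc z)) as Dc.
  { intros z Hz. apply cderiv_cayley, disc_neq_circle; auto. }
  set (p := fun w => (dc (icayley tau w) * G (icayley tau w))%C).
  assert (forall z, unit_disc z -> phi 0 z = z) as P0 by (intros; apply (semigroup_0 _ Hphi); auto).
  assert (forall z, unit_disc z -> G z <> RtoC 0) as Gn.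
  { intros z Hz E. apply Hne. exists z; split; auto. }
  assert (forall z, unit_disc z -> dc z <> RtoC 0) as Dn.
  { intros z Hz. unfold dc, Cdiv. pose proof (disc_neq_circle tau z Htau Hz).
    apply Cmult_neq_0; [apply Cmult_neq_0; [apply RtoC_neq; lra|apply Cmod1_neq; auto]|].
    apply Cinv_neq_0. apply Cmult_neq_0; auto. }
  assert (forall w, 0 < Re w -> p w <> RtoC 0) as Pn.
  { intros w Hw. pose proof (icayley_disc tau w Htau Hw). apply Cmult_neq_0; auto. }
  assert (forall w, 0 < Re w -> cderivable p w) as Pd.
  { intros w Hw. pose proof (icayley_disc tau w Htau Hw) as Hz.
    apply (cderivable_comp (fun z => dc z * G z)%C (icayley tau)); [|apply cderivable_icayley; lra].
    destruct (GH _ Hz) as [l Hl]. eexists. unfold dc. cder; [|exact Hl].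
    pose proof (disc_neq_circle tau _ Htau Hz). apply Cmult_neq_0; auto. }
  assert (forall z, unit_disc z -> p (cayley tau z) = dc z * G z)%C as Pc.
  { intros z Hz. unfold p. rewrite icayley_cayley; auto. }
  assert (forall w, 0 < Re w -> 0 <= Re (p w)) as Pp.
  { intros w Hw. set (z := icayley tau w). assert (unit_disc z) as Hz by (apply icayley_disc; auto).
    apply Rnot_lt_le; intros Q.
    assert (tderiv (fun t => cayley tau (phi t z)) 0 (p w)) as T.
    { apply (tderiv_comp (cayley tau) (fun t => phi t z)).
      - apply semigroup_tcont; auto; lra.
      - rewrite P0 by auto. apply Dc; auto.
      - fold z. pose proof (Gd z 0 Hz (Rle_refl 0)) as Q0. rewrite (P0 z Hz) in Q0. exact Q0. }
    destruct (T (- Re (p w) / 2) ltac:(lra)) as [d [Hd K]].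
    specialize (K (d / 2) ltac:(lra)). rewrite Rminus_0_r, Rabs_pos_eq in K by lra.
    specialize (K ltac:(lra)). rewrite P0 in K by auto.
    pose proof (HP (d / 2) z ltac:(lra) Hz) as M.
    pose proof (semigroup_maps _ Hphi (d / 2) ltac:(lra) z Hz) as Hz2.
    rewrite <- !re_cayley in M by (auto; apply disc_neq_circle; auto).
    pose proof (Rle_trans _ _ _ (re_le_Cmod _) K) as K2. apply Rabs_le_between in K2.
    set (c1 := cayley tau (phi (d / 2) z)) in *. set (c0 := cayley tau z) in *.
    replace (Re (c1 - c0 - RtoC (d / 2) * p w)) with (Re c1 - Re c0 - d / 2 * Re (p w)) in K2
      by (destruct c1, c0, (p w); unfold Re; simpl; ring).
    nra. }
  destruct (primitive_half_plane (fun w => Ci / p w)%C) as [k Hk].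
  { intros w Hw. destruct (Pd w Hw) as [l Hl]. eexists. cder; [exact Hl|auto]. }
  assert (forall z w, 0 < Re z -> 0 < Re w -> k z = k w -> z = w) as Kinj.
  (* A zero of the real part forces [p] to be constant, by the Schwarz-Pick inequality. *)
  { destruct (classic (exists w0, 0 < Re w0 /\ Re (p w0) = 0)) as [[w0 [Hw0 E0]]|Np].
    - assert (forall w, 0 < Re w -> p w = p w0) as Pconst.
      { intros w Hw. pose proof (Schwarz_Pick_half_plane p Pd Pp w w0 Hw Hw0) as S. rewrite E0 in S.
        apply Ceq_minus, norm2_eq_0. pose proof (norm2_ge_0 (p w - p w0)).
        assert (0 < Re w * Re w0) by (apply Rmult_lt_0_compat; auto). nra. }
      intros z w Hz Hw E. set (c := (Ci / p w0)%C).
      assert (Cmod (k w - k z - c * (w - z)) <= 0 * Cmod (w - z)) as B.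
      { apply (cderiv_mean_value k (fun w => Ci / p w)%C); intros s Hs;
          pose proof (half_plane_segment z w s Hs Hz Hw) as Sg; [apply Hk; auto|].
        rewrite Pconst by auto. unfold c.
        replace (Ci / p w0 - Ci / p w0)%C with (RtoC 0) by Cring. rewrite Cmod_0; lra. }
      rewrite E in B. replace (k w - k w - c * (w - z))%C with (- (c * (w - z)))%C in B by Cring.
      rewrite Cmod_opp, Cmod_mult, Rmult_0_l in B.
      assert (0 < Cmod c) as Pc0.
      { apply Cmod_gt_0. unfold c, Cdiv. apply Cmult_neq_0; [apply Ci_nz|apply Cinv_neq_0; auto]. }
      symmetry. apply Ceq_minus, Cmod_eq_0. pose proof (Cmod_ge_0 (w - z)). nra.
    - intros z w Hz Hw E.
      apply (Noshiro_Warschawski (fun w => - Ci * k w)%C (fun w => / p w)%C); auto.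
      + intros v Hv. eapply cderiv_eq; [cder; apply Hk; auto|]. cbv beta.
        replace (/ p v)%C with (- (Ci * Ci) * / p v)%C by
          (replace (Ci * Ci)%C with (- RtoC 1)%C by (apply C_ext; unfold Re, Im; simpl; ring); Cring).
        unfold Cdiv; Cring.
      + intros v Hv. assert (0 < Re (p v)) as Q.
        { destruct (Pp v Hv) as [Q|Q]; auto. exfalso. apply Np. exists v; auto. }
        destruct (p v) as [a b]. unfold Re in *; simpl in *. apply Rdiv_lt_0_compat; nra.
      + rewrite E; auto. }
  set (h := fun z => k (cayley tau z)).
  assert (forall z, unit_disc z -> cderiv h z (Ci / G z)%C) as Dh.
  { intros z Hz. eapply cderiv_eq.
    - apply (cderiv_comp k (cayley tau)); [apply Hk, cayley_pos; auto|apply Dc; auto].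
    - cbv beta. rewrite Pc by auto. specialize (Gn z Hz). specialize (Dn z Hz). Cfield; auto. }
  exists h; split; [split|].
  - intros z Hz. exists (Ci / G z)%C. apply Dh; auto.
  - intros z w Hz Hw E. apply Kinj in E; try (apply cayley_pos; auto).
    rewrite <- (icayley_cayley tau z), <- (icayley_cayley tau w), E; auto.
  - intros t z Ht Hz. unfold vertical_translation.
    assert (forall s, 0 <= s -> unit_disc (phi s z)) as Pm by (intros; apply (semigroup_maps _ Hphi); auto).
    assert (forall s, 0 <= s -> tderiv (fun s => h (phi s z)) s Ci) as T.
    { intros s Hs. replace Ci with (Ci / G (phi s z) * G (phi s z))%C.
      - apply (tderiv_comp h (fun s => phi s z)); [apply semigroup_tcont; auto|apply Dh; auto|apply Gd; auto].
      - specialize (Gn _ (Pm s Hs)). Cfield; auto. }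
    assert (forall s, 0 <= s -> tcont (fun s => h (phi s z)) s) as TC.
    { intros s Hs e He. pose proof (cderiv_continuous _ _ _ (Dh _ (Pm s Hs))) as Ch. rewrite Ccont_eps in Ch.
      destruct (Ch e He) as [d1 [D1 K1]]. destruct (semigroup_tcont _ Hphi z s Hz Hs d1 D1) as [d2 [D2 K2]].
      exists d2; split; auto. }
    pose proof (tderiv_zero_const (fun s => h (phi s z) - Ci * RtoC s)%C) as Z.
    assert (h (phi t z) - Ci * RtoC t = h (phi 0 z) - Ci * RtoC 0)%C as E.
    { apply Z; auto.
      - intros s Hs e He. destruct (TC s Hs (e/2)) as [d1 [D1 K1]]; [lra|].
        exists (Rmin d1 (e/2)); split; [apply Rmin_glb_lt; lra|]. intros r Hr Hrs.
        pose proof (Rlt_le_trans _ _ _ Hrs (Rmin_l _ _)) as R1. pose proof (Rlt_le_trans _ _ _ Hrs (Rmin_r _ _)) as R2.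
        specialize (K1 r Hr R1).
        replace (h (phi r z) - Ci * RtoC r - (h (phi s z) - Ci * RtoC s))%C with
          ((h (phi r z) - h (phi s z)) + - (Ci * RtoC (r - s)))%C by (rewrite RtoC_minus; Cring).
        eapply Rle_lt_trans; [apply Cmod_triangle|].
        rewrite Cmod_opp, Cmod_mult, Cmod_Ci, Cmod_R. lra.
      - intros s Hs e He. destruct (T s ltac:(lra) e He) as [d [D1 K1]]. exists d; split; auto.
        intros r Hr Hrs. specialize (K1 r Hr Hrs).
        replace (h (phi r z) - Ci * RtoC r - (h (phi s z) - Ci * RtoC s) - RtoC (r - s) * RtoC 0)%C with
          (h (phi r z) - h (phi s z) - RtoC (r - s) * Ci)%C by (rewrite RtoC_minus; Cring). auto. }
    rewrite P0 in E by auto.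
    replace (h (phi t z)) with (h (phi t z) - Ci * RtoC t + Ci * RtoC t)%C by Cring. rewrite E. Cring.
Qed.

End Koenigs.

(** * Base spaces *)

(** An order-convex set without extreme points is an open interval, bounded or not. *)
Lemma open_interval_cases : forall P : R -> Prop, (exists x, P x) ->
  (forall x y z, P x -> P z -> x <= y <= z -> P y) ->
  (forall x, P x -> exists d, 0 < d /\ P (x - d) /\ P (x + d)) ->
  (exists a b, a < b /\ forall x, P x <-> a < x < b) \/ (exists a, forall x, P x <-> a < x) \/
  (exists b, forall x, P x <-> x < b) \/ (forall x, P x).
Proof.
  intros P [x0 H0] Cv Op.
  assert ((exists a, a < x0 /\ forall x, x <= x0 -> (P x <-> a < x)) \/ (forall x, x <= x0 -> P x)) as L.
  { destruct (classic (exists m, forall x, P x -> m <= x)) as [[m Hm]|N].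
    - left. destruct (completeness (fun y => P (- y))) as [s [S1 S2]].
      + exists (- m). intros y Hy. specialize (Hm _ Hy). lra.
      + exists (- x0). rewrite Ropp_involutive; auto.
      + assert (forall x, P x -> - s < x) as Q.
        { intros x Hx. destruct (Op x Hx) as [d [Hd [H1 _]]].
          rewrite <- (Ropp_involutive (x - d)) in H1. specialize (S1 _ H1). lra. }
        exists (- s); split; [auto|]. intros x Hx; split; auto. intros Hsx.
        apply NNPP; intros K. assert (s <= - x); [|lra]. apply S2. intros y Hy.
        apply Rnot_lt_le; intros Q2. apply K. apply (Cv (- y) x x0); auto; lra.
    - right. intros x Hx. apply NNPP; intros K. apply N. exists x. intros y Hy.
      apply Rnot_lt_le; intros Q. apply K. apply (Cv y x x0); auto; lra. }
  assert ((exists b, x0 < b /\ forall x, x0 <= x -> (P x <-> x < b)) \/ (forall x, x0 <= x -> P x)) as R.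
  { destruct (classic (exists m, forall x, P x -> x <= m)) as [[m Hm]|N].
    - left. destruct (completeness P) as [s [S1 S2]].
      + exists m. intros y Hy. auto.
      + exists x0; auto.
      + assert (forall x, P x -> x < s) as Q.
        { intros x Hx. destruct (Op x Hx) as [d [Hd [_ H1]]]. specialize (S1 _ H1). lra. }
        exists s; split; [auto|]. intros x Hx; split; auto. intros Hsx.
        apply NNPP; intros K. assert (s <= x); [|lra]. apply S2. intros y Hy.
        apply Rnot_lt_le; intros Q2. apply K. apply (Cv x0 x y); auto; lra.
    - right. intros x Hx. apply NNPP; intros K. apply N. exists x. intros y Hy.
      apply Rnot_lt_le; intros Q. apply K. apply (Cv x0 x y); auto; lra. }
  destruct L as [[a [La HL]]|HL], R as [[b [Rb HR]]|HR].
  - left. exists a, b; split; [lra|]. intros x. destruct (Rle_dec x x0).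
    + rewrite HL by auto. lra.
    + rewrite HR by lra. lra.
  - right; left. exists a. intros x. destruct (Rle_dec x x0); [apply HL; auto|].
    split; [lra|intros; apply HR; lra].
  - right; right; left. exists b. intros x. destruct (Rle_dec x x0); [|apply HR; lra].
    split; [lra|intros; apply HL; lra].
  - right; right; right. intros x. destruct (Rle_dec x x0); [apply HL|apply HR]; lra.
Qed.

(** Two open sets would split a segment; consider the supremum of the times up to which the
    segment stays in the first one. *)
Lemma convex_connected : forall A : C -> Prop,
  (forall z w s, A z -> A w -> 0 <= s <= 1 -> A (z + RtoC s * (w - z))%C) -> connected_set A.
Proof.
  intros A HA U V HU HV Cov [z [Az Uz]] [w [Aw Vw]]. apply NNPP; intros K.
  assert (forall x, A x -> U x -> V x -> False) as Dis by (intros x; intros; apply K; exists x; auto).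
  set (g := fun s : R => (z + RtoC s * (w - z))%C).
  assert (forall s, 0 <= s <= 1 -> A (g s)) as Ag by (intros; apply HA; auto).
  assert (forall (W : C -> Prop) s, open (T := C_UniformSpace) W -> W (g s) ->
    exists d, 0 < d /\ forall r, Rabs (r - s) < d -> W (g r)) as Near.
  { intros W s HW Ws. rewrite open_C in HW. destruct (HW _ Ws) as [e [He E]].
    pose proof (Rcont_affine z (w - z)%C s) as Cg. rewrite Rcont_eps in Cg.
    destruct (Cg e He) as [d [Hd Q]]. exists d; split; auto. intros r Hr; apply E, Q, Hr. }
  destruct (completeness (fun s => 0 <= s <= 1 /\ forall r, 0 <= r <= s -> U (g r))) as [m [M1 M2]].
  - exists 1. intros s [Hs _]; lra.
  - exists 0. split; [lra|]. intros r Hr. replace r with 0 by lra. unfold g.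
    replace (z + RtoC 0 * (w - z))%C with z by Cring. auto.
  - assert (0 <= m <= 1) as Hm.
    { split; [apply M1|apply M2; intros s [Hs _]; lra]. split; [lra|]. intros r Hr. replace r with 0 by lra.
      unfold g. replace (z + RtoC 0 * (w - z))%C with z by Cring. auto. }
    assert (forall r, 0 <= r < m -> U (g r)) as Below.
    { intros r Hr. apply NNPP; intros Q. assert (m <= r); [|lra]. apply M2. intros s [Hs1 Hs2].
      apply Rnot_lt_le; intros L. apply Q, Hs2; lra. }
    destruct (Cov (g m) (Ag m Hm)) as [Um|Vm].
    + destruct (Near U m HU Um) as [d [Hd D]].
      assert (forall r, 0 <= r <= Rmin 1 (m + d / 2) -> U (g r)) as Up.
      { intros r Hr. destruct (Rlt_dec r m); [apply Below; lra|]. apply D.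
        pose proof (Rmin_r 1 (m + d / 2)). rewrite Rabs_pos_eq; lra. }
      assert (Rmin 1 (m + d / 2) <= m) as Q.
      { apply M1; split; auto. split; [apply Rmin_glb; lra|apply Rmin_l]. }
      assert (m = 1). { unfold Rmin in Q; destruct Rle_dec in Q; lra. }
      subst m. apply (Dis w Aw); auto. unfold g in Um.
      replace (z + RtoC 1 * (w - z))%C with w in Um by Cring. auto.
    + destruct (Near V m HV Vm) as [d [Hd D]].
      destruct (Req_dec m 0) as [E0|N0].
      * apply (Dis z Az Uz). subst m. unfold g in Vm. replace (z + RtoC 0 * (w - z))%C with z in Vm by Cring. auto.
      * set (r := Rmax (m / 2) (m - d / 2)). assert (m / 2 <= r) by apply Rmax_l. assert (m - d / 2 <= r) by apply Rmax_r.
        assert (r < m) by (apply Rmax_lub_lt; lra).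
        apply (Dis (g r)); [apply Ag; lra|apply Below; lra|]. apply D.
        rewrite <- Rabs_Ropp, Rabs_pos_eq; lra.
Qed.

Lemma vertical_translation_group : forall (Omega : C -> Prop) (P : R -> Prop),
  (forall z, Omega z <-> P (Re z)) -> automorphism_group Omega vertical_translation.
Proof.
  intros Omega P HO.
  assert (forall t z, Re (vertical_translation t z) = Re z) as Rv.
  { intros t [a b]. unfold vertical_translation, Re; simpl. ring. }
  assert (forall t, maps_into Omega Omega (vertical_translation t)) as Mv.
  { intros t z Hz. apply HO. rewrite Rv. apply HO; auto. }
  assert (forall t, holomorphic_on Omega (vertical_translation t)) as Hv.
  { intros t z _. eexists. unfold vertical_translation. cder. }
  assert (forall s t z, vertical_translation (s + t) z = vertical_translation s (vertical_translation t z)) as Av.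
  { intros s t z. unfold vertical_translation. rewrite RtoC_plus. Cring. }
  assert (forall z, vertical_translation 0 z = z) as Zv by (intros; unfold vertical_translation; Cring).
  split; auto.
  - intros t. split; [auto|split; auto]. exists (vertical_translation (- t)).
    split; [auto|split; auto]. split; intros z _; rewrite <- Av.
    + replace (- t + t) with 0 by ring. auto.
    + replace (t + - t) with 0 by ring. auto.
  - intros t0 _ K _ _ eps. exists eps. intros t _ Ht z _. unfold vertical_translation.
    replace (z + Ci * RtoC t - (z + Ci * RtoC t0))%C with (Ci * RtoC (t - t0))%C by (rewrite RtoC_minus; Cring).
    rewrite Cmod_mult, Cmod_Ci, Cmod_R, Rmult_1_l. auto.
Qed.

(** For a conjugation to translations all requirements on a model reduce to the
    determination of the real parts taken by [h]. *)
Lemma translation_model : forall phi (h : C -> C) (Omega : C -> Prop) (P : R -> Prop) (c : R),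
  semigroup phi -> univalent_on unit_disc h ->
  (forall t z, 0 <= t -> unit_disc z -> h (phi t z) = vertical_translation t (h z)) ->
  (forall z, Omega z <-> P (Re z)) ->
  (forall x y z, P x -> P z -> x <= y <= z -> P y) ->
  (forall x, P x -> exists d, 0 < d /\ P (x - d) /\ P (x + d)) ->
  (forall x, P x <-> exists z, unit_disc z /\ Re (h z) = x + c) ->
  holomorphic_model phi Omega (fun z => h z - RtoC c)%C vertical_translation.
Proof.
  intros phi h Omega P c Hphi [Hh Inj] Ab HO Cv Op HX.
  split.
  - apply open_C. intros z Hz. apply HO in Hz. destruct (Op _ Hz) as [d [Hd [P1 P2]]].
    exists d; split; auto. intros w Hw. apply HO. apply (Cv (Re z - d) _ (Re z + d)); auto.
    pose proof (re_le_Cmod (w - z)) as Q. replace (Re (w - z)) with (Re w - Re z) in Q by (unfold Re; simpl; ring).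
    apply Rabs_le_between in Q. lra.
  - apply convex_connected. intros z w s Hz Hw Hs. apply HO. apply HO in Hz, Hw.
    replace (Re (z + RtoC s * (w - z))) with (Re z + s * (Re w - Re z)) by (destruct z, w; unfold Re; simpl; ring).
    destruct (Rle_dec (Re z) (Re w)).
    + apply (Cv (Re z) _ (Re w)); auto. nra.
    + apply (Cv (Re w) _ (Re z)); auto. nra.
  - intros z Hz. apply HO, HX. exists z; split; auto. unfold Re; simpl; ring.
  - split.
    + intros z Hz. destruct (Hh z Hz) as [l Hl]. eexists. cder. exact Hl.
    + intros z w Hz Hw E. apply Inj; auto. replace (h z) with (h z - RtoC c + RtoC c)%C by Cring. rewrite E. Cring.
  - apply (vertical_translation_group Omega P HO).
  - intros t z Ht Hz. rewrite Ab by auto. unfold vertical_translation. Cring.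
  - intros w; split.
    + intros Hw. apply HO, HX in Hw. destruct Hw as [z [Hz E]].
      set (y := Im w - Im (h z)).
      destruct (Rle_dec 0 y) as [Hy|Hy].
      * exists 0, (phi y z). split; [lra|split; [apply (semigroup_maps _ Hphi); auto|]].
        rewrite Ab by auto. unfold vertical_translation.
        apply C_ext; unfold y, Re, Im in *; simpl; lra.
      * exists (- y), z. split; [lra|split; auto]. unfold vertical_translation.
        apply C_ext; unfold y, Re, Im in *; simpl; lra.
    + intros [t [z [Ht [Hz E]]]]. apply HO, HX. exists z; split; auto. subst w.
      unfold vertical_translation, Re; simpl. ring.
Qed.

Lemma re_image_interval : forall h : C -> C, univalent_on unit_disc h ->
  let X := fun x => exists z, unit_disc z /\ Re (h z) = x in
  (exists x, X x) /\ (forall x y z, X x -> X z -> x <= y <= z -> X y) /\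
  (forall x, X x -> exists d, 0 < d /\ X (x - d) /\ X (x + d)).
Proof.
  intros h Hh X. split; [|split].
  - exists (Re (h (RtoC 0))), (RtoC 0). split; auto. unfold unit_disc. rewrite Cmod_0; lra.
  - intros x y z [u [Hu Eu]] [v [Hv Ev]] Hy.
    set (g := fun s : R => Re (h (u + RtoC s * (v - u))%C)).
    assert (forall s, 0 <= s <= 1 -> unit_disc (u + RtoC s * (v - u))%C) as Sg.
    { intros s Hs. unfold unit_disc in *. set (r := Rmax (Cmod u) (Cmod v)).
      apply Rle_lt_trans with r; [|apply Rmax_lub_lt; auto].
      replace (u + RtoC s * (v - u))%C with (u + RtoC s * (v - u) - RtoC 0)%C by Cring.
      apply segment_in_disc; auto; replace (u - RtoC 0)%C with u by Cring; replace (v - RtoC 0)%C with v by Cring;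
        [apply Rmax_l|apply Rmax_r]. }
    destruct (f_interv_is_interv g 0 1 y) as [s [Hs E]]; [lra| | |].
    + unfold g. replace (u + RtoC 0 * (v - u))%C with u by Cring. replace (u + RtoC 1 * (v - u))%C with v by Cring. lra.
    + intros s Hs. apply continuity_pt_filterlim. unfold g.
      apply (Rcont_re_im (fun s => h (u + RtoC s * (v - u))%C)).
      apply (Rcont_comp h (fun s => u + RtoC s * (v - u))%C); [apply Rcont_affine|].
      destruct (proj1 Hh _ (Sg s Hs)) as [l Hl]. eapply cderiv_continuous; eauto.
    + exists (u + RtoC s * (v - u))%C; auto.
  - intros x [z [Hz E]]. destruct (univalent_open_map h Hh z Hz 1 Rlt_0_1) as [m [Hm K]].
    exists (m / 2); split; [lra|].
    assert (forall y, Rabs y = m / 2 -> X (x + y)) as Q.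
    { intros y Hy. destruct (K (h z + RtoC y)%C) as [w [Hw [_ Ew]]].
      - replace (h z + RtoC y - h z)%C with (RtoC y) by Cring. rewrite Cmod_R; lra.
      - exists w; split; auto. rewrite Ew, <- E. unfold Re; simpl; ring. }
    split; [apply (Q (- (m / 2)))|apply Q]; [rewrite Rabs_Ropp|]; apply Rabs_pos_eq; lra.
Qed.

(** The base space is invariant under all vertical translations, so it is the preimage of
    an open interval under [Re]. *)
Theorem model_exists : forall phi, semigroup phi -> ~ elliptic phi ->
  (exists rho h, 0 < rho /\ holomorphic_model phi (strip rho) h vertical_translation) \/
  (exists h, holomorphic_model phi right_half_plane h vertical_translation) \/
  (exists h, holomorphic_model phi left_half_plane h vertical_translation) \/
  (exists h, holomorphic_model phi whole_plane h vertical_translation).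
Proof.
  intros phi Hphi Hne. destruct (Koenigs_function phi Hphi Hne) as [h [Uh Ab]].
  destruct (re_image_interval h Uh) as [X1 [X2 X3]].
  destruct (open_interval_cases _ X1 X2 X3) as [[a [b [Hab H]]]|[[a H]|[[b H]|H]]].
  - left. exists (b - a), (fun z => h z - RtoC a)%C. split; [lra|].
    apply (translation_model phi h _ (fun x => 0 < x < b - a) a); auto.
    + intros z; unfold strip; tauto.
    + intros; lra.
    + intros x Hx. exists (Rmin x (b - a - x) / 2).
      pose proof (Rmin_l x (b - a - x)); pose proof (Rmin_r x (b - a - x)).
      assert (0 < Rmin x (b - a - x)) by (apply Rmin_glb_lt; lra). lra.
    + intros x. rewrite H. lra.
  - right; left. exists (fun z => h z - RtoC a)%C.
    apply (translation_model phi h _ (fun x => 0 < x) a); auto.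
    + intros z; unfold right_half_plane; tauto.
    + intros; lra.
    + intros x Hx. exists (x / 2). lra.
    + intros x. rewrite H. lra.
  - right; right; left. exists (fun z => h z - RtoC b)%C.
    apply (translation_model phi h _ (fun x => x < 0) b); auto.
    + intros z; unfold left_half_plane; tauto.
    + intros; lra.
    + intros x Hx. exists (- x / 2). lra.
    + intros x. rewrite H. lra.
  - right; right; right. exists (fun z => h z - RtoC 0)%C.
    apply (translation_model phi h _ (fun x => True) 0); auto.
    + intros z; unfold whole_plane; tauto.
    + intros x _. exists 1. split; [lra|auto].
    + intros x. split; auto.
Qed.

(** * Julia's lemma and boundary dilation *)

(** The map [f] sends horodiscs at [s] into horodiscs at [s'], enlarged by the factor [a]. *)
Definition julia (f : C -> C) (s s' : C) (a : R) : Prop :=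
  forall z, unit_disc z -> poisson s z <= a * poisson s' (f z).

(** Minimality ranges over all image points, so that the constant depends on [f] and [s]
    alone. *)
Definition exact_julia (f : C -> C) (s s' : C) (a : R) : Prop :=
  Cmod s' = 1 /\ julia f s s' a /\
  forall s'' b, Cmod s'' = 1 -> julia f s s'' b -> a <= b.

Lemma Cmod_lim : forall z l, Cconv z l -> is_lim_seq (fun n => Cmod (z n)) (Cmod l).
Proof.
  intros z l H. apply is_lim_seq_spec. intros e. destruct (H e (cond_pos e)) as [N HN].
  exists N; intros n Hn. eapply Rle_lt_trans; [apply Cmod_diff_le|auto].
Qed.

Lemma poisson_div : forall a s s' z w, (s - z)%C <> RtoC 0 -> (s' - w)%C <> RtoC 0 ->
  (1 - norm2 z) * norm2 (s' - w) <= a * (1 - norm2 w) * norm2 (s - z) ->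
  poisson s z <= a * poisson s' w.
Proof.
  intros a s s' z w Hz Hw H. unfold poisson.
  pose proof (norm2_pos _ Hz). pose proof (norm2_pos _ Hw).
  apply Rle_div_l; auto.
  replace (a * ((1 - norm2 w) / norm2 (s' - w)) * norm2 (s - z)) with
    (a * (1 - norm2 w) * norm2 (s - z) / norm2 (s' - w)) by (field; lra).
  apply Rle_div_r; auto.
Qed.

(** Let [n] tend to infinity in the Schwarz-Pick inequality for [w] and [z n], divided by
    [1 - |z n|]. *)
Lemma julia_of_sequence : forall f (z : nat -> C) (a : nat -> R) s s' (a0 : R),
  disc_selfmap f -> Cmod s = 1 -> (forall n, unit_disc (z n)) -> Cconv z s ->
  Cconv (fun n => f (z n)) s' ->
  (forall n, 1 - Cmod (f (z n)) <= a n * (1 - Cmod (z n))) -> is_lim_seq a a0 ->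
  Cmod s' = 1 /\ julia f s s' a0.
Proof.
  intros f z a s s' a0 Hf Hs Hz Lz Lf Ha La.
  pose proof (Cmod_lim _ _ Lz) as M1. pose proof (Cmod_lim _ _ Lf) as M2. cbv beta in M2.
  assert (Cmod s' = 1) as Hs'.
  { apply Rle_antisym.
    - apply (Cconv_Cmod_le _ s' 1 Lf). intros n. left. apply (proj2 Hf), Hz.
    - assert (is_lim_seq (fun n => 1 - Cmod (f (z n))) (1 - Cmod s')) as A by lim_poly.
      assert (is_lim_seq (fun n => a n * (1 - Cmod (z n))) (a0 * (1 - Cmod s))) as B by lim_poly.
      pose proof (is_lim_seq_le _ _ _ _ Ha A B) as Q. simpl in Q. rewrite Hs in Q. lra. }
  split; auto. intros w Hw. pose proof (proj2 Hf w Hw) as Hfw.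
  apply poisson_div; try (apply disc_neq_circle; auto).
  assert (forall n, (1 - norm2 w) * norm2 (1 - Cconj (f w) * f (z n)) * (1 + Cmod (z n)) <=
    a n * (1 + Cmod (f (z n))) * (1 - norm2 (f w)) * norm2 (1 - Cconj w * z n)) as K.
  { intros n. pose proof (Schwarz_Pick f Hf (z n) w (Hz n) Hw) as S.
    specialize (Ha n). specialize (Hz n). pose proof (proj2 Hf _ Hz) as Fz. unfold unit_disc in Hz, Fz.
    pose proof (Cmod_ge_0 (z n)). pose proof (Cmod_ge_0 (f (z n))).
    rewrite <- !(Cmod_sqr (z n)), <- !(Cmod_sqr (f (z n))) in S.
    pose proof (norm2_lt_1 _ Hfw). pose proof (norm2_ge_0 (1 - Cconj w * z n)).
    set (m := Cmod (z n)) in *. set (k := Cmod (f (z n))) in *.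
    set (X := norm2 (1 - Cconj (f w) * f (z n))) in *. set (Y := norm2 (1 - Cconj w * z n)) in *.
    set (W := 1 - norm2 w) in *. set (V := 1 - norm2 (f w)) in *.
    apply Rmult_le_reg_r with (1 - m); [lra|].
    apply Rle_trans with ((1 - k * k) * V * Y); [lra|].
    replace (1 - k * k) with ((1 - k) * (1 + k)) by ring.
    apply Rle_trans with (a n * (1 - m) * (1 + k) * V * Y); [|lra].
    repeat apply Rmult_le_compat_r; lra. }
  assert (forall v b, Cconv v b -> forall c, is_lim_seq (fun n => norm2 (1 - Cconj c * v n)) (norm2 (1 - Cconj c * b))) as L.
  { intros v b Hv c. apply norm2_lim. apply Cconv_minus; [apply Cconv_const|].
    apply Cconv_mult; auto. apply Cconv_const. }
  pose proof (L _ _ Lf (f w)) as L1. pose proof (L _ _ Lz w) as L2. cbv beta in L1, L2.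
  assert (is_lim_seq (fun n => (1 - norm2 w) * norm2 (1 - Cconj (f w) * f (z n)) * (1 + Cmod (z n)))
    ((1 - norm2 w) * norm2 (1 - Cconj (f w) * s') * (1 + Cmod s))) as A by lim_poly.
  assert (is_lim_seq (fun n => a n * (1 + Cmod (f (z n))) * (1 - norm2 (f w)) * norm2 (1 - Cconj w * z n))
    (a0 * (1 + Cmod s') * (1 - norm2 (f w)) * norm2 (1 - Cconj w * s))) as B by lim_poly.
  pose proof (is_lim_seq_le _ _ _ _ K A B) as Q. simpl in Q. rewrite Hs, Hs' in Q.
  assert (forall c v, Cmod c = 1 -> norm2 (1 - Cconj v * c) = norm2 (c - v)) as E.
  { intros c v Hc. rewrite norm2_one_minus_conj, <- (Cmod_sqr c), Hc. lra. }
  rewrite !E in Q by auto. lra.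
Qed.

Lemma julia_of_bounded_ratio : forall f (z : nat -> C) (a : nat -> R) s (a0 : R),
  disc_selfmap f -> Cmod s = 1 -> (forall n, unit_disc (z n)) -> Cconv z s ->
  (forall n, 1 - Cmod (f (z n)) <= a n * (1 - Cmod (z n))) -> is_lim_seq a a0 ->
  exists s', Cmod s' = 1 /\ julia f s s' a0.
Proof.
  intros f z a s a0 Hf Hs Hz Lz Ha La.
  destruct (bounded_subseq (fun n => f (z n)) 1) as [k [s' [Hk Ls]]].
  { intros n; left. apply (proj2 Hf), Hz. }
  exists s'. apply (julia_of_sequence f (fun n => z (k n)) (fun n => a (k n)) s s' a0); auto.
  - apply (Cconv_subseq z s k); auto.
  - apply is_lim_seq_subseq; auto. apply eventually_subseq; auto.
Qed.

Lemma poisson_radius : forall s r, Cmod s = 1 -> 0 <= r < 1 ->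
  poisson s (RtoC r * s) = (1 + r) / (1 - r).
Proof.
  intros s r Hs Hr. unfold poisson.
  replace (s - RtoC r * s)%C with (RtoC (1 - r) * s)%C by (rewrite RtoC_minus; Cring).
  rewrite !norm2_mult, <- (Cmod_sqr s), Hs.
  replace (norm2 (RtoC r)) with (r * r) by (unfold norm2, Re, Im; simpl; ring).
  replace (norm2 (RtoC (1 - r))) with ((1 - r) * (1 - r)) by (unfold norm2, Re, Im; simpl; ring).
  field. lra.
Qed.

Lemma radius_disc : forall s r, Cmod s = 1 -> 0 <= r < 1 -> unit_disc (RtoC r * s).
Proof. intros s r Hs Hr. unfold unit_disc. rewrite Cmod_mult, Hs, Cmod_R, Rabs_pos_eq; lra. Qed.

Lemma poisson_le : forall s z, Cmod s = 1 -> unit_disc z -> poisson s z * (1 - Cmod z) <= 1 + Cmod z.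
Proof.
  intros s z Hs Hz. pose proof (disc_neq_circle s z Hs Hz) as N. pose proof (norm2_pos _ N) as P.
  unfold unit_disc in Hz. pose proof (Cmod_ge_0 z).
  assert ((1 - Cmod z) * (1 - Cmod z) <= norm2 (s - z)) as K.
  { rewrite <- (Cmod_sqr (s - z)). pose proof (Cmod_le_add s z). rewrite Hs in H0.
    apply Rmult_le_compat; lra. }
  unfold poisson. rewrite <- (Cmod_sqr z).
  apply Rle_trans with ((1 + Cmod z) * ((1 - Cmod z) * (1 - Cmod z)) / norm2 (s - z)).
  - right; field; lra.
  - apply Rle_div_l; auto. apply Rmult_le_compat_l; lra.
Qed.

Lemma julia_const_pos : forall f s s' a, disc_selfmap f -> Cmod s = 1 -> Cmod s' = 1 -> julia f s s' a -> 0 < a.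
Proof.
  intros f s s' a Hf Hs Hs' J. assert (unit_disc 0) as H0 by (unfold unit_disc; rewrite Cmod_0; lra).
  specialize (J _ H0). pose proof (poisson_pos s _ Hs H0). pose proof (poisson_pos s' _ Hs' (proj2 Hf _ H0)).
  destruct (Rle_dec a 0); [|lra]. nra.
Qed.

Lemma julia_radius_modulus : forall f s s' a r, disc_selfmap f -> Cmod s = 1 -> Cmod s' = 1 ->
  julia f s s' a -> 0 <= r < 1 ->
  1 - Cmod (f (RtoC r * s)%C) <= 2 * a / (1 + r) * (1 - r).
Proof.
  intros f s s' a r Hf Hs Hs' J Hr. pose proof (julia_const_pos _ _ _ _ Hf Hs Hs' J) as Pa.
  pose proof (radius_disc s r Hs Hr) as Hz. specialize (J _ Hz). rewrite poisson_radius in J by auto.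
  pose proof (proj2 Hf _ Hz) as Fz. pose proof (poisson_le s' _ Hs' Fz) as Q. unfold unit_disc in Fz.
  set (w := f (RtoC r * s)%C) in *. set (p := poisson s' w) in *.
  pose proof (Cmod_ge_0 w).
  assert ((1 + r) / (1 - r) * (1 - Cmod w) <= a * (1 + Cmod w)).
  { apply Rle_trans with (a * p * (1 - Cmod w)); [apply Rmult_le_compat_r; lra|].
    rewrite Rmult_assoc. apply Rmult_le_compat_l; lra. }
  replace (2 * a / (1 + r) * (1 - r)) with (2 * a * ((1 - r) / (1 + r))) by (field; lra).
  assert (0 < (1 - r) / (1 + r)) by (apply Rdiv_lt_0_compat; lra).
  replace (1 - Cmod w) with ((1 - r) / (1 + r) * ((1 + r) / (1 - r) * (1 - Cmod w))) by (field; lra).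
  rewrite (Rmult_comm (2 * a)). apply Rmult_le_compat_l; [lra|]. nra.
Qed.

Lemma julia_radius_near : forall f s s' a r, disc_selfmap f -> Cmod s = 1 -> Cmod s' = 1 ->
  julia f s s' a -> 0 <= r < 1 -> norm2 (s' - f (RtoC r * s)%C) <= a * (1 - r).
Proof.
  intros f s s' a r Hf Hs Hs' J Hr. pose proof (julia_const_pos _ _ _ _ Hf Hs Hs' J) as Pa.
  pose proof (radius_disc s r Hs Hr) as Hz. specialize (J _ Hz). rewrite poisson_radius in J by auto.
  pose proof (proj2 Hf _ Hz) as Fz. set (w := f (RtoC r * s)%C) in *.
  pose proof (norm2_pos _ (disc_neq_circle s' w Hs' Fz)) as P. unfold poisson in J.
  pose proof (norm2_ge_0 w).
  apply Rmult_le_reg_l with ((1 + r) / (1 - r) * / norm2 (s' - w)).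
  { apply Rmult_lt_0_compat; [apply Rdiv_lt_0_compat; lra|apply Rinv_0_lt_compat; auto]. }
  replace ((1 + r) / (1 - r) * / norm2 (s' - w) * norm2 (s' - w)) with ((1 + r) / (1 - r)) by (field; lra).
  eapply Rle_trans; [exact J|].
  replace ((1 + r) / (1 - r) * / norm2 (s' - w) * (a * (1 - r))) with (a * ((1 + r) / norm2 (s' - w))) by (field; lra).
  apply Rmult_le_compat_l; [lra|]. apply Rmult_le_compat_r; [left; apply Rinv_0_lt_compat; auto|lra].
Qed.

(** Starts at [1 / 2], so that division by [radii n] is possible. *)
Definition radii (n : nat) : R := 1 - / INR (S (S n)).

Lemma radii_range : forall n, 0 <= radii n < 1.
Proof. intros n. pose proof (one_minus_inv_range n). unfold radii; lra. Qed.

Lemma radial_conv : forall s, Cconv (fun n => RtoC (radii n) * s)%C s.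
Proof.
  intros s. assert (Cconv (fun n => RtoC (radii n) * s)%C (RtoC 1 * s)%C) as Q.
  { apply (Cconv_mult (fun n => RtoC (radii n)) (fun _ => s)); [|apply Cconv_const]. apply RtoC_lim, lim_one_minus_inv. }
  rewrite Cmult_1_l in Q. auto.
Qed.

Lemma julia_radial_limit : forall f s s' a, disc_selfmap f -> Cmod s = 1 -> Cmod s' = 1 ->
  julia f s s' a -> Cconv (fun n => f (RtoC (radii n) * s)%C) s'.
Proof.
  intros f s s' a Hf Hs Hs' J e He. pose proof (julia_const_pos _ _ _ _ Hf Hs Hs' J) as Pa.
  pose proof lim_one_minus_inv as L. apply is_lim_seq_spec in L.
  assert (0 < e * e / a) as Pe by (apply Rdiv_lt_0_compat; nra).
  destruct (L (mkposreal _ Pe)) as [N HN]. exists N; intros n Hn. specialize (HN n Hn). simpl pos in HN.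
  pose proof (radii_range n) as Rr. fold (radii n) in HN. rewrite <- Rabs_Ropp, Rabs_pos_eq in HN by lra.
  rewrite Cmod_minus_sym. apply Cmod_lt_norm2; [lra|].
  eapply Rle_lt_trans; [apply (julia_radius_near f s s' a); auto|].
  apply Rlt_div_r in HN; auto. lra.
Qed.

Lemma julia_image_unique : forall f s s1 s2 a b, disc_selfmap f -> Cmod s = 1 -> Cmod s1 = 1 -> Cmod s2 = 1 ->
  julia f s s1 a -> julia f s s2 b -> s1 = s2.
Proof.
  intros f s s1 s2 a b Hf Hs H1 H2 J1 J2.
  apply (Cconv_unique (fun n => f (RtoC (radii n) * s)%C)); eapply julia_radial_limit; eauto.
Qed.

Lemma julia_comp : forall f g s s1 s2 a b, 0 <= a -> disc_selfmap g -> julia g s s1 a -> julia f s1 s2 b ->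
  julia (fun z => f (g z)) s s2 (a * b).
Proof.
  intros f g s s1 s2 a b Ha Hg J1 J2 z Hz. eapply Rle_trans; [apply J1; auto|].
  rewrite Rmult_assoc. apply Rmult_le_compat_l; auto. apply J2, (proj2 Hg); auto.
Qed.

(** The exact constant in Julia's inequality is the lower limit of the ratio of boundary
    distances: sequences realise it by Julia's lemma and radii achieve it. *)
Theorem liminf_iff_exact_julia : forall f s a, disc_selfmap f -> Cmod s = 1 ->
  is_liminf (within unit_disc (locally s)) (fun z => (1 - Cmod (f z)) / (1 - Cmod z)) a <->
  exists s', exact_julia f s s' a.
Proof.
  intros f s a Hf Hs.
  assert (forall z b, unit_disc z -> ((1 - Cmod (f z)) / (1 - Cmod z) <= b <-> 1 - Cmod (f z) <= b * (1 - Cmod z))) as Q.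
  { intros z b Hz. unfold unit_disc in Hz. apply Rle_div_l. lra. }
  assert (forall (P : C -> Prop), ~ within unit_disc (locally s) P -> exists z, (forall n, unit_disc (z n) /\ ~ P (z n)) /\ Cconv z s) as Neg.
  { intros P HP.
    assert (forall n, exists z, (unit_disc z /\ ~ P z) /\ Cmod (z - s) < / INR (S n)) as K.
    { intros n. apply NNPP; intros K. apply HP. apply locally_C. exists (/ INR (S n)).
      split; [apply Rinv_0_lt_compat, lt_0_INR; lia|]. intros w Hw Hwd. apply NNPP; intros Pw. apply K.
      exists w; auto. }
    apply choice in K. destruct K as [z Hz]. exists z; split; [intros n; apply Hz|].
    intros e He. destruct (archimed_cor1 e He) as [N [HN HN0]]. exists N; intros n Hn.
    eapply Rlt_trans; [apply Hz|]. eapply Rle_lt_trans; [|exact HN].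
    apply Rinv_le_contravar; [apply lt_0_INR; lia|apply le_INR; lia]. }
  assert (forall (P : C -> Prop) z, Cconv z s -> (forall n, unit_disc (z n)) -> within unit_disc (locally s) P ->
     exists N, forall n, (N <= n)%nat -> P (z n)) as Pos.
  { intros P z Lz Hz HP. apply locally_C in HP. destruct HP as [d [Hd HP]].
    destruct (Lz d Hd) as [N HN]. exists N; intros n Hn. apply HP; auto. }
  assert (forall n, unit_disc (RtoC (radii n) * s)) as Rd by (intros; apply radius_disc; auto; apply radii_range).
  assert (forall s' b c, Cmod s' = 1 -> julia f s s' b -> b < c ->
    exists N, forall n, (N <= n)%nat -> (1 - Cmod (f (RtoC (radii n) * s)%C)) / (1 - Cmod (RtoC (radii n) * s)) < c) as Rad.
  { intros s' b c Hs' J Hbc. pose proof (julia_const_pos _ _ _ _ Hf Hs Hs' J) as Pb.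
    assert (is_lim_seq (fun n => 2 * b / (1 + radii n)) (2 * b / (1 + 1))) as L.
    { apply is_lim_seq_div'; [apply is_lim_seq_const| |lra].
      apply (is_lim_seq_plus' (fun _ => 1) radii); [apply is_lim_seq_const|apply lim_one_minus_inv]. }
    replace (2 * b / (1 + 1)) with b in L by field. apply is_lim_seq_spec in L.
    assert (0 < c - b) as Pc by lra. destruct (L (mkposreal _ Pc)) as [N HN]. exists N; intros n Hn.
    specialize (HN n Hn). simpl in HN. apply Rabs_def2 in HN.
    pose proof (radii_range n) as Rr. pose proof (julia_radius_modulus f s s' b (radii n) Hf Hs Hs' J Rr) as M.
    rewrite Cmod_mult, Hs, Cmod_R, Rabs_pos_eq, Rmult_1_r by lra.
    apply Rlt_div_l; [lra|]. eapply Rle_lt_trans; [exact M|]. apply Rmult_lt_compat_r; lra. }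
  split.
  - intros HL.
    assert (exists s', Cmod s' = 1 /\ julia f s s' a) as [s' [Hs' J]].
    { assert (forall n, exists z, unit_disc z /\ Cmod (z - s) < / INR (S n) /\
        1 - Cmod (f z) <= (a + / INR (S n)) * (1 - Cmod z)) as K.
      { intros n. assert (0 < / INR (S n)) as Pn by (apply Rinv_0_lt_compat, lt_0_INR; lia).
        destruct (HL (mkposreal _ Pn)) as [_ NF]. destruct (Neg _ NF) as [z [Hz Lz]].
        destruct (Lz _ Pn) as [N HN]. exists (z N). destruct (Hz N) as [Z1 Z2].
        split; [auto|split; [auto|]]. apply Q; auto. left. apply Rnot_le_lt. exact Z2. }
      apply choice in K. destruct K as [z Hz].
      assert (is_lim_seq (fun n => / INR (S n)) 0) as L0.
      { replace (Finite 0) with (Rbar_inv p_infty) by reflexivity. apply is_lim_seq_inv; [|discriminate].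
        apply (is_lim_seq_incr_1 INR), is_lim_seq_INR. }
      apply (julia_of_bounded_ratio f z (fun n => a + / INR (S n)) s a); auto.
      - intros n; apply Hz.
      - intros e He. apply is_lim_seq_spec in L0. destruct (L0 (mkposreal e He)) as [N HN]. exists N; intros n Hn.
        specialize (HN n Hn). simpl pos in HN. rewrite Rminus_0_r in HN. apply Rabs_def2 in HN.
        eapply Rlt_trans; [apply Hz|lra].
      - intros n; apply Hz.
      - replace (Finite a) with (Finite (a + 0)) by (f_equal; ring).
        apply (is_lim_seq_plus' (fun _ => a) (fun n => / INR (S n))); [apply is_lim_seq_const|auto]. }
    exists s'. split; [auto|split; auto]. intros s'' b Hs'' Jb. apply Rnot_lt_le; intros Hba.
    assert (0 < (a - b) / 2) as Pe by lra.
    destruct (HL (mkposreal _ Pe)) as [F1 _].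
    destruct (Pos _ _ (radial_conv s) Rd F1) as [N1 K1].
    destruct (Rad s'' b (a - (a - b) / 2) Hs'' Jb ltac:(lra)) as [N2 K2].
    specialize (K1 (N1 + N2)%nat ltac:(lia)). specialize (K2 (N1 + N2)%nat ltac:(lia)). simpl in K1. lra.
  - intros [s' [Hs' [J Min]]] e. pose proof (cond_pos e) as He. split.
    + apply NNPP; intros NF. destruct (Neg _ NF) as [z [Hz Lz]].
      destruct (julia_of_bounded_ratio f z (fun _ => a - e) s (a - e)) as [s'' [Hs'' J'']]; auto.
      * intros n; apply Hz.
      * intros n. apply Q; [apply Hz|]. apply Rnot_lt_le. apply Hz.
      * apply is_lim_seq_const.
      * specialize (Min s'' _ Hs'' J''). lra.
    + intros F. destruct (Pos _ _ (radial_conv s) Rd F) as [N1 K1].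
      destruct (Rad s' a (a + e) Hs' J ltac:(lra)) as [N2 K2].
      specialize (K1 (N1 + N2)%nat ltac:(lia)). specialize (K2 (N1 + N2)%nat ltac:(lia)). simpl in K1. lra.
Qed.

(** * Angular derivatives *)

Lemma Re_le_Cmod : forall z, Re z <= Cmod z.
Proof. intros z. eapply Rle_trans; [apply Rle_abs|apply re_le_Cmod]. Qed.

(** By the Schwarz-Pick inequality a single point where [Re q / Re w] is small forces [q]
    to be small compared with [w] in every sector. *)
Theorem sectorial_little_o : forall q : C -> C,
  (forall w, 0 < Re w -> cderivable q w) -> (forall w, 0 < Re w -> 0 <= Re (q w)) ->
  (forall e, 0 < e -> exists w, 0 < Re w /\ Re (q w) <= e * Re w) ->
  forall K e, 0 < K -> 0 < e -> exists R, 0 < R /\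
    forall w, 0 < Re w -> R <= Cmod w -> Cmod w <= K * Re w -> Cmod (q w) <= e * Cmod w.
Proof.
  intros q Hd Hp Hi K e HK He.
  set (u := e / (16 * K)). assert (0 < u) as Hu by (apply Rdiv_lt_0_compat; lra).
  destruct (Hi u Hu) as [v [Hv Qv]].
  set (Q0 := Cmod (q v)). assert (0 <= Q0) by apply Cmod_ge_0.
  pose proof (Cmod_ge_0 v).
  exists (Cmod v + 2 * Q0 / e + 1). assert (0 <= 2 * Q0 / e) by (apply Rle_div_r; lra).
  split; [lra|]. intros w Hw Rw Kw.
  pose proof (Schwarz_Pick_half_plane q Hd Hp w v Hw Hv) as S.
  set (m := Cmod w) in *. set (Q := Cmod (q w)). assert (0 <= Q) by apply Cmod_ge_0.
  apply Rnot_lt_le; intros Big.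
  assert (2 * Q0 <= e * m).
  { replace (2 * Q0) with (e * (2 * Q0 / e)) by (field; lra). apply Rmult_le_compat_l; lra. }
  assert (Q / 2 * (Q / 2) <= norm2 (q w - q v)) as A1.
  { rewrite <- Cmod_sqr. pose proof (Cmod_le_add (q w) (q v)). fold Q Q0 in H4. apply Rmult_le_compat; lra. }
  assert (norm2 (w - v) <= 4 * (m * m)) as A2.
  { rewrite <- Cmod_sqr. pose proof (Cmod_triangle w (- v)) as T. rewrite Cmod_opp in T.
    change (w + - v)%C with (w - v)%C in T. fold m in T. pose proof (Cmod_ge_0 (w - v)).
    replace (4 * (m * m)) with (2 * m * (2 * m)) by ring. apply Rmult_le_compat; lra. }
  pose proof (Re_le_Cmod (q w)) as A3. fold Q in A3. pose proof (Hp w Hw).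
  assert (Re w * Re v * (Q / 2 * (Q / 2)) <= Q * (u * Re v) * (4 * (m * m))) as B.
  { eapply Rle_trans; [apply Rmult_le_compat_l; [nra|exact A1]|]. eapply Rle_trans; [exact S|].
    apply Rmult_le_compat; auto using norm2_ge_0; [apply Rmult_le_pos; auto|].
    apply Rmult_le_compat; auto. }
  assert (Re w * (Q * Q) <= 16 * u * Q * (m * m)) as B2.
  { apply Rmult_le_reg_r with (Re v / 4); lra. }
  assert (0 < Q) by nra. assert (0 < m) by lra.
  assert (Re w * Q <= 16 * u * (m * m)) as B3 by (apply Rmult_le_reg_r with Q; lra).
  assert (m * Q <= K * (16 * u * (m * m))).
  { apply Rle_trans with (K * Re w * Q); [apply Rmult_le_compat_r; lra|]. rewrite Rmult_assoc. apply Rmult_le_compat_l; lra. }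
  replace (K * (16 * u * (m * m))) with (m * (e * m)) in H7 by (unfold u; field; lra).
  apply Rmult_le_reg_l in H7; lra.
Qed.

Definition half_plane_conj (s s' : C) (f : C -> C) (w : C) : C := cayley s' (f (icayley s w)).

Lemma half_plane_conj_deriv : forall f s s', disc_selfmap f -> Cmod s = 1 -> Cmod s' = 1 ->
  forall w, 0 < Re w -> cderivable (half_plane_conj s s' f) w.
Proof.
  intros f s s' Hf Hs Hs' w Hw. pose proof (icayley_disc s w Hs Hw) as Hz.
  apply (cderivable_comp (cayley s') (fun w => f (icayley s w))).
  - apply cderivable_cayley; auto. apply (proj2 Hf); auto.
  - apply (cderivable_comp f (icayley s)); [apply (proj1 Hf); auto|apply cderivable_icayley; lra].
Qed.

(** The function [F w - w / a] has nonnegative real part by Julia's inequality; if the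
    infimum of its real part over that of [w] were positive, the constant [a] could be
    improved. So [sectorial_little_o] applies. *)
Theorem angular_derivative : forall f s s' a, disc_selfmap f -> Cmod s = 1 -> exact_julia f s s' a ->
  (forall w, 0 < Re w -> Re w / a <= Re (half_plane_conj s s' f w)) /\
  forall K e, 0 < K -> 0 < e -> exists R, 0 < R /\
    forall w, 0 < Re w -> R <= Cmod w -> Cmod w <= K * Re w ->
    Cmod (half_plane_conj s s' f w - w / RtoC a) <= e * Cmod w.
Proof.
  intros f s s' a Hf Hs [Hs' [J Min]]. pose proof (julia_const_pos _ _ _ _ Hf Hs Hs' J) as Pa.
  set (F := half_plane_conj s s' f).
  assert (forall w, 0 < Re w -> Re (F w) = poisson s' (f (icayley s w))) as EF.
  { intros w Hw. apply re_cayley; auto. apply disc_neq_circle; auto. apply (proj2 Hf), icayley_disc; auto. }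
  assert (forall w, 0 < Re w -> Re w = poisson s (icayley s w)) as Ew.
  { intros w Hw. rewrite <- re_cayley, cayley_icayley; auto. apply disc_neq_circle; auto. apply icayley_disc; auto. }
  assert (forall w, Re (F w - w / RtoC a) = Re (F w) - Re w / a) as Rq.
  { intros w. unfold Cdiv. rewrite <- RtoC_inv by lra. destruct (F w), w. unfold Re; simpl. unfold Rdiv. ring. }
  assert (forall w, 0 < Re w -> Re w / a <= Re (F w)) as Low.
  { intros w Hw. rewrite EF by auto. rewrite (Ew w Hw) at 1.
    pose proof (J _ (icayley_disc s w Hs Hw)). apply Rle_div_l; lra. }
  split; auto.
  apply (sectorial_little_o (fun w => F w - w / RtoC a)%C).
  - intros w Hw. destruct (half_plane_conj_deriv f s s' Hf Hs Hs' w Hw) as [l Hl].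
    eexists. cder; [exact Hl|]. apply RtoC_neq; lra.
  - intros w Hw. rewrite Rq. specialize (Low w Hw). lra.
  - intros e He. apply NNPP; intros N.
    assert (julia f s s' (/ (/ a + e))) as J2.
    { intros z Hz. set (w := cayley s z). assert (0 < Re w) as Hw by (apply cayley_pos; auto).
      assert (icayley s w = z) as Ez by (apply icayley_cayley; auto).
      pose proof (Ew w Hw) as E1. pose proof (EF w Hw) as E2. rewrite Ez in *. rewrite <- E1, <- E2.
      assert (0 < / a) by (apply Rinv_0_lt_compat; auto).
      apply Rmult_le_reg_l with (/ a + e); [lra|].
      rewrite <- (Rmult_assoc (/ a + e)), Rinv_r, Rmult_1_l by lra.
      apply Rnot_lt_le; intros L. apply N. exists w; split; auto. rewrite Rq. unfold Rdiv. lra. }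
    specialize (Min _ _ Hs' J2).
    assert (0 < / a) by (apply Rinv_0_lt_compat; auto).
    assert (/ (/ a + e) < / / a) by (apply Rinv_lt_contravar; [apply Rmult_lt_0_compat|]; lra).
    rewrite Rinv_inv in H0. lra.
Qed.

(** * Displacement and dilation *)

(** The expression of [pdist] in half-plane coordinates. *)
Lemma pdist_cayley : forall s z v, Cmod s = 1 -> unit_disc z -> unit_disc v ->
  norm2 (cayley s z - cayley s v) = 4 * poisson s z * poisson s v * pdist z v.
Proof.
  intros s z v Hs Hz Hv. pose proof (disc_neq_circle s z Hs Hz) as N1. pose proof (disc_neq_circle s v Hs Hv) as N2.
  pose proof (norm2_pos _ N1). pose proof (norm2_pos _ N2). pose proof (norm2_lt_1 _ Hz). pose proof (norm2_lt_1 _ Hv).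
  replace (cayley s z - cayley s v)%C with (RtoC 2 * s * (z - v) / ((s - z) * (s - v)))%C
    by (unfold cayley; Cfield; auto).
  rewrite norm2_div, !norm2_mult, <- (Cmod_sqr s), Hs by (apply Cmult_neq_0; auto).
  replace (norm2 (RtoC 2)) with 4 by (unfold norm2, Re, Im; simpl; ring).
  unfold poisson, pdist. field. repeat split; lra.
Qed.

Lemma pdist_ge_0 : forall z w, unit_disc z -> unit_disc w -> 0 <= pdist z w.
Proof.
  intros z w Hz Hw. unfold pdist. pose proof (norm2_lt_1 _ Hz). pose proof (norm2_lt_1 _ Hw).
  apply Rle_div_r; [nra|]. rewrite Rmult_0_l; apply norm2_ge_0.
Qed.

Lemma displacement_mono : forall b c, 1 <= b -> 1 <= c ->
  (c - 1) * (c - 1) / (4 * c) <= (b - 1) * (b - 1) / (4 * b) -> c <= b.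
Proof.
  intros b c Hb Hc H. apply Rnot_lt_le; intros L.
  apply (Rmult_le_compat_r (4 * c * b)) in H; [|nra].
  replace ((c - 1) * (c - 1) / (4 * c) * (4 * c * b)) with ((c - 1) * (c - 1) * b) in H by (field; lra).
  replace ((b - 1) * (b - 1) / (4 * b) * (4 * c * b)) with ((b - 1) * (b - 1) * c) in H by (field; lra).
  assert (0 < (c - b) * (c * b - 1)) by (apply Rmult_lt_0_compat; nra). nra.
Qed.

(** In half-plane coordinates the real part of each point is multiplied by at least [1 / a],
    which costs a definite displacement. *)
Lemma dilation_le_displacement : forall f s a c, disc_selfmap f -> Cmod s = 1 -> a <= 1 -> 1 <= c ->
  julia f s s a ->
  (forall e, 0 < e -> exists y, unit_disc y /\ pdist y (f y) <= (c - 1) * (c - 1) / (4 * c) + e) -> / a <= c.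
Proof.
  intros f s a c Hf Hs Ha Hc J H. pose proof (julia_const_pos _ _ _ _ Hf Hs Hs J) as Pa.
  assert (1 <= / a) as Hb by (rewrite <- Rinv_1; apply Rinv_le_contravar; lra).
  set (b := / a) in *. apply displacement_mono; auto.
  apply le_epsilon. intros e He. destruct (H e He) as [y [Hy Q]]. eapply Rle_trans; [|exact Q].
  pose proof (proj2 Hf y Hy) as Fy.
  pose proof (pdist_cayley s (f y) y Hs Fy Hy) as E.
  pose proof (poisson_pos s y Hs Hy) as P1. pose proof (poisson_pos s _ Hs Fy) as P2.
  assert (pdist (f y) y = pdist y (f y)) as Sym.
  { unfold pdist. f_equal; [|ring]. rewrite <- !Cmod_sqr, Cmod_minus_sym; auto. }
  rewrite Sym in E.
  set (X := poisson s (f y)) in *. set (Y := poisson s y) in *.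
  assert ((X - Y) * (X - Y) <= norm2 (cayley s (f y) - cayley s y)) as L.
  { unfold X, Y. rewrite <- !re_cayley by (auto; apply disc_neq_circle; auto).
    set (U := cayley s (f y)). set (V := cayley s y). unfold norm2.
    replace (Re (U - V)) with (Re U - Re V) by (unfold Re; simpl; ring). nra. }
  rewrite E in L. specialize (J y Hy). fold X Y in J.
  assert (b * Y <= X) as Jb.
  { unfold b. apply Rmult_le_reg_l with a; auto. rewrite <- Rmult_assoc, Rinv_r; lra. }
  set (p := pdist y (f y)) in *.
  set (x := X / Y). assert (X = x * Y) as EX by (unfold x; field; lra).
  assert (b <= x) as Hx by (unfold x; apply Rle_div_r; lra).
  clearbody x b. assert (0 < x) as Px by lra.
  rewrite EX in L. apply Rle_trans with ((x - 1) * (x - 1) / (4 * x)).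
  - apply Rle_div_l; [lra|]. replace ((x - 1) * (x - 1) / (4 * x) * (4 * b)) with ((x - 1) * (x - 1) * b / x) by (field; lra).
    apply (Rle_div_r _ _ _ Px). assert (0 <= (x - b) * (x * b - 1)) by (apply Rmult_le_pos; nra). nra.
  - apply Rle_div_l; [lra|]. apply Rmult_le_reg_r with (Y * Y); [nra|]. lra.
Qed.

(** By [angular_derivative] the map is close to the dilation by [1 / a] far out on the real
    axis of the half-plane, so its displacement there is almost that of the dilation. *)
Lemma displacement_le_dilation : forall f s a c, disc_selfmap f -> Cmod s = 1 -> a <= 1 -> 1 <= c ->
  exact_julia f s s a ->
  (forall y, unit_disc y -> (c - 1) * (c - 1) / (4 * c) <= pdist y (f y)) -> c <= / a.
Proof.
  intros f s a c Hf Hs Ha Hc EJ H. pose proof EJ as [_ [J _]].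
  pose proof (julia_const_pos _ _ _ _ Hf Hs Hs J) as Pa.
  assert (1 <= / a) as Hb by (rewrite <- Rinv_1; apply Rinv_le_contravar; lra).
  destruct (angular_derivative f s s a Hf Hs EJ) as [Low AD].
  set (b := / a) in *. apply displacement_mono; auto.
  assert (forall e, 0 < e -> (c - 1) * (c - 1) / (4 * c) <= (b - 1 + e) * (b - 1 + e) / (4 * b)) as K.
  { intros e He. destruct (AD 1 e Rlt_0_1 He) as [R [HR Q]].
    assert (Re (RtoC R) = R) as ER by reflexivity.
    assert (0 < Re (RtoC R)) as HR1 by (rewrite ER; auto).
    assert (Cmod (RtoC R) = R) as EC by (rewrite Cmod_R, Rabs_pos_eq; lra).
    specialize (Q (RtoC R) HR1). rewrite EC, ER in Q. specialize (Q (Rle_refl _) ltac:(lra)).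
    specialize (Low (RtoC R) HR1). rewrite ER in Low.
    pose proof (icayley_disc s (RtoC R) Hs HR1) as Hy. set (y := icayley s (RtoC R)) in *.
    assert (cayley s y = RtoC R) as Ey by (apply cayley_icayley; auto).
    pose proof (proj2 Hf y Hy) as Fy.
    pose proof (pdist_cayley s y (f y) Hs Hy Fy) as E. rewrite Ey in E.
    rewrite <- !re_cayley, Ey, ER in E by (auto; apply disc_neq_circle; auto).
    unfold half_plane_conj in *. fold y in Q, Low. set (W := cayley s (f y)) in *.
    apply Rle_trans with (pdist y (f y)); [apply H; auto|].
    assert (norm2 (RtoC R - W) <= ((b - 1 + e) * R) * ((b - 1 + e) * R)) as B.
    { apply Cmod_le_norm2; [apply Rmult_le_pos; lra|].
      replace (RtoC R - W)%C with (RtoC (- (b - 1) * R) - (W - RtoC R / RtoC a))%C.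
      - pose proof (Cmod_triangle (RtoC (- (b - 1) * R)) (- (W - RtoC R / RtoC a))) as T.
        rewrite Cmod_opp, Cmod_R in T. change (RtoC (- (b - 1) * R) + - (W - RtoC R / RtoC a))%C with
         (RtoC (- (b - 1) * R) - (W - RtoC R / RtoC a))%C in T.
        replace (Rabs (- (b - 1) * R)) with ((b - 1) * R) in T; [lra|].
        replace (- (b - 1) * R) with (- ((b - 1) * R)) by ring. rewrite Rabs_Ropp, Rabs_pos_eq; auto. apply Rmult_le_pos; lra.
      - unfold b. rewrite RtoC_mult, RtoC_opp, RtoC_minus, RtoC_inv by lra.
        assert (RtoC a <> RtoC 0) by (apply RtoC_neq; lra). Cfield; auto. }
    rewrite E in B. replace (R / a) with (b * R) in Low by (unfold b; field; lra).
    pose proof (pdist_ge_0 y (f y) Hy Fy). set (p := pdist y (f y)) in *.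
    apply (proj1 (Rle_div_r p ((b - 1 + e) * (b - 1 + e)) (4 * b) ltac:(lra))).
    apply Rmult_le_reg_r with (R * R); [nra|].
    assert (4 * R * (b * R) * p <= 4 * R * Re W * p).
    { apply Rmult_le_compat_r; auto. apply Rmult_le_compat_l; lra. }
    lra. }
  apply le_epsilon. intros e He. set (d := Rmin 1 (e * (4 * b) / (2 * b))).
  assert (e * (4 * b) / (2 * b) = 2 * e) as E2 by (field; lra).
  assert (0 < d) as Hd by (unfold d; rewrite E2; apply Rmin_glb_lt; lra).
  assert (d <= 1) by apply Rmin_l. assert (d <= 2 * e) by (unfold d; rewrite E2; apply Rmin_r).
  eapply Rle_trans; [apply (K d Hd)|]. apply Rle_div_l; [lra|].
  replace (((b - 1) * (b - 1) / (4 * b) + e) * (4 * b)) with ((b - 1) * (b - 1) + 4 * b * e) by (field; lra).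
  nra.
Qed.

Lemma exact_constant_exists : forall f s, disc_selfmap f -> Cmod s = 1 -> julia f s s 1 ->
  exists a, a <= 1 /\ exact_julia f s s a.
Proof.
  intros f s Hf Hs J1.
  destruct (completeness (fun x => julia f s s (- x))) as [m [M1 M2]].
  - exists 0. intros x Hx. pose proof (julia_const_pos _ _ _ _ Hf Hs Hs Hx). lra.
  - exists (- (1)). cbv beta; rewrite Ropp_involutive; auto.
  - exists (- m). split; [|split; [auto|split]].
    + assert (- (1) <= m) by (apply M1; cbv beta; rewrite Ropp_involutive; auto). lra.
    + intros z Hz. pose proof (poisson_pos s _ Hs (proj2 Hf z Hz)) as P.
      set (X := poisson s (f z)) in *. apply Rnot_lt_le; intros L.
      assert (m <= - (poisson s z / X)).
      { apply M2. intros x Hx. specialize (Hx z Hz). fold X in Hx.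
        assert (poisson s z / X <= - x) by (apply Rle_div_l; auto). lra. }
      pose proof (proj1 (Rle_div_l (poisson s z) (- m) X P) ltac:(lra)). lra.
    + intros s'' b Hs'' Jb. pose proof (julia_image_unique _ _ _ _ _ _ Hf Hs Hs Hs'' J1 Jb) as E. subst s''.
      assert (- b <= m) by (apply M1; cbv beta; rewrite Ropp_involutive; auto). lra.
Qed.

(** The dilation at the Denjoy-Wolff point is determined by the infimum of the
    hyperbolic displacement: [(c - 1)^2 / (4 c) = sinh^2 (ln c / 2)]. *)
Theorem dilation_of_displacement : forall f s c, disc_selfmap f -> Cmod s = 1 -> julia f s s 1 -> 1 <= c ->
  (forall y, unit_disc y -> (c - 1) * (c - 1) / (4 * c) <= pdist y (f y)) ->
  (forall e, 0 < e -> exists y, unit_disc y /\ pdist y (f y) <= (c - 1) * (c - 1) / (4 * c) + e) ->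
  exact_julia f s s (/ c).
Proof.
  intros f s c Hf Hs J1 Hc H1 H2. destruct (exact_constant_exists f s Hf Hs J1) as [a [Ha EJ]].
  assert (/ a = c) as E.
  { apply Rle_antisym.
    - apply (dilation_le_displacement f s a c Hf Hs Ha Hc (proj1 (proj2 EJ)) H2).
    - apply (displacement_le_dilation f s a c Hf Hs Ha Hc EJ H1). }
  rewrite <- E, Rinv_inv. auto.
Qed.

(** * Hyperbolic geometry of a model *)

Section Model.
Variables (phi : R -> C -> C) (Omega : C -> Prop) (h : C -> C).
Hypothesis Hphi : semigroup phi.
Hypothesis HM : holomorphic_model phi Omega h vertical_translation.

Lemma model_translate : forall t z, 0 <= t -> unit_disc z -> h (phi t z) = (h z + Ci * RtoC t)%C.
Proof. intros t z Ht Hz. apply (model_conj _ _ _ _ HM t z Ht Hz). Qed.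

Lemma model_no_fixed_point : forall t z, 0 < t -> unit_disc z -> phi t z <> z.
Proof.
  intros t z Ht Hz E. pose proof (model_translate t z (Rlt_le _ _ Ht) Hz) as Q. rewrite E in Q.
  apply (f_equal Im) in Q. unfold Im in Q; simpl in Q. lra.
Qed.

Lemma model_not_elliptic : ~ elliptic phi.
Proof. intros [x [Hx F]]. apply (model_no_fixed_point 1 x Rlt_0_1 Hx). apply F; lra. Qed.

(** Differentiate [h (phi t z) = h z + Ci t] at [t = 0]: the derivative of [h] divides
    [Ci]. *)
Lemma model_deriv_nonzero : forall z l, unit_disc z -> cderiv h z l -> l <> RtoC 0.
Proof.
  intros z l Hz Hl E. subst l. destruct (generator_exists phi Hphi) as [G [_ [Gd _]]].
  assert (phi 0 z = z) as P0 by (apply (semigroup_0 _ Hphi); auto).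
  assert (tderiv (fun t => h (phi t z)) 0 (RtoC 0 * G (phi 0 z))%C) as T1.
  { apply (tderiv_comp h (fun t => phi t z)); [apply semigroup_tcont; auto; lra|rewrite P0; auto|apply Gd; auto; lra]. }
  assert (tderiv (fun t => h (phi t z)) 0 Ci) as T2.
  { intros e He. exists 1; split; [lra|]. intros t Ht _. rewrite P0, model_translate by auto.
    replace (h z + Ci * RtoC t - h z - RtoC (t - 0) * Ci)%C with (RtoC 0) by (rewrite RtoC_minus; Cring).
    rewrite Cmod_0. pose proof (Rabs_pos (t - 0)). nra. }
  pose proof (tderiv_unique _ _ _ _ (Rle_refl 0) T1 T2) as Q.
  apply Ci_nz. rewrite <- Q. Cring.
Qed.

(** The inverse is continuous because [h] is open, and differentiable because [h'] has
    no zeros. *)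
Lemma model_inverse : exists g : C -> C, forall z, unit_disc z -> g (h z) = z /\ cderivable g (h z).
Proof.
  pose proof (model_univalent _ _ _ _ HM) as Uh.
  assert (forall w, exists z, forall u, unit_disc u -> h u = w -> z = u) as K.
  { intros w. destruct (classic (exists u, unit_disc u /\ h u = w)) as [[u [Hu E]]|N].
    - exists u. intros v Hv Ev. apply (proj2 Uh); auto. congruence.
    - exists (RtoC 0). intros u Hu E. exfalso; apply N; exists u; auto. }
  apply choice in K. destruct K as [g Hg].
  assert (forall z, unit_disc z -> g (h z) = z) as Gh by (intros z Hz; apply (Hg (h z) z Hz eq_refl)).
  exists g. intros z Hz; split; auto.
  destruct (proj1 Uh z Hz) as [l Hl]. exists (/ l)%C. apply (cderiv_inverse h).
  - apply (model_deriv_nonzero z); auto.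
  - rewrite Gh; auto.
  - apply Ccont_eps. intros e He. destruct (univalent_open_map h Uh z Hz e He) as [m [Hm Q]].
    exists m; split; auto. intros w Hw. destruct (Q w Hw) as [u [Hu [Hu2 Eu]]].
    rewrite (Gh z Hz), <- Eu, Gh; auto.
  - destruct (univalent_open_map h Uh z Hz 1 Rlt_0_1) as [m [Hm Q]].
    exists m; split; auto. intros w Hw. destruct (Q w Hw) as [u [Hu [_ Eu]]].
    rewrite <- Eu, Gh; auto.
Qed.

(** Translated upwards far enough, a compact part of the base space lies in [h(D)], so
    holomorphic discs in the base space can be pulled back along late parts of orbits. *)
Theorem orbit_exhaustion : forall (k : C -> C) p q z t, unit_disc z -> 0 <= t ->
  (forall x, unit_disc x -> cderivable k x) -> (forall x, unit_disc x -> Omega (k x)) ->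
  unit_disc p -> unit_disc q -> k p = h z -> k q = (h z + Ci * RtoC t)%C ->
  forall e, 0 < e -> exists s0, 0 <= s0 /\ forall s, s0 <= s ->
    pdist (phi s z) (phi s (phi t z)) <= pdist p q + e.
Proof.
  intros k p q z t Hz Ht Hk HO Hp Hq Ep Eq.
  pose proof (model_univalent _ _ _ _ HM) as Uh.
  destruct model_inverse as [g Hg].
  set (img := fun w => exists u, unit_disc u /\ h u = w).
  (* Compactness of [k] on the disc of radius [r], together with openness of [h]. *)
  assert (forall r, 0 <= r < 1 -> exists s0, 0 <= s0 /\ forall s x, s0 <= s -> Cmod x <= r ->
    img (k x + Ci * RtoC s)%C) as Cpt.
  { intros r Hr. apply NNPP; intros N.
    assert (forall n : nat, exists x, Cmod x <= r /\ exists s, INR n <= s /\ ~ img (k x + Ci * RtoC s)%C) as K.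
    { intros n. apply NNPP; intros K. apply N. exists (INR n); split; [apply pos_INR|]. intros s x Hs Hx.
      apply NNPP; intros Q. apply K. exists x; split; auto. exists s; auto. }
    apply choice in K. destruct K as [x Hx].
    destruct (bounded_subseq x r) as [m [l [Hm Hl]]]; [intros; apply Hx|].
    assert (Cmod l <= r) as Lr by (apply (Cconv_Cmod_le _ l r Hl); intros; apply Hx).
    assert (unit_disc l) as Ld by (unfold unit_disc; lra).
    destruct (proj1 (model_absorbing _ _ _ _ HM (k l)) (HO l Ld)) as [s1 [u [Hs1 [Hu Eu]]]].
    destruct (univalent_open_map h Uh u Hu 1 Rlt_0_1) as [d [Hd Op]].
    destruct (Hk l Ld) as [kl Hkl]. apply cderiv_continuous in Hkl.
    pose proof (Cconv_cont k _ l Hkl Hl) as Ck. destruct (Ck d Hd) as [N1 K1].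
    destruct (INR_unbounded s1) as [N2 H2]. set (n := (N1 + N2)%nat).
    specialize (K1 n ltac:(lia)). destruct (Hx (m n)) as [_ [s [Hs Ns]]].
    pose proof (subseq_ge m Hm n). assert (INR N2 <= INR (m n)) by (apply le_INR; lia).
    apply Ns. destruct (Op (k (x (m n)) + Ci * RtoC s1)%C) as [v [Hv [_ Ev]]].
    - unfold vertical_translation in Eu.
      replace (k (x (m n)) + Ci * RtoC s1 - h u)%C with (k (x (m n)) - k l)%C; auto.
      rewrite Eu, RtoC_opp. Cring.
    - exists (phi (s - s1) v). split; [apply (semigroup_maps _ Hphi); auto; lra|].
      rewrite model_translate, Ev by (auto; lra). rewrite RtoC_minus. Cring. }
  assert (forall r, 0 < r < 1 -> Cmod p < r -> Cmod q < r -> exists s0, 0 <= s0 /\ forall s, s0 <= s ->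
    pdist (phi s z) (phi s (phi t z)) <= pdist (p / RtoC r) (q / RtoC r)) as Main.
  { intros r Hr Hpr Hqr. destruct (Cpt r ltac:(lra)) as [s0 [Hs0 K]]. exists s0; split; auto. intros s Hs.
    assert (RtoC r <> RtoC 0) as Nr by (apply RtoC_neq; lra).
    (* The pulled-back disc, a self-map of [D] carrying [p / r] and [q / r] to the two
       points of the orbit. *)
    set (G := fun x => g (k (RtoC r * x) + Ci * RtoC s)%C).
    assert (forall x, unit_disc x -> Cmod (RtoC r * x) <= r) as Mx.
    { intros x Hx. unfold unit_disc in Hx. rewrite Cmod_mult, Cmod_R, Rabs_pos_eq by lra. pose proof (Cmod_ge_0 x); nra. }
    assert (disc_selfmap G) as SG.
    { split; intros x Hx; destruct (K s (RtoC r * x)%C Hs (Mx x Hx)) as [u [Hu Eu]]; destruct (Hg u Hu) as [G1 G2].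
      - apply (cderivable_comp g (fun x => k (RtoC r * x) + Ci * RtoC s)%C); [rewrite <- Eu; auto|].
        destruct (Hk (RtoC r * x)%C) as [l Hl]. { specialize (Mx x Hx). unfold unit_disc; lra. }
        eexists. cder. apply (cderiv_comp k (fun x => RtoC r * x)%C); [exact Hl|cder].
      - unfold G. rewrite <- Eu, G1. auto. }
    assert (forall a, Cmod a < r -> unit_disc (a / RtoC r)) as Da.
    { intros a Ha. unfold unit_disc. rewrite Cmod_div, Cmod_R, Rabs_pos_eq by (auto; lra). apply Rlt_div_l; lra. }
    pose proof (pdist_selfmap G SG _ _ (Da p Hpr) (Da q Hqr)) as P.
    assert (forall a, RtoC r * (a / RtoC r) = a)%C as Er by (intros; Cfield; auto).
    unfold G in P. rewrite !Er, Ep, Eq in P.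
    assert (unit_disc (phi t z)) as Hzt by (apply (semigroup_maps _ Hphi); auto).
    rewrite <- (model_translate t z Ht Hz), <- !model_translate in P by (auto; lra).
    assert (forall y, unit_disc y -> g (h (phi s y)) = phi s y) as Gy
      by (intros y Hy; apply Hg, (semigroup_maps _ Hphi); auto; lra).
    rewrite !Gy in P by auto. exact P. }
  intros e He.
  assert (is_lim_seq (fun n => pdist (p / RtoC (radii n)) (q / RtoC (radii n))) (pdist p q)) as L.
  { assert (forall a, Cconv (fun n => a / RtoC (radii n))%C a) as Lc.
    { intros a. assert (Cconv (fun n => a * RtoC (/ radii n))%C (a * RtoC 1)%C) as Q.
      { apply (Cconv_mult (fun _ => a) (fun n => RtoC (/ radii n))); [apply Cconv_const|].
        apply RtoC_lim. replace (Finite 1) with (Rbar_inv (Finite 1)) by (simpl; f_equal; apply Rinv_1).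
        apply is_lim_seq_inv; [apply lim_one_minus_inv|]. intros Q; inversion Q; lra. }
      rewrite Cmult_1_r in Q. intros e0 He0. destruct (Q e0 He0) as [N HN]. exists N; intros n Hn.
      specialize (HN n Hn). rewrite RtoC_inv in HN; auto.
      pose proof (one_minus_inv_range n). unfold radii; lra. }
    unfold pdist. apply is_lim_seq_div'.
    - apply norm2_lim, Cconv_minus; auto.
    - pose proof (norm2_lim _ _ (Lc p)). pose proof (norm2_lim _ _ (Lc q)). lim_poly.
    - pose proof (norm2_lt_1 p Hp). pose proof (norm2_lt_1 q Hq). nra. }
  apply is_lim_seq_spec in L. destruct (L (mkposreal e He)) as [N1 K1].
  pose proof lim_one_minus_inv as L2. apply is_lim_seq_spec in L2.
  assert (0 < 1 - Rmax (Cmod p) (Cmod q)) as Pd.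
  { unfold unit_disc in *. assert (Rmax (Cmod p) (Cmod q) < 1) by (apply Rmax_lub_lt; auto). lra. }
  destruct (L2 (mkposreal _ Pd)) as [N2 K2]. set (n := (N1 + N2)%nat).
  specialize (K1 n ltac:(lia)). specialize (K2 n ltac:(lia)). fold (radii n) in K2. simpl in K1, K2.
  apply Rabs_def2 in K1. apply Rabs_def2 in K2.
  pose proof (Rmax_l (Cmod p) (Cmod q)). pose proof (Rmax_r (Cmod p) (Cmod q)).
  pose proof (one_minus_inv_range n) as Rr. fold (radii n) in Rr.
  destruct (Main (radii n) Rr) as [s0 [Hs0 Q]]; try lra.
  exists s0; split; auto. intros s Hs. specialize (Q s Hs). lra.
Qed.

End Model.

(** * The logarithm on the half-plane *)

(** By the intermediate value theorem a continuous angle cannot leave the interval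
    where the cosine is positive. *)
Lemma cos_pos_bounded : forall (u : R -> R), (forall s, 0 <= s <= 1 -> continuity_pt u s) ->
  u 0 = 0 -> (forall s, 0 <= s <= 1 -> 0 < cos (u s)) -> - (PI / 2) < u 1 < PI / 2.
Proof.
  intros u Hc H0 Hp. pose proof PI_RGT_0. split; apply Rnot_le_lt; intros L.
  - destruct (f_interv_is_interv (fun s => - u s) 0 1 (PI / 2)) as [s [Hs E]]; [lra|lra| |].
    + intros s Hs. apply continuity_pt_opp; auto.
    + specialize (Hp s Hs). replace (u s) with (- (PI / 2)) in Hp by lra. rewrite cos_neg, cos_PI2 in Hp. lra.
  - destruct (f_interv_is_interv u 0 1 (PI / 2)) as [s [Hs E]]; [lra|lra|auto|].
    specialize (Hp s Hs). rewrite E, cos_PI2 in Hp. lra.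
Qed.

(** The primitive of [1 / w] vanishing at [1]. The bound on its imaginary part comes from
    [cos_pos_bounded] along segments starting at [1]. *)
Theorem half_plane_logarithm : exists L : C -> C,
  (forall w, 0 < Re w -> cderivable L w /\ cexp (L w) = w /\ - (PI / 2) < Im (L w) < PI / 2) /\
  forall x, 0 < x -> L (RtoC x) = RtoC (ln x).
Proof.
  assert (forall w, 0 < Re w -> w <> RtoC 0) as Nz.
  { intros w Hw E. subst w. unfold Re in Hw; simpl in Hw; lra. }
  destruct (primitive_half_plane (fun w => / w)%C) as [M HM].
  { intros w Hw. eexists. cder. auto. }
  set (L := fun w => (M w - M (RtoC 1))%C).
  assert (forall w, 0 < Re w -> cderiv L w (/ w)%C) as DL.
  { intros w Hw. eapply cderiv_eq; [unfold L; cder; apply HM; auto|]. cbv beta. Cring. }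
  assert (0 < Re (RtoC 1)) as H1 by (unfold Re; simpl; lra).
  assert (L (RtoC 1) = RtoC 0) as L1 by (unfold L; Cring).
  assert (forall w, 0 < Re w -> cexp (L w) = w) as EL.
  { intros w Hw.
    assert (Cmod (cexp (- L w) * w - cexp (- L (RtoC 1)) * RtoC 1 - RtoC 0 * (w - RtoC 1)) <= 0 * Cmod (w - RtoC 1)) as B.
    { apply (cderiv_mean_value (fun u => cexp (- L u) * u)%C (fun _ => RtoC 0)); intros s Hs.
      - pose proof (half_plane_segment (RtoC 1) w s Hs H1 Hw) as Sg.
        set (v := (RtoC 1 + RtoC s * (w - RtoC 1))%C) in *. eapply cderiv_eq.
        + apply (cderiv_mult (fun u => cexp (- L u)) (fun u => u)); [|apply cderiv_id].
          apply (cderiv_comp cexp (fun u => - L u)%C); [apply cderiv_cexp|cder; apply DL; auto].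
        + cbv beta. specialize (Nz v Sg). Cfield; auto.
      - replace (RtoC 0 - RtoC 0)%C with (RtoC 0) by Cring. rewrite Cmod_0; lra. }
    rewrite Rmult_0_l, L1 in B. replace (- RtoC 0)%C with (RtoC 0) in B by Cring. rewrite cexp_0 in B.
    assert (cexp (- L w) * w = RtoC 1)%C as E.
    { apply Ceq_minus, Cmod_eq_0. pose proof (Cmod_ge_0 (cexp (- L w) * w - RtoC 1)).
      replace (cexp (- L w) * w - RtoC 1 * RtoC 1 - RtoC 0 * (w - RtoC 1))%C with (cexp (- L w) * w - RtoC 1)%C in B by Cring. lra. }
    assert (cexp (L w) * cexp (- L w) = RtoC 1)%C as E2.
    { rewrite <- cexp_plus. replace (L w + - L w)%C with (RtoC 0) by Cring. apply cexp_0. }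
    transitivity (cexp (L w) * (cexp (- L w) * w))%C; [rewrite E; Cring|].
    rewrite Cmult_assoc, E2. Cring. }
  assert (forall w, 0 < Re w -> - (PI / 2) < Im (L w) < PI / 2) as BL.
  { intros w Hw. set (g := fun s : R => (RtoC 1 + RtoC s * (w - RtoC 1))%C).
    assert (g 1 = w) as G1 by (unfold g; Cring). assert (g 0 = RtoC 1) as G0 by (unfold g; Cring).
    rewrite <- G1. apply (cos_pos_bounded (fun s => Im (L (g s)))).
    - intros s Hs. apply continuity_pt_filterlim. apply (Rcont_re_im (fun s => L (g s))).
      apply (Rcont_comp L g); [apply Rcont_affine|]. eapply cderiv_continuous, DL, half_plane_segment; auto.
    - rewrite G0, L1. reflexivity.
    - intros s Hs. pose proof (half_plane_segment (RtoC 1) w s Hs H1 Hw) as Sg. fold (g s) in Sg.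
      pose proof (f_equal Re (EL _ Sg)) as Q.
      change (exp (Re (L (g s))) * cos (Im (L (g s))) = Re (g s)) in Q.
      rewrite <- Q in Sg. pose proof (exp_pos (Re (L (g s)))).
      apply Rmult_lt_reg_l with (exp (Re (L (g s)))); lra. }
  exists L; split.
  - intros w Hw. split; [eexists; apply DL; auto|split; auto].
  - intros x Hx. assert (0 < Re (RtoC x)) as Hx' by (unfold Re; simpl; auto).
    pose proof (EL _ Hx') as E. pose proof (BL _ Hx') as B. set (u := L (RtoC x)) in *.
    unfold cexp in E. pose proof (exp_pos (Re u)) as Pe.
    assert (exp (Re u) * cos (Im u) = x) as E1 by (apply (f_equal Re) in E; exact E).
    assert (exp (Re u) * sin (Im u) = 0) as E2 by (apply (f_equal Im) in E; exact E).
    assert (sin (Im u) = 0) as S0 by (apply Rmult_integral in E2; destruct E2; lra).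
    assert (Im u = 0) as I0.
    { destruct (Rtotal_order (Im u) 0) as [Q|[Q|Q]]; auto; exfalso.
      - pose proof (sin_lt_0_var (Im u)). pose proof PI_RGT_0. lra.
      - pose proof (sin_gt_0 (Im u)). pose proof PI_RGT_0. lra. }
    rewrite I0, cos_0, Rmult_1_r in E1. apply C_ext.
    + transitivity (ln (exp (Re u))); [rewrite ln_exp; reflexivity|rewrite E1; reflexivity].
    + rewrite I0. reflexivity.
Qed.

(** * Displacements in the four models *)

(** The contraction of hyperbolic distances by maps into the half-plane. *)
Lemma pdist_half_plane_map : forall g : C -> C, (forall z, unit_disc z -> cderivable g z) ->
  (forall z, unit_disc z -> 0 < Re (g z)) -> forall z w, unit_disc z -> unit_disc w ->
  norm2 (g z - g w) <= 4 * Re (g z) * Re (g w) * pdist z w.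
Proof.
  intros g Hg Pg z w Hz Hw.
  assert (Cmod (RtoC 1) = 1) as H1 by (rewrite Cmod_R, Rabs_R1; auto).
  set (G := fun z => icayley 1 (g z)).
  assert (forall z, unit_disc z -> unit_disc (G z)) as MG by (intros; apply icayley_disc; auto).
  assert (forall z, unit_disc z -> cayley 1 (G z) = g z) as CG by (intros; apply cayley_icayley; auto).
  assert (disc_selfmap G) as SG.
  { split; auto. intros x Hx. apply (cderivable_comp (icayley 1) g); [|apply Hg; auto].
    apply cderivable_icayley. left; auto. }
  pose proof (pdist_selfmap G SG z w Hz Hw) as P.
  pose proof (pdist_cayley 1 (G z) (G w) H1 (MG z Hz) (MG w Hw)) as E.
  rewrite <- !re_cayley, !CG in E by (auto; apply disc_neq_circle; auto).
  rewrite E. apply Rmult_le_compat_l; auto.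
  pose proof (Pg z Hz). pose proof (Pg w Hw). nra.
Qed.

Lemma pdist_icayley : forall a b, 0 < Re a -> 0 < Re b ->
  4 * Re a * Re b * pdist (icayley 1 a) (icayley 1 b) = norm2 (a - b).
Proof.
  intros a b Ha Hb. assert (Cmod (RtoC 1) = 1) as H1 by (rewrite Cmod_R, Rabs_R1; auto).
  pose proof (icayley_disc 1 a H1 Ha) as Da. pose proof (icayley_disc 1 b H1 Hb) as Db.
  rewrite <- (cayley_icayley 1 a H1 Ha) at 1 3. rewrite <- (cayley_icayley 1 b H1 Hb) at 1 3.
  rewrite !re_cayley by (auto; apply disc_neq_circle; auto).
  symmetry. apply pdist_cayley; auto.
Qed.

Section ModelDisplacement.
Variables (phi : R -> C -> C) (Omega : C -> Prop) (h : C -> C).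
Hypothesis Hphi : semigroup phi.
Hypothesis HM : holomorphic_model phi Omega h vertical_translation.

Lemma semigroup_comm : forall s t z, 0 <= s -> 0 <= t -> unit_disc z -> phi s (phi t z) = phi t (phi s z).
Proof.
  intros s t z Hs Ht Hz. rewrite <- !(semigroup_add _ Hphi) by auto. rewrite Rplus_comm; auto.
Qed.

(** The displacement of a translation measured in a disc contained in the base space is an
    upper bound for displacements in [D], up to arbitrarily small errors. *)
Lemma displacement_upper : forall (k : C -> C) p q z t, unit_disc z -> 0 <= t ->
  (forall x, unit_disc x -> cderivable k x) -> (forall x, unit_disc x -> Omega (k x)) ->
  unit_disc p -> unit_disc q -> k p = h z -> k q = (h z + Ci * RtoC t)%C ->
  forall e, 0 < e -> exists y, unit_disc y /\ pdist y (phi t y) <= pdist p q + e.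
Proof.
  intros k p q z t Hz Ht Hk HO Hp Hq Ep Eq e He.
  destruct (orbit_exhaustion phi Omega h Hphi HM k p q z t Hz Ht Hk HO Hp Hq Ep Eq e He) as [s0 [Hs0 Q]].
  exists (phi s0 z). split; [apply (semigroup_maps _ Hphi); auto|].
  rewrite <- semigroup_comm by auto. apply Q; lra.
Qed.

Lemma model_point : forall w, Omega w -> exists z t, unit_disc z /\ h z = (w + Ci * RtoC t)%C.
Proof.
  intros w Hw. destruct (proj1 (model_absorbing _ _ _ _ HM w) Hw) as [t [z [Ht [Hz E]]]].
  exists z, t; split; auto. rewrite E. unfold vertical_translation. rewrite RtoC_opp. Cring.
Qed.

Lemma model_holo : forall z, unit_disc z -> cderivable h z.
Proof. apply (proj1 (model_univalent _ _ _ _ HM)). Qed.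

Lemma model_in : forall z, unit_disc z -> Omega (h z).
Proof. apply (model_maps _ _ _ _ HM). Qed.

Theorem dilation_of_model : forall lam, 0 <= lam ->
  (forall t, 0 <= t -> let c := exp (lam * t) in
    (forall y, unit_disc y -> (c - 1) * (c - 1) / (4 * c) <= pdist y (phi t y)) /\
    (forall e, 0 < e -> exists y, unit_disc y /\ pdist y (phi t y) <= (c - 1) * (c - 1) / (4 * c) + e)) ->
  exists tau, Cmod tau = 1 /\ forall t, 0 <= t -> exact_julia (phi t) tau tau (exp (- lam * t)).
Proof.
  intros lam Hl Hd.
  destruct (Denjoy_Wolff_point phi Hphi (model_not_elliptic phi Omega h HM)) as [tau [Ht J]].
  exists tau; split; auto. intros t Ht0. destruct (Hd t Ht0) as [H1 H2].
  replace (- lam * t) with (- (lam * t)) by ring. rewrite exp_Ropp.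
  apply dilation_of_displacement; auto.
  - apply semigroup_selfmap; auto.
  - intros z Hz. rewrite Rmult_1_l. apply J; auto.
  - rewrite <- exp_0. apply exp_le_mono. apply Rmult_le_pos; auto.
Qed.

End ModelDisplacement.

Section FourModels.
Variable phi : R -> C -> C.
Hypothesis Hphi : semigroup phi.

Definition has_dilation (lam : R) : Prop :=
  exists tau, Cmod tau = 1 /\ forall t, 0 <= t -> exact_julia (phi t) tau tau (exp (- lam * t)).

(** The exponential map identifies the strip with the half-plane and the translation by
    [Ci t] with the dilation by [exp (lam t)], whose displacement is smallest on the real
    axis, the image of the middle line of the strip. *)
Lemma strip_model_dilation : forall lam h, 0 < lam ->
  holomorphic_model phi (strip (PI / lam)) h vertical_translation -> has_dilation lam.
Proof.
  intros lam h Hl HM. pose proof PI_RGT_0 as HPI.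
  assert (Cmod (RtoC 1) = 1) as H1 by (rewrite Cmod_R, Rabs_R1; auto).
  assert (RtoC lam <> RtoC 0) as Nl by (apply RtoC_neq; lra).
  apply (dilation_of_model phi _ h Hphi HM); [lra|]. intros t Ht c.
  assert (0 < c) as Hc by apply exp_pos. split.
  - intros y Hy.
    (* Maps the strip onto the half-plane; the translation becomes multiplication by [c]. *)
    set (E := fun z : C => cexp (Ci * (RtoC (PI / 2) - RtoC lam * z))%C).
    assert (forall z, unit_disc z -> 0 < Re (E (h z))) as PE.
    { intros z Hz. pose proof (model_in _ _ _ HM z Hz) as [S1 S2]. unfold E, cexp.
      apply Rlt_div_r in S2; [|lra].
      destruct (h z) as [a b]; unfold Re, Im in *; simpl in *.
      apply Rmult_lt_0_compat; [apply exp_pos|]. apply cos_gt_0; nra. }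
    assert (forall z, unit_disc z -> cderivable (fun z => E (h z)) z) as DE.
    { intros z Hz. apply (cderivable_comp E h); [|apply (model_holo _ _ _ HM); auto].
      eexists. unfold E. apply (cderiv_comp cexp (fun z => Ci * (RtoC (PI / 2) - RtoC lam * z))%C); [apply cderiv_cexp|cder]. }
    pose proof (pdist_half_plane_map _ DE PE y (phi t y) Hy (semigroup_maps _ Hphi t Ht y Hy)) as P. cbv beta in P.
    assert (E (h (phi t y)) = RtoC c * E (h y))%C as Ec.
    { rewrite (model_translate _ _ _ HM) by auto. unfold E, c.
      assert (RtoC (exp (lam * t)) = cexp (RtoC (lam * t))) as Ee.
      { unfold cexp, Re, Im; simpl. rewrite cos_0, sin_0. apply C_ext; unfold Re, Im; simpl; ring. }
      rewrite Ee, <- cexp_plus. f_equal. rewrite RtoC_mult.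
      replace (RtoC lam * RtoC t)%C with (- (Ci * Ci) * (RtoC lam * RtoC t))%C; [Cring|].
      replace (Ci * Ci)%C with (- RtoC 1)%C by (apply C_ext; unfold Re, Im; simpl; ring). Cring. }
    rewrite Ec in P. specialize (PE y Hy). set (g := E (h y)) in *. set (p := pdist y (phi t y)) in *.
    apply Rle_div_l; [lra|].
    assert (0 < Re g * Re g) by nra. apply Rmult_le_reg_r with (Re g * Re g); auto.
    assert ((c - 1) * (c - 1) * (Re g * Re g) <= norm2 (g - RtoC c * g)) as Q.
    { destruct g as [a b].
      replace (norm2 ((a, b) - RtoC c * (a, b))) with ((c - 1) * (c - 1) * (a * a) + (c - 1) * (c - 1) * (b * b))
        by (unfold norm2, Re, Im; simpl; ring).
      assert (0 <= (c - 1) * (c - 1) * (b * b)) by (apply Rmult_le_pos; apply Rle_0_sqr). unfold Re; simpl; lra. }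
    replace (Re (RtoC c * g)) with (c * Re g) in P by (destruct g; unfold Re; simpl; ring). lra.
  - intros e He.
    destruct half_plane_logarithm as [L [HL Lx]].
    destruct (model_point _ _ _ HM (RtoC (PI / 2 / lam))) as [z [t' [Hz Ez]]].
    { unfold strip, Re; simpl. split; [apply Rdiv_lt_0_compat; lra|]. unfold Rdiv.
      apply Rmult_lt_compat_r; [apply Rinv_0_lt_compat|]; lra. }
    set (x0 := exp (lam * t')). assert (0 < x0) as Px by apply exp_pos.
    assert (0 < Re (RtoC x0)) as Px1 by (unfold Re; simpl; auto).
    assert (0 < Re (RtoC (c * x0))) as Px2 by (unfold Re; simpl; nra).
    (* The inverse identification; the real axis goes to the middle line of the strip. *)
    set (k := fun x => (RtoC (PI / 2 / lam) + Ci * L (cayley 1 x) / RtoC lam)%C).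
    destruct (displacement_upper phi _ h Hphi HM k (icayley 1 (RtoC x0)) (icayley 1 (RtoC (c * x0))) z t Hz Ht) with (e := e)
      as [y [Hy Q]]; auto; try (apply icayley_disc; auto).
    + intros x Hx. destruct (HL _ (cayley_pos 1 x H1 Hx)) as [[l Hl'] _].
      destruct (cderivable_cayley 1 x H1 Hx) as [l2 Hl2].
      eexists. unfold k. cder; auto. apply (cderiv_comp L (cayley 1)); [exact Hl'|exact Hl2].
    + intros x Hx. destruct (HL _ (cayley_pos 1 x H1 Hx)) as [_ [_ B]]. unfold k, strip.
      set (v := L (cayley 1 x)) in *.
      replace (Re (RtoC (PI / 2 / lam) + Ci * v / RtoC lam)) with ((PI / 2 - Im v) * / lam).
      * assert (0 < / lam) by (apply Rinv_0_lt_compat; auto). unfold Rdiv in *. split.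
        -- apply Rmult_lt_0_compat; lra.
        -- apply Rmult_lt_compat_r; lra.
      * unfold Cdiv. rewrite <- RtoC_inv by lra. destruct v; unfold Re, Im; simpl. unfold Rdiv. ring.
    + unfold k. rewrite cayley_icayley, Lx, Ez by auto. unfold x0. rewrite ln_exp, RtoC_mult. Cfield; auto.
    + unfold k. rewrite cayley_icayley, Lx, Ez by (auto; nra). unfold x0, c. rewrite <- exp_plus, ln_exp, RtoC_plus, !RtoC_mult.
      Cfield; auto.
    + exists y; split; auto. eapply Rle_trans; [exact Q|]. apply Rplus_le_compat_r. right.
      pose proof (pdist_icayley _ _ Px1 Px2) as P.
      replace (norm2 (RtoC x0 - RtoC (c * x0))) with ((c - 1) * (c - 1) * (x0 * x0)) in P
        by (unfold norm2, Re, Im; simpl; ring).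
      unfold Re in P; simpl in P.
      assert (0 < 4 * x0 * (c * x0)) by (repeat apply Rmult_lt_0_compat; lra).
      apply Rmult_eq_reg_l with (4 * x0 * (c * x0)); [|lra].
      clearbody c x0. rewrite P. field. lra.
Qed.

Lemma zero_displacement_dilation : forall Omega h, holomorphic_model phi Omega h vertical_translation ->
  (forall t e, 0 <= t -> 0 < e -> exists y, unit_disc y /\ pdist y (phi t y) <= e) -> has_dilation 0.
Proof.
  intros Omega h HM H. apply (dilation_of_model phi Omega h Hphi HM); [lra|]. intros t Ht c.
  replace c with 1 by (unfold c; rewrite Rmult_0_l, exp_0; auto).
  replace ((1 - 1) * (1 - 1) / (4 * 1)) with 0 by field. split.
  - intros y Hy. apply pdist_ge_0; auto. apply (semigroup_maps _ Hphi); auto.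
  - intros e He. destruct (H t e Ht He) as [y [Hy Q]]. exists y; split; auto. lra.
Qed.

Lemma shift_small_far : forall t e, 0 < e -> exists X, 0 < X /\ t * t <= 4 * X * X * e.
Proof.
  intros t e He. exists (t * t / e + 1). assert (0 <= t * t / e) as P.
  { apply (proj1 (Rle_div_r 0 (t * t) e He)). nra. }
  split; [lra|]. assert (t * t = t * t / e * e) as E by (field; lra). rewrite E at 1.
  apply Rmult_le_compat_r; [lra|]. nra.
Qed.

(** Far from the boundary the translation by [Ci t] moves points by small hyperbolic
    distances. *)
Lemma right_half_plane_dilation : forall h,
  holomorphic_model phi right_half_plane h vertical_translation -> has_dilation 0.
Proof.
  intros h HM. assert (Cmod (RtoC 1) = 1) as H1 by (rewrite Cmod_R, Rabs_R1; auto).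
  apply (zero_displacement_dilation _ h HM). intros t e Ht He.
  destruct (shift_small_far t (e / 2)) as [X [HX EX]]; [lra|].
  destruct (model_point _ _ _ HM (RtoC X)) as [z [t' [Hz Ez]]]; [exact HX|].
  set (w := h z) in *. assert (Re w = X) as Ew by (rewrite Ez; unfold Re; simpl; ring).
  assert (Re (w + Ci * RtoC t) = X) as Ew2 by (rewrite <- Ew; unfold Re; simpl; ring).
  assert (0 < Re w) as P1 by lra. assert (0 < Re (w + Ci * RtoC t)) as P2 by lra.
  destruct (displacement_upper phi _ h Hphi HM (cayley 1) (icayley 1 w) (icayley 1 (w + Ci * RtoC t)) z t Hz Ht) with (e := e / 2)
    as [y [Hy Q]]; try (apply icayley_disc; auto); try (apply cayley_icayley; auto); try lra.
  - intros x Hx. apply cderivable_cayley; auto.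
  - intros x Hx. apply cayley_pos; auto.
  - exists y; split; auto. pose proof (pdist_icayley _ _ P1 P2) as P. rewrite Ew, Ew2 in P.
    replace (norm2 (w - (w + Ci * RtoC t))) with (t * t) in P by (destruct w; unfold norm2, Re, Im; simpl; ring).
    assert (4 * X * X * pdist (icayley 1 w) (icayley 1 (w + Ci * RtoC t)) <= 4 * X * X * (e / 2)) as K by lra.
    apply Rmult_le_reg_l in K; [lra|nra].
Qed.

Lemma left_half_plane_dilation : forall h,
  holomorphic_model phi left_half_plane h vertical_translation -> has_dilation 0.
Proof.
  intros h HM. assert (Cmod (RtoC 1) = 1) as H1 by (rewrite Cmod_R, Rabs_R1; auto).
  apply (zero_displacement_dilation _ h HM). intros t e Ht He.
  destruct (shift_small_far t (e / 2)) as [X [HX EX]]; [lra|].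
  destruct (model_point _ _ _ HM (RtoC (- X))) as [z [t' [Hz Ez]]].
  { unfold left_half_plane, Re; simpl; lra. }
  set (w := (- h z)%C) in *. assert (Re w = X) as Ew by (unfold w; rewrite Ez; unfold Re; simpl; ring).
  assert (Re (w - Ci * RtoC t) = X) as Ew2 by (rewrite <- Ew; unfold Re; simpl; ring).
  assert (0 < Re w) as P1 by lra. assert (0 < Re (w - Ci * RtoC t)) as P2 by lra.
  destruct (displacement_upper phi _ h Hphi HM (fun x => - cayley 1 x)%C (icayley 1 w) (icayley 1 (w - Ci * RtoC t)) z t Hz Ht) with (e := e / 2)
    as [y [Hy Q]]; try (apply icayley_disc; auto); try lra.
  - intros x Hx. destruct (cderivable_cayley 1 x H1 Hx) as [l Hl]. eexists. cder. exact Hl.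
  - intros x Hx. pose proof (cayley_pos 1 x H1 Hx). unfold left_half_plane. rewrite re_opp. lra.
  - rewrite cayley_icayley by auto. unfold w. Cring.
  - rewrite cayley_icayley by auto. unfold w. Cring.
  - exists y; split; auto. pose proof (pdist_icayley _ _ P1 P2) as P. rewrite Ew, Ew2 in P.
    replace (norm2 (w - (w - Ci * RtoC t))) with (t * t) in P by (destruct w; unfold norm2, Re, Im; simpl; ring).
    assert (4 * X * X * pdist (icayley 1 w) (icayley 1 (w - Ci * RtoC t)) <= 4 * X * X * (e / 2)) as K by lra.
    apply Rmult_le_reg_l in K; [lra|nra].
Qed.

(** In the whole plane arbitrarily large discs are available, so late parts of every
    orbit move by arbitrarily small hyperbolic distances. *)
Lemma whole_plane_orbits : forall h, holomorphic_model phi whole_plane h vertical_translation ->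
  forall z t, unit_disc z -> 0 <= t -> forall e, 0 < e -> exists s0, 0 <= s0 /\
  forall s, s0 <= s -> pdist (phi s z) (phi s (phi t z)) <= e.
Proof.
  intros h HM z t Hz Ht e He.
  set (d := Rmin (1 / 2) (e / 4)). assert (0 < d) as Hd by (unfold d; apply Rmin_glb_lt; lra).
  assert (d <= 1 / 2) as D1 by apply Rmin_l. assert (d <= e / 4) as D2 by apply Rmin_r. clearbody d.
  (* In a disc of radius [R0] about [h z] the translate [h z + Ci t] is close to the centre. *)
  set (R0 := t / d + 1). assert (0 <= t / d) by (apply (proj1 (Rle_div_r 0 t d Hd)); lra).
  assert (0 < R0) as HR by (unfold R0; lra).
  assert (RtoC R0 <> RtoC 0) as NR by (apply RtoC_neq; lra).
  set (q := (Ci * RtoC t / RtoC R0)%C).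
  assert (Cmod q <= d) as Hq.
  { unfold q. rewrite Cmod_div, Cmod_mult, Cmod_Ci, !Cmod_R, !Rabs_pos_eq, Rmult_1_l by (auto; lra).
    apply (proj2 (Rle_div_l t d R0 HR)). unfold R0. replace (d * (t / d + 1)) with (t + d) by (field; lra). lra. }
  assert (norm2 q <= d) as Nq.
  { rewrite <- Cmod_sqr. pose proof (Cmod_ge_0 q). nra. }
  assert (unit_disc (RtoC 0)) as H0 by (unfold unit_disc; rewrite Cmod_0; lra).
  assert (unit_disc q) as Hq1 by (unfold unit_disc; lra).
  destruct (orbit_exhaustion phi _ h Hphi HM (fun x => h z + RtoC R0 * x)%C (RtoC 0) q z t Hz Ht) with (e := e / 2)
    as [s0 [Hs0 Q]]; auto; try lra.
  - intros x _. eexists. cder.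
  - intros x _. exact I.
  - Cring.
  - unfold q. Cfield; auto.
  - exists s0; split; auto. intros s Hs. specialize (Q s Hs).
    assert (pdist (RtoC 0) q <= 2 * d).
    { unfold pdist. replace (norm2 (RtoC 0 - q)) with (norm2 q) by (destruct q; unfold norm2, Re, Im; simpl; ring).
      replace (norm2 (RtoC 0)) with 0 by (unfold norm2, Re, Im; simpl; ring).
      pose proof (norm2_ge_0 q).
      apply Rle_div_l; [lra|]. nra. }
    lra.
Qed.

Lemma whole_plane_dilation : forall h,
  holomorphic_model phi whole_plane h vertical_translation -> has_dilation 0.
Proof.
  intros h HM. apply (zero_displacement_dilation _ h HM). intros t e Ht He.
  assert (unit_disc (RtoC 0)) as H0 by (unfold unit_disc; rewrite Cmod_0; lra).
  destruct (whole_plane_orbits h HM (RtoC 0) t H0 Ht e He) as [s0 [Hs0 Q]].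
  exists (phi s0 (RtoC 0)). split; [apply (semigroup_maps _ Hphi); auto|].
  rewrite <- (semigroup_comm phi Hphi) by auto. apply Q; lra.
Qed.

Lemma has_dilation_spectral : forall lam, 0 <= lam -> has_dilation lam -> spectral_value phi lam.
Proof.
  intros lam Hl [tau [Ht EJ]]. exists tau. split; [auto|split; auto]. intros t Ht0.
  apply liminf_iff_exact_julia; auto. { apply semigroup_selfmap; auto. } exists tau; auto.
Qed.

(** * Hyperbolic steps *)

(** The relation [tanh^2 (1 + sinh^2) = sinh^2] links the two measures of distance. *)
Lemma pseudo_hyperbolic_pdist : forall z w, unit_disc z -> unit_disc w ->
  let r := Cmod ((z - w) / (1 - Cconj w * z)) in
  0 <= r < 1 /\ r * r * (1 + pdist z w) = pdist z w.
Proof.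
  intros z w Hz Hw r.
  assert ((1 - Cconj w * z)%C <> RtoC 0) as N.
  { replace (1 - Cconj w * z)%C with (1 + Cconj (- w) * z)%C by (rewrite Copp_conj; Cring).
    apply moebius_den; [rewrite Cmod_opp; auto|left; auto]. }
  pose proof (norm2_pos _ N) as P. pose proof (norm2_lt_1 z Hz). pose proof (norm2_lt_1 w Hw).
  assert (r * r = norm2 (z - w) / norm2 (1 - Cconj w * z)) as E by (unfold r; rewrite Cmod_sqr, norm2_div; auto).
  rewrite norm2_one_minus_conj in *. pose proof (norm2_ge_0 (z - w)).
  set (D := (1 - norm2 z) * (1 - norm2 w)) in *. assert (0 < D) by (unfold D; nra).
  set (n := norm2 (z - w)) in *. assert (0 <= r) by apply Cmod_ge_0.
  split.
  - split; auto. assert (r * r < 1); [|nra]. rewrite E. apply Rlt_div_l; lra.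
  - rewrite E. unfold pdist. fold D n. field. lra.
Qed.

Lemma hyperbolic_distance_lower : forall z w d, unit_disc z -> unit_disc w -> 0 < d -> d <= pdist z w ->
  let r := sqrt (d / (1 + d)) in 0 < / 2 * ln ((1 + r) / (1 - r)) <= hyperbolic_distance z w.
Proof.
  intros z w d Hz Hw Hd Hp r.
  assert (0 < d / (1 + d)) as P by (apply Rdiv_lt_0_compat; lra).
  assert (d / (1 + d) < 1) as P1 by (apply Rlt_div_l; lra).
  assert (0 < r) as R0 by (apply sqrt_lt_R0; auto).
  assert (r * r = d / (1 + d)) as R2 by (apply sqrt_sqrt; lra).
  assert (r < 1) as R1 by nra.
  destruct (pseudo_hyperbolic_pdist z w Hz Hw) as [Q1 Q2]. unfold hyperbolic_distance.
  set (q := Cmod ((z - w) / (1 - Cconj w * z))) in *. set (p := pdist z w) in *.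
  assert (r <= q) as Rq.
  { apply Rnot_lt_le; intros L. assert (q * q < r * r) as L2 by nra.
    rewrite R2 in L2. apply (Rmult_lt_compat_r ((1 + d) * (1 + p))) in L2; [|nra].
    replace (d / (1 + d) * ((1 + d) * (1 + p))) with (d * (1 + p)) in L2 by (field; lra). nra. }
  assert (1 < (1 + r) / (1 - r)) as G1.
  { apply (proj1 (Rlt_div_r 1 (1 + r) (1 - r) ltac:(lra))). lra. }
  assert ((1 + r) / (1 - r) <= (1 + q) / (1 - q)) as G2.
  { apply (proj2 (Rle_div_l (1 + r) ((1 + q) / (1 - q)) (1 - r) ltac:(lra))).
    replace ((1 + q) / (1 - q) * (1 - r)) with ((1 + q) * (1 - r) / (1 - q)) by (field; lra).
    apply (proj1 (Rle_div_r (1 + r) ((1 + q) * (1 - r)) (1 - q) ltac:(lra))). lra. }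
  split.
  - apply Rmult_lt_0_compat; [lra|]. rewrite <- ln_1. apply ln_increasing; lra.
  - apply Rmult_le_compat_l; [lra|]. apply ln_le; lra.
Qed.

Lemma hyperbolic_distance_upper : forall z w d, unit_disc z -> unit_disc w -> 0 < d <= 1 / 2 -> pdist z w <= d * d ->
  0 <= hyperbolic_distance z w <= 2 * d.
Proof.
  intros z w d Hz Hw Hd Hp. destruct (pseudo_hyperbolic_pdist z w Hz Hw) as [Q1 Q2]. unfold hyperbolic_distance.
  pose proof (pdist_ge_0 z w Hz Hw).
  set (q := Cmod ((z - w) / (1 - Cconj w * z))) in *. set (p := pdist z w) in *.
  assert (q <= d) as Hq. { apply Rnot_lt_le; intros L. assert (d * d < q * q) by nra. nra. }
  set (x := (1 + q) / (1 - q)).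
  assert (1 <= x) as Hx. { apply (proj1 (Rle_div_r 1 (1 + q) (1 - q) ltac:(lra))). lra. }
  assert (x <= 1 + 4 * d) as Hx2. { apply (proj2 (Rle_div_l (1 + q) (1 + 4 * d) (1 - q) ltac:(lra))). nra. }
  split.
  - apply Rmult_le_pos; [lra|]. rewrite <- ln_1. apply ln_le; lra.
  - assert (ln x <= x - 1); [|lra].
    pose proof (exp_ineq1_le (ln x)). rewrite exp_ln in H0 by lra. lra.
Qed.

(** Along an orbit the real part of [g] is constant, so all steps of length [1] have the same
    hyperbolic length in the half-plane. The direction [e] is [Ci] or [- Ci], which
    covers both half-planes. *)
Lemma half_plane_positive_step : forall g : C -> C,
  (forall z, unit_disc z -> cderivable g z) -> (forall z, unit_disc z -> 0 < Re (g z)) ->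
  (exists e : C, norm2 e = 1 /\ Re e = 0 /\
    forall t z, 0 <= t -> unit_disc z -> g (phi t z) = (g z + e * RtoC t)%C) ->
  positive_hyperbolic_step phi.
Proof.
  intros g Dg Pg [e [He [He0 Tg]]].
  assert (unit_disc (RtoC 0)) as H0 by (unfold unit_disc; rewrite Cmod_0; lra).
  exists (RtoC 0), 1. split; [auto|split; [lra|]].
  assert (forall t, 0 <= t -> unit_disc (phi t (RtoC 0))) as Hm by (intros; apply (semigroup_maps _ Hphi); auto).
  set (X := Re (g (RtoC 0))). assert (0 < X) as HX by (apply Pg; auto).
  assert (forall t, 0 <= t -> Re (g (phi t (RtoC 0))) = X) as Rg.
  { intros t Ht. rewrite Tg by auto. destruct e as [e1 e2]. unfold Re in He0; simpl in He0. subst e1. unfold X, Re; simpl; ring. }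
  set (d := / (4 * X * X)). assert (0 < d) as Hd by (unfold d; apply Rinv_0_lt_compat; nra).
  assert (forall s, 0 <= s -> d <= pdist (phi s (RtoC 0)) (phi (s + 1) (RtoC 0))) as B.
  { intros s Hs. pose proof (pdist_half_plane_map g Dg Pg _ _ (Hm s Hs) (Hm (s + 1) ltac:(lra))) as P.
    rewrite !Rg, !Tg in P by (auto; lra).
    replace (g (RtoC 0) + e * RtoC s - (g (RtoC 0) + e * RtoC (s + 1)))%C with (- e)%C in P by (rewrite RtoC_plus; Cring).
    replace (norm2 (- e)) with 1 in P by (rewrite <- He; destruct e; unfold norm2, Re, Im; simpl; ring).
    unfold d. apply Rmult_le_reg_l with (4 * X * X); [nra|]. rewrite Rinv_r; [lra|nra]. }
  set (r := sqrt (d / (1 + d))). set (m := / 2 * ln ((1 + r) / (1 - r))).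
  assert (forall s, 0 <= s -> 0 < m <= hyperbolic_distance (phi s (RtoC 0)) (phi (s + 1) (RtoC 0))) as LB.
  { intros s Hs. apply hyperbolic_distance_lower; auto. apply Hm; lra. }
  unfold hyperbolic_step, Lim.
  apply Rbar_lt_le_trans with (Finite m); [apply (LB 0); lra|].
  rewrite <- (Lim_seq_const m). apply Lim_seq_le_loc. exists O. intros n _. apply LB. apply pos_INR.
Qed.

Lemma right_half_plane_step : forall h,
  holomorphic_model phi right_half_plane h vertical_translation -> positive_hyperbolic_step phi.
Proof.
  intros h HM. apply (half_plane_positive_step h).
  - apply (model_holo _ _ _ HM).
  - apply (model_in _ _ _ HM).
  - exists Ci. split; [unfold norm2, Re, Im; simpl; ring|split; [reflexivity|]].
    intros t z Ht Hz. apply (model_translate _ _ _ HM); auto.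
Qed.

Lemma left_half_plane_step : forall h,
  holomorphic_model phi left_half_plane h vertical_translation -> positive_hyperbolic_step phi.
Proof.
  intros h HM. apply (half_plane_positive_step (fun z => - h z)%C).
  - intros z Hz. destruct (model_holo _ _ _ HM z Hz) as [l Hl]. eexists. cder. exact Hl.
  - intros z Hz. pose proof (model_in _ _ _ HM z Hz) as Q. unfold left_half_plane in Q. rewrite re_opp. lra.
  - exists (- Ci)%C. split; [unfold norm2, Re, Im; simpl; ring|split; [unfold Re; simpl; ring|]].
    intros t z Ht Hz. rewrite (model_translate _ _ _ HM) by auto. Cring.
Qed.

Lemma whole_plane_step : forall h,
  holomorphic_model phi whole_plane h vertical_translation -> zero_hyperbolic_step phi.
Proof.
  intros h HM [z [u [Hz [Hu P]]]].
  assert (is_lim (fun r => hyperbolic_distance (phi r z) (phi (r + u) z)) p_infty 0) as L.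
  { apply is_lim_spec. intros e. pose proof (cond_pos e) as He.
    set (d := Rmin (1 / 2) (e / 4)). assert (0 < d) as Hd by (unfold d; apply Rmin_glb_lt; lra).
    assert (d <= 1 / 2) as D1 by apply Rmin_l. assert (d <= e / 4) as D2 by apply Rmin_r. clearbody d.
    destruct (whole_plane_orbits h HM z u Hz Hu (d * d)) as [s0 [Hs0 Q]]; [nra|].
    exists s0. intros s Hs. specialize (Q s (Rlt_le _ _ Hs)).
    rewrite <- (semigroup_add _ Hphi) in Q by (auto; lra).
    destruct (hyperbolic_distance_upper (phi s z) (phi (s + u) z) d) as [A B]; auto; try lra.
    - apply (semigroup_maps _ Hphi); auto; lra.
    - apply (semigroup_maps _ Hphi); auto; lra.
    - rewrite Rminus_0_r, Rabs_pos_eq; lra. }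
  unfold hyperbolic_step in P. rewrite (is_lim_unique _ _ _ L) in P. simpl in P. lra.
Qed.

End FourModels.

(** * Chords and horodiscs *)

Lemma poisson_horodisc : forall s z k, (s - z)%C <> RtoC 0 -> 0 < k ->
  / k <= poisson s z -> norm2 (s - z) <= k * (1 - norm2 z).
Proof.
  intros s z k N Hk H. pose proof (norm2_pos _ N). unfold poisson in H.
  apply (proj2 (Rle_div_r _ _ _ H0)) in H.
  apply Rmult_le_reg_l with (/ k); [apply Rinv_0_lt_compat; auto|].
  rewrite <- Rmult_assoc, Rinv_l; lra.
Qed.

(** Add the two inequalities and complete the square in [w]. As the left-hand side is
    nonnegative, two horodiscs of size [k] meet only if [k] is at least the length of the
    chord; in case of equality they touch at a single point. *)
Lemma horodiscs_meet : forall s1 s2 w k, Cmod s1 = 1 -> Cmod s2 = 1 -> 0 < k ->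
  norm2 (s1 - w) <= k / 2 * (1 - norm2 w) -> norm2 (s2 - w) <= k / 2 * (1 - norm2 w) ->
  norm2 (RtoC (2 + k) * w - (s1 + s2)) <= k * k - norm2 (s1 - s2).
Proof.
  intros s1 s2 w k H1 H2 Hk A B.
  pose proof (Cmod_sqr s1) as E1. pose proof (Cmod_sqr s2) as E2. rewrite H1 in E1. rewrite H2 in E2.
  destruct s1 as [a b], s2 as [c d], w as [x y]. unfold norm2, Re, Im in *; simpl in *.
  assert ((2 + k) * ((a + - x) * (a + - x) + (b + - y) * (b + - y) + ((c + - x) * (c + - x) + (d + - y) * (d + - y)))
    <= (2 + k) * (k * (1 - (x * x + y * y)))) by (apply Rmult_le_compat_l; lra).
  nra.
Qed.

(** The point closest to [0] on the geodesic with ends [s1] and [s2], where the horodiscs of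
    equal size at the two ends touch. *)
Definition chord_midpoint (s1 s2 : C) : C := ((s1 + s2) / RtoC (2 + Cmod (s1 - s2)))%C.

Lemma chord_midpoint_horodiscs : forall s1 s2, Cmod s1 = 1 -> Cmod s2 = 1 -> s1 <> s2 ->
  unit_disc (chord_midpoint s1 s2) /\
  poisson s1 (chord_midpoint s1 s2) = 2 / Cmod (s1 - s2) /\
  poisson s2 (chord_midpoint s1 s2) = 2 / Cmod (s1 - s2).
Proof.
  intros s1 s2 H1 H2 N. set (l := Cmod (s1 - s2)).
  assert (0 < l) as Hl by (apply Cmod_gt_0; intros Q; apply N, Ceq_minus; auto).
  pose proof (Cmod_sqr s1) as E1. pose proof (Cmod_sqr s2) as E2. rewrite H1 in E1. rewrite H2 in E2.
  assert (l * l = norm2 (s1 - s2)) as El by apply Cmod_sqr.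
  assert (norm2 (s1 + s2) = 4 - l * l) as Es.
  { rewrite El. destruct s1, s2; unfold norm2, Re, Im in *; simpl in *. lra. }
  assert (RtoC (2 + l) <> RtoC 0) as Nl by (apply RtoC_neq; lra).
  assert (norm2 (RtoC (2 + l)) = (2 + l) * (2 + l)) as En by (unfold norm2, Re, Im; simpl; ring).
  set (m := chord_midpoint s1 s2).
  assert (1 - norm2 m = 2 * l / (2 + l)) as Em.
  { unfold m, chord_midpoint. fold l. rewrite norm2_div, Es, En by auto. field. lra. }
  assert (forall a b : C, norm2 a = 1 -> norm2 b = 1 -> norm2 (a - b) = l * l ->
    norm2 (a - (a + b) / RtoC (2 + l)) = l * l / (2 + l)) as K.
  { intros a b Ha Hb Hab.
    replace (a - (a + b) / RtoC (2 + l))%C with ((RtoC (1 + l) * a - b) / RtoC (2 + l))%C.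
    - rewrite norm2_div, En by auto.
      assert (norm2 (RtoC (1 + l) * a - b) = l * l * (2 + l)) as Q.
      { destruct a as [p q], b as [u v]; unfold norm2, Re, Im in *; simpl in *. nra. }
      rewrite Q. field. lra.
    - rewrite !RtoC_plus in *. Cfield; auto. }
  split; [|split].
  - apply unit_disc_norm2. assert (0 < 2 * l / (2 + l)) by (apply Rdiv_lt_0_compat; lra). lra.
  - unfold poisson. rewrite Em. unfold m, chord_midpoint. fold l. rewrite K by lra. field. lra.
  - unfold poisson. rewrite Em. unfold m, chord_midpoint. fold l. rewrite (Cplus_comm s1 s2), K; try lra.
    + field. lra.
    + rewrite El, <- !Cmod_sqr, Cmod_minus_sym. auto.
Qed.

(** The image of the touching point lies in the two image horodiscs. *)
Lemma julia_pair_horodiscs : forall f s1 s2 t1 t2 a, disc_selfmap f -> Cmod s1 = 1 -> Cmod s2 = 1 ->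
  Cmod t1 = 1 -> Cmod t2 = 1 -> s1 <> s2 -> julia f s1 t1 a -> julia f s2 t2 a ->
  let k := a * Cmod (s1 - s2) in
  norm2 (RtoC (2 + k) * f (chord_midpoint s1 s2) - (t1 + t2)) <= k * k - norm2 (t1 - t2).
Proof.
  intros f s1 s2 t1 t2 a Hf H1 H2 G1 G2 N J1 J2 k.
  pose proof (julia_const_pos _ _ _ _ Hf H1 G1 J1) as Pa.
  assert (0 < Cmod (s1 - s2)) as Hl by (apply Cmod_gt_0; intros Q; apply N, Ceq_minus; auto).
  assert (0 < k) as Hk by (unfold k; apply Rmult_lt_0_compat; auto).
  destruct (chord_midpoint_horodiscs s1 s2 H1 H2 N) as [D [P1 P2]].
  pose proof (proj2 Hf _ D) as Df. specialize (J1 _ D). specialize (J2 _ D). rewrite P1 in J1. rewrite P2 in J2.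
  assert (forall t, Cmod t = 1 -> 2 / Cmod (s1 - s2) <= a * poisson t (f (chord_midpoint s1 s2)) ->
    norm2 (t - f (chord_midpoint s1 s2)) <= k / 2 * (1 - norm2 (f (chord_midpoint s1 s2)))) as K.
  { intros t Ht J. apply poisson_horodisc; [apply disc_neq_circle; auto|lra|].
    apply Rmult_le_reg_l with a; auto. eapply Rle_trans; [|exact J]. right. unfold k. field. lra. }
  apply horodiscs_meet; auto.
Qed.

Lemma chord_contraction : forall f s1 s2 t1 t2 a, disc_selfmap f -> Cmod s1 = 1 -> Cmod s2 = 1 ->
  Cmod t1 = 1 -> Cmod t2 = 1 -> julia f s1 t1 a -> julia f s2 t2 a ->
  Cmod (t1 - t2) <= a * Cmod (s1 - s2).
Proof.
  intros f s1 s2 t1 t2 a Hf H1 H2 G1 G2 J1 J2. pose proof (julia_const_pos _ _ _ _ Hf H1 G1 J1) as Pa.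
  pose proof (Cmod_ge_0 (s1 - s2)).
  destruct (Ceq_dec s1 s2) as [E|N].
  - subst s2. rewrite (julia_image_unique _ _ _ _ _ _ Hf H1 G1 G2 J1 J2).
    replace (t2 - t2)%C with (RtoC 0) by Cring. rewrite Cmod_0. apply Rmult_le_pos; lra.
  - pose proof (julia_pair_horodiscs f s1 s2 t1 t2 a Hf H1 H2 G1 G2 N J1 J2) as P. cbv zeta in P.
    pose proof (norm2_ge_0 (RtoC (2 + a * Cmod (s1 - s2)) * f (chord_midpoint s1 s2) - (t1 + t2))).
    apply Cmod_le_norm2; [apply Rmult_le_pos; lra|]. lra.
Qed.

Lemma julia_pair_fixed : forall f s1 s2, disc_selfmap f -> Cmod s1 = 1 -> Cmod s2 = 1 -> s1 <> s2 ->
  julia f s1 s1 1 -> julia f s2 s2 1 -> f (chord_midpoint s1 s2) = chord_midpoint s1 s2.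
Proof.
  intros f s1 s2 Hf H1 H2 N J1 J2.
  pose proof (julia_pair_horodiscs f s1 s2 s1 s2 1 Hf H1 H2 H1 H2 N J1 J2) as P. cbv zeta in P.
  rewrite Rmult_1_l, Cmod_sqr in P. set (l := Cmod (s1 - s2)) in *.
  assert (0 <= l) by apply Cmod_ge_0. assert (RtoC (2 + l) <> RtoC 0) by (apply RtoC_neq; lra).
  assert (RtoC (2 + l) * f (chord_midpoint s1 s2) - (s1 + s2) = RtoC 0)%C as E.
  { apply norm2_eq_0. pose proof (norm2_ge_0 (RtoC (2 + l) * f (chord_midpoint s1 s2) - (s1 + s2))). lra. }
  unfold chord_midpoint at 2. fold l.
  replace (f (chord_midpoint s1 s2)) with
    ((RtoC (2 + l) * f (chord_midpoint s1 s2) - (s1 + s2) + (s1 + s2)) / RtoC (2 + l))%C by (Cfield; auto).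
  rewrite E. f_equal. Cring.
Qed.

Lemma julia_weaken : forall f s s' a b, disc_selfmap f -> Cmod s' = 1 -> a <= b -> julia f s s' a -> julia f s s' b.
Proof.
  intros f s s' a b Hf Hs' Hab J z Hz. eapply Rle_trans; [apply J; auto|].
  apply Rmult_le_compat_r; auto. left. apply poisson_pos; auto. apply (proj2 Hf); auto.
Qed.

(** * Two fixed points *)

(** Equality in Schwarz's lemma. The quotient [g] takes the value [1] at an interior
    point; transported to the half-plane, [1 - g] has nonnegative real part and a zero, so
    [Schwarz_Pick_half_plane] forces it to vanish identically. *)
Theorem two_fixed_points : forall f x y, disc_selfmap f -> unit_disc x -> unit_disc y -> x <> y ->
  f x = x -> f y = y -> forall z, unit_disc z -> f z = z.
Proof.
  intros f x y Hf Hx Hy N Fx Fy z Hz.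
  assert (forall a, Cmod a < 1 -> Cmod (- a) < 1) as Op by (intros; rewrite Cmod_opp; auto).
  set (F := fun u => moebius (- x) (f (moebius x u))).
  assert (forall u, Cmod u < 1 -> Cmod (F u) < 1) as BF.
  { intros u Hu. unfold F. apply moebius_open; auto. apply (proj2 Hf), moebius_open; auto. }
  assert (forall u, Cmod u < 1 -> cderivable F u) as HF.
  { intros u Hu. apply (cderivable_comp (moebius (- x)) (fun u => f (moebius x u))).
    - apply cderivable_moebius; auto. left. apply (proj2 Hf), moebius_open; auto.
    - apply (cderivable_comp f (moebius x)); [apply (proj1 Hf), moebius_open; auto|].
      apply cderivable_moebius; auto; lra. }
  assert (forall u, unit_disc u -> moebius (- x) (moebius x u) = u) as Inv.
  { intros u Hu. pose proof (moebius_inv (- x) u (Op _ Hx) Hu) as Q.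
    replace (- - x)%C with x in Q by Cring. auto. }
  assert (F (RtoC 0) = RtoC 0) as F0.
  { unfold F. rewrite moebius_0, Fx. unfold moebius. replace (x + - x)%C with (RtoC 0) by Cring. unfold Cdiv; Cring. }
  destruct (Schwarz_quotient F HF (fun u Hu => Rlt_le _ _ (BF u Hu)) F0) as [g [Dg [Eg Bg]]].
  set (v := moebius (- x) y). assert (unit_disc v) as Hv by (apply moebius_open; auto).
  assert (F v = v) as Fv by (unfold F, v; rewrite moebius_inv, Fy; auto).
  assert (v <> RtoC 0) as Nv.
  { intros E. apply N. rewrite <- (moebius_inv x y) by auto. fold v. rewrite E, moebius_0. auto. }
  assert (g v = RtoC 1) as Gv.
  { rewrite Eg in Fv. replace (g v) with ((v * g v) / v)%C by (Cfield; auto). rewrite Fv. Cfield; auto. }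
  assert (Cmod (RtoC 1) = 1) as H1 by (rewrite Cmod_R, Rabs_R1; auto).
  set (q := fun w => (RtoC 1 - g (icayley 1 w))%C).
  assert (forall w, 0 < Re w -> cderivable q w) as Dq.
  { intros w Hw. destruct (cderivable_comp g (icayley 1) w) as [l Hl].
    - apply Dg, icayley_disc; auto.
    - apply cderivable_icayley; lra.
    - eexists. unfold q. apply (cderiv_minus (fun _ => RtoC 1) (fun w => g (icayley 1 w))); [apply cderiv_const|exact Hl]. }
  assert (forall w, 0 < Re w -> 0 <= Re (q w)) as Pq.
  { intros w Hw. pose proof (Bg _ (icayley_disc 1 w H1 Hw)) as B. pose proof (Re_le_Cmod (g (icayley 1 w))).
    unfold q. replace (Re (RtoC 1 - g (icayley 1 w))) with (1 - Re (g (icayley 1 w))) by (unfold Re; simpl; ring). lra. }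
  assert (forall u, unit_disc u -> F u = u) as FI.
  { intros u Hu.
    pose proof (Schwarz_Pick_half_plane q Dq Pq (cayley 1 u) (cayley 1 v) (cayley_pos 1 u H1 Hu) (cayley_pos 1 v H1 Hv)) as S.
    assert (q (cayley 1 v) = RtoC 0) as Q0 by (unfold q; rewrite icayley_cayley, Gv by auto; Cring).
    rewrite Q0 in S. replace (Re (RtoC 0)) with 0 in S by reflexivity.
    pose proof (cayley_pos 1 u H1 Hu). pose proof (cayley_pos 1 v H1 Hv).
    assert (q (cayley 1 u) - RtoC 0 = RtoC 0)%C as E.
    { apply norm2_eq_0. pose proof (norm2_ge_0 (q (cayley 1 u) - RtoC 0)).
      assert (0 < Re (cayley 1 u) * Re (cayley 1 v)) by nra. nra. }
    unfold q in E. rewrite icayley_cayley in E by auto. rewrite Eg.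
    replace (g u) with (RtoC 1 - (RtoC 1 - g u - RtoC 0))%C by Cring. rewrite E. Cring. }
  set (u := moebius (- x) z). assert (unit_disc u) as Hu by (apply moebius_open; auto).
  pose proof (FI u Hu) as E. unfold F, u in E. rewrite moebius_inv in E by auto.
  rewrite <- (moebius_inv x (f z)), E, moebius_inv; auto. apply (proj2 Hf); auto.
Qed.

(** * The derivative along the boundary *)

(** The Poisson kernel of a boundary point [p], in the coordinate that sends [s] to infinity
    and [p] to [Ci V]. *)
Lemma poisson_boundary : forall s p z V, Cmod s = 1 -> Cmod p = 1 -> s <> p -> unit_disc z ->
  cayley s p = (Ci * RtoC V)%C ->
  poisson p z * norm2 (cayley s z - Ci * RtoC V) = Re (cayley s z) * (1 + V * V).
Proof.
  intros s p z V Hs Hp N Hz EV.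
  assert (s - p <> RtoC 0)%C as N1 by (intros Q; apply N, Ceq_minus; auto).
  pose proof (disc_neq_circle s z Hs Hz) as N2. pose proof (disc_neq_circle p z Hp Hz) as N3.
  pose proof (norm2_pos _ N1). pose proof (norm2_pos _ N2). pose proof (norm2_pos _ N3).
  rewrite re_cayley by auto.
  assert (1 + V * V = 4 / norm2 (s - p)) as E1.
  { replace (V * V) with (norm2 (cayley s p)) by (rewrite EV; unfold norm2, Re, Im; simpl; ring).
    unfold cayley. rewrite norm2_div by auto.
    pose proof (Cmod_sqr s) as Q1. pose proof (Cmod_sqr p) as Q2. rewrite Hs in Q1. rewrite Hp in Q2.
    apply Rmult_eq_reg_r with (norm2 (s - p)); [|lra].
    replace ((1 + norm2 (s + p) / norm2 (s - p)) * norm2 (s - p)) with (norm2 (s - p) + norm2 (s + p)) by (field; lra).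
    replace (4 / norm2 (s - p) * norm2 (s - p)) with 4 by (field; lra).
    destruct s, p; unfold norm2, Re, Im in *; simpl in *. lra. }
  rewrite E1, <- EV.
  replace (cayley s z - cayley s p)%C with (RtoC 2 * s * (z - p) / ((s - z) * (s - p)))%C
    by (unfold cayley; Cfield; auto).
  rewrite norm2_div, !norm2_mult, <- (Cmod_sqr s), Hs by (apply Cmult_neq_0; auto).
  replace (norm2 (RtoC 2)) with 4 by (unfold norm2, Re, Im; simpl; ring).
  replace (norm2 (z - p)) with (norm2 (p - z)) by (rewrite <- !Cmod_sqr, Cmod_minus_sym; auto).
  unfold poisson. field. repeat split; lra.
Qed.

(** Sectorial convergence at [s], used at points lying close to the boundary point [p]
    compared with the distance from [p] to [s], pins down where Julia's inequality at
    [p] can send [p]. *)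
Theorem boundary_quotient : forall f s s' a, disc_selfmap f -> Cmod s = 1 -> exact_julia f s s' a ->
  forall e, 0 < e -> exists M, 0 < M /\ forall p p' V V', Cmod p = 1 -> Cmod p' = 1 -> s <> p -> s' <> p' ->
  cayley s p = (Ci * RtoC V)%C -> cayley s' p' = (Ci * RtoC V')%C -> julia f p p' a -> M <= Rabs V ->
  Rabs (V' - V / a) <= e * Rabs V.
Proof.
  intros f s s' a Hf Hs EJ e He. pose proof EJ as [Hs' [J _]].
  pose proof (julia_const_pos _ _ _ _ Hf Hs Hs' J) as Pa.
  assert (0 < / a) as Pb by (apply Rinv_0_lt_compat; auto). set (b := / a) in *.
  (* In half-plane coordinates [p] is [Ci V]; the test point [kap |V| + Ci V] is close to it
     compared with [|V|], but lies in a sector where [angular_derivative] applies. *)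
  set (kap := Rmin (1 / 4) (e / (4 * (2 * b + 6)))).
  assert (0 < e / (4 * (2 * b + 6))) by (apply Rdiv_lt_0_compat; lra).
  assert (0 < kap) as K0 by (unfold kap; apply Rmin_glb_lt; lra).
  assert (kap <= 1 / 4) as K1 by apply Rmin_l.
  assert (kap * (4 * (2 * b + 6)) <= e) as K2.
  { apply (proj2 (Rle_div_r kap e (4 * (2 * b + 6)) ltac:(lra))). apply Rmin_r. }
  clearbody kap.
  set (u := Rmin 1 (Rmin (kap * b / 2) (e / 4))).
  assert (0 < kap * b) by nra.
  assert (0 < u) as U0 by (unfold u; repeat apply Rmin_glb_lt; lra).
  assert (u <= 1) as U1 by apply Rmin_l.
  assert (u <= kap * b / 2) as U2 by (eapply Rle_trans; [apply Rmin_r|apply Rmin_l]).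
  assert (u <= e / 4) as U3 by (eapply Rle_trans; [apply Rmin_r|apply Rmin_r]). clearbody u.
  destruct (angular_derivative f s s' a Hf Hs EJ) as [_ AD].
  destruct (AD (2 / kap) u) as [M [HM Q]]; auto. { apply Rdiv_lt_0_compat; lra. }
  exists (M + 1). split; [lra|]. intros p p' V V' Hp Hp' N N' EV EV' Jp LV.
  set (v := Rabs V) in *. assert (0 < v) as Pv by lra.
  set (w := (kap * v, V) : C).
  assert (Re w = kap * v) as Rw by reflexivity.
  assert (0 < Re w) as Rw0 by (rewrite Rw; nra).
  assert (v <= Cmod w) as W1 by apply (im_le_Cmod w).
  assert (Cmod w <= 2 * v) as W2.
  { eapply Rle_trans; [apply Cmod_le_re_im|]. rewrite Rw. unfold Im, w; simpl. fold v. rewrite Rabs_pos_eq; nra. }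
  assert (Cmod w <= 2 / kap * Re w) as W3.
  { rewrite Rw. replace (2 / kap * (kap * v)) with (2 * v) by (field; lra). auto. }
  specialize (Q w Rw0 ltac:(lra) W3). set (F := half_plane_conj s s' f w) in *.
  set (z := icayley s w). assert (unit_disc z) as Hz by (apply icayley_disc; auto).
  assert (cayley s z = w) as Ez by (apply cayley_icayley; auto).
  pose proof (proj2 Hf z Hz) as Fz.
  assert (cayley s' (f z) = F) as EF by reflexivity.
  pose proof (poisson_boundary s p z V Hs Hp N Hz EV) as B1. rewrite Ez in B1.
  pose proof (poisson_boundary s' p' (f z) V' Hs' Hp' N' Fz EV') as B2. rewrite EF in B2.
  specialize (Jp z Hz).
  pose proof (poisson_pos p z Hp Hz) as PP1. pose proof (poisson_pos p' (f z) Hp' Fz) as PP2.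
  set (P1 := poisson p z) in *. set (P2 := poisson p' (f z)) in *.
  assert (norm2 (w - Ci * RtoC V) = kap * v * (kap * v)) as Nw by (unfold w, norm2, Re, Im; simpl; ring).
  rewrite Nw, Rw in B1.
  assert (V * V = v * v) as VV by (unfold v; rewrite <- Rabs_mult, Rabs_pos_eq; nra).
  set (X := norm2 (F - Ci * RtoC V')) in *. assert (0 <= X) as X0 by apply norm2_ge_0.
  assert (P1 * (kap * v) = 1 + v * v) as B3.
  { apply Rmult_eq_reg_r with (kap * v); [|nra]. rewrite VV in B1. lra. }
  assert (Cmod (F - w / RtoC a) <= u * (2 * v)) as Q2.
  { eapply Rle_trans; [exact Q|]. apply Rmult_le_compat_l; lra. }
  assert ((w / RtoC a)%C = ((b * (kap * v), b * V) : C)) as Ew.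
  { unfold Cdiv. rewrite <- RtoC_inv by lra. fold b. unfold w. apply C_ext; unfold Re, Im; simpl; ring. }
  rewrite Ew in Q2.
  assert (Re F <= b * (kap * v) + u * (2 * v)) as RF.
  { pose proof (Rle_trans _ _ _ (Re_le_Cmod _) Q2) as T. change (Re F - b * (kap * v) <= u * (2 * v)) in T. lra. }
  assert (Rabs (Im F - b * V) <= u * (2 * v)) as IF_.
  { pose proof (Rle_trans _ _ _ (im_le_Cmod _) Q2) as T. change (Rabs (Im F - b * V) <= u * (2 * v)) in T. exact T. }
  assert (0 < Re F) as RF0 by (rewrite <- EF; apply cayley_pos; auto).
  assert (Re F <= 2 * b * kap * v) as RF2.
  { assert (u * (2 * v) <= kap * b / 2 * (2 * v)) by (apply Rmult_le_compat_r; lra). lra. }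
  (* Julia's inequality at [p] bounds the distance of [F] from [Ci V'], since [F] lies
     close to the boundary: its real part is at most a multiple of [kap v]. *)
  assert (X <= 2 * kap * kap * (1 + V' * V')) as XB.
  { assert (P1 * X <= a * (Re F * (1 + V' * V'))) as S1.
    { rewrite <- B2. rewrite <- Rmult_assoc. apply Rmult_le_compat_r; auto. }
    assert (a * (Re F * (1 + V' * V')) <= 2 * kap * v * (1 + V' * V')) as S2.
    { rewrite <- Rmult_assoc. apply Rmult_le_compat_r; [nra|].
      apply Rle_trans with (a * (2 * b * kap * v)); [apply Rmult_le_compat_l; lra|].
      right. unfold b. field. lra. }
    assert ((1 + v * v) * X <= 2 * kap * v * (kap * v) * (1 + V' * V')) as S3.
    { rewrite <- B3. replace (P1 * (kap * v) * X) with (P1 * X * (kap * v)) by ring.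
      replace (2 * kap * v * (kap * v) * (1 + V' * V')) with (2 * kap * v * (1 + V' * V') * (kap * v)) by ring.
      apply Rmult_le_compat_r; nra. }
    apply Rmult_le_reg_l with (v * v); [nra|].
    apply Rle_trans with ((1 + v * v) * X); [nra|]. lra. }
  assert (Rabs (Im F - V') <= 2 * kap * (1 + Rabs V')) as IB.
  { assert (Cmod (F - Ci * RtoC V') <= 2 * kap * (1 + Rabs V')) as T.
    { pose proof (Rabs_pos V'). apply Cmod_le_norm2; [nra|]. fold X. eapply Rle_trans; [exact XB|].
      assert (V' * V' = Rabs V' * Rabs V') as E by (rewrite <- Rabs_mult, Rabs_pos_eq; nra). rewrite E.
      assert (0 < kap * kap) by nra. nra. }
    eapply Rle_trans; [|exact T]. eapply Rle_trans; [|apply im_le_Cmod]. right. f_equal.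
    unfold Im; simpl. ring. }
  assert (Rabs (V' - b * V) <= 2 * kap * (1 + Rabs V') + 2 * u * v) as D1.
  { replace (V' - b * V) with (- (Im F - V') + (Im F - b * V)) by ring.
    eapply Rle_trans; [apply Rabs_triang|]. rewrite Rabs_Ropp. lra. }
  assert (Rabs V' <= Rabs (V' - b * V) + b * v) as D2.
  { replace V' with ((V' - b * V) + b * V) at 1 by ring. eapply Rle_trans; [apply Rabs_triang|].
    rewrite (Rabs_mult b), (Rabs_pos_eq b) by lra. fold v. lra. }
  pose proof (Rabs_pos V').
  assert (Rabs V' <= (2 * b + 5) * v) as D3.
  { assert (2 * kap * (1 + Rabs V') <= 1 / 2 * (1 + Rabs V')) by (apply Rmult_le_compat_r; lra). nra. }
  replace (V / a) with (b * V) by (unfold b; field; lra).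
  assert (2 * kap * (1 + Rabs V') <= 2 * kap * ((2 * b + 6) * v)) by (apply Rmult_le_compat_l; lra).
  assert (kap * (4 * (2 * b + 6)) * v <= e * v) by (apply Rmult_le_compat_r; lra).
  assert (u * v <= e / 4 * v) by (apply Rmult_le_compat_r; lra). lra.
Qed.

(** * Boundary arcs in the angular coordinate *)

Lemma unit_at_plus : forall m h, unit_at (m + h) = (unit_at m * unit_at h)%C.
Proof.
  intros m h. unfold unit_at. apply C_ext; unfold Re, Im; simpl; [rewrite cos_plus|rewrite sin_plus]; ring.
Qed.

Lemma chord_length : forall s x y, Cmod s = 1 ->
  Cmod (s * unit_at x - s * unit_at y) = 2 * Rabs (sin ((x - y) / 2)).
Proof.
  intros s x y Hs.
  replace (s * unit_at x - s * unit_at y)%C with (s * (unit_at x - unit_at y))%C by Cring.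
  rewrite Cmod_mult, Hs, Rmult_1_l.
  set (m := (x + y) / 2). set (h := (x - y) / 2).
  replace x with (m + h) by (unfold m, h; field). replace y with (m + - h) by (unfold m, h; field).
  rewrite !unit_at_plus.
  replace (unit_at m * unit_at h - unit_at m * unit_at (- h))%C with (unit_at m * (Ci * RtoC (2 * sin h)))%C.
  2:{ unfold unit_at. rewrite cos_neg, sin_neg. apply C_ext; unfold Re, Im; simpl; ring. }
  rewrite !Cmod_mult, Cmod_unit_at, Cmod_Ci, Cmod_R, Rabs_mult, (Rabs_pos_eq 2) by lra. ring.
Qed.

Lemma cayley_unit_at : forall s x y, Cmod s = 1 -> sin ((y - x) / 2) <> 0 ->
  cayley (s * unit_at x) (s * unit_at y) =
  (Ci * RtoC (cos ((y - x) / 2) / sin ((y - x) / 2)))%C.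
Proof.
  intros s x y Hs. set (m := (x + y) / 2). set (h := (y - x) / 2). intros Sh.
  replace x with (m + - h) by (unfold m, h; field). replace y with (m + h) by (unfold m, h; field).
  unfold cayley. rewrite !unit_at_plus.
  pose proof (Cmod1_neq s Hs) as Ns. pose proof (unit_at_nonzero m) as Nm.
  replace (s * (unit_at m * unit_at (- h)) + s * (unit_at m * unit_at h))%C
    with (s * unit_at m * RtoC (2 * cos h))%C.
  2:{ unfold unit_at. rewrite cos_neg, sin_neg. apply C_ext; unfold Re, Im; simpl; ring. }
  replace (s * (unit_at m * unit_at (- h)) - s * (unit_at m * unit_at h))%C
    with (s * unit_at m * (Ci * RtoC (- 2 * sin h)))%C.
  2:{ unfold unit_at. rewrite cos_neg, sin_neg. apply C_ext; unfold Re, Im; simpl; ring. }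
  assert (Ci <> RtoC 0) as Nc. { intros E. pose proof Cmod_Ci as T. rewrite E, Cmod_0 in T. lra. }
  assert (RtoC (- 2 * sin h) <> RtoC 0) as Nsin.
  { apply RtoC_neq. intros E. apply Sh. lra. }
  assert (RtoC (2 * cos h) = (Ci * RtoC (cos h / sin h)) * (Ci * RtoC (- 2 * sin h)))%C as E.
  { apply C_ext; unfold Re, Im; simpl; field; auto. }
  rewrite E. Cfield; auto.
Qed.

Lemma angle_exists : exists A : C -> R, forall w, Cmod w = 1 -> 0 < Re w ->
  unit_at (A w) = w /\ - (PI / 2) < A w < PI / 2 /\
  forall e, 0 < e -> exists d, 0 < d /\ forall w', Cmod (w' - w) < d -> Rabs (A w' - A w) < e.
Proof.
  destruct half_plane_logarithm as [L [HL _]]. exists (fun w => Im (L w)). intros w Mw Rw.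
  destruct (HL w Rw) as [D [E B]]. destruct D as [l D]. split; [|split; [exact B|]].
  - assert (Re (L w) = 0) as E0.
    { pose proof (Cmod_cexp (L w)) as T. rewrite E, Mw in T. apply exp_inv. rewrite exp_0, <- T. reflexivity. }
    rewrite <- E at 2. unfold cexp, unit_at. rewrite E0, exp_0, !Rmult_1_l. auto.
  - intros e He. destruct (proj1 (Ccont_eps _ _) (cderiv_continuous _ _ _ D) e He) as [d [Hd H]].
    exists d; split; auto. intros w' Hw'. eapply Rle_lt_trans; [|apply (H w' Hw')].
    eapply Rle_trans; [|apply im_le_Cmod]. right. f_equal.
Qed.

Lemma atan_near_0 : forall e, 0 < e -> exists d, 0 < d /\ forall y, Rabs y < d -> Rabs (atan y - y) <= e * Rabs y.
Proof.
  intros e He. assert (is_derive atan 0 1) as D.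
  { apply is_derive_Reals. pose proof (derivable_pt_lim_atan 0) as T.
    match type of T with derivable_pt_lim _ _ ?l => replace l with 1 in T by (unfold Rsqr; field; lra) end. exact T. }
  destruct (real_deriv_eps _ _ _ D e He) as [d [Hd H]]. exists d; split; auto. intros y Hy.
  specialize (H y). rewrite atan_0, !Rminus_0_r, Rmult_1_r in H. auto.
Qed.

Lemma tan_near_0 : forall e, 0 < e -> exists d, 0 < d /\ forall y, Rabs y < d -> Rabs (tan y) < e.
Proof.
  intros e He. assert (continuity_pt tan 0) as T.
  { apply derivable_continuous_pt. apply derivable_pt_tan. pose proof PI_RGT_0. lra. }
  apply continuity_pt_filterlim in T. pose proof (proj1 (RRcont_eps tan 0) T e He) as [d [Hd H]].
  exists d; split; auto. intros y Hy. specialize (H y). rewrite tan_0, !Rminus_0_r in H. auto.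
Qed.

(** Under [cayley_unit_at] boundary points are given by cotangents of half-angles; since
    [tan h] is close to [h] for small [h], a relation between cotangents becomes the same
    relation between angles, inverted. *)
Lemma cot_ratio_angle : forall a e, 0 < a -> 0 < e -> exists e' d, 0 < e' /\ 0 < d /\ forall h h',
  Rabs h < d -> Rabs h < PI / 2 -> Rabs h' < PI / 2 -> sin h <> 0 -> sin h' <> 0 ->
  Rabs (cos h' / sin h' - cos h / sin h / a) <= e' * Rabs (cos h / sin h) ->
  Rabs (h' - a * h) <= e * Rabs h.
Proof.
  intros a e Ha He. assert (0 < / a) as Pb by (apply Rinv_0_lt_compat; auto). set (b := / a) in *.
  assert (a * b = 1) as AB by (unfold b; field; lra).
  set (u := Rmin (1 / 2) (e / (16 * a))).
  assert (0 < e / (16 * a)) by (apply Rdiv_lt_0_compat; lra).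
  assert (0 < u) as Pu by (unfold u; apply Rmin_glb_lt; lra).
  assert (u <= 1 / 2) as U1 by apply Rmin_l.
  assert (u * (16 * a) <= e) as U2. { apply (proj2 (Rle_div_r u e (16 * a) ltac:(lra))). apply Rmin_r. }
  clearbody u.
  destruct (atan_near_0 u Pu) as [d1 [Hd1 AT]].
  set (m := Rmin d1 (d1 / (2 * a))).
  assert (0 < m) as Pm. { unfold m; apply Rmin_glb_lt; auto. apply Rdiv_lt_0_compat; lra. }
  assert (m <= d1) as M1 by apply Rmin_l.
  assert (m * (2 * a) <= d1) as M2. { apply (proj2 (Rle_div_r m d1 (2 * a) ltac:(lra))). apply Rmin_r. }
  clearbody m.
  destruct (tan_near_0 m Pm) as [d [Hd TN]].
  set (e' := Rmin (b / 2) (e * b * b / 16)).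
  assert (0 < b * b) as Pbb by nra.
  assert (0 < e * b * b / 16) by nra.
  assert (0 < e') as Pe' by (unfold e'; apply Rmin_glb_lt; lra).
  assert (e' <= b / 2) as E1 by apply Rmin_l. assert (e' <= e * b * b / 16) as E2 by apply Rmin_r. clearbody e'.
  exists e', d. split; auto. split; auto. intros h h' Hh Bh Bh' Sh Sh' Q.
  apply Rabs_def2 in Bh. apply Rabs_def2 in Bh'.
  assert (0 < cos h) as Ch by (apply cos_gt_0; lra). assert (0 < cos h') as Ch' by (apply cos_gt_0; lra).
  pose proof (atan_tan h ltac:(lra)) as Eh. pose proof (atan_tan h' ltac:(lra)) as Eh'.
  specialize (TN h Hh). set (T := tan h) in *. set (T' := tan h') in *.
  assert (T <> 0) as NT. { unfold T, tan. apply Rmult_integral_contrapositive; split; auto. apply Rinv_neq_0_compat; lra. }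
  assert (T' <> 0) as NT'. { unfold T', tan. apply Rmult_integral_contrapositive; split; auto. apply Rinv_neq_0_compat; lra. }
  replace (cos h / sin h) with (/ T) in Q by (unfold T, tan; field; split; auto; lra).
  replace (cos h' / sin h') with (/ T') in Q by (unfold T', tan; field; split; auto; lra).
  set (q := T / T').
  assert (Rabs (q - b) <= e') as Q1.
  { replace (q - b) with (T * (/ T' - / T / a)) by (unfold q, b; field; repeat split; auto; lra).
    rewrite Rabs_mult. apply Rle_trans with (Rabs T * (e' * Rabs (/ T))).
    - apply Rmult_le_compat_l; [apply Rabs_pos|exact Q].
    - rewrite Rabs_inv. right. field. apply Rabs_no_R0; auto. }
  apply Rabs_le_between in Q1. assert (b / 2 <= q) as Q2 by lra.
  assert (T' * q = T) as ET by (unfold q; field; auto).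
  assert (0 < Rabs T) as PT by (apply Rabs_pos_lt; auto). pose proof (Rabs_pos T') as PT'.
  assert (Rabs T' * q = Rabs T) as ETa by (rewrite <- ET, Rabs_mult, (Rabs_pos_eq q); lra).
  clearbody q T T'. clear Q.
  assert (Rabs T' <= 2 * a * Rabs T) as T2.
  { assert (Rabs T' * (b / 2) <= Rabs T) by (rewrite <- ETa; apply Rmult_le_compat_l; lra).
    replace (Rabs T') with (2 * a * (Rabs T' * (b / 2))) by (unfold b; field; lra). apply Rmult_le_compat_l; lra. }
  assert (Rabs (T' - a * T) <= e / 8 * Rabs T) as T3.
  { replace (T' - a * T) with (T' * (a * (b - q))) by (rewrite <- ET; replace (T' * (a * (b - q))) with (T' * (a * b) - a * (T' * q)) by ring; rewrite AB; ring).
    rewrite Rabs_mult, Rabs_mult, (Rabs_pos_eq a) by lra.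
    assert (Rabs (b - q) <= e * b * b / 16) as T4 by (apply Rabs_le; lra).
    apply Rle_trans with (2 * a * Rabs T * (a * (e * b * b / 16))).
    - apply Rmult_le_compat; auto. + apply Rmult_le_pos; [lra|apply Rabs_pos]. + apply Rmult_le_compat_l; lra.
    - right. replace (2 * a * Rabs T * (a * (e * b * b / 16))) with (e / 8 * Rabs T * (a * b) * (a * b)) by field. rewrite AB; ring. }
  pose proof (AT T ltac:(lra)) as A1.
  assert (Rabs T' < d1) as T5. { assert (2 * a * Rabs T < 2 * a * m) by (apply Rmult_lt_compat_l; lra). lra. }
  pose proof (AT T' T5) as A2. rewrite Eh in A1. rewrite Eh' in A2.
  assert (Rabs T <= 2 * Rabs h) as T6.
  { pose proof (Rabs_triang_inv T (T - h)) as W. replace (T - (T - h)) with h in W by ring.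
    rewrite (Rabs_minus_sym T h) in W. nra. }
  replace (h' - a * h) with ((h' - T') + (T' - a * T) + a * (T - h)) by ring.
  eapply Rle_trans; [apply Rabs_triang|]. eapply Rle_trans; [apply Rplus_le_compat_r, Rabs_triang|].
  rewrite (Rabs_mult a), (Rabs_pos_eq a), (Rabs_minus_sym T h) by lra.
  assert (u * Rabs T' <= u * (2 * a * Rabs T)) by (apply Rmult_le_compat_l; lra).
  assert (a * Rabs (h - T) <= a * (u * Rabs T)) by (apply Rmult_le_compat_l; lra).
  assert (u * (16 * a) * Rabs T <= e * Rabs T) by (apply Rmult_le_compat_r; lra).
  assert (e * Rabs T <= e * (2 * Rabs h)) by (apply Rmult_le_compat_l; lra).
  assert (0 <= e * Rabs h) by (apply Rmult_le_pos; [lra|apply Rabs_pos]).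
  lra.
Qed.

Lemma cot_large : forall M, 0 < M -> exists d, 0 < d /\ forall h, Rabs h < d -> Rabs h < PI / 2 -> sin h <> 0 ->
  M <= Rabs (cos h / sin h).
Proof.
  intros M HM. destruct (tan_near_0 (/ M)) as [d [Hd T]]. { apply Rinv_0_lt_compat; auto. }
  exists d; split; auto. intros h Hh B Sh. specialize (T h Hh). apply Rabs_def2 in B.
  assert (0 < cos h) as Ch by (apply cos_gt_0; lra).
  assert (tan h <> 0) as NT. { unfold tan. apply Rmult_integral_contrapositive; split; auto. apply Rinv_neq_0_compat; lra. }
  replace (cos h / sin h) with (/ tan h) by (unfold tan; field; split; auto; lra).
  rewrite Rabs_inv. rewrite <- (Rinv_inv M). apply Rinv_le_contravar; [apply Rabs_pos_lt; auto|lra].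
Qed.

(** A function with derivative [0] relative to an interval. Clamping the argument turns
    the interval into the half-line of times, so [tderiv_zero_const] applies at both ends. *)
Lemma little_o_constant : forall (G : R -> R) lo hi,
  (forall x, lo <= x <= hi -> forall e, 0 < e -> exists d, 0 < d /\ forall x', lo <= x' <= hi -> Rabs (x' - x) < d ->
    Rabs (G x' - G x) <= e * Rabs (x' - x)) -> forall x, lo <= x <= hi -> G x = G lo.
Proof.
  intros G lo hi H x Hx. set (c := fun t => Rmin (lo + t) hi).
  assert (forall t, 0 <= t -> lo <= c t <= hi) as C1.
  { intros t Ht. unfold c. split; [apply Rmin_glb; lra|apply Rmin_r]. }
  assert (forall t t', Rabs (c t' - c t) <= Rabs (t' - t)) as C2.
  { intros t t'. unfold c, Rmin. repeat destruct Rle_dec; unfold Rabs; repeat destruct Rcase_abs; lra. }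
  assert (forall t, 0 <= t -> tderiv (fun t => RtoC (G (c t))) t (RtoC 0)) as D.
  { intros t Ht e He. destruct (H (c t) (C1 t Ht) e He) as [d [Hd Q]]. exists d; split; auto. intros t' Ht' Hd'.
    replace (RtoC (G (c t')) - RtoC (G (c t)) - RtoC (t' - t) * RtoC 0)%C with (RtoC (G (c t') - G (c t)))
      by (rewrite RtoC_minus; Cring).
    rewrite Cmod_R. eapply Rle_trans; [apply Q; [auto|]|apply Rmult_le_compat_l; [lra|apply C2]].
    eapply Rle_lt_trans; [apply C2|auto]. }
  pose proof (tderiv_zero_const (fun t => RtoC (G (c t)))) as K.
  assert (RtoC (G (c (x - lo))) = RtoC (G (c 0))) as E.
  { apply K; [| |lra].
    - intros t Ht e He. destruct (D t Ht 1 Rlt_0_1) as [d [Hd Q]]. exists (Rmin d e). split; [apply Rmin_glb_lt; auto|].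
      intros t' Ht' B. pose proof (Rmin_l d e). pose proof (Rmin_r d e).
      specialize (Q t' Ht' ltac:(lra)).
      replace (RtoC (G (c t')) - RtoC (G (c t)) - RtoC (t' - t) * RtoC 0)%C with (RtoC (G (c t')) - RtoC (G (c t)))%C in Q by Cring.
      lra.
    - intros t Ht. apply D; lra. }
  apply RtoC_inj in E. unfold c in E. rewrite !Rmin_left in E by lra.
  replace (lo + (x - lo)) with x in E by ring. rewrite Rplus_0_r in E. auto.
Qed.

(** Strict concavity of the sine, by comparing derivatives. *)
Lemma sin_scaled : forall a y, 0 < a < 1 -> 0 < y < PI -> a * sin y < sin (a * y).
Proof.
  intros a y Ha Hy.
  destruct (MVT_cor2 (fun y => sin (a * y) - a * sin y) (fun y => a * cos (a * y) - a * cos y) 0 y ltac:(lra)) as [c [E B]].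
  { intros c _. apply is_derive_Reals. auto_derive; auto. ring. }
  rewrite Rmult_0_r, sin_0 in E.
  assert (cos c < cos (a * c)). { apply cos_decreasing_1; nra. }
  assert (0 < (a * cos (a * c) - a * cos c) * (y - 0)) by (apply Rmult_lt_0_compat; nra). lra.
Qed.

Lemma poisson_rotate : forall u s z, Cmod u = 1 -> poisson (u * s) (u * z) = poisson s z.
Proof.
  intros u s z Hu. assert (norm2 u = 1) as N by (rewrite <- Cmod_sqr, Hu; ring).
  unfold poisson. replace (u * s - u * z)%C with (u * (s - z))%C by Cring. rewrite !norm2_mult, N, !Rmult_1_l. auto.
Qed.

(** If [a < 1], the ratio of the chords of the image arc and of the arc would exceed [a],
    by [sin_scaled], against [chord_contraction]. If [a = 1], the map [f] followed
    by the rotation through [- c] fixes the points of the arc with Julia constant [1], so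
    it fixes the interior points attached to two different chords and is the identity. *)
Theorem arc_affine_rotation : forall f s lo hi a c, disc_selfmap f -> Cmod s = 1 -> lo < hi < lo + PI -> 0 < a <= 1 ->
  (forall x, lo <= x <= hi -> julia f (s * unit_at x) (s * unit_at (a * x + c)) a) -> f (RtoC 0) = RtoC 0.
Proof.
  intros f s lo hi a c Hf Hs Hl Ha J.
  assert (forall x, Cmod (s * unit_at x) = 1) as M1 by (intros x; rewrite Cmod_mult, Hs, Cmod_unit_at; ring).
  assert (a = 1) as A1.
  { destruct (Rle_lt_or_eq_dec a 1 (proj2 Ha)) as [A|A]; auto. exfalso.
    pose proof (chord_contraction f _ _ _ _ a Hf (M1 hi) (M1 lo) (M1 _) (M1 _) (J hi ltac:(lra)) (J lo ltac:(lra))) as K.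
    rewrite !chord_length in K by auto.
    replace ((a * hi + c - (a * lo + c)) / 2) with (a * ((hi - lo) / 2)) in K by field.
    pose proof (sin_scaled a ((hi - lo) / 2) ltac:(lra) ltac:(lra)) as S.
    assert (0 < sin ((hi - lo) / 2)) by (apply sin_gt_0; lra).
    assert (0 < a * sin ((hi - lo) / 2)) by (apply Rmult_lt_0_compat; lra).
    rewrite (Rabs_pos_eq (sin (a * _))), (Rabs_pos_eq (sin ((hi - lo) / 2))) in K by lra. lra. }
  subst a. set (g := fun z => (unit_at (- c) * f z)%C).
  assert (disc_selfmap g) as Hg.
  { split.
    - intros z Hz. destruct (proj1 Hf z Hz) as [l D]. eexists. unfold g. cder. exact D.
    - intros z Hz. unfold g, unit_disc. rewrite Cmod_mult, Cmod_unit_at, Rmult_1_l. apply (proj2 Hf); auto. }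
  assert (forall x, lo <= x <= hi -> julia g (s * unit_at x) (s * unit_at x) 1) as Jg.
  { intros x Hx z Hz. eapply Rle_trans; [apply (J x Hx z Hz)|]. right. f_equal. unfold g.
    rewrite <- (poisson_rotate (unit_at (- c)) (s * unit_at (1 * x + c)) (f z)) by apply Cmod_unit_at.
    f_equal. replace x with (- c + (1 * x + c)) at 2 by ring. rewrite (unit_at_plus (- c)). Cring. }
  (* Chords of different lengths have different midpoints. *)
  set (mid := (lo + hi) / 2).
  assert (forall x, lo < x <= hi -> (s * unit_at lo)%C <> (s * unit_at x)%C) as Ne.
  { intros x Hx E. pose proof (chord_length s x lo Hs) as T. rewrite E in T.
    replace (s * unit_at x - s * unit_at x)%C with (RtoC 0) in T by Cring. rewrite Cmod_0 in T.
    assert (0 < sin ((x - lo) / 2)) as P by (apply sin_gt_0; lra). rewrite Rabs_pos_eq in T; lra. }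
  assert (lo < mid < hi) as Hm by (unfold mid; lra).
  pose proof (julia_pair_fixed g _ _ Hg (M1 lo) (M1 hi) (Ne hi ltac:(lra)) (Jg lo ltac:(lra)) (Jg hi ltac:(lra))) as F1.
  pose proof (julia_pair_fixed g _ _ Hg (M1 lo) (M1 mid) (Ne mid ltac:(lra)) (Jg lo ltac:(lra)) (Jg mid ltac:(lra))) as F2.
  destruct (chord_midpoint_horodiscs _ _ (M1 lo) (M1 hi) (Ne hi ltac:(lra))) as [D1 [P1 _]].
  destruct (chord_midpoint_horodiscs _ _ (M1 lo) (M1 mid) (Ne mid ltac:(lra))) as [D2 [P2 _]].
  assert (unit_disc (RtoC 0)) as H0 by (unfold unit_disc; rewrite Cmod_0; lra).
  assert (g (RtoC 0) = RtoC 0) as G0.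
  { apply (two_fixed_points g _ _ Hg D1 D2); auto. intros E. rewrite E, P2 in P1.
    rewrite !(chord_length s lo) in P1 by auto.
    replace ((lo - mid) / 2) with (- ((mid - lo) / 2)) in P1 by field.
    replace ((lo - hi) / 2) with (- ((hi - lo) / 2)) in P1 by field.
    rewrite !sin_neg, !Rabs_Ropp in P1.
    assert (0 < sin ((mid - lo) / 2)) as S1 by (apply sin_gt_0; lra).
    assert (sin ((mid - lo) / 2) < sin ((hi - lo) / 2)) as S2 by (apply sin_increasing_1; lra).
    rewrite !Rabs_pos_eq in P1 by lra. apply Rmult_eq_reg_l in P1; [|lra]. apply Rinv_eq_reg in P1. lra. }
  unfold g in G0. assert (f (RtoC 0) = unit_at c * (unit_at (- c) * f (RtoC 0)))%C as E.
  { rewrite Cmult_assoc, <- unit_at_plus. replace (c + - c) with 0 by ring. unfold unit_at. rewrite cos_0, sin_0.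
    change ((1, 0) : C) with (RtoC 1). Cring. }
  rewrite E, G0. Cring.
Qed.

(** * Julia constants along a boundary orbit *)

Lemma Cmod_radius : forall s r, Cmod s = 1 -> 0 <= r -> Cmod (RtoC r * s) = r.
Proof. intros s r Hs Hr. rewrite Cmod_mult, Cmod_R, Hs, Rabs_pos_eq; lra. Qed.

Lemma radii_lim : is_lim_seq radii 1.
Proof.
  apply is_lim_seq_spec. intros e. destruct (radial_conv (RtoC 1) e (cond_pos e)) as [N H].
  exists N. intros n Hn. specialize (H n Hn).
  replace (RtoC (radii n) * RtoC 1 - RtoC 1)%C with (RtoC (radii n - 1)) in H by (rewrite RtoC_minus; Cring).
  rewrite Cmod_R in H. auto.
Qed.

(** Every approach gives at least the lower limit, and the radius gives at most the Julia
    constant, by [julia_radius_modulus]. *)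
Lemma radial_ratio_limit : forall f s s' a, disc_selfmap f -> Cmod s = 1 -> exact_julia f s s' a ->
  is_lim_seq (fun n => (1 - Cmod (f (RtoC (radii n) * s)%C)) / (1 - radii n)) a.
Proof.
  intros f s s' a Hf Hs EJ. pose proof EJ as [Hs' [J _]].
  pose proof (julia_const_pos f s s' a Hf Hs Hs' J) as Pa.
  pose proof (proj2 (liminf_iff_exact_julia f s a Hf Hs) (ex_intro _ s' EJ)) as LI.
  apply is_lim_seq_spec. intros e. destruct (LI e) as [L _]. unfold within in L. apply locally_C in L.
  destruct L as [d [Hd L]].
  destruct (radial_conv s d Hd) as [N1 H1].
  pose proof (proj2 (is_lim_seq_spec _ _) radii_lim (mkposreal (e / a) (Rdiv_lt_0_compat _ _ (cond_pos e) Pa))) as [N2 H2].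
  exists (Nat.max N1 N2). intros n Hn. specialize (H1 n ltac:(lia)). specialize (H2 n ltac:(lia)). simpl in H2.
  destruct (radii_range n) as [R0 R1].
  specialize (L _ H1 (radius_disc s (radii n) Hs (radii_range n))).
  rewrite Cmod_radius in L by auto.
  pose proof (julia_radius_modulus f s s' a (radii n) Hf Hs Hs' J (radii_range n)) as U.
  apply Rabs_def1; [|lra].
  set (r := radii n) in *. set (X := 1 - Cmod (f (RtoC r * s)%C)) in *.
  assert (X / (1 - r) <= 2 * a / (1 + r)) as U2.
  { apply (proj2 (Rle_div_l X (2 * a / (1 + r)) (1 - r) ltac:(lra))). auto. }
  assert (2 * a / (1 + r) <= a + a * (1 - r)) as U3.
  { apply (proj2 (Rle_div_l (2 * a) (a + a * (1 - r)) (1 + r) ltac:(lra))). assert (0 <= a * (r * (1 - r))) by (repeat apply Rmult_le_pos; lra). lra. }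
  assert (a * (1 - r) < e).
  { rewrite Rabs_minus_sym, Rabs_pos_eq in H2 by lra. replace (pos e) with (a * (e / a)) by (field; lra).
    apply Rmult_lt_compat_l; auto. }
  lra.
Qed.

(** The image under [f] of the radius at [s] is a sequence tending to [s1] along which the
    ratio of boundary distances of [g] is the quotient of the radial ratios of [k] and
    [f], so it tends to [c / a]; minimality follows from [julia_comp]. *)
Lemma exact_julia_quotient : forall f g k s s1 s2 a c, disc_selfmap f -> disc_selfmap g -> disc_selfmap k -> Cmod s = 1 ->
  (forall z, unit_disc z -> k z = g (f z)) -> exact_julia f s s1 a -> exact_julia k s s2 c ->
  exact_julia g s1 s2 (c / a).
Proof.
  intros f g k s s1 s2 a c Hf Hg Hk Hs K E1 E2. pose proof E1 as [M1 [J1 _]]. pose proof E2 as [M2 [J2 X2]].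
  pose proof (julia_const_pos f s s1 a Hf Hs M1 J1) as Pa.
  pose proof (radial_ratio_limit f s s1 a Hf Hs E1) as L1.
  pose proof (radial_ratio_limit k s s2 c Hk Hs E2) as L2.
  set (z := fun n => f (RtoC (radii n) * s)%C).
  assert (forall n, unit_disc (RtoC (radii n) * s)) as D by (intros n; apply radius_disc; [auto|apply radii_range]).
  assert (forall n, unit_disc (z n)) as Dz by (intros n; apply (proj2 Hf); auto).
  split; [auto|split].
  - apply (julia_of_sequence g z (fun n => ((1 - Cmod (k (RtoC (radii n) * s)%C)) / (1 - radii n)) /
       ((1 - Cmod (f (RtoC (radii n) * s)%C)) / (1 - radii n))) s1 s2 (c / a)); auto.
    + apply (julia_radial_limit f s s1 a); auto.
    + pose proof (julia_radial_limit k s s2 c Hk Hs M2 J2) as T. intros e He. destruct (T e He) as [N H].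
      exists N. intros n Hn. specialize (H n Hn). rewrite K in H by auto. auto.
    + intros n. rewrite K by auto. fold (z n). pose proof (Dz n) as T. unfold unit_disc in T.
      destruct (radii_range n). right. field. split; lra.
    + apply is_lim_seq_div'; auto. lra.
  - intros s'' b M'' J. apply (proj2 (Rle_div_l c b a Pa)). rewrite Rmult_comm. apply (X2 s''); auto.
    intros x Hx. rewrite K by auto. refine (julia_comp g f s s1 s'' a b _ Hf J1 J x Hx). lra.
Qed.

Section BoundaryOrbit.
Variable phi : R -> C -> C.
Hypothesis Hphi : semigroup phi.
Hypothesis free : forall t z, 0 < t -> unit_disc z -> phi t z <> z.
Variable tau : C.
Hypothesis Htau : Cmod tau = 1.
Hypothesis Jtau : forall t, 0 <= t -> julia (phi t) tau tau 1.
Variable sigma : C.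
Hypothesis Hsigma : Cmod sigma = 1.
Hypothesis sigma_tau : sigma <> tau.
Variable lam : R.
Hypothesis Hlam : 0 <= lam.
Variable eta : R -> C.
Hypothesis Eeta : forall t, 0 <= t -> exact_julia (phi t) sigma (eta t) (exp (- lam * t)).

Let self t (Ht : 0 <= t) := semigroup_selfmap phi Hphi t Ht.

Lemma orbit_circle : forall t, 0 <= t -> Cmod (eta t) = 1.
Proof. intros t Ht. apply (Eeta t Ht). Qed.

Lemma orbit_0 : eta 0 = sigma.
Proof.
  destruct (Eeta 0 (Rle_refl 0)) as [M [J _]].
  apply (julia_image_unique (phi 0) sigma (eta 0) sigma (exp (- lam * 0)) 1); auto. { apply self; lra. }
  intros z Hz. rewrite (semigroup_0 phi Hphi) by auto. lra.
Qed.

(** The cocycle relation: the exact constants at [s + t] and at [s] determine the one of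
    [phi t] at [eta s]. *)
Lemma orbit_exact : forall s t, 0 <= s -> 0 <= t -> exact_julia (phi t) (eta s) (eta (s + t)) (exp (- lam * t)).
Proof.
  intros s t Hs Ht. replace (exp (- lam * t)) with (exp (- lam * (s + t)) / exp (- lam * s)).
  2:{ unfold Rdiv. rewrite <- exp_Ropp, <- exp_plus. f_equal. ring. }
  apply (exact_julia_quotient (phi s) (phi t) (phi (s + t)) sigma); auto; try (apply self; lra).
  - intros z Hz. rewrite Rplus_comm. apply (semigroup_add phi Hphi); auto.
  - apply Eeta; lra.
Qed.

Lemma dilation_le_1 : forall t, 0 <= t -> exp (- lam * t) <= 1.
Proof. intros t Ht. rewrite <- exp_0. apply exp_le_mono. nra. Qed.

(** A coincidence would make [eta s] and [tau] two boundary fixed points of one map with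
    constants at most [1], and then the map fixes an interior point. *)
Lemma orbit_injective : forall s s', 0 <= s < s' -> eta s <> tau -> eta s <> eta s'.
Proof.
  intros s s' Hs N E. destruct (orbit_exact s (s' - s)) as [_ [J _]]; try lra.
  replace (s + (s' - s)) with s' in J by ring. rewrite <- E in J.
  pose proof (orbit_circle s (proj1 Hs)) as M.
  assert (disc_selfmap (phi (s' - s))) as D by (apply self; lra).
  apply (julia_weaken _ _ _ _ 1) in J; auto; [|apply dilation_le_1; lra].
  destruct (chord_midpoint_horodiscs _ _ M Htau N) as [B _].
  apply (free (s' - s) _ ltac:(lra) B). apply julia_pair_fixed; auto. apply Jtau; lra.
Qed.

(** On the radius, [julia_radius_near] locates [eta t] near [phi t (r sigma)] uniformly in
    [t], and the latter point is close to [r sigma] for small [t]. *)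
Lemma orbit_continuous_0 : tcont eta 0.
Proof.
  intros e He. rewrite orbit_0. set (k := Rmin 1 (e / 4)).
  assert (0 < k) as Pk by (apply Rmin_glb_lt; lra). assert (k <= 1) as K1 by apply Rmin_l.
  assert (k <= e / 4) as K2 by apply Rmin_r. clearbody k.
  (* The point at distance [k^2] from [sigma] is mapped to within [k] of [eta t]. *)
  set (r := 1 - k * k). assert (0 <= r < 1) as Hr by (unfold r; nra).
  set (z := (RtoC r * sigma)%C). assert (unit_disc z) as Hz by (apply radius_disc; auto).
  destruct (semigroup_tcont phi Hphi z 0 Hz (Rle_refl 0) (e / 4) ltac:(lra)) as [d [Hd T]].
  exists d; split; auto. intros t Ht B. specialize (T t Ht B). rewrite (semigroup_0 phi Hphi) in T by auto.
  destruct (Eeta t Ht) as [M [J _]].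
  pose proof (julia_radius_near (phi t) sigma (eta t) _ r (self t Ht) Hsigma M J Hr) as Q. fold z in Q.
  assert (norm2 (eta t - phi t z) <= k * k) as Q2.
  { eapply Rle_trans; [exact Q|]. pose proof (dilation_le_1 t Ht). unfold r. replace (1 - (1 - k * k)) with (k * k) by ring.
    rewrite <- (Rmult_1_l (k * k)) at 2. apply Rmult_le_compat_r; nra. }
  apply Cmod_le_norm2 in Q2; [|lra].
  assert (Cmod (z - sigma) = k * k) as Q3.
  { replace (z - sigma)%C with (RtoC (r - 1) * sigma)%C by (unfold z; rewrite RtoC_minus; Cring).
    rewrite Cmod_mult, Hsigma, Cmod_R, Rabs_minus_sym. unfold r. rewrite Rabs_pos_eq; nra. }
  pose proof (Cmod_sub_triangle (eta t) (phi t z) sigma). pose proof (Cmod_sub_triangle (phi t z) z sigma).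
  assert (k * k <= k) by nra. lra.
Qed.

(** The map [phi s] contracts the chord between [sigma] and [eta (s' - s)]. *)
Lemma orbit_modulus : forall s s', 0 <= s <= s' -> Cmod (eta s' - eta s) <= Cmod (eta (s' - s) - sigma).
Proof.
  intros s s' Hs. destruct (orbit_exact (s' - s) s) as [_ [J1 _]]; try lra.
  replace (s' - s + s) with s' in J1 by ring. destruct (Eeta s (proj1 Hs)) as [_ [J2 _]].
  pose proof (chord_contraction (phi s) (eta (s' - s)) sigma (eta s') (eta s) _ (self s (proj1 Hs))
    (orbit_circle (s' - s) ltac:(lra)) Hsigma (orbit_circle s' ltac:(lra)) (orbit_circle s ltac:(lra)) J1 J2) as K.
  pose proof (dilation_le_1 s ltac:(lra)). pose proof (Cmod_ge_0 (eta (s' - s) - sigma)).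
  nra.
Qed.

Lemma orbit_continuous : forall s, 0 <= s -> tcont eta s.
Proof.
  intros s Hs e He. destruct (orbit_continuous_0 e He) as [d [Hd T]]. rewrite orbit_0 in T.
  exists d; split; auto. intros s' Hs' B. destruct (Rle_dec s s') as [L|L].
  - eapply Rle_lt_trans; [apply orbit_modulus; lra|]. rewrite Rabs_pos_eq in B by lra.
    apply T; [lra|]. rewrite Rminus_0_r, Rabs_pos_eq; lra.
  - rewrite Cmod_minus_sym. eapply Rle_lt_trans; [apply orbit_modulus; lra|].
    rewrite Rabs_minus_sym, Rabs_pos_eq in B by lra. apply T; [lra|]. rewrite Rminus_0_r, Rabs_pos_eq; lra.
Qed.

(** The coordinate [th] is the continuous branch of the argument of [eta s / sigma] near
    [1]; up to the time [T] the orbit also stays away from [tau], as [orbit_injective]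
    requires. *)
Lemma orbit_angle : exists (T : R) (th : R -> R), 0 < T /\
  (forall s, 0 <= s <= T -> eta s = (sigma * unit_at (th s))%C /\ - (PI / 2) < th s < PI / 2 /\ eta s <> tau) /\
  (forall s, 0 <= s <= T -> continuity_pt th s).
Proof.
  destruct angle_exists as [A HA].
  set (r := Rmin (1 / 2) (Cmod (tau - sigma))).
  assert (0 < Cmod (tau - sigma)) as P.
  { apply Cmod_gt_0. intros E. apply sigma_tau. replace sigma with (tau - (tau - sigma))%C by Cring. rewrite E; Cring. }
  assert (0 < r) as Pr by (unfold r; apply Rmin_glb_lt; lra).
  assert (r <= 1 / 2) as R1 by apply Rmin_l. assert (r <= Cmod (tau - sigma)) as R2 by apply Rmin_r. clearbody r.
  destruct (orbit_continuous_0 r Pr) as [d [Hd B]]. rewrite orbit_0 in B.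
  pose proof (Cmod1_neq sigma Hsigma) as Ns.
  assert (forall s, 0 <= s <= d / 2 -> Cmod (eta s - sigma) < r) as B'.
  { intros s Hs. apply B; [lra|]. rewrite Rminus_0_r, Rabs_pos_eq; lra. }
  assert (forall z : C, Cmod (z / sigma) = Cmod z) as MD.
  { intros z. rewrite Cmod_div by auto. rewrite Hsigma. field. }
  assert (forall s, 0 <= s <= d / 2 -> Cmod (eta s / sigma) = 1 /\ 0 < Re (eta s / sigma)) as W.
  { intros s Hs. split. { rewrite MD. apply orbit_circle; lra. }
    specialize (B' s Hs).
    pose proof (Re_le_Cmod (RtoC 1 - eta s / sigma)) as Q.
    replace (Cmod (RtoC 1 - eta s / sigma)) with (Cmod (eta s - sigma)) in Q.
    2:{ rewrite Cmod_minus_sym. rewrite <- (MD (sigma - eta s)%C). f_equal. Cfield; auto. }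
    change (Re (RtoC 1 - eta s / sigma)%C) with (1 - Re (eta s / sigma)%C) in Q. lra. }
  exists (d / 2), (fun s => A (eta (Rmax s 0) / sigma)%C). split; [lra|split].
  - intros s Hs. rewrite Rmax_left by lra. destruct (W s Hs) as [W1 W2]. destruct (HA _ W1 W2) as [E [I _]].
    split; [|split; auto].
    + rewrite E. Cfield; auto.
    + intros Et. specialize (B' s Hs). rewrite Et in B'. lra.
  - intros s Hs. apply continuity_pt_filterlim. apply (proj2 (RRcont_eps (fun s => A (eta (Rmax s 0) / sigma)%C) s)). intros e He.
    destruct (W s Hs) as [W1 W2]. destruct (HA _ W1 W2) as [_ [_ Q]]. destruct (Q e He) as [d1 [Hd1 Q1]].
    destruct (orbit_continuous s (proj1 Hs) d1 Hd1) as [d2 [Hd2 Q2]].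
    exists d2; split; auto. intros s' Hs'. rewrite (Rmax_left s) by lra. apply Q1.
    replace (eta (Rmax s' 0) / sigma - eta s / sigma)%C with ((eta (Rmax s' 0) - eta s) / sigma)%C by (Cfield; auto).
    rewrite MD. apply Q2; [apply Rmax_r|].
    eapply Rle_lt_trans; [|exact Hs']. unfold Rmax. destruct Rle_dec; unfold Rabs; repeat destruct Rcase_abs; lra.
Qed.

Lemma IVT_either : forall (f : R -> R) b y, 0 < b -> (forall s, 0 <= s <= b -> continuity_pt f s) ->
  Rmin (f 0) (f b) <= y <= Rmax (f 0) (f b) -> exists s, 0 <= s <= b /\ f s = y.
Proof.
  intros f b y Hb Hc Hy. unfold Rmin, Rmax in Hy. destruct (Rle_dec (f 0) (f b)) as [L|L].
  - destruct (f_interv_is_interv f 0 b y Hb Hy Hc) as [s Hs]. exists s; auto.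
  - destruct (f_interv_is_interv (fun s => - f s) 0 b (- y) Hb) as [s [Hs E]]; [lra| |exists s; split; auto; lra].
    intros s Hs. apply (continuity_pt_opp f). auto.
Qed.

(** In the angular coordinate, [phi t] induces on an arc of the orbit a map [G]. By
    [boundary_quotient] and [cot_ratio_angle] it has derivative [a] everywhere, so it is
    affine, and [arc_affine_rotation] produces a fixed point of [phi t]. *)
Theorem no_second_dilation_point : False.
Proof.
  destruct orbit_angle as [T [th [HT [Hth Cth]]]]. pose proof PI_RGT_0 as HPI.
  set (t := T / 2). assert (0 < t) as Ht by (unfold t; lra). assert (T = 2 * t) as ET by (unfold t; lra).
  clearbody t. subst T. set (a := exp (- lam * t)).
  assert (0 < a) as Pa by apply exp_pos. assert (a <= 1) as A1 by (apply dilation_le_1; lra).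
  assert (forall s s', 0 <= s <= 2 * t -> 0 <= s' <= 2 * t -> s <> s' -> th s <> th s') as Inj.
  { assert (forall s s', 0 <= s < s' -> s' <= 2 * t -> th s <> th s') as K.
    { intros s s' Hs Hs' E. destruct (Hth s ltac:(lra)) as [E1 [_ N]]. destruct (Hth s' ltac:(lra)) as [E2 _].
      apply (orbit_injective s s' Hs N). rewrite E1, E2, E. auto. }
    intros s s' Hs Hs' Ne E. destruct (Rtotal_order s s') as [L|[L|L]]; [|auto|].
    - apply (K s s'); auto; lra. - apply (K s' s); auto; lra. }
  set (lo := Rmin (th 0) (th t)). set (hi := Rmax (th 0) (th t)).
  assert (lo < hi) as LH.
  { pose proof (Inj 0 t ltac:(lra) ltac:(lra) ltac:(lra)). unfold lo, hi, Rmin, Rmax. destruct Rle_dec; lra. }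
  assert (hi < lo + PI) as HL.
  { destruct (Hth 0 ltac:(lra)) as [_ [B0 _]]. destruct (Hth t ltac:(lra)) as [_ [B1 _]].
    unfold lo, hi, Rmin, Rmax. destruct Rle_dec; lra. }
  assert (forall x, exists s, lo <= x <= hi -> 0 <= s <= t /\ th s = x) as Inv.
  { intros x. destruct (classic (lo <= x <= hi)) as [B|B]; [|exists 0; tauto].
    destruct (IVT_either th t x Ht) as [s Hs]; [|exact B|exists s; auto]. intros s Hs. apply Cth; lra. }
  apply choice in Inv. destruct Inv as [S HS].
  set (G := fun x => th (S x + t)).
  assert (forall x, lo <= x <= hi -> eta (S x) = (sigma * unit_at x)%C /\ eta (S x + t) = (sigma * unit_at (G x))%C) as EG.
  { intros x Hx. destruct (HS x Hx) as [B E]. destruct (Hth (S x) ltac:(lra)) as [E1 _].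
    destruct (Hth (S x + t) ltac:(lra)) as [E2 _]. rewrite E in E1. auto. }
  assert (forall x, Cmod (sigma * unit_at x) = 1) as M1 by (intros x; rewrite Cmod_mult, Hsigma, Cmod_unit_at; ring).
  assert (forall x, lo <= x <= hi -> exact_julia (phi t) (sigma * unit_at x) (sigma * unit_at (G x)) a) as J.
  { intros x Hx. destruct (EG x Hx) as [<- <-]. apply orbit_exact; [apply (HS x Hx)|lra]. }
  assert (disc_selfmap (phi t)) as Hf by (apply self; lra).
  assert (forall x, lo <= x <= hi -> - (PI / 2) < x < PI / 2 /\ - (PI / 2) < G x < PI / 2) as Rng.
  { intros x Hx. destruct (HS x Hx) as [B E]. rewrite <- E at 1 2.
    split; [apply (Hth (S x)); lra|apply (Hth (S x + t)); lra]. }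
  assert (forall x, - (PI / 2) < x < PI / 2 -> x <> 0 -> sin x <> 0) as Sn.
  { intros x Hx N E. destruct (Rle_dec 0 x).
    - assert (0 < sin x) by (apply sin_gt_0; lra). lra.
    - assert (0 < sin (- x)) as Q by (apply sin_gt_0; lra). rewrite sin_neg in Q. lra. }
  assert (forall x, lo <= x <= hi -> G x - a * x = G lo - a * lo) as Aff.
  { intros x Hx. apply (little_o_constant (fun x => G x - a * x) lo hi); auto. clear x Hx. intros x Hx e He.
    destruct (cot_ratio_angle a e Pa He) as [e' [d1 [He' [Hd1 CR]]]].
    destruct (boundary_quotient (phi t) _ _ a Hf (M1 x) (J x Hx) e' He') as [M [HM BQ]].
    destruct (cot_large M HM) as [d2 [Hd2 CL]].
    exists (Rmin d1 d2). split; [apply Rmin_glb_lt; auto|]. intros x' Hx' B.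
    pose proof (Rmin_l d1 d2). pose proof (Rmin_r d1 d2).
    destruct (Req_dec x' x) as [->|Ne]. { rewrite !Rminus_diag, Rabs_R0. lra. }
    destruct (Rng x Hx) as [X1 X2]. destruct (Rng x' Hx') as [X3 X4].
    destruct (HS x Hx) as [SB SE]. destruct (HS x' Hx') as [SB' SE'].
    assert (G x' <> G x) as NeG.
    { unfold G. apply Inj; try lra. intros E. apply Ne. rewrite <- SE, <- SE'. f_equal. lra. }
    assert (sin ((x' - x) / 2) <> 0) as S1 by (apply Sn; lra).
    assert (sin ((G x' - G x) / 2) <> 0) as S2 by (apply Sn; lra).
    assert (Rabs ((x' - x) / 2) = Rabs (x' - x) / 2) as EA by (unfold Rdiv; rewrite Rabs_mult, (Rabs_pos_eq (/ 2)); lra).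
    assert (Rabs ((x' - x) / 2) < PI / 2) as B1 by (apply Rabs_def1; lra).
    assert (Rabs ((G x' - G x) / 2) < PI / 2) as B2 by (apply Rabs_def1; lra).
    pose proof (Rabs_pos (x' - x)).
    assert (Rabs ((x' - x) / 2) < d1) as B3 by (rewrite EA; lra).
    assert (Rabs ((x' - x) / 2) < d2) as B4 by (rewrite EA; lra).
    assert (forall u v, sin ((v - u) / 2) <> 0 -> (sigma * unit_at u)%C <> (sigma * unit_at v)%C) as Dst.
    { intros u v Suv E. pose proof (chord_length sigma v u Hsigma) as Q. rewrite E in Q.
      replace (sigma * unit_at v - sigma * unit_at v)%C with (RtoC 0) in Q by Cring. rewrite Cmod_0 in Q.
      pose proof (Rabs_pos_lt _ Suv). lra. }
    pose proof (BQ _ _ _ _ (M1 x') (M1 (G x')) (Dst _ _ S1) (Dst _ _ S2)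
      (cayley_unit_at sigma x x' Hsigma S1) (cayley_unit_at sigma (G x) (G x') Hsigma S2)
      (proj1 (proj2 (J x' Hx'))) (CL _ B4 B1 S1)) as Q.
    pose proof (CR _ _ B3 B1 B2 S1 S2 Q) as R. rewrite EA in R.
    replace (G x' - a * x' - (G x - a * x)) with (2 * ((G x' - G x) / 2 - a * ((x' - x) / 2))) by field.
    rewrite Rabs_mult, (Rabs_pos_eq 2) by lra. lra. }
  assert (unit_disc (RtoC 0)) as H0 by (unfold unit_disc; rewrite Cmod_0; lra).
  apply (free t (RtoC 0) Ht H0).
  apply (arc_affine_rotation (phi t) sigma lo hi a (G lo - a * lo) Hf Hsigma); [lra|lra|].
  intros x Hx. replace (a * x + (G lo - a * lo)) with (G x) by (rewrite <- (Aff x Hx); ring). apply (J x Hx).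
Qed.

End BoundaryOrbit.

(** * Uniqueness of the spectral value and the classification *)

(** At the Denjoy-Wolff point itself the exact constant at time [1] determines [lam]; other
    points are excluded by [no_second_dilation_point]. *)
Theorem spectral_value_unique : forall phi Omega h, semigroup phi ->
  holomorphic_model phi Omega h vertical_translation ->
  forall lam lam', 0 <= lam' -> has_dilation phi lam' -> spectral_value phi lam -> lam = lam'.
Proof.
  intros phi Omega h Hphi HM lam lam' Hl' [tau [Htau Et]] [sigma [Hsigma [Hl LI]]].
  assert (forall t, exists e, 0 <= t -> exact_julia (phi t) sigma e (exp (- lam * t))) as X.
  { intros t. destruct (Rle_dec 0 t) as [Ht|Ht]; [|exists (RtoC 0); tauto].
    destruct (proj1 (liminf_iff_exact_julia (phi t) sigma _ (semigroup_selfmap phi Hphi t Ht) Hsigma) (LI t Ht)) as [e He].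
    exists e; auto. }
  apply choice in X. destruct X as [eta Eeta].
  destruct (classic (sigma = tau)) as [E|N].
  - subst sigma. assert (exp (- lam * 1) = exp (- lam' * 1)) as EE.
    { destruct (Eeta 1 ltac:(lra)) as [M1 [J1 X1]]. destruct (Et 1 ltac:(lra)) as [M2 [J2 X2]].
      apply Rle_antisym; [apply (X1 tau); auto|apply (X2 (eta 1)); auto]. }
    apply exp_inv in EE. lra.
  - exfalso. apply (no_second_dilation_point phi Hphi (model_no_fixed_point phi Omega h HM) tau Htau) with (sigma := sigma) (lam := lam) (eta := eta); auto.
    intros t Ht. destruct (Et t Ht) as [M [J _]].
    apply (julia_weaken _ _ _ _ 1) in J; auto. { apply semigroup_selfmap; auto. }
    rewrite <- exp_0. apply exp_le_mono. nra.
Qed.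

Theorem theorem3p7 (phi : R -> C -> C) (Hphi : semigroup phi) :
  (forall lam : R, 0 < lam ->
     ((hyperbolic phi /\ spectral_value phi lam) <->
      exists h : C -> C,
        holomorphic_model phi (strip (PI / lam)) h vertical_translation)) /\
  ((parabolic phi /\ positive_hyperbolic_step phi) <->
   ((exists h : C -> C,
       holomorphic_model phi right_half_plane h vertical_translation) \/
    (exists h : C -> C,
       holomorphic_model phi left_half_plane h vertical_translation))) /\
  ((parabolic phi /\ zero_hyperbolic_step phi) <->
   exists h : C -> C,
     holomorphic_model phi whole_plane h vertical_translation).
Proof.
  assert (forall lam Omega h, 0 <= lam -> holomorphic_model phi Omega h vertical_translation -> has_dilation phi lam ->
    forall lam', spectral_value phi lam' -> lam' = lam) as Uniq.
  { intros lam Omega h Hl HM D lam' Sp. apply (spectral_value_unique phi Omega h Hphi HM lam' lam); auto. }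
  assert (forall rho h, 0 < rho -> holomorphic_model phi (strip rho) h vertical_translation ->
    has_dilation phi (PI / rho)) as Strip.
  { intros rho h Hr HM. pose proof PI_RGT_0. apply (strip_model_dilation phi Hphi (PI / rho) h).
    - apply Rdiv_lt_0_compat; lra. - replace (PI / (PI / rho)) with rho by (field; lra). auto. }
  assert (forall Omega h, holomorphic_model phi Omega h vertical_translation -> has_dilation phi 0 -> parabolic phi) as Par.
  { intros Omega h HM D. split. { apply (model_not_elliptic phi Omega h HM). }
    apply has_dilation_spectral; auto. lra. }
  pose proof PI_RGT_0 as HPI.
  split; [|split].
  - intros lam Hl. split.
    + intros [[NE _] Sp]. destruct (model_exists phi Hphi NE) as [[rho [h [Hr HM]]]|[[h HM]|[[h HM]|[h HM]]]].
      * assert (0 < PI / rho) by (apply Rdiv_lt_0_compat; lra).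
        pose proof (Uniq (PI / rho) _ h ltac:(lra) HM (Strip rho h Hr HM) lam Sp) as ->.
        exists h. replace (PI / (PI / rho)) with rho by (field; lra). auto.
      * exfalso. pose proof (Uniq 0 _ h (Rle_refl 0) HM (right_half_plane_dilation phi Hphi h HM) lam Sp). lra.
      * exfalso. pose proof (Uniq 0 _ h (Rle_refl 0) HM (left_half_plane_dilation phi Hphi h HM) lam Sp). lra.
      * exfalso. pose proof (Uniq 0 _ h (Rle_refl 0) HM (whole_plane_dilation phi Hphi h HM) lam Sp). lra.
    + intros [h HM].
      assert (spectral_value phi lam) as Sp.
      { apply has_dilation_spectral; auto; [lra|]. apply (strip_model_dilation phi Hphi lam h); auto. }
      split; auto. split; [apply (model_not_elliptic phi _ h HM)|exists lam; auto].
  - split.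
    + intros [[NE Sp] Step]. destruct (model_exists phi Hphi NE) as [[rho [h [Hr HM]]]|[[h HM]|[[h HM]|[h HM]]]].
      * exfalso. assert (0 < PI / rho) by (apply Rdiv_lt_0_compat; lra).
        pose proof (Uniq (PI / rho) _ h ltac:(lra) HM (Strip rho h Hr HM) 0 Sp). lra.
      * left; exists h; auto.
      * right; exists h; auto.
      * exfalso. apply (whole_plane_step phi Hphi h HM Step).
    + intros [[h HM]|[h HM]].
      * split; [apply (Par _ h HM); apply (right_half_plane_dilation phi Hphi h HM)|apply (right_half_plane_step phi Hphi h HM)].
      * split; [apply (Par _ h HM); apply (left_half_plane_dilation phi Hphi h HM)|apply (left_half_plane_step phi Hphi h HM)].
  - split.
    + intros [[NE Sp] Step]. destruct (model_exists phi Hphi NE) as [[rho [h [Hr HM]]]|[[h HM]|[[h HM]|[h HM]]]].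
      * exfalso. assert (0 < PI / rho) by (apply Rdiv_lt_0_compat; lra).
        pose proof (Uniq (PI / rho) _ h ltac:(lra) HM (Strip rho h Hr HM) 0 Sp). lra.
      * exfalso. apply Step. apply (right_half_plane_step phi Hphi h HM).
      * exfalso. apply Step. apply (left_half_plane_step phi Hphi h HM).
      * exists h; auto.
    + intros [h HM]. split; [apply (Par _ h HM); apply (whole_plane_dilation phi Hphi h HM)|apply (whole_plane_step phi Hphi h HM)].
Qed.
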